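(* Up to isomorphism, there are exactly twenty-four Isaacs groups of degree $25$ that are $5$-closed and exactly two Isaacs groups of degree $25$ that are not $5$-closed. The two that are not $5$-closed are not solvable (nor even $5$-solvable); for one of them $O_5(G)$ has nilpotence class $3$, and for the other $O_5(G)$ has nilpotence class $2$.
   Context: All groups are finite. For an integer $e > 1$, a group $G$ is an Isaacs group of degree $e$ if $|G| = e^4 - e^3$ and $d = e^2 - e$ is the degree of some irreducible complex character of $G$ (so that $|G| = d(d+e)$); for $e = 25$ this means $|G| = 375000$ and $G$ has an irreducible character of degree $600$. A group is $5$-closed if it has a normal Sylow $5$-subgroup. $O_5(G)$ is the largest normal $5$-subgroup of $G$. *)

(* Defs.v *)
From mathcomp Require Import all_boot all_algebra all_fingroup all_solvable.
From mathcomp Require Import all_field all_character.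

Set Implicit Arguments.
Unset Strict Implicit.
Unset Printing Implicit Defensive.

Import GroupScope GRing.Theory.
Local Open Scope ring_scope.
Local Open Scope group_scope.

(* Complex characters are taken over algC, as everywhere in character theory  *)
(* in the library: complex representations of finite groups are realized over *)
(* the algebraic numbers, so the irreducible characters are the same.         *)
Definition Isaacs_group (e : nat) (gT : finGroupType) (G : {group gT}) : Prop :=
  [/\ (1 < e)%N,
      #|G| = (e ^ 4 - e ^ 3)%N
    & exists i : Iirr G, ('chi_i 1%g = (e ^ 2 - e)%N%:R)%R].

Definition p_closed (p : nat) (gT : finGroupType) (G : {group gT}) : Prop :=
  exists2 P : {group gT}, p.-Sylow(G) P & P <| G.

Definition p_or_p'_factor (p : nat) (gT : finGroupType) (G V U : {set gT}) :=
  invariant_factor G V U && (p.-group (U / V) || p^'.-group (U / V)).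

(* The series runs upwards from 1 to G, through subgroups normal in G. *)
Definition p_solvable (p : nat) (gT : finGroupType) (G : {group gT}) : Prop :=
  exists2 s : seq {group gT},
    (p_or_p'_factor p G).-series 1%G s & last 1%G s = G.

(* G_0, ..., G_(n-1) represent, without repetition, all the isomorphism       *)
(* classes of finite groups satisfying P (an isomorphism-invariant property). *)
Definition isog_representatives
    (P : forall gT : finGroupType, {group gT} -> Prop) (n : nat)
    (gT : 'I_n -> finGroupType) (G : forall i : 'I_n, {group gT i}) : Prop :=
  [/\ forall i : 'I_n, P (gT i) (G i),
      forall i j : 'I_n, G i \isog G j -> i = j
    & forall (hT : finGroupType) (H : {group hT}),
        P hT H -> exists i : 'I_n, H \isog G i].

(* Main.v *)
From HB Require Import structures.
Require Import Defs.
From mathcomp Require Import all_boot all_order all_algebra all_fingroup all_solvable.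
From mathcomp Require Import all_field all_character.
From mathcomp Require Import zify ring.

Set Implicit Arguments.
Unset Strict Implicit.
Unset Printing Implicit Defensive.

Import GroupScope Order.TTheory GRing.Theory Num.Theory.
Local Open Scope ring_scope.
Local Open Scope group_scope.

(*BEGIN*)

(** Let chi have degree 600 and let P be a Sylow 5-subgroup, of order 5^6. Characters of P have
    degree at most 25, and comparing degree and norm of the restriction of chi to P leaves no slack,
    so all constituents have degree 25. For a normal subgroup N of P of order 25 this puts
    Cauchy-Schwarz in its equality case: chi is -25 on N^# and 0 off N, so N is normal in G
    ([small_normal_exists]). Orthogonality then shows that N^# is one class and that commutators
    with an element of P outside N cover N, up to a small subgroup ([Camina_Sylow]). Conversely such
    properties give back the character ([Isaacs_of_Camina]).

    Suppose P is normal. A complement H has order 24, is regular on N^#, and has one involution t,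
    which inverts N. The Sylow 2-subgroup of H, of order 8, permutes the conjugates of t other than
    t semiregularly, so indices of centralizers of t are powers of 25. It follows that D = C_P(t)
    has order 25 and, with E = N D, that commutators give a pairing of D with P / E into N without
    zero divisors: the multiplication of F_25 ([coords_exist]). H acts by autotopisms, hence
    semilinearly ([autotopism]), and up to scaling there are 12 actions of a cyclic H and 6 of a
    nonabelian one. What remains of P is [w1, w2] in D and the fifth powers of w1, w2 in N, for
    lifts w1, w2 of a basis of P / E. A finite check ([rel_testP]) finds that H allows the zero
    choice always, and one more choice up to scaling in three cases of each kind: 12 + 3 + 6 + 3 =
    24.

    Suppose P is not normal. Then C = C_G(N) has order 5^5, and G / C acts on N as SL_2(5),
    generated by two shears u, b that can be lifted to commute with an involution t inverting N. Now
    C_C(t) = <z> has order 5, commutation with z maps C onto N, and comparing relations with their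
    images under t determines the Sylow subgroup up to one parameter gam in F_5 ([co_pre]).
    Rescaling identifies the nonzero values ([nc_pre_cases]), which leaves two groups.

    Equal data give isomorphic groups by Gaschutz' theorem, applied to the pairs that preserve the
    graph of an isomorphism between the two copies of E ([isog_of_matched_Sylow]). Existence comes
    from explicit permutations of F_25 x F_25 ([modgroup]). The 24 groups are told apart by how an
    element of the complement acts ([slope]) and by whether O_5(G) has class at most 2 and exponent
    5; the other two by the class of O_5(G). Failure of 5-solvability comes from commutators in
    SL_2(5) ([commutator_testP]). *)

Lemma Isaacs25_order : (25 ^ 4 - 25 ^ 3 = 24 * 5 ^ 6)%N.
Proof. by rewrite (expnM 5 2 3) -[(5 ^ 2)%N]/25%N expnS -[X in (_ - X)%N]mul1n -mulnBl. Qed.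

Lemma order_Sylow5 (gT : finGroupType) (G P : {group gT}) :
  #|G| = (24 * 5 ^ 6)%N -> 5.-Sylow(G) P -> #|P| = (5 ^ 6)%N.
Proof.
move=> oG /card_Hall->; rewrite p_part oG lognM // ?lognX ?(pfactorK 6) //.
Qed.

Lemma degree_5power (gT : finGroupType) (P : {group gT}) (j : Iirr P) n :
  #|P| = (5 ^ n)%N -> exists k, ('chi_j 1%g = (5 ^ k)%:R)%R.
Proof.
move=> oP; have:= dvd_irr1_cardG j; rewrite irr1_degree dvdC_nat oP.
by case/dvdn_pfactor=> // k _ ->; exists k.
Qed.

Lemma center_sub_cfcenter (gT : finGroupType) (P : {group gT}) (j : Iirr P) :
  'Z(P) \subset 'Z('chi_j)%CF.
Proof. by rewrite -cap_cfcenter_irr bigcap_inf. Qed.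

Lemma irr_bound_sub (gT : finGroupType) (P Z : {group gT}) (j : Iirr P) k a b :
  #|P| = (5 ^ a)%N -> ('chi_j 1%g = (5 ^ k)%:R)%R ->
  Z \subset 'Z('chi_j)%CF -> #|Z| = (5 ^ b)%N -> (k.*2 + b <= a)%N.
Proof.
move=> oP dj sZ oZ; have [] := irr1_bound j; rewrite dj -natrX ler_nat => le_k _.
have:= Lagrange (cfcenter_sub 'chi_j); rewrite oP => def_a.
have leZ: (5 ^ b <= #|'Z('chi_j)%CF|)%N by rewrite -oZ subset_leq_card.
rewrite -(leq_exp2l _ _ (isT : 1 < 5)%N) expnD -muln2 expnM -def_a mulnC.
exact: leq_mul.
Qed.

(** A nontrivial quotient of a 5-group has a nontrivial centre, so the centre of the character is
    strictly larger than [B]; this gains a factor 5 over [irr_bound_sub]. *)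
Lemma irr_bound_ker (gT : finGroupType) (P B : {group gT}) (j : Iirr P) k a b :
    #|P| = (5 ^ a)%N -> ('chi_j 1%g = (5 ^ k)%:R)%R -> B <| P -> #|B| = (5 ^ b)%N ->
  B \subset cfker 'chi_j -> B \proper P -> (k.*2 + b < a)%N.
Proof.
move=> oP dj nBP oB sBK prBP; have pP : 5.-group P by rewrite /pgroup oP pnatX.
have sKZ := normal_sub (cfker_center_normal 'chi_j).
have sBZ := subset_trans sBK sKZ.
have [eZB | neZB] := eqVneq ('Z('chi_j)%CF) B.
  have eKB : cfker 'chi_j = B.
    by apply/eqP; rewrite eqEsubset sBK -{1}eZB sKZ.
  have := cfcenter_eq_center j; rewrite eKB eZB trivg_quotient => /esym.
  move/(trivg_center_pgroup (quotient_pgroup _ pP)) => /trivgP.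
  by rewrite quotient_sub1 ?normal_norm // (negPf (proper_subn prBP)).
have pZ: 5.-group 'Z('chi_j)%CF := pgroupS (cfcenter_sub _) pP.
have [c oZ] := p_natP pZ.
have le_c := irr_bound_sub oP dj (subxx _) oZ.
suffices: (b < c)%N by lia.
rewrite -(ltn_exp2l _ _ (isT : 1 < 5)%N) -oB -oZ; apply: proper_card.
by rewrite properEneq eq_sym neZB.
Qed.

Section SmallNormal.
Variables (gT : finGroupType) (G : {group gT}) (i : Iirr G).
Hypotheses (oG : #|G| = (24 * 5 ^ 6)%N) (chi1 : ('chi_i 1%g = 600%:R)%R).

(** The centre of P is nontrivial, which bounds degrees by 25, and the norm of the restriction is at
    most |G : P| = 24. As 600 = 24 * 25, there is no room for a smaller degree. *)
Lemma constt_degree25 (P : {group gT}) (j : Iirr P) :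
  5.-Sylow(G) P -> j \in irr_constt ('Res[P] 'chi_i) -> ('chi_j 1%g = 25%:R)%R.
Proof.
move=> sylP; have oP := order_Sylow5 oG sylP; have sPG := pHall_sub sylP.
have pP := pHall_pgroup sylP.
have le25 k : ('chi[P]_k 1%g <= 25%:R)%R.
  have [d dk] := degree_5power k oP.
  have ntZ : 'Z(P) != 1.
    apply/eqP=> /(trivg_center_pgroup pP) P1; have := oP; rewrite P1 cards1.
    by move/eqP; rewrite ltn_eqF // (ltn_exp2l 0).
  have [b oZ] := p_natP (pgroupS (center_sub P) pP).
  have := irr_bound_sub oP dk (center_sub_cfcenter k) oZ.
  case: b oZ => [|b _ le_d]; first by move/card1_trivg=> /eqP; rewrite (negPf ntZ).
  by rewrite dk -[25%N]/(5 ^ 2)%N ler_nat leq_exp2l //; lia.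
pose phi := ('Res[P] 'chi_i)%R; pose n k := ('[phi, 'chi_k])%R.
have Nn k : n k \in Num.nat by rewrite Cnat_cfdot_char_irr ?cfRes_char ?irr_char.
have sum1 : (\sum_k n k * 'chi_k 1%g = 600%:R)%R.
  rewrite -chi1 -(cfRes1 P 'chi_i) [in RHS](cfun_sum_cfdot ('Res[P] 'chi_i)) sum_cfunE.
  by apply: eq_bigr => k _; rewrite cfunE.
have sum2 : (\sum_k n k ^+ 2 <= 24%:R)%R.
  have := (cfnorm_Res_leif 'chi_i sPG).1; rewrite cfnorm_irr mulr1 cfdot_sum_irr.
  rewrite (_ : #|G : P| = 24%N); last by rewrite -divgS // oG oP mulnK ?expn_gt0.
  by congr (_ <= _)%R; apply: eq_bigr => k _; rewrite conj_natr ?Nn // expr2.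
(* Multiplicities are natural numbers, so they are at most their squares and sum to at most 24. The
   nonnegative terms n (25 - degree) thus have a nonpositive sum. *)
have sum0 : (\sum_k n k * (25%:R - 'chi_k 1%g) <= 0)%R.
  rewrite (eq_bigr _ (fun k _ => mulrBr _ _ _)) sumrB sum1 subr_le0.
  rewrite (_ : 600%:R = 24%:R * 25%:R :> algC)%R; last by rewrite -natrM.
  rewrite -mulr_suml ler_pM2r ?ltr0n //; apply: le_trans sum2; apply: ler_sum => k _.
  have /natrP[m ->] := Nn k; rewrite -natrX ler_nat; nia.
have ge0 k : (0 <= n k * (25%:R - 'chi_k 1%g))%R.
  by rewrite mulr_ge0 ?subr_ge0 ?natr_ge0.
have /eqP := le_anti (etrans (andbC _ _) (introT andP (conj (sumr_ge0 _ (fun k _ => ge0 k)) sum0))).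
rewrite psumr_eq0 //= => /allP/(_ j (mem_index_enum j)).
by rewrite irr_consttE mulf_eq0 orbC subr_eq0 => /orP[/eqP-> // | /eqP]; rewrite /n /phi => ->; rewrite eqxx.
Qed.

(* A normal subgroup B of order 25 of a Sylow subgroup P is not in the kernel of  *)
(* an irreducible constituent of degree 25, so the values of chi sum to 0 on B,   *)
(* and the Cauchy-Schwarz inequality on B^# is an equality.                       *)
Lemma small_normal_exists :
  exists N : {group gT}, [/\ N <| G, #|N| = 25%N,
    {in N^#, forall x, 'chi_i x = - 25%:R}%R & {in G :\: N, forall x, 'chi_i x = 0}%R].
Proof.
have [P sylP] := Sylow_exists 5 G; have oP := order_Sylow5 oG sylP.
have pP := pHall_pgroup sylP; have sPG := pHall_sub sylP.
have [||B [_ nsBP oB]] := @normal_pgroup 5 _ 2 _ P pP; first exact: normal_refl.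
  by rewrite oP pfactorK.
have {}oB : #|B| = 25%N by [].
have sBP := normal_sub nsBP; have sBG := subset_trans sBP sPG.
have sum0 : (\sum_(x in B) 'chi_i x = 0)%R.
  have: ('['Res[B] 'chi_i, 1] = 0)%R.
    rewrite -(cfResRes _ sBP sPG) [X in 'Res[B] X](cfun_sum_constt ('Res[P] 'chi_i)).
    rewrite linear_sum cfdot_suml big1 // => j Pj; rewrite linearZ cfdotZl /=.
    rewrite (_ : '[_, 1] = 0)%R ?mulr0 //; apply: contraTeq isT => nz.
    have sBker : B \subset cfker 'chi_j.
      by apply: constt0_Res_cfker => //; rewrite irr_consttE irr0.
    have prBP : B \proper P by rewrite properEcard sBP oB oP (@ltn_exp2l 5 2 6).
    by have := @irr_bound_ker _ P B j 2 6 2 oP (constt_degree25 sylP Pj) nsBP oB sBker prBP.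
  rewrite cfdotE => /eqP; rewrite mulf_eq0 invr_eq0 pnatr_eq0 oB /= => /eqP sum_eq0.
  by rewrite -[RHS]sum_eq0; apply: eq_bigr => x Bx; rewrite cfResE // cfun1E Bx conjC1 mulr1.
have sumB : (\sum_(x in B^#) 'chi_i x = - 600%:R)%R.
  by apply/eqP; rewrite -addr_eq0 addrC -chi1 -(big_setD1 _ (group1 B)) sum0.
have sumG : (\sum_(x in G) `|'chi_i x| ^+ 2 = #|G|%:R)%R.
  have := cfnorm_irr i; rewrite cfdotE => /(congr1 (fun z => #|G|%:R * z)%R).
  rewrite mulrA mulfV ?neq0CG // mul1r mulr1 => <-.
  by apply: eq_bigr => x _; rewrite normCK.
pose f x := (`|'chi_i x + (x \in B)%:R * 25%:R| ^+ 2)%R.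
(* Expanding the squares gives (|G| - 600^2) - 2 * 25 * 600 + 24 * 625 = 0. *)
have sumf : (\sum_(x in G^#) f x = 0)%R.
  have -> : (\sum_(x in G^#) f x = \sum_(x in G^#) (`|'chi_i x| ^+ 2) +
      \sum_(x in B^#) ('chi_i x * 25%:R + ('chi_i x * 25%:R)^* + 625%:R))%R.
    rewrite (big_setID B^#) [in RHS](big_setID B^#) /=.
    rewrite (setIidPr (setSD _ sBG)) addrAC -big_split /=; congr (_ + _)%R; last first.
      apply: eq_bigr => x; rewrite /f !inE => /andP[] /[swap] /andP[-> _] /=.
      by move/negPf->; rewrite mul0r addr0.
    apply: eq_bigr => x /setD1P[_ Bx]; rewrite /f Bx mul1r !normCK !rmorphD !rmorphM /=.
    rewrite !rmorph_nat mulrDl !mulrDr.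
    rewrite (_ : 625%:R = 25%:R * 25%:R :> algC)%R; last by rewrite -natrM.
    move: ('chi_i x) ('chi_i x)^*%R => a b; ring.
  have oB1 : #|B^#| = 24%N by have := cardsD1 1 B; rewrite group1 oB => -[].
  rewrite big_split /= sumr_const oB1 big_split -mulr_suml sumB /= -rmorph_sum -mulr_suml sumB /=.
  move: sumG; rewrite (big_setD1 1%g (group1 G)) chi1 /= => sumG.
  have -> : (\sum_(x in G^#) `|'chi_i x| ^+ 2 = #|G|%:R - 600%:R ^+ 2)%R.
    by rewrite -sumG normr_nat addrC addrK.
  rewrite oG rmorphM rmorphN !rmorph_nat -[(625%:R *+ 24)%R]mulr_natr natrM natrX.
  rewrite (_ : 600%:R = 24%:R * 25%:R :> algC)%R; last by rewrite -natrM.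
  rewrite (_ : 25%:R = 5%:R ^+ 2 :> algC)%R; last by rewrite -natrX.
  rewrite (_ : 625%:R = 5%:R ^+ 4 :> algC)%R; last by rewrite -natrX.
  rewrite (_ : 24%:R = 5%:R ^+ 2 - 1 :> algC)%R; last first.
    by apply/eqP; rewrite eq_sym subr_eq -natrX natr1.
  move: (5%:R : algC)%R => a; ring.
have f0 x : x \in G^# -> f x = 0%R.
  move/eqP: sumf; rewrite psumr_eq0 => [/allP sumf Gx | y _]; last exact: exprn_ge0.
  by have:= sumf x (mem_index_enum x); rewrite Gx => /eqP.
have def_chi x : x \in G^# -> ('chi_i x = - ((x \in B)%:R * 25%:R))%R.
  by move/f0/eqP; rewrite expf_eq0 normr_eq0 /= addr_eq0 => /eqP.
have nBG : B <| G.
  apply/andP; split=> //; apply/subsetP=> g Gg; rewrite inE; apply/subsetP=> _ /imsetP[x Bx ->].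
  have [-> | ntx] := eqVneq x 1; first by rewrite conj1g.
  have Gx := subsetP sBG x Bx.
  have := def_chi (x ^ g); rewrite !inE conjg_eq1 ntx groupJ // cfunJ // def_chi ?inE ?ntx //.
  rewrite Bx; case: (x ^ g \in B) => // /(_ isT)/eqP.
  by rewrite mul0r mul1r oppr0 oppr_eq0 pnatr_eq0.
exists B; split=> // x.
  case/setD1P=> ntx Bx; rewrite def_chi ?inE ?ntx ?(subsetP sBG) // Bx mul1r //.
case/setDP=> Gx nBx; rewrite def_chi ?(negPf nBx) ?mul0r ?oppr0 // !inE Gx andbT.
by apply: contraNneq nBx => ->.
Qed.
End SmallNormal.

(** * The Camina property of the pair (G, N) *)

Section CaminaProperties.
Variables (gT : finGroupType) (G N : {group gT}) (i : Iirr G).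
Hypotheses (oG : #|G| = (24 * 5 ^ 6)%N) (chi1 : ('chi_i 1%g = 600%:R)%R).
Hypotheses (nsNG : N <| G) (oN : #|N| = 25%N).
Hypotheses (chiN : {in N^#, forall x, 'chi_i x = - 25%:R}%R).
Hypotheses (chiG : {in G :\: N, forall x, 'chi_i x = 0}%R).

Let sNG : N \subset G := normal_sub nsNG.

(** Orthogonality with chi_i forces the sum of any other chi_j over N to be 25 chi_j(1), so the
    restriction of chi_j to N contains the trivial character. *)
Lemma irr_nontrivial_unique (j : Iirr G) : ~~ (N \subset cfker 'chi_j) -> j = i.
Proof.
apply: contraNeq => ne_ji; apply: constt0_Res_cfker => //.
rewrite irr_consttE irr0; have := cfdot_irr i j; rewrite eq_sym (negPf ne_ji) cfdotE.
move/eqP; rewrite mulf_eq0 invr_eq0 (negPf (neq0CG _)) /= (big_setID N) /=.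
rewrite (setIidPr sNG) [X in (_ + X)%R]big1 ?addr0; last by move=> x Gx; rewrite chiG ?mul0r.
rewrite (big_setD1 1%g) //= chi1 (eq_bigr (fun x => - 25%:R * ('chi_j x)^*)%R); last first.
  by move=> x Nx; rewrite chiN.
rewrite -mulr_sumr => eq0; have sumN : (\sum_(x in N) ('chi_j x)^* = 25%:R * 'chi_j 1%g)%R.
  rewrite (big_setD1 1%g) //=; have conj1 : (('chi_j 1%g)^* = 'chi_j 1%g)%R.
    by rewrite irr1_degree conjC_nat.
  rewrite conj1 in eq0 *.
  move: eq0; rewrite mulNr subr_eq0 (_ : 600%:R = 25%:R * 24%:R :> algC)%R; last by rewrite -natrM.
  rewrite -mulrA (inj_eq (mulfI _)) ?pnatr_eq0 // => /eqP <-.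
  by rewrite -{1}['chi_j 1%g]mul1r -mulrDl -(natrD _ 1 24).
rewrite cfdotC conjC_eq0 cfdotE mulf_neq0 ?invr_eq0 ?neq0CG //.
rewrite (eq_bigr (fun x => ('chi_j x)^*)%R); last first.
  by move=> x Nx; rewrite cfResE // cfun1E Nx mul1r.
by rewrite sumN mulf_neq0 ?irr1_neq0 ?pnatr_eq0.
Qed.

(** In the column relation for x and y, chi_i contributes 625 and every other character, being
    trivial on N, contributes the square of its degree; the sum cannot vanish. *)
Lemma small_normal_trans x y : x \in N^# -> y \in N^# -> x \in y ^: G.
Proof.
move=> Nx Ny; have Gy : y \in G by case/setD1P: Ny => _ /(subsetP sNG).
apply: contraTT isT => nxy; have := second_orthogonality_relation x Gy.
rewrite (negPf nxy) mulr0n => /eqP; rewrite (bigD1 i) //= gt_eqF //.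
rewrite ltr_wpDr ?chiN ?(chiN Ny) //; last by rewrite rmorphN /= ?rmorph_nat mulrNN -natrM ltr0n.
apply: sumr_ge0 => j ne_ji.
have sNk : N \subset cfker 'chi_j.
  by apply: contraNT ne_ji => /irr_nontrivial_unique->.
case/setD1P: Nx => _ /(subsetP sNk)/cfker1->; case/setD1P: Ny => _ /(subsetP sNk)/cfker1->.
exact: mul_conjC_ge0.
Qed.

(** By reciprocity and [irr_nontrivial_unique] the character lies under chi_i, so its degree is 25.
    Since 25^2 * 25 = |P|, its centre is exactly N and its degree is as large as the centre allows;
    characters attaining that bound vanish off their centre. *)
Lemma Sylow_char_vanish (P : {group gT}) (j : Iirr P) :
    5.-Sylow(G) P -> N \subset P -> [~: N, P] \subset cfker 'chi_j ->
    ~~ (N \subset cfker 'chi_j) ->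
  {in P :\: N, forall x, 'chi_j x = 0}%R.
Proof.
move=> sylP sNP sNPk nNk; have sPG := pHall_sub sylP; have oP := order_Sylow5 oG sylP.
have [a aP] := constt_cfInd_irr j sPG; rewrite constt_Ind_Res in aP.
have def_a : a = i.
  apply: irr_nontrivial_unique; apply: contra nNk => sNk.
  have := cfker_constt (cfRes_char P (irr_char a)) aP; apply: subset_trans.
  exact: sub_cfker_Res.
rewrite {}def_a in aP; have dj := constt_degree25 oG chi1 sylP aP.
have sNZ : N \subset 'Z('chi_j)%CF.
  have nkN : N \subset 'N(cfker 'chi_j) by rewrite (subset_trans sNP) // normal_norm ?cfker_normal.
  rewrite -(quotientSGK nkN (normal_sub (cfker_center_normal _))).
  rewrite cfcenter_eq_center. apply/subsetIP; split; first exact: quotientS.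
  by rewrite quotient_cents2r.
have [k oZ] := p_natP (pgroupS (cfcenter_sub 'chi_j) (pHall_pgroup sylP)).
have le_k : (4 + k <= 6)%N := @irr_bound_sub _ P _ j 2 6 k oP dj (subxx _) oZ.
have eZN : 'Z('chi_j)%CF = N.
  apply/esym/eqP; rewrite eqEcard sNZ oZ oN /= -[25%N]/(5 ^ 2)%N leq_exp2l //; lia.
have [_ eqZ] := irr1_bound j; rewrite dj eZN in eqZ.
have := eqZ; rewrite -divgS // oP oN (_ : (5 ^ 6 = 625 * 25)%N); last first.
  by rewrite (expnD 5 4 2).
rewrite mulnK // -natrX eqr_nat -[(25 ^ 2)%N]/625%N eqxx => /esym onN x /setDP[_ nNx].
exact: cfun_on0 onN nNx.
Qed.

(** Column orthogonality in P / K for the images of x and x z: characters trivial on N agree on the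
    two, the others vanish at x, and the trivial character makes the sum positive. It is applied
    with K = 1 in the closed case and with K = <n1> in the other. *)
Lemma Camina_Sylow (P K : {group gT}) x z :
    5.-Sylow(G) P -> K \subset N -> K <| P -> N \subset P -> [~: N, P] \subset K ->
    x \in P :\: N -> z \in N ->
  exists2 y, y \in P & z^-1 * [~ x, y] \in K.
Proof.
move=> sylP sKN nsKP sNP sNPK PNx Nz; have [Px nNx] := setDP PNx.
have Pz := subsetP sNP z Nz; have nKP := normal_norm nsKP; have nK := subsetP nKP.
have Qxz : coset K (x * z) \in P / K by rewrite mem_quotient ?groupM.
suffices /imsetP[yb /morphimP[y Ny Py ->] def_xz] : coset K (x * z) \in coset K x ^: (P / K).
  exists y => //; rewrite -morphJ ?nK // in def_xz.
  have : (x * z)^-1 * (x ^ y) \in K.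
    have [Nxz Nxy]: x * z \in 'N(K) /\ x ^ y \in 'N(K).
      by split; apply: nK; [exact: groupM | exact: groupJ].
    apply: coset_idr; first by rewrite groupM ?groupV.
    by rewrite /= morphM ?groupV // morphV // -def_xz mulVg.
  by rewrite invMg -mulgA -commgEl.
rewrite class_sym; apply: contraTT isT => nxz.
have := second_orthogonality_relation (coset K x) Qxz.
rewrite (negPf nxz) mulr0n => /eqP; rewrite (bigD1 0)%R //= gt_eqF //.
rewrite ltr_wpDr //; last first.
  by rewrite irr0 !cfun1E Qxz mem_quotient // conjC1 mul1r ltr01.
apply: sumr_ge0 => j _.
have eqM y : y \in P -> ('chi_j (coset K y) = 'chi_(mod_Iirr j) y)%R.
  by move=> Py; rewrite mod_IirrE // cfModE.
rewrite !{}eqM ?groupM //; set l := mod_Iirr j.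
have sKl : K \subset cfker 'chi_l by rewrite mod_IirrE // cfker_mod.
have [sNl | nNl] := boolP (N \subset cfker 'chi_l).
  by rewrite cfkerMr ?mul_conjC_ge0 // (subsetP sNl).
by rewrite (Sylow_char_vanish sylP sNP (subset_trans sNPK sKl) nNl PNx) mul0r.
Qed.

End CaminaProperties.

(** * Recovering the character from the Camina property *)

Section CaminaConverse.
Variables (gT : finGroupType) (G N : {group gT}).
Hypotheses (nsNG : N <| G).

(** The sum of the representing matrices over N commutes with G, so it is scalar by Schur's lemma;
    its trace is 0, so it is the zero matrix, even after multiplication by x. *)
Lemma irr_sum_coset0 (i : Iirr G) x :
    ~~ (N \subset cfker 'chi_i) -> x \in G -> (\sum_(z in N) 'chi_i (x * z)%g = 0)%R.
Proof.
move=> nNi Gx; have sNG := normal_sub nsNG; have nNG := subsetP (normal_norm nsNG).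
have res0 : (\sum_(z in N) 'chi_i z = 0)%R.
  have: ('['Res[N] 'chi_i, 1] = 0)%R.
    by apply: contraNeq nNi => nz; apply: constt0_Res_cfker; rewrite // irr_consttE irr0.
  rewrite cfdotE => /eqP; rewrite mulf_eq0 invr_eq0 (negPf (neq0CG _)) /= => /eqP {2}<-.
  by apply: eq_bigr => z Nz; rewrite cfResE // cfun1E Nz conjC1 mulr1.
pose rG := 'Chi_i; pose A := (\sum_(z in N) rG z)%R.
have cA : centgmx rG A.
  apply/centgmxP=> g Gg; rewrite mulmx_suml mulmx_sumr.
  rewrite (reindex_inj (conjg_inj g^-1)) /=.
  have Ng z : (z ^ g^-1 \in N) = (z \in N) by rewrite memJ_norm ?nNG ?groupV.
  apply: eq_big => // z; rewrite Ng => Nz; have Gz := subsetP sNG z Nz.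
  by rewrite -!repr_mxM ?groupJ ?groupV // conjgE invgK !mulgA mulgKV.
have /is_scalar_mxP[a defA] : is_scalar_mx A.
  by apply: mx_abs_irr_cent_scalar cA; apply/groupC/socle_irr.
have chiE g : g \in G -> ('chi_i g = \tr (rG g))%R by move=> Gg; rewrite -irrRepr cfunE Gg.
have : (\tr A = 0)%R.
  by rewrite raddf_sum -[RHS]res0; apply: eq_bigr => z Nz; rewrite chiE ?(subsetP sNG).
rewrite defA mxtrace_scalar -mulr_natl => /eqP; rewrite mulf_eq0 => /orP[|/eqP a0].
  by rewrite -irr1_degree (negPf (irr1_neq0 i)).
rewrite (eq_bigr (fun z => \tr (rG x *m rG z))%R); last first.
  by move=> z Nz; have Gz := subsetP sNG z Nz; rewrite chiE ?groupM // repr_mxM.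
by rewrite -raddf_sum -mulmx_sumr -/A defA a0 raddf0 mulmx0 raddf0.
Qed.

(* An irreducible character nontrivial on N vanishes off N and is constant on N^#, *)
(* so its norm determines its degree.                                              *)
Lemma Isaacs_of_Camina :
    #|G| = (24 * 5 ^ 6)%N -> #|N| = 25%N ->
    {in N^# &, forall x y, x \in y ^: G} ->
    {in G :\: N & N, forall x z, x * z \in x ^: G} ->
  Isaacs_group 25 G.
Proof.
move=> oG oN trN Cam; have sNG := normal_sub nsNG; split; [by [] | by rewrite oG -Isaacs25_order | ].
have [i nNi] : exists i : Iirr G, ~~ (N \subset cfker 'chi_i).
  apply/existsP; rewrite -negb_forall; apply: contraL isT => /forallP kerN.
  have : N \subset [1 gT] by rewrite -(TI_cfker_irr G); apply/bigcapsP.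
  by move/subset_leq_card; rewrite oN cards1.
exists i; set d := ('chi_i 1%g)%R.
have chiG x : x \in G :\: N -> ('chi_i x = 0)%R.
  move=> GNx; have [Gx nNx] := setDP GNx; have := irr_sum_coset0 nNi Gx.
  rewrite (eq_bigr (fun=> 'chi_i x)); last first.
    by move=> z Nz; have /imsetP[g Gg ->] := Cam x z GNx Nz; rewrite cfunJ.
  by rewrite sumr_const oN => /eqP; rewrite mulrn_eq0 /= => /eqP.
have [n Nn] : exists n, n \in N^#.
  by apply/set0Pn; rewrite setD_eq0 subG1 -cardG_gt1 oN.
have oN1 : #|N^#| = 24%N by have := cardsD1 1 N; rewrite group1 oN => -[].
have chiN x : x \in N^# -> ('chi_i x = 'chi_i n)%R.
  by move=> Nx; have /imsetP[g Gg ->] := trN x n Nx Nn; rewrite cfunJ.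
have dn : (d = - (24%:R * 'chi_i n))%R.
  have := irr_sum_coset0 nNi (group1 G); rewrite (big_setD1 1%g) //= mulg1 -/d.
  rewrite (eq_bigr (fun=> 'chi_i n)); last by move=> z Nz; rewrite mul1g chiN.
  by rewrite sumr_const oN1 mulr_natl => /eqP; rewrite addr_eq0 => /eqP.
have nreal : (('chi_i n)^* = 'chi_i n)%R.
  have : ((d)^* = d)%R by rewrite /d irr1_degree conjC_nat.
  rewrite dn rmorphN rmorphM /= rmorph_nat => /oppr_inj/mulfI; apply.
  by rewrite pnatr_eq0.
have := cfnorm_irr i; rewrite cfdotE => /(congr1 (fun z => #|G|%:R * z)%R).
rewrite mulrA mulfV ?neq0CG // mul1r mulr1 (big_setID N) /= (setIidPr sNG).
rewrite [X in (_ + X)%R]big1 ?addr0; last by move=> x Gx; rewrite chiG ?mul0r.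
rewrite (big_setD1 1%g) //= (eq_bigr (fun=> 'chi_i n ^+ 2)%R); last first.
  by move=> x Nx; rewrite chiN // nreal expr2.
rewrite sumr_const oN1 -/d -[(_ ^+ 2 *+ 24)%R]mulr_natl {2}dn rmorphN rmorphM /= rmorph_nat nreal {1}dn oG.
(* With a the value on N^#, the degree is -24 a and the norm equation is (24^2 + 24) a^2 = 24 * 5^6.
   So a is 25 or -25, and a positive degree selects -25. *)
move=> eqn; have {eqn} : (('chi_i n) ^+ 2 = 25%:R ^+ 2)%R.
  apply: (mulfI (_ : 600%:R != 0)%R); first by rewrite pnatr_eq0.
  transitivity ((24 * 5 ^ 6)%:R : algC)%R.
    rewrite -eqn (_ : 600%:R = 24%:R * 24%:R + 24%:R :> algC)%R; last first.
      by rewrite -natrM -natrD.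
    by move: (24%:R : algC)%R ('chi_i n) => a b; ring.
  have -> : (600%:R = 24%:R * 5%:R ^+ 2 :> algC)%R by rewrite -natrX -natrM.
  have -> : (25%:R = 5%:R ^+ 2 :> algC)%R by rewrite -natrX.
  rewrite natrM natrX.
  by move: (24%:R : algC)%R (5%:R : algC)%R => a b; ring.
move/eqP; rewrite eqf_sqr => /orP[] /eqP chin.
  by have := irr1_gt0 i; rewrite -/d dn chin oppr_gt0 -natrM ltrn0.
by rewrite -/d dn chin mulrN opprK -natrM.
Qed.

End CaminaConverse.

(** * Isomorphism by Gaschutz' theorem *)

(* The complement provided by Gaschutz' theorem is the graph of an isomorphism. *)
Lemma isog_of_matched_Sylow (gT1 gT2 : finGroupType) (p : nat)
    (G1 E1 : {group gT1}) (G2 E2 : {group gT2}) (R L Q : {group gT1 * gT2}) :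
    setX E1 E2 \subset R -> R \subset 'N(setX E1 E2) -> p.-abelem E1 -> p.-abelem E2 ->
    fst @: R = G1 -> snd @: R = G2 -> fst @: L = E1 -> snd @: L = E2 ->
    (forall g, (1, g) \in R -> g \in E2) -> (forall g, (g, 1) \in R -> g \in E1) ->
    (forall g, (1, g) \in L -> g = 1) -> (forall g, (g, 1) \in L -> g = 1) ->
    R \subset 'N(L) -> L \subset Q -> Q \subset R ->
    Q :&: setX E1 E2 = L -> p^'.-nat #|R : Q <*> setX E1 E2| ->
  G1 \isog G2.
Proof.
pose F : {group gT1 * gT2} := setX_group E1 E2; rewrite -[setX E1 E2]/(F : {set _}).
move=> sFR nFR abE1 abE2 R1 R2 L1 L2 kR1 kR2 kL1 kL2 nLR sLQ sQR QF coR.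
have sLF : L \subset F by rewrite -QF subsetIr.
have abF : abelian F.
  apply/centsP=> -[x1 x2] /setXP[Ex1 Ex2] [y1 y2] /setXP[Ey1 Ey2].
  congr (_, _); last exact: (centsP (abelem_abelian abE2)).
  exact: (centsP (abelem_abelian abE1)).
have pF : p.-group F.
  by rewrite /pgroup /= cardsX pnatM; apply/andP; split; apply: abelem_pgroup.
have nsFR : F / L <| R / L by rewrite quotient_normal // /normal sFR.
have sQN := subset_trans sQR nLR.
have nFQ : Q \subset 'N(F) := subset_trans sQR nFR.
(* The abelian normal p-subgroup F / L has the complement Q / L in a subgroup of index prime to p,
   so Gaschutz' theorem provides a complement in R / L. *)
have splitR : [splits R / L, over F / L].
  pose P := ((Q / L) <*> (F / L))%G.
  have sFP : F / L \subset P by apply: joing_subr.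
  have sPR : P \subset R / L by rewrite join_subG !quotientS.
  rewrite (Gaschutz_split nsFR sFP sPR) ?quotient_abelian //.
    apply/splitsP; exists (Q / L)%G; apply/complP; split.
      by rewrite -quotientGI // setIC QF trivg_quotient.
    by rewrite /= joingC norm_joinEr ?quotient_norms.
  apply: (@pnat_coprime p); first exact: quotient_pgroup.
  rewrite /= -quotientY ?(subset_trans sFR) // index_quotient_eq ?join_subG ?sQR //.
  exact: subset_trans (subsetIr _ _) (subset_trans sLQ (joing_subl _ _)).
have /splitsP[K /complP[tiFK FK]] := splitR.
pose D := (coset L @*^-1 K)%G.
have sKR : K \subset R / L by rewrite -FK mulG_subr.
have sLR := subset_trans sLQ sQR.
have sDR : D \subset R by rewrite -(quotientGK (_ : L <| R)) ?cosetpreSK // /normal sLR.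
have DF x : x \in D -> x \in F -> x \in L.
  move=> Dx Fx; have Nx : x \in 'N(L) by rewrite (subsetP (subset_trans sDR nLR)).
  apply: coset_idr => //; have : coset L x \in F / L :&: K.
    by rewrite inE mem_quotient //; case/morphpreP: Dx.
  by rewrite tiFK => /set1P.
have sLD : L \subset D by rewrite sub_cosetpre.
have RFD x : x \in R -> exists2 f, f \in F & f^-1 * x \in D.
  move=> Rx; have Nx := subsetP nLR x Rx.
  have : coset L x \in F / L * K by rewrite FK mem_quotient.
  case/mulsgP=> _ k /morphimP[f Nf Ff ->] Kk def_x; exists f => //.
  apply/morphpreP; split; first by rewrite groupM ?groupV.
  by rewrite /= morphM ?groupV // morphV // [X in _ * X]def_x mulKg.
(* D meets F in L and covers R modulo F, the kernel of each projection of R lies in F, and L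
   projects isomorphically onto each E; so each projection of D is bijective. *)
have proj (gT : finGroupType) (f : {morphism [set: gT1 * gT2] >-> gT}) (G E : {group gT}) :
    f @: R = G -> f @: L = E -> f @: F = E -> (forall x, x \in R -> f x = 1 -> x \in F) ->
    (forall x, x \in L -> f x = 1 -> x = 1) -> G \isog D.
  move=> fR fL fF kR kL; rewrite isog_sym.
  apply/isogP; exists [morphism of restrm (subsetT D) f].
    apply/subsetP=> x /morphpreP[/= Dx /set1P fx].
    by apply/set1P/kL => //; apply: DF => //; apply: kR (subsetP sDR x Dx) _.
  rewrite morphim_restrm setIid morphimE setTI; apply/setP=> y.
  apply/imsetP/idP=> [[x Dx ->] | ]; first by rewrite -fR imset_f ?(subsetP sDR).
  rewrite -{1}fR => /imsetP[x Rx ->]; have [u Fu Dux] := RFD x Rx.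
  have : f u \in E by rewrite -fF imset_f.
  rewrite -fL => /imsetP[v Lv def_u]; exists (v * (u^-1 * x)); first exact: groupM (subsetP sLD v Lv) Dux.
  by rewrite !morphM ?morphV ?inE // -def_u mulKVg.
apply: isog_trans (proj _ _ _ _ R1 L1 _ _ _) _; last first.
  rewrite isog_sym; apply: (proj _ _ _ _ R2 L2).
  - apply/setP=> y; apply/imsetP/idP=> [[[a b] /setXP[? ?] ->] // | Ey].
    by exists (1, y); rewrite // inE /= group1.
  - by move=> [a b] Rab /= b1; rewrite b1 in Rab *; rewrite inE /= group1 andbT kR2.
  by move=> [a b] Rab /= b1; rewrite b1 in Rab *; rewrite (kL2 a).
- by move=> [a b] Rab /= b1; rewrite b1 in Rab *; rewrite (kL1 b).
- by move=> [a b] Rab /= b1; rewrite b1 in Rab *; rewrite inE /= group1 kR1.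
apply/setP=> y; apply/imsetP/idP=> [[[a b] /setXP[? ?] ->] // | Ey].
by exists (y, 1); rewrite // inE /= group1 andbT.
Qed.

Lemma norm_gen_imset (U : finType) (gT : finGroupType) (e : U -> gT) (E : {group gT}) (x : gT) (f : U -> U) :
  E = e @: U :> {set gT} -> (forall u, e u ^ x = e (f u)) -> x \in 'N(E).
Proof.
move=> defE cx; rewrite inE defE; apply/subsetP=> _ /imsetP[_ /imsetP[u _ ->] ->].
by rewrite cx imset_f.
Qed.

(** Relations must be matched only inside a Sylow p-subgroup, where they take the form of a bound on
    the order of the group generated by the pairs [ws]. The pairs [hs] need only act alike on the
    two copies of E: Gaschutz' theorem supplies their relations. That E contains its centralizer
    keeps the kernels of both projections inside E. *)
Lemma isog_of_ext_data (p : nat) (U : finZmodType) (gT1 gT2 : finGroupType)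
    (G1 E1 P1 : {group gT1}) (G2 E2 : {group gT2}) (e1 : U -> gT1) (e2 : U -> gT2)
    (ws hs : seq (gT1 * gT2)) :
    prime p -> (forall u : U, u *+ p = 0)%R ->
    E1 = e1 @: U :> {set gT1} -> E2 = e2 @: U :> {set gT2} ->
    {morph e1 : u v / (u + v)%R >-> u * v} -> {morph e2 : u v / (u + v)%R >-> u * v} ->
    injective e1 -> injective e2 ->
    {in ws ++ hs, forall x, exists f : U -> U,
       forall u, e1 u ^ x.1 = e1 (f u) /\ e2 u ^ x.2 = e2 (f u)} ->
    G1 = <<E1 :|: [set:: map fst (ws ++ hs)]>> :> {set gT1} ->
    G2 = <<E2 :|: [set:: map snd (ws ++ hs)]>> :> {set gT2} ->
    'C_G1(E1) \subset E1 -> 'C_G2(E2) \subset E2 ->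
    p.-Sylow(G1) P1 -> P1 = <<E1 :|: [set:: map fst ws]>> :> {set gT1} ->
    (#|<<[set (e1 u, e2 u) | u : U] :|: [set:: ws]>>| <= #|P1|)%N ->
  G1 \isog G2.
Proof.
move=> pr_p Up defE1 defE2 e1M e2M inj1 inj2 acts defG1 defG2 cE1 cE2 sylP defP leQ.
have e10 : e1 0%R = 1 by apply: (mulgI (e1 0%R)); rewrite -e1M addr0 mulg1.
have e20 : e2 0%R = 1 by apply: (mulgI (e2 0%R)); rewrite -e2M addr0 mulg1.
have gL : group_set [set (e1 u, e2 u) | u : U].
  apply/group_setP; split; first by apply/imsetP; exists 0%R; rewrite // e10 e20.
  move=> _ _ /imsetP[u _ ->] /imsetP[v _ ->].
  by apply/imsetP; exists (u + v)%R; rewrite // e1M e2M.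
pose L := Group gL; pose Q := <<L :|: [set:: ws]>>%G.
have eX1 u n : e1 u ^+ n = e1 (u *+ n)%R.
  by elim: n => [|n IHn]; rewrite ?expg0 ?mulr0n ?e10 // expgS mulrS e1M IHn.
have eX2 u n : e2 u ^+ n = e2 (u *+ n)%R.
  by elim: n => [|n IHn]; rewrite ?expg0 ?mulr0n ?e20 // expgS mulrS e2M IHn.
have abE1 : p.-abelem E1.
  apply/abelemP=> //; split=> [|_ /[1!defE1] /imsetP[u _ ->]]; last by rewrite eX1 Up e10.
  apply/centsP=> x + y; rewrite defE1 => /imsetP[u _ ->] /imsetP[v _ ->].
  by rewrite /commute -!e1M addrC.
have abE2 : p.-abelem E2.
  apply/abelemP=> //; split=> [|_ /[1!defE2] /imsetP[u _ ->]]; last by rewrite eX2 Up e20.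
  apply/centsP=> x + y; rewrite defE2 => /imsetP[u _ ->] /imsetP[v _ ->].
  by rewrite /commute -!e2M addrC.
have sE1G : E1 \subset G1 by rewrite defG1 (subset_trans _ (subset_gen _)) // subsetUl.
have sE2G : E2 \subset G2 by rewrite defG2 (subset_trans _ (subset_gen _)) // subsetUl.
have inG1 x : x \in ws ++ hs -> x.1 \in G1.
  by move=> xin; rewrite defG1 mem_gen // inE; apply/orP; right; rewrite inE map_f.
have inG2 x : x \in ws ++ hs -> x.2 \in G2.
  by move=> xin; rewrite defG2 mem_gen // inE; apply/orP; right; rewrite inE map_f.
have nE1 : G1 \subset 'N(E1).
  rewrite defG1 gen_subG subUset normG; apply/subsetP=> x; rewrite inE => /mapP[y /acts[f fP] ->].
  by apply: norm_gen_imset defE1 _ => u; case: (fP u) => ->.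
have nE2 : G2 \subset 'N(E2).
  rewrite defG2 gen_subG subUset normG; apply/subsetP=> x; rewrite inE => /mapP[y /acts[f fP] ->].
  by apply: norm_gen_imset defE2 _ => u; case: (fP u) => _ ->.
have nLx x : x \in ws ++ hs -> x \in 'N(L).
  move=> /acts[f fP]; apply: (@norm_gen_imset U _ (fun u => (e1 u, e2 u)) L x f) => // u.
  by have [f1 f2] := fP u; rewrite -f1 -f2; case: (x).
pose R := (setX_group G1 G2 :&: 'N(L))%G.
have sFN : setX E1 E2 \subset 'N(L).
  apply/cents_norm/centsP=> -[a b] /setXP[Ea Eb] _ /imsetP[u _ ->].
  congr (_, _); first by apply: (centsP (abelem_abelian abE1)); [exact: Ea | by rewrite defE1 /= imset_f].
  by apply: (centsP (abelem_abelian abE2)); [exact: Eb | by rewrite defE2 /= imset_f].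
have sFR : setX E1 E2 \subset R by rewrite subsetI setXS.
have xR x : x \in ws ++ hs -> x \in R.
  by move=> xin; rewrite inE nLx // inE inG1 ?inG2.
have sLF : L \subset setX E1 E2.
  by apply/subsetP=> _ /imsetP[u _ ->]; apply/setXP; rewrite /= defE1 defE2 !imset_f.
have sQR : Q \subset R.
  rewrite gen_subG subUset (subset_trans sLF) //; apply/subsetP=> x; rewrite inE => xin.
  by apply: xR; rewrite mem_cat xin.
have fstR : fst @: R = G1.
  apply/eqP; rewrite eqEsubset; apply/andP; split.
    by apply/subsetP=> _ /imsetP[[a b] /setIP[/setXP[? ?] _] ->].
  have -> : fst @: R = (fst_morphism gT1 gT2 @* R)%G by rewrite /= morphimE setTI.
  rewrite defG1 gen_subG subUset /= morphimE setTI; apply/andP; split.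
    apply/subsetP=> x Ex; apply/imsetP; exists (x, 1) => //; apply: (subsetP sFR).
    by rewrite inE Ex /= group1.
  by apply/subsetP=> x; rewrite inE => /mapP[y yin ->]; rewrite imset_f ?xR.
have sndR : snd @: R = G2.
  apply/eqP; rewrite eqEsubset; apply/andP; split.
    by apply/subsetP=> _ /imsetP[[a b] /setIP[/setXP[? ?] _] ->].
  have -> : snd @: R = (snd_morphism gT1 gT2 @* R)%G by rewrite /= morphimE setTI.
  rewrite defG2 gen_subG subUset /= morphimE setTI; apply/andP; split.
    apply/subsetP=> x Ex; apply/imsetP; exists (1, x) => //; apply: (subsetP sFR).
    by rewrite inE Ex /= group1.
  by apply/subsetP=> x; rewrite inE => /mapP[y yin ->]; rewrite imset_f ?xR.
have kR1 g : (1, g) \in R -> g \in E2.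
  case/setIP=> /setXP[_ Gg] /normP nLg; apply: (subsetP cE2); rewrite inE Gg.
  apply/centP=> x; rewrite defE2 => /imsetP[u _ ->]; apply/esym/commgP/conjg_fixP.
  have : (e1 u, e2 u) ^ (1, g) \in L by rewrite -nLg memJ_conjg imset_f.
  case/imsetP=> v _ eqv; have : e1 u ^ 1 = e1 v := congr1 fst eqv.
  by rewrite conjg1 => /inj1 uv; rewrite -uv in eqv; apply: (congr1 snd eqv).
have kR2 g : (g, 1) \in R -> g \in E1.
  case/setIP=> /setXP[Gg _] /normP nLg; apply: (subsetP cE1); rewrite inE Gg.
  apply/centP=> x; rewrite defE1 => /imsetP[u _ ->]; apply/esym/commgP/conjg_fixP.
  have : (e1 u, e2 u) ^ (g, 1) \in L by rewrite -nLg memJ_conjg imset_f.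
  case/imsetP=> v _ eqv; have : e2 u ^ 1 = e2 v := congr1 snd eqv.
  by rewrite conjg1 => /inj2 uv; rewrite -uv in eqv; apply: (congr1 fst eqv).
have fstQ : (fst_morphism gT1 gT2 @* Q)%G = P1.
  apply/val_inj; rewrite /= morphim_gen ?subsetT // morphimU defP; congr <<_ :|: _>>.
    rewrite morphimE setTI defE1; apply/setP=> x; apply/imsetP/imsetP.
      by case=> _ /imsetP[u _ ->] ->; exists u.
    by case=> u _ ->; exists (e1 u, e2 u); rewrite ?imset_f.
  rewrite morphimE setTI; apply/setP=> x; rewrite inE; apply/imsetP/mapP.
    by case=> y; rewrite inE => ? ->; exists y.
  by case=> y ? ->; exists y; rewrite ?inE.
(* Q maps onto P1 and is not larger than P1, so the first projection is injective on it. *)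
have injQ : {in Q &, injective fst}.
  apply/imset_injP; rewrite eqn_leq leq_imset_card /=.
  have -> : fst @: Q = P1 by rewrite -fstQ /= morphimE setTI.
  exact: leQ.
have QF : Q :&: setX E1 E2 = L.
  apply/eqP; rewrite eqEsubset subsetI sLF (subset_trans _ (subset_gen _)) ?subsetUl // !andbT.
  apply/subsetP=> -[x y] /setIP[Qxy /setXP[]]; rewrite defE1 => /imsetP[u _ def_x] _.
  have Lu : (e1 u, e2 u) \in L by rewrite imset_f.
  have Qu : (e1 u, e2 u) \in Q by rewrite mem_gen // inE Lu.
  by rewrite (injQ _ _ Qxy Qu def_x).
apply: (@isog_of_matched_Sylow _ _ p G1 E1 G2 E2 R L Q) => //.
- apply/subsetP=> -[a b] /setIP[/setXP[Ga Gb] _]; rewrite inE; apply/subsetP=> _ /imsetP[[x y] /setXP[Ex Ey] ->].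
  by apply/setXP; split; rewrite /= memJ_norm // ?(subsetP nE1) // (subsetP nE2).
- apply/setP=> x; rewrite defE1; apply/imsetP/imsetP; first by case=> _ /imsetP[u _ ->] ->; exists u.
  by case=> u _ ->; exists (e1 u, e2 u); rewrite ?imset_f.
- apply/setP=> x; rewrite defE2; apply/imsetP/imsetP; first by case=> _ /imsetP[u _ ->] ->; exists u.
  by case=> u _ ->; exists (e1 u, e2 u); rewrite ?imset_f.
- by move=> g /imsetP[u _ [eu ->]]; move: eu; rewrite -e10 => /inj1 <-; rewrite e20.
- by move=> g /imsetP[u _ [-> eu]]; move: eu; rewrite -e20 => /inj2 <-; rewrite e10.
- exact: subsetIr.
- by rewrite (subset_trans _ (subset_gen _)) ?subsetUl.
have sQFR : Q <*> setX E1 E2 \subset R by rewrite join_subG sQR.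
have := index_morphim_ker (fst_morphism gT1 gT2) sQFR (subsetT R).
have -> : fst_morphism gT1 gT2 @* R = G1 by rewrite morphimE setTI.
have -> : fst_morphism gT1 gT2 @* (Q <*> setX E1 E2) = P1.
  rewrite morphimY ?subsetT // -[_ @* Q]/(gval (fst_morphism gT1 gT2 @* Q)%G) fstQ.
  apply/joing_idPl; rewrite morphimE setTI defP; apply/subsetP=> _ /imsetP[[x y] /setXP[Ex _] ->].
  by rewrite mem_gen // inE Ex.
suffices -> : #|'ker_R (fst_morphism gT1 gT2) : Q <*> setX E1 E2| = 1%N.
  by rewrite muln1 => <-; case/and3P: sylP.
apply/eqP; rewrite indexg_eq1; apply/subsetP=> -[x y] /setIP[Rxy /morphpreP[_ /set1P /= x1]].
rewrite x1 in Rxy *; apply: (subsetP (joing_subr _ _)).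
by rewrite inE /= group1 kR1.
Qed.

(** * Computable fields of orders 5 and 25 *)

(** Constructors and operations defined by [match] let exhaustive checks over the field run in
    [vm_compute]. *)
Inductive GF5 : predArgType := f0 | f1 | f2 | f3 | f4.

Definition GF5_nat x := match x with f0 => 0 | f1 => 1 | f2 => 2 | f3 => 3 | f4 => 4 end%N.
Definition GF5_of_nat n := match n with 0 => f0 | 1 => f1 | 2 => f2 | 3 => f3 | _ => f4 end%N.
Lemma GF5_natK : cancel GF5_nat GF5_of_nat. Proof. by case. Qed.

Definition GF5_eq x y := match x, y with
  | f0, f0 | f1, f1 | f2, f2 | f3, f3 | f4, f4 => true | _, _ => false end.
Lemma GF5_eqP : Equality.axiom GF5_eq. Proof. by do 2 case; constructor. Qed.
HB.instance Definition _ := hasDecEq.Build GF5 GF5_eqP.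
HB.instance Definition _ := CanHasChoice GF5_natK.
HB.instance Definition _ := CanIsCountable GF5_natK.

Definition GF5s := [:: f0; f1; f2; f3; f4].
Lemma GF5_enum : Finite.axiom GF5s. Proof. by case. Qed.
HB.instance Definition _ := isFinite.Build GF5 GF5_enum.

Definition GF5_opp x := match x with f0 => f0 | f1 => f4 | f2 => f3 | f3 => f2 | f4 => f1 end.
Definition GF5_succ x := match x with f0 => f1 | f1 => f2 | f2 => f3 | f3 => f4 | f4 => f0 end.
Definition GF5_add x y := match x with
  | f0 => y | f1 => GF5_succ y | f2 => GF5_succ (GF5_succ y)
  | f3 => GF5_opp (GF5_succ (GF5_succ (GF5_opp y))) | f4 => GF5_opp (GF5_succ (GF5_opp y)) end.
Definition GF5_mul x y := match x with
  | f0 => f0 | f1 => y | f2 => GF5_add y y | f3 => GF5_opp (GF5_add y y) | f4 => GF5_opp y end.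

Lemma GF5_addA : associative GF5_add. Proof. by do 3 case. Qed.
Lemma GF5_addC : commutative GF5_add. Proof. by do 2 case. Qed.
Lemma GF5_add0 : left_id f0 GF5_add. Proof. by case. Qed.
Lemma GF5_addN : left_inverse f0 GF5_opp GF5_add. Proof. by case. Qed.
HB.instance Definition _ := GRing.isZmodule.Build GF5 GF5_addA GF5_addC GF5_add0 GF5_addN.

Lemma GF5_mulA : associative GF5_mul. Proof. by do 3 case. Qed.
Lemma GF5_mulC : commutative GF5_mul. Proof. by do 2 case. Qed.
Lemma GF5_mul1 : left_id f1 GF5_mul. Proof. by case. Qed.
Lemma GF5_mulD : left_distributive GF5_mul GF5_add. Proof. by do 3 case. Qed.
Lemma GF5_1neq0 : f1 != f0 :> GF5. Proof. by []. Qed.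
HB.instance Definition _ := GRing.Zmodule_isComNzRing.Build GF5 GF5_mulA GF5_mulC GF5_mul1 GF5_mulD GF5_1neq0.

Notation V := (GF5 * GF5)%type.

Definition Vs : seq V := [seq (x, y) | x <- GF5s, y <- GF5s].
Lemma mem_F5s x : x \in GF5s. Proof. by case: x. Qed.
Lemma mem_Vs x : x \in Vs.
Proof. by case: x => a b; apply: allpairs_f; apply: mem_F5s. Qed.

Lemma V_all (P : pred V) : all P Vs -> forall x, P x.
Proof. by move/allP=> allP x; apply/allP/mem_Vs. Qed.

(* V is the field of order 25, as F_5[s] with s^2 = 2. *)
Definition mulV (x y : V) : V :=
  ((x.1 * y.1 + (x.2 * y.2 + x.2 * y.2))%R, (x.1 * y.2 + x.2 * y.1)%R).
Definition oneV : V := (f1, f0).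
Definition frobV (x : V) : V := (x.1, - x.2)%R.
Definition expV x n := iter n (mulV x) oneV.

Lemma mulVA x y z : mulV x (mulV y z) = mulV (mulV x y) z.
Proof. by case: x y z => [? ?] [? ?] [? ?]; congr (_, _) => /=; ring. Qed.
Lemma mulVC x y : mulV x y = mulV y x.
Proof. by case: x y => [? ?] [? ?]; congr (_, _) => /=; ring. Qed.
Lemma mul1V x : mulV oneV x = x.
Proof. by apply/eqP; move: x; apply: V_all; vm_compute. Qed.
Lemma mulV1 x : mulV x oneV = x. Proof. by rewrite mulVC mul1V. Qed.
Lemma mul0V x : mulV 0%R x = 0%R.
Proof. by apply/eqP; move: x; apply: V_all; vm_compute. Qed.
Lemma mulV0 x : mulV x 0%R = 0%R. Proof. by rewrite mulVC mul0V. Qed.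
Lemma mulVDl x y z : mulV (x + y)%R z = (mulV x z + mulV y z)%R.
Proof. by case: x y z => [? ?] [? ?] [? ?]; congr (_, _) => /=; ring. Qed.
Lemma mulVDr x y z : mulV z (x + y)%R = (mulV z x + mulV z y)%R.
Proof. by rewrite !(mulVC z) mulVDl. Qed.
Lemma mulNV x y : mulV (- x)%R y = (- mulV x y)%R.
Proof. by case: x y => [? ?] [? ?]; congr (_, _) => /=; ring. Qed.
Lemma mulVN x y : mulV x (- y)%R = (- mulV x y)%R.
Proof. by rewrite mulVC mulNV mulVC. Qed.

(** Nonzero elements satisfy x^24 = 1; the value at 0 is 0. *)
Definition invV (x : V) : V := expV x 23.
Definition sqV : V := (f0, f1).
(** A generator omega of the multiplicative group, as [omV_log] verifies. *)
Definition omV : V := (f2, f1).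
Definition sactV (a : V) (b : bool) (x : V) : V := mulV a (if b then frobV x else x).

Lemma V_all2 (P : V -> V -> bool) : all (fun x => all (P x) Vs) Vs -> forall x y, P x y.
Proof. by move=> allP x; apply/V_all; move: x; apply/V_all. Qed.
Lemma V_all3 (P : V -> V -> V -> bool) :
  all (fun x => all (fun y => all (P x y) Vs) Vs) Vs -> forall x y z, P x y z.
Proof. by move=> allP x y; apply/V_all; move: x y; apply/V_all2. Qed.

Lemma mulV_eq0 x y : (mulV x y == 0%R) = (x == 0%R) || (y == 0%R).
Proof. by apply/(@eqP bool); move: x y; apply: V_all2; vm_compute. Qed.
Lemma mulIV z x y : z != 0%R -> mulV x z = mulV y z -> x = y.
Proof.
move=> nz /eqP; rewrite -subr_eq0 -mulNV -mulVDl mulV_eq0 (negPf nz) orbF subr_eq0.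
by move/eqP.
Qed.
Lemma mulfVV x : x != 0%R -> mulV x (invV x) = oneV.
Proof. by move=> nz; apply/eqP/(implyP _ nz); move: x {nz}; apply: V_all; vm_compute. Qed.
Lemma sactVD a b x y : sactV a b (x + y)%R = (sactV a b x + sactV a b y)%R.
Proof.
rewrite /sactV -mulVDr; case: b => //; congr (mulV _ _).
by case: x y => [? ?] [? ?]; congr (_, _) => /=; ring.
Qed.
Lemma sactV0 a b : sactV a b 0%R = 0%R.
Proof. by apply: (addrI (sactV a b 0%R)); rewrite -sactVD !addr0. Qed.
Lemma card_V : #|{: V}| = 25%N.
Proof. by rewrite card_prod !cardT enumT unlock. Qed.
Lemma V_mul5 (x : V) : (x *+ 5 = 0)%R.
Proof. by apply/eqP; move: x; apply: V_all; vm_compute. Qed.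

Section Combs.
Local Open Scope ring_scope.
HB.instance Definition _ (A B : finZmodType) := GRing.Zmodule.on (A * B)%type.
End Combs.

(* F25 is V with its field multiplication; on V itself the ring structure of the  *)
(* library is the componentwise one.                                              *)
Definition F25 : Type := V.
HB.instance Definition _ := FinRing.Zmodule.copy F25 V.
Fact one_neq0_F25 : oneV != 0%R :> F25. Proof. by []. Qed.
HB.instance Definition _ := GRing.Zmodule_isComNzRing.Build F25 mulVA mulVC mul1V mulVDl one_neq0_F25.

Lemma expV_F25 (x : F25) n : expV x n = (x ^+ n)%R.
Proof. by elim: n => //= n ->; rewrite exprS. Qed.
Lemma frobVM x y : frobV (mulV x y) = mulV (frobV x) (frobV y).
Proof. by case: x y => [? ?] [? ?]; congr (_, _) => /=; ring. Qed.
Lemma frobVD x y : frobV (x + y)%R = (frobV x + frobV y)%R.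
Proof. by case: x y => [? ?] [? ?]; congr (_, _) => /=; ring. Qed.
Lemma frobVN x : frobV (- x)%R = (- frobV x)%R.
Proof. by case: x => [? ?]. Qed.
Lemma frobVK x : frobV (frobV x) = x.
Proof. by case: x => [? x2]; congr (_, _) => /=; rewrite opprK. Qed.
Lemma frobVX x n : frobV (expV x n) = expV (frobV x) n.
Proof. by elim: n => //= n <-; rewrite frobVM. Qed.
Lemma frobV_eq0 x : (frobV x == 0%R) = (x == 0%R).
Proof. by apply/(@eqP bool); move: x; apply: V_all; vm_compute. Qed.
Lemma frobV_expV x : frobV x = expV x 5.
Proof. by apply/eqP; move: x; apply: V_all; vm_compute. Qed.

(** * The determinant form and the Witt vector cocycle *)

Definition dt (v w : V) : GF5 := (v.1 * w.2 - v.2 * w.1)%R.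
Definition scV (c : GF5) (x : V) : V := (c * x.1, c * x.2)%R.
Definition normV (x : V) : GF5 := (x.1 * x.1 - (x.2 * x.2 + x.2 * x.2))%R.
Lemma scV_mulV c x : scV c x = mulV (c, 0%R) x.
Proof. by case: x => ? ?; congr (_, _) => /=; ring. Qed.
Definition sgV (b : bool) : GF5 := if b then (- 1)%R else 1%R.
(** Multiplication by b has determinant its norm to F_5, and the Frobenius map has determinant
    -1. *)
Lemma dt_act b t x y :
  dt (sactV b t x) (sactV b t y) = (sgV t * normV b * dt x y)%R.
Proof.
by rewrite /sactV /dt /sgV /normV; case: t; case: b x y => [? ?] [? ?] [? ?] /=; ring.
Qed.

(* The carry of the second component in the addition of Witt vectors over V,     *)
(* up to the Frobenius automorphism: (v^5 + y^5 - (v + y)^5) / 5.                 *)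
Definition wittV (v y : V) : V :=
  (- (mulV v (expV y 4) + mulV (expV v 2) (expV y 3) *+ 2
      + mulV (expV v 3) (expV y 2) *+ 2 + mulV (expV v 4) y))%R.
Lemma wittV_F25 (v y : F25) :
  wittV v y = (- (v * y ^+ 4 + v ^+ 2 * y ^+ 3 *+ 2 + v ^+ 3 * y ^+ 2 *+ 2 + v ^+ 4 * y) : F25)%R.
Proof. by rewrite -!expV_F25. Qed.
(** Over the integers the polynomial is a coboundary divided by 5, so it satisfies the cocycle
    identity there, and hence over F_25. *)
Lemma wittV_cocycle v w y :
  (wittV w (y + v) + wittV v y = wittV (v + w) y + wittV w v)%R.
Proof.
have eqW (x1 x2 x3 : F25) : ((wittV x2 (x3 + x1) : F25) + wittV x1 x3 =
    (wittV (x1 + x2) x3 : F25) + wittV x2 x1 :> F25)%R by rewrite !wittV_F25; ring.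
exact: eqW.
Qed.
Lemma wittV_act b t v y :
  wittV (sactV b t v) (sactV b t y) = mulV (expV b 5) (if t then frobV (wittV v y) else wittV v y).
Proof.
have eqF (c x1 x2 : F25) :
    (wittV (c * x1)%R (c * x2)%R : F25) = (c ^+ 5 * (wittV x1 x2 : F25))%R :> F25.
  by rewrite !wittV_F25; ring.
have eqM (c x1 x2 : F25) : wittV (mulV c x1) (mulV c x2) = mulV (expV c 5) (wittV x1 x2).
  by rewrite expV_F25; exact: eqF.
rewrite /sactV; case: t; last exact: eqM.
rewrite [LHS](eqM b (frobV v) (frobV y)); congr (mulV _ _).
by rewrite /wittV !(frobVN, frobVD, mulr2n, frobVM, frobVX).
Qed.

(** * Permutation models on F_25 x F_25 *)

Section Model.
Local Open Scope ring_scope.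
Variables (K : finType) (A B lam : K -> V -> V) (L : seq K) (DD : seq V).
Variables (q dl ka : V -> V -> V) (k1 : K) (kM : K -> K -> K) (dJ : V -> K -> V).

(** The translations n form N and the shears d lie in D; k is an element of the complement (or of
    SL_2(5)), acting by [B] and [A] with a twist [lam]. The term [q] bends the translations by v, so
    that these need not commute or have order 5. *)
Definition modfun (n v d : V) (k : K) (p : V * V) : V * V :=
  (B k p.1 + lam k p.2 - mulV d (A k p.2) + q v (A k p.2) + n, A k p.2 + v).

(** The default [1] is never taken for k in [L], by [modfun_inj]. *)
Definition modperm n v d k : {perm V * V} := 
  if injectiveP (modfun n v d k) is ReflectT h then perm h else 1%g.

(** [modqD] says that the bent translations multiply up to a shear [dl] and a translation [ka];
    [modqB] and [modDJ] let k pass through [q] and through the shears. Together they close the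
    family under composition. [DD] will be all of F_25 for the 5-closed groups and the prime field
    for the others. *)
Record model_hyp : Prop := ModelHyp {
  modAD : {in L, forall k, {morph A k : x y / x + y}};
  modBD : {in L, forall k, {morph B k : x y / x + y}};
  modlD : {in L, forall k, {morph lam k : x y / x + y}};
  modAI : {in L, forall k, injective (A k)};
  modBI : {in L, forall k, injective (B k)};
  modk1 : [/\ k1 \in L, A k1 =1 id, B k1 =1 id & lam k1 =1 (fun=> 0)];
  modkM : {in L &, forall k k', [/\ kM k k' \in L, A (kM k k') =1 A k' \o A k,
     B (kM k k') =1 B k' \o B k
   & forall x, lam (kM k k') x = B k' (lam k x) + lam k' (A k x)]};
  modD0 : 0 \in DD;
  modDD : {in DD &, forall d d', d + d' \in DD};
  modDJ : {in DD & L, forall d k, dJ d k \in DD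
     /\ forall y, B k (mulV d y) = mulV (dJ d k) (A k y)};
  modqB : {in L, forall k v y, B k (q v y) = q (A k v) (A k y)};
  modqD : forall v w y, q w (y + v) + q v y = q (v + w) y - mulV (dl v w) y + ka v w;
  moddl : forall v w, dl v w \in DD;
  modq0 : forall y, q 0 y = 0;
  modinj : {in L &, forall k k', A k =1 A k' -> B k =1 B k' -> k = k'}
}.

Hypothesis mH : model_hyp.

Lemma modfun_inj n v d k : k \in L -> injective (modfun n v d k).
Proof.
move=> Lk [x y] [x' y'] eqf; have /= eqx := congr1 fst eqf; have /= eqy := congr1 snd eqf.
have {}eqy := modAI mH Lk (addIr _ eqy); rewrite eqy in eqx *.
by rewrite (modBI mH Lk (addIr _ (addIr _ (addIr _ (addIr _ eqx))))).
Qed.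

Lemma modpermE n v d k p : k \in L -> modperm n v d k p = modfun n v d k p.
Proof.
move=> Lk; rewrite /modperm; case: injectiveP => [h | []]; first by rewrite permE.
exact: modfun_inj.
Qed.

Lemma modpermM n v d k n' v' d' k' :
    k \in L -> k' \in L -> d \in DD -> d' \in DD ->
  (modperm n v d k * modperm n' v' d' k' =
     modperm (B k' n + lam k' v - mulV d' (A k' v) + ka (A k' v) v' + n')
       (A k' v + v') (dJ d k' + d' + dl (A k' v) v') (kM k k'))%g.
Proof.
move=> Lk Lk' Dd Dd'; apply/permP=> -[x y]; rewrite permM.
have [Lkk AM BM lM] := modkM mH Lk Lk'; rewrite !modpermE // /modfun /= !AM BM lM /=.
have BD := modBD mH Lk'; have AD := modAD mH Lk'; have lD := modlD mH Lk'.
have BN u : B k' (- u) = - B k' u.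
  have B0 : B k' 0 = 0 by apply: (addrI (B k' 0)); rewrite -BD !addr0.
  by apply: (addrI (B k' u)); rewrite -BD !subrr.
rewrite !(BD, AD, BN, lD) (modqB mH) //; congr (_, _); last by rewrite addrA.
have [_ ->] := modDJ mH Dd Lk'.
set Y := A k' (A k y); set u := A k' v.
have := modqD mH u v' Y => qD.
apply/eqP; rewrite -subr_eq0; apply/eqP.
rewrite mulVDr !mulVDl -[q v' (Y + u)](addrK (q u Y)) qD.
ring.
Qed.

Lemma modA0 k : k \in L -> A k 0 = 0.
Proof. by move=> Lk; apply: (addrI (A k 0)); rewrite -(modAD mH) // !addr0. Qed.
Lemma modB0 k : k \in L -> B k 0 = 0.
Proof. by move=> Lk; apply: (addrI (B k 0)); rewrite -(modBD mH) // !addr0. Qed.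
Lemma modl0 k : k \in L -> lam k 0 = 0.
Proof. by move=> Lk; apply: (addrI (lam k 0)); rewrite -(modlD mH) // !addr0. Qed.

Lemma modperm1 : modperm 0 0 0 k1 = 1%g.
Proof.
have [Lk1 A1 B1 l1] := modk1 mH; apply/permP=> -[x y]; rewrite modpermE // perm1.
by rewrite /modfun /= A1 B1 l1 (modq0 mH) mul0V oppr0 !addr0.
Qed.

Definition modset : {set {perm V * V}} :=
  [set modperm t.1.1.1 t.1.1.2 t.1.2 t.2 | t in [pred t : V * V * V * K | (t.1.2 \in DD) && (t.2 \in L)]].

Lemma modsetP s :
  reflect (exists n v d k, [/\ d \in DD, k \in L & s = modperm n v d k]) (s \in modset).
Proof.
apply: (iffP imsetP) => [[[[[n v] d] k] /andP[/= Dd Lk] ->] | [n [v [d [k [Dd Lk ->]]]]]].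
  by exists n, v, d, k.
by exists (n, v, d, k); rewrite // inE /= Dd.
Qed.

Lemma group_set_mod : group_set modset.
Proof.
have [Lk1 _ _ _] := modk1 mH; apply/group_setP; split.
  by apply/modsetP; exists 0, 0, 0, k1; rewrite (modD0 mH) modperm1.
move=> _ _ /modsetP[n [v [d [k [Dd Lk ->]]]]] /modsetP[n' [v' [d' [k' [Dd' Lk' ->]]]]].
rewrite modpermM //; apply/modsetP; do 4 eexists; split; last by reflexivity.
  by rewrite !(modDD mH) ?(moddl mH) //; case: (modDJ mH Dd Lk').
by case: (modkM mH Lk Lk').
Qed.
Definition modgroup := Group group_set_mod.

Lemma modperm_in n v d k : d \in DD -> k \in L -> modperm n v d k \in modgroup.
Proof. by move=> Dd Lk; apply/modsetP; exists n, v, d, k. Qed.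

(** The image of (0, 0) gives n and v, the two axes give [A k] and [B k], and d is read where [A k]
    takes the value 1. *)
Lemma modperm_inj n v d k n' v' d' k' :
    k \in L -> k' \in L -> modperm n v d k = modperm n' v' d' k' ->
  [/\ n = n', v = v', d = d' & k = k'].
Proof.
move=> Lk Lk' eqp; have eqf x y : modfun n v d k (x, y) = modfun n' v' d' k' (x, y).
  by rewrite -!modpermE // eqp.
have eqv : v = v'.
  by have /(congr1 snd) /= := eqf 0 0; rewrite !modA0 // !add0r.
have eqn : n = n'.
  have /(congr1 fst) /= := eqf 0 0; rewrite !modA0 // !modB0 // !modl0 // !mulV0.
  by rewrite eqv => /addrI.
have eqA : A k =1 A k'.
  by move=> y; have /(congr1 snd) /= := eqf 0 y; rewrite eqv => /addIr.
have eqB : B k =1 B k'.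
  move=> x; have /(congr1 fst) /= := eqf x 0; rewrite !modA0 // !modl0 // !mulV0 eqv eqn.
  by move/addIr/addIr/addIr/addIr.
have eqk := modinj mH Lk Lk' eqA eqB; split=> //; rewrite -eqk in eqf.
have [c Ac] : exists c, A k c = oneV by exists (invF (modAI mH Lk) oneV); rewrite f_invF.
have /(congr1 fst) /= := eqf 0 c; rewrite Ac eqv eqn => /addIr/addIr/addrI/oppr_inj.
by rewrite !mulV1.
Qed.

Lemma card_modgroup : uniq DD -> uniq L -> #|modgroup| = (625 * (size DD * size L))%N.
Proof.
move=> uD uL; rewrite /= card_in_imset; last first.
  move=> [[[n v] d] k] [[[n' v'] d'] k'] /andP[/= _ Lk] /andP[/= _ Lk'] eqp.
  by have [-> -> -> ->] := modperm_inj Lk Lk' eqp.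
rewrite (eq_card (_ : _ =i setX (setX [set: V * V] [set:: DD]) [set:: L])); last first.
  by move=> t; rewrite !inE.
rewrite !cardsX cardsT card_prod card_V !cardsE (card_uniqP uD) (card_uniqP uL).
by rewrite mulnA.
Qed.
Definition mT v := modperm 0 v 0 k1.
Definition mh k := modperm 0 0 0 k.
Definition me (u : V * V) := modperm u.1 0 u.2 k1.

Let Lk1 : k1 \in L. Proof. by case: (modk1 mH). Qed.
Let A1 x : A k1 x = x. Proof. by case: (modk1 mH) => _ ->. Qed.
Let B1 x : B k1 x = x. Proof. by case: (modk1 mH) => _ _ ->. Qed.
Let l1 x : lam k1 x = 0. Proof. by case: (modk1 mH) => _ _ _ ->. Qed.

Lemma modkMk1 k : k \in L -> kM k k1 = k.
Proof.
move=> Lk; have [Lk' Ak Bk _] := modkM mH Lk Lk1.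
by apply: (modinj mH Lk' Lk) => x; rewrite ?Ak ?Bk /= ?A1 ?B1.
Qed.

Lemma modk1Mk k : k \in L -> kM k1 k = k.
Proof.
move=> Lk; have [Lk' Ak Bk _] := modkM mH Lk1 Lk.
by apply: (modinj mH Lk' Lk) => x; rewrite ?Ak ?Bk /= ?A1 ?B1.
Qed.

Lemma moddJE d k e : d \in DD -> k \in L -> (forall y, B k (mulV d y) = mulV e (A k y)) -> dJ d k = e.
Proof.
move=> Dd Lk eqe; have [_ eqJ] := modDJ mH Dd Lk.
have [c Ac] : exists c, A k c = oneV by exists (invF (modAI mH Lk) oneV); rewrite f_invF.
by have := eqJ c; rewrite eqe Ac !mulV1.
Qed.

Lemma moddJ0 k : k \in L -> dJ 0 k = 0.
Proof. by move=> Lk; apply: moddJE; rewrite ?(modD0 mH) // => y; rewrite !mul0V modB0. Qed.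

Lemma moddJ1 d : d \in DD -> dJ d k1 = d.
Proof. by move=> Dd; apply: moddJE => // y; rewrite A1 B1. Qed.

Lemma moddl0l w : dl 0 w = 0 /\ ka 0 w = 0.
Proof.
have eqq y : - mulV (dl 0 w) y + ka 0 w = 0.
  have := modqD mH 0 w y; rewrite (modq0 mH) addr0 add0r addr0 -addrA.
  by move/esym/eqP; rewrite -subr_eq0 addrAC subrr add0r => /eqP.
have k0 : ka 0 w = 0 by rewrite -[RHS](eqq 0) mulV0 oppr0 add0r.
by split=> //; have := eqq oneV; rewrite k0 addr0 mulV1 => /eqP; rewrite oppr_eq0 => /eqP.
Qed.

Lemma moddl0r v : dl v 0 = 0 /\ ka v 0 = 0.
Proof.
have eqq y : - mulV (dl v 0) y + ka v 0 = 0.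
  have := modqD mH v 0 y; rewrite (modq0 mH) add0r addr0 -addrA.
  by move/esym/eqP; rewrite -subr_eq0 addrAC subrr add0r => /eqP.
have k0 : ka v 0 = 0 by rewrite -[RHS](eqq 0) mulV0 oppr0 add0r.
by split=> //; have := eqq oneV; rewrite k0 addr0 mulV1 => /eqP; rewrite oppr_eq0 => /eqP.
Qed.

Lemma meJ u n v d k : u.2 \in DD -> d \in DD -> k \in L ->
  (me u ^ modperm n v d k)%g = me (B k u.1 + mulV (dJ u.2 k) v, dJ u.2 k).
Proof.
case: u => x z /= Dz Dd Lk; have [Dz' _] := modDJ mH Dz Lk.
apply: (mulgI (modperm n v d k)); rewrite -conjgC /me /= !modpermM // ?(modD0 mH) //.
rewrite !modA0 // !modl0 // (modk1Mk Lk) (modkMk1 Lk) (moddl0l v).1 (moddl0l v).2 (moddl0r _).1 (moddl0r _).2.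
rewrite moddJ1 // A1 B1 l1 mulV0; congr (modperm _ _ _ _); ring.
Qed.

Lemma meM u v : u.2 \in DD -> v.2 \in DD -> me (u + v) = (me u * me v)%g.
Proof.
case: u v => [x z] [x' z'] /= Dz Dz'; rewrite /me /= modpermM // A1 B1 l1 mulV0.
rewrite (moddl0l _).1 (moddl0l _).2 moddJ1 // modkMk1 // ; congr (modperm _ _ _ _); ring.
Qed.

Lemma modperm_decomp n v d k : d \in DD -> k \in L ->
  modperm n v d k = (mh k * me (0, d) * mT v * me (n, 0))%g.
Proof.
have D0 := modD0 mH; move=> Dd Lk.
have -> : (mh k * me (0, d))%g = modperm 0 0 d k.
  rewrite /mh /me /= modpermM // modkMk1 // A1 B1 l1 (moddl0r _).1 (moddl0r _).2 moddJ1 // mulV0.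
  congr (modperm _ _ _ _); ring.
have -> : (modperm 0 0 d k * mT v)%g = modperm 0 v d k.
  rewrite /mT modpermM // modkMk1 // A1 B1 l1 (moddl0l _).1 (moddl0l _).2 moddJ1 // mulV0.
  congr (modperm _ _ _ _); ring.
rewrite /me /= modpermM // modkMk1 // A1 B1 l1 (moddl0r _).1 (moddl0r _).2 moddJ1 // mul0V.
congr (modperm _ _ _ _); ring.
Qed.

Lemma mTM v w : (mT v * mT w)%g = modperm (ka v w) (v + w) (dl v w) k1.
Proof.
have D0 := modD0 mH; rewrite /mT modpermM // A1 B1 l1 mul0V moddJ1 // modkMk1 //.
congr (modperm _ _ _ _); ring.
Qed.

Lemma mhM k k' : k \in L -> k' \in L -> (mh k * mh k')%g = mh (kM k k').
Proof.
have D0 := modD0 mH; move=> Lk Lk'; rewrite /mh modpermM // modA0 // modB0 // modl0 // mulV0 moddJ0 //.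
by rewrite (moddl0l _).1 (moddl0l _).2 oppr0 !addr0.
Qed.

Lemma mTJ v k : k \in L -> (mT v ^ mh k)%g = (mT (A k v) * me (lam k v, 0))%g.
Proof.
have D0 := modD0 mH; move=> Lk; apply: (mulgI (mh k)); rewrite -conjgC mulgA.
have <- : modperm (lam k v) (A k v) 0 k = (mh k * mT (A k v) * me (lam k v, 0))%g.
  rewrite modperm_decomp //; congr (_ * _ * _)%g; rewrite -[RHS]mulg1; congr (_ * _)%g.
  exact: modperm1.
rewrite /mT /mh modpermM // modB0 // (moddl0r _).1 (moddl0r _).2 moddJ0 // mul0V modk1Mk //.
congr (modperm _ _ _ _); ring.
Qed.

Lemma me_inj u v : me u = me v -> u = v.
Proof. by case: u v => [x z] [x' z'] /modperm_inj[] //= -> _ ->. Qed.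

Lemma mT_in v : mT v \in modgroup.
Proof. by apply: modperm_in => //; apply: modD0 mH. Qed.
Lemma mh_in k : k \in L -> mh k \in modgroup.
Proof. by apply: modperm_in; apply: modD0 mH. Qed.

Lemma mod_cent_me n v d k : d \in DD -> k \in L ->
    (forall u, u.2 \in DD -> (me u ^ modperm n v d k)%g = me u) ->
  B k =1 id /\ {in DD, forall z, dJ z k = z /\ mulV z v = 0}.
Proof.
have D0 := modD0 mH; move=> Dd Lk cEm; split=> [x | z Dz].
  have := cEm (x, 0) D0; rewrite meJ //= moddJ0 // mul0V addr0 => /me_inj/(congr1 fst) //.
have := cEm (0, z) Dz; rewrite meJ //= modB0 // add0r => /me_inj eqz.
have dz : dJ z k = z := congr1 snd eqz; split=> //.
by have /= := congr1 fst eqz; rewrite dz.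
Qed.

Lemma V_span (S : V -> Prop) :
  S 0 -> S oneV -> S sqV -> (forall v w, S v -> S w -> S (v + w)) -> forall v, S v.
Proof.
move=> S0 S1 Ss SD v; have SX x n : S x -> S (x *+ n).
  by move=> Sx; elim: n => // n IHn; rewrite mulrS; apply: SD.
have -> : v = oneV *+ GF5_nat v.1 + sqV *+ GF5_nat v.2; last by apply: SD; apply: SX.
by case: v => [[] []].
Qed.

Lemma mT_gen (H : {group {perm V * V}}) :
  (forall u, u.2 \in DD -> me u \in H) -> mT oneV \in H -> mT sqV \in H -> forall v, mT v \in H.
Proof.
have D0 := modD0 mH; have Dl := moddl mH; move=> HE H1 Hs; apply: V_span => //.
  by have -> : mT 0 = 1%g by apply: modperm1.
move=> v w Hv Hw; have := groupM Hv Hw; rewrite mTM modperm_decomp //.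
have -> : mh k1 = 1%g by apply: modperm1.
by rewrite mul1g (groupMr _ (HE (ka v w, 0) D0)) (groupMl _ (HE (0, dl v w) (Dl v w))).
Qed.

End Model.

(** Shrinking the set of k produces subgroups of a model by the same construction: with k = 1 only,
    P in the closed case and C in the other. *)
Lemma model_hyp_sub (K : finType) (A B lam : K -> V -> V) (L L' : seq K) (DD : seq V)
    (q dl ka : V -> V -> V) (k1 : K) (kM : K -> K -> K) (dJ : V -> K -> V) :
    model_hyp A B lam L DD q dl ka k1 kM dJ ->
    {subset L' <= L} -> k1 \in L' -> {in L' &, forall k k', kM k k' \in L'} ->
  model_hyp A B lam L' DD q dl ka k1 kM dJ.
Proof.
case=> AD BD lD AI BI k1P kMP D0 DDP DJ qB qD dlP q0 inj sL Lk1 LM.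
split.
- by move=> k /sL/AD.
- by move=> k /sL/BD.
- by move=> k /sL/lD.
- by move=> k /sL/AI.
- by move=> k /sL/BI.
- by case: k1P.
- by move=> k k' Lk Lk'; have [_ ? ? ?] := kMP k k' (sL k Lk) (sL k' Lk'); split=> //; apply: LM.
- exact: D0.
- exact: DDP.
- by move=> d k Dd /sL; apply: DJ.
- by move=> k /sL/qB.
- exact: qD.
- exact: dlP.
- exact: q0.
by move=> k k' /sL Lk /sL Lk'; apply: inj.
Qed.

(** * The 24 parameters and the 5-closed models *)

Definition tri := (V * V * bool)%type.
Definition actd (t : tri) (x : V) := sactV t.1.1 t.2 x.
Definition actv (t : tri) (x : V) := sactV t.1.2 t.2 x.
Definition actn (t : tri) (x : V) := sactV (mulV t.1.1 t.1.2) t.2 x.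
Definition tri1 : tri := (oneV, oneV, false).
Definition trimul (t t' : tri) : tri :=
  (mulV t'.1.1 (if t'.2 then frobV t.1.1 else t.1.1),
   mulV t'.1.2 (if t'.2 then frobV t.1.2 else t.1.2), t.2 (+) t'.2).
Definition tripow t n := iter n (trimul^~ t) tri1.

(* The action (x, z) |-> (c x^sigma, a z^sigma) of a complement on E = N D, with  *)
(* c = a b: the triple (a, b, sigma) records its actions on D, P / E and N.       *)
Definition acte (t : tri) (u : V * V) : V * V := (actn t u.1, actd t u.2).

(** The elements w1, w2 lift the basis 1, s of P / E. No relation links them to the generators h1,
    h2 of the complement, since [isog_of_ext_data] only uses the actions on E. *)
Definition closed_data (t1 t2 : tri) (dl p1 p2 : V) (gT : finGroupType) (G : {group gT}) : Prop :=
  exists (e : V * V -> gT) (E P : {group gT}) (w1 w2 h1 h2 : gT),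
  [/\ [/\ {morph e : u v / (u + v)%R >-> u * v}, injective e,
          E = e @: setT :> {set gT} & 'C_G(E) \subset E],
      [/\ forall u, e u ^ w1 = e (u.1 + u.2, u.2)%R,
          forall u, e u ^ w2 = e (u.1 + mulV u.2 sqV, u.2)%R,
          [~ w1, w2] = e (0%R, dl), w1 ^+ 5 = e (p1, 0%R) & w2 ^+ 5 = e (p2, 0%R)],
      [/\ forall u, e u ^ h1 = e (acte t1 u) & forall u, e u ^ h2 = e (acte t2 u)]
    & [/\ G = <<E :|: [set:: [:: w1; w2; h1; h2]]>> :> {set gT},
          P = <<E :|: [set:: [:: w1; w2]]>> :> {set gT},
          #|P| = (5 ^ 6)%N & #|G| = (24 * 5 ^ 6)%N]].

(** The shapes of P: split over E ([Q0]); with [w1, w2] outside N ([Qd k], k nonzero); or with a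
    fifth-power map from P / E to N that is the identity ([Q1]) or the Frobenius map ([Q5]) of
    F_25. *)
Inductive qkind := Q0 | Qd of V | Q1 | Q5.
Definition qkind_code (c : qkind) : nat * V := match c with
  | Q0 => (0%N, 0%R) | Qd k => (1%N, k) | Q1 => (2%N, 0%R) | Q5 => (3%N, 0%R) end.
Definition qkind_decode (x : nat * V) : qkind := match x.1 with
  | 0%N => Q0 | 1%N => Qd x.2 | 2%N => Q1 | _ => Q5 end.
Lemma qkind_codeK : cancel qkind_code qkind_decode. Proof. by case. Qed.
HB.instance Definition _ := Equality.copy qkind (can_type qkind_codeK).

(** For [Qd], the cubic dt(v, y) (y + 3 v) solves the equation [modqD] with a shear proportional to
    dt(v, w), as [dt_identity] verifies; for [Q1] and [Q5] a solution is the Witt vector carry. *)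
Definition qq (c : qkind) (v y : V) : V := match c with
  | Q0 => 0%R | Qd k => mulV k (scV (dt v y) (y + v *+ 3)%R)
  | Q1 => frobV (wittV v y) | Q5 => wittV v y end.
Definition qdl (c : qkind) (v w : V) : V :=
  if c is Qd k then (- (scV (dt v w) k))%R else 0%R.
Definition qka (c : qkind) (v w : V) : V := match c with
  | Q0 => 0%R | Qd k => mulV k (scV (dt w v) (v + w *+ 3)%R)
  | Q1 => frobV (wittV w v) | Q5 => wittV w v end.

Definition qc_dl c : V := if c is Qd k then (k *+ 3)%R else 0%R.
(** The element of D by which the lift of s is multiplied, so that [w1, w2] has no component in
    N. *)
Definition qc_adj c : V := if c is Qd k then mulV k (f4, f4) else 0%R.
Definition qc_p1 c : V := match c with Q1 | Q5 => oneV | _ => 0%R end.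
Definition qc_p2 c : V := match c with Q1 => sqV | Q5 => (- sqV)%R | _ => 0%R end.

Definition cparam := (bool * nat * qkind)%type.
(** The multiplier on N is omega in the cyclic case and omega^2 in the other, where [ct2] adds the
    map x -> omega x^5; either way the complement is regular on N^#. The exponent k is that of the
    action on P / E. *)
Definition ct1 (c : cparam) : tri := let: (M, k, _) := c in
  if M then (expV omV (26 - k.*2)%N, expV omV (k.*2)%N, false) else (expV omV (25 - k)%N, expV omV k, false).
Definition ct2 (c : cparam) : tri := let: (M, k, _) := c in
  if M then (expV omV (25 - k)%N, expV omV k, true) else tri1.
Definition cL (c : cparam) : seq tri :=
  [seq trimul (tripow (ct1 c) i) (tripow (ct2 c) j) |
    i <- iota 0 (if c.1.1 then 12 else 24)%N, j <- iota 0 (if c.1.1 then 2 else 1)%N].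
(** The exponent k is odd because the involution must fix D while inverting N. A nonsplit P occurs
    only at the three exponents where the complement preserves its relations. *)
Definition cparams : seq cparam :=
  [seq (false, k.*2.+1, Q0) | k <- iota 0 12]
  ++ [:: (false, 7%N, Qd (f2, f0)); (false, 1%N, Q1); (false, 5%N, Q5)]
  ++ [seq (true, k.*2.+1, Q0) | k <- iota 0 6]
  ++ [:: (true, 7%N, Qd (f0, f2)); (true, 1%N, Q1); (true, 5%N, Q5)].

(** The multiplier a b of N has to match the weight of [qq] in b: norm(b) b for [Qd], up to sign and
    the Frobenius image of k, b^25 = b for [Q1], and b^5 for [Q5]. *)
Definition qcond (c : qkind) (t : tri) := match c with
  | Q0 => true
  | Qd k => mulV t.1.1 (if t.2 then frobV k else k) == scV (sgV t.2 * normV t.1.2)%R k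
  | Q1 => t.1.1 == oneV
  | Q5 => t.1.1 == expV t.1.2 4 end.

Definition cok (c : cparam) := let L := cL c in
  [&& tri1 \in L, uniq L, size L == 24%N, (ct1 c \in L) && (ct2 c \in L),
      all (fun t => (t.1.1 != 0%R) && (t.1.2 != 0%R)) L,
      all (fun t => all (fun t' => trimul t t' \in L) L) L,
      all (fun t => (t == tri1) || all (fun x => (x == 0%R) || (actn t x != x)) Vs) L,
      all (fun x => (x == 0%R) || has (fun t => actn t oneV == x) L) Vs &
      all (qcond c.2) L].
Lemma all_cok : all cok cparams. Proof. by vm_compute. Qed.

Lemma dt_identity v w y :
  (scV (dt w (y + v)) (y + v + w *+ 3) + scV (dt v y) (y + v *+ 3) =
   scV (dt (v + w) y) (y + (v + w) *+ 3) + scV (dt v w) y + scV (dt w v) (v + w *+ 3))%R.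
Proof. by apply/eqP; move: v w y; apply: V_all3; vm_compute. Qed.

Lemma scV_mulVl c x y : mulV (scV c x) y = mulV x (scV c y).
Proof. by rewrite !scV_mulV (mulVC _ x) -mulVA. Qed.

Lemma qqD c v w y :
  (qq c w (y + v) + qq c v y = qq c (v + w) y - mulV (qdl c v w) y + qka c v w)%R.
Proof.
case: c => [|k||] /=; rewrite ?mul0V ?oppr0 ?addr0 //.
- by rewrite mulNV opprK scV_mulVl -!mulVDr dt_identity.
- by rewrite -!frobVD wittV_cocycle.
exact: wittV_cocycle.
Qed.

Lemma scV0 c : scV c 0%R = 0%R. Proof. by rewrite scV_mulV mulV0. Qed.
Lemma sc0V x : scV 0%R x = 0%R. Proof. by rewrite scV_mulV mul0V. Qed.

Lemma qq0 c y : qq c 0%R y = 0%R.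
Proof.
have d0 : dt 0%R y = 0%R by case: y => ? ?; rewrite /dt /=; ring.
have w0 : wittV 0%R y = 0%R by rewrite /wittV /= !mul0V !mul0rn !addr0 oppr0.
by case: c => [|k||] //=; rewrite ?d0 ?sc0V ?mulV0 // w0.
Qed.

Lemma sactV_comp b t b' t' x : sactV b' t' (sactV b t x) =
  sactV (mulV b' (if t' then frobV b else b)) (t (+) t') x.
Proof. by rewrite /sactV; case: t; case: t'; rewrite /= ?frobVM ?frobVK mulVA. Qed.

Lemma mulVACA x y z t : mulV (mulV x y) (mulV z t) = mulV (mulV x z) (mulV y t).
Proof. by rewrite -!mulVA (mulVA y) (mulVC y) -mulVA. Qed.

Lemma sactV_mulV a b t z y :
  sactV (mulV a b) t (mulV z y) = mulV (sactV a t z) (sactV b t y).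
Proof. by rewrite /sactV; case: t; rewrite ?frobVM mulVACA. Qed.

Lemma sactV_eq0 b t x : b != 0%R -> (sactV b t x == 0%R) = (x == 0%R).
Proof. by move=> nz; rewrite /sactV mulV_eq0 (negPf nz); case: t; rewrite ?frobV_eq0. Qed.

Lemma sactV_inj b t : b != 0%R -> injective (sactV b t).
Proof.
move=> nz x y /eqP eqxy; apply/eqP; rewrite -subr_eq0 -(sactV_eq0 t _ nz).
have sN u : (sactV b t (- u) = - sactV b t u)%R.
  by rewrite /sactV; case: (t); rewrite ?frobVN mulVN.
by rewrite sactVD sN subr_eq0.
Qed.

Lemma acts_trimul t t' x :
  [/\ actd (trimul t t') x = actd t' (actd t x), actv (trimul t t') x = actv t' (actv t x)
    & actn (trimul t t') x = actn t' (actn t x)].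
Proof.
rewrite /actd /actv /actn /= !sactV_comp; split=> //; congr (sactV _ _ _).
by case: (t'.2); rewrite ?frobVM mulVACA.
Qed.

Lemma acts_tri1 x : [/\ actd tri1 x = x, actv tri1 x = x & actn tri1 x = x].
Proof. by rewrite /actd /actv /actn /sactV /= !mul1V. Qed.

Lemma qqB c t v y : t.1.2 != 0%R -> qcond c t -> actn t (qq c v y) = qq c (actv t v) (actv t y).
Proof.
case: t => [[a b] t] /= nz; rewrite /actn /actv /=.
case: c => [|k||] /=; first by rewrite sactV0.
- move/eqP=> eqk; rewrite sactV_mulV dt_act {1}/sactV eqk scV_mulVl; congr (mulV k _).
  have scZ d u : sactV b t (scV d u) = scV d (sactV b t u).
    by rewrite /sactV !scV_mulV [RHS]mulVA (mulVC _ b) -mulVA; case: (t); rewrite ?frobVM //= /frobV /= oppr0.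
  rewrite scZ !(mulrS, mulr0n, addr0, sactVD).
  by rewrite !scV_mulV mulVA; congr (mulV _ _); rewrite -scV_mulV /scV /= mulr0.
- move/eqP->; rewrite mul1V wittV_act /sactV frobVM -{1}(frobVK b) -frobV_expV.
  by case: (t).
move/eqP->; rewrite wittV_act /sactV; congr (mulV _ _).
by rewrite mulVC.
Qed.

Definition pck (c : qkind) (t t' : V * V * V) : V * V * V :=
  (t.1.1 - mulV t'.2 t.1.2 + qka c t.1.2 t'.1.2 + t'.1.1,
   t.1.2 + t'.1.2, t.2 + t'.2 + qdl c t.1.2 t'.1.2)%R.

Section ClosedModel.
Variable c : cparam.
Hypothesis okc : cok c.

Lemma closed_model_hyp :
  model_hyp actv actn (fun _ _ => 0%R) (cL c) Vs (qq c.2) (qdl c.2) (qka c.2) tri1 trimul (fun d t => actd t d).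
Proof.
case/and5P: okc => L1 uL szL /andP[Lt1 Lt2] /and5P[/allP nz /allP LM /allP fpf /allP trans /allP qc].
have nz12 t : t \in cL c -> t.1.1 != 0%R /\ t.1.2 != 0%R by move/nz/andP.
have nzn t : t \in cL c -> mulV t.1.1 t.1.2 != 0%R.
  by case/nz12=> nz1 nz2; rewrite mulV_eq0 (negPf nz1) (negPf nz2).
split.
- by move=> t _ x y; apply: sactVD.
- by move=> t _ x y; apply: sactVD.
- by move=> t _ x y; rewrite addr0.
- by move=> t /nz12[_ nz2]; apply: sactV_inj.
- by move=> t /nzn nzt; apply: sactV_inj.
- by split=> // x; case: (acts_tri1 x).
- move=> t t' Lt Lt'; split; first exact: (allP (LM t Lt)).
  + by move=> x; case: (acts_trimul t t' x).
  + by move=> x; case: (acts_trimul t t' x).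
  by move=> x; rewrite /actn sactV0 addr0.
- exact: mem_Vs.
- by move=> *; apply: mem_Vs.
- by move=> d t _ _; split=> [|y]; [apply: mem_Vs | rewrite /actn sactV_mulV].
- by move=> t Lt v y; apply: qqB; [case: (nz12 t Lt) | apply: qc].
- by move=> v w y; apply: qqD.
- by move=> *; apply: mem_Vs.
- exact: qq0.
move=> [[a b] t] [[a' b'] t'] Lt Lt' eqA eqB.
have [nza nzb] := nz12 _ Lt; have [/= nza' nzb'] := nz12 _ Lt'.
have eb : b = b'.
  have := eqA oneV; rewrite /actv /sactV /=.
  by have -> : frobV oneV = oneV by []; rewrite !if_same !mulV1.
have ea : a = a'.
  have := eqB oneV; rewrite /actn /sactV /=; have -> : frobV oneV = oneV by [].
  by rewrite !if_same !mulV1 eb => /(mulIV nzb').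
have := eqA sqV; rewrite ea eb /actv /sactV /= !(mulVC b') => /(mulIV nzb').
by case: (t); case: (t').
Qed.

Notation mH := closed_model_hyp.
Definition closed_model := modgroup mH.

Lemma closed_P_hyp :
  model_hyp actv actn (fun _ _ => 0%R) [:: tri1] Vs (qq c.2) (qdl c.2) (qka c.2) tri1 trimul (fun d t => actd t d).
Proof.
apply: model_hyp_sub mH _ _ _; rewrite ?mem_seq1 //.
  by move=> t; rewrite mem_seq1 => /eqP->; case/and5P: okc.
by move=> t t'; rewrite !mem_seq1 => /eqP-> /eqP->.
Qed.

Lemma closed_model_card : #|closed_model| = (24 * 5 ^ 6)%N.
Proof.
case/and5P: okc => _ uL /eqP szL _ _; rewrite card_modgroup ?szL; [|by []|exact: uL].
rewrite -[size Vs]/(5 ^ 2)%N -[625%N]/(5 ^ 4)%N; lia.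
Qed.

Lemma closed_P_card : #|modgroup closed_P_hyp| = (5 ^ 6)%N.
Proof. by rewrite card_modgroup // -[size Vs]/(5 ^ 2)%N -[625%N]/(5 ^ 4)%N muln1 -expnD. Qed.

Lemma closed_model_regular t : t \in cL c -> (forall x, actn t x = x) -> t = tri1.
Proof.
case/and5P: okc => _ _ _ _ /and5P[_ _ /allP fpf _ _] Lt fixt.
have /orP[/eqP // | /allP/(_ oneV (mem_Vs _))] := fpf t Lt.
by rewrite fixt eqxx.
Qed.

Notation me := (me actv actn (fun _ _ => 0%R) (qq c.2) tri1).
Notation mT := (mT actv actn (fun _ _ => 0%R) (qq c.2) tri1).
Notation mh := (mh actv actn (fun _ _ => 0%R) (qq c.2)).

Lemma mh_tripow (H : {group {perm V * V}}) t n :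
  t \in cL c -> mh t \in H -> mh (tripow t n) \in H /\ tripow t n \in cL c.
Proof.
have okL := okc; case/and5P: okL => L1 _ _ _ /and5P[_ /allP LM _ _ _].
move=> Lt Ht; elim: n => [|n [IH1 IH2]] /=.
  by split=> //; have -> : mh tri1 = 1 by apply: (modperm1 mH).
split; last exact: (allP (LM _ IH2)).
by rewrite -[mh _](mhM mH) //; apply: groupM.
Qed.

Definition mp3 (t : V * V * V) := modperm actv actn (fun _ _ => 0%R) (qq c.2) t.1.1 t.1.2 t.2 tri1.
Definition pc := pck c.2.

Lemma mp3M t t' : (mp3 t * mp3 t')%g = mp3 (pc t t').
Proof.
case: t t' => [[n v] d] [[n' v'] d']; have [L1 Av Bv _] := modk1 mH.
rewrite /mp3 /pc /pck /= (modpermM mH) ?mem_Vs // !Av Bv addr0.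
by case: (acts_tri1 d) => -> _ _.
Qed.

Let W1 : V * V * V := (0%R, oneV, 0%R).
Let W2 : V * V * V := pc (0%R, sqV, 0%R) (0%R, 0%R, qc_adj c.2).

Lemma closed_model_rel :
  [/\ [~ mp3 W1, mp3 W2] = me (0%R, qc_dl c.2), mp3 W1 ^+ 5 = me (qc_p1 c.2, 0%R)
    & mp3 W2 ^+ 5 = me (qc_p2 c.2, 0%R)].
Proof.
split.
- apply: (mulgI (mp3 W2 * mp3 W1)); rewrite -commgC -[me _]/(mp3 (_, 0, _)%R) !mp3M.
  congr mp3; rewrite /W1 /W2 /pc; case: (c.2) => [|z||]; [by vm_compute | | by vm_compute | by vm_compute].
  by apply/eqP; move: z; apply: V_all; vm_compute.
- rewrite -[me _]/(mp3 (_, 0, _)%R) !expgS expg0 mulg1 !mp3M; congr mp3.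
  rewrite /W1 /W2 /pc; case: (c.2) => [|z||]; [by vm_compute | | by vm_compute | by vm_compute].
  by apply/eqP; move: z; apply: V_all; vm_compute.
rewrite -[me _]/(mp3 (_, 0, _)%R) !expgS expg0 mulg1 !mp3M; congr mp3.
rewrite /W1 /W2 /pc; case: (c.2) => [|z||]; [by vm_compute | | by vm_compute | by vm_compute].
by apply/eqP; move: z; apply: V_all; vm_compute.
Qed.

Lemma closed_model_data :
  closed_data (ct1 c) (ct2 c) (qc_dl c.2) (qc_p1 c.2) (qc_p2 c.2) closed_model.
Proof.
have [rel1 rel2 rel3] := closed_model_rel.
have okL := okc; case/and5P: okL => L1 _ _ /andP[Lt1 Lt2] _.
have eM : {morph me : u v / (u + v)%R >-> u * v}.
  by move=> u v; apply: (meM mH); apply: mem_Vs.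
have gE : group_set (me @: setT).
  apply/group_setP; split; first by apply/imsetP; exists 0%R => //; rewrite -(modperm1 mH).
  by move=> _ _ /imsetP[u _ ->] /imsetP[v _ ->]; rewrite -eM imset_f.
have eJ u n v d k : k \in cL c -> me u ^ modperm actv actn (fun _ _ => 0%R) (qq c.2) n v d k =
    me (actn k u.1 + mulV (actd k u.2) v, actd k u.2)%R.
  by move=> Lk; apply: (meJ mH); rewrite ?mem_Vs.
have mp3E : modperm actv actn (fun _ _ => 0%R) (qq c.2) 0%R 0%R 0%R tri1 = 1 := modperm1 mH.
pose P := modgroup closed_P_hyp.
have inP n v d : modperm actv actn (fun _ _ => 0%R) (qq c.2) n v d tri1 \in P.
  by apply: (modperm_in closed_P_hyp); rewrite ?mem_Vs ?mem_seq1.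
exists me, (Group gE), P, (mp3 W1), (mp3 W2), (mh (ct1 c)), (mh (ct2 c)); split.
- split=> //; first by move=> u v; apply: (me_inj mH).
  apply/subsetP=> _ /setIP[/modsetP[n [v [d [k [Dd Lk ->]]]]] cE].
  have [| Bk zk] := mod_cent_me mH (n := n) (v := v) Dd Lk.
    by move=> u _; apply/conjg_fixP/commgP/commute_sym/(centP cE); rewrite imset_f.
  have k1 := closed_model_regular Lk Bk; have [_ ] := zk oneV (mem_Vs _).
  by rewrite mul1V k1 => ->; apply/imsetP; exists (n, d).
- split=> // u; rewrite eJ //; case: (acts_tri1 u.1) => _ _ ->; case: (acts_tri1 u.2) => -> _ _.
    by rewrite mulV1.
  by congr (me (_ + mulV _ _, _))%R; rewrite /pc /pck /= addr0.
- by split=> u; rewrite eJ // mulV0 addr0.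
have meH (H : {group {perm V * V}}) : me @: setT \subset H -> forall u, me u \in H.
  by move=> /subsetP sEH u; apply: sEH; rewrite imset_f.
have mTH (H : {group {perm V * V}}) : me @: setT \subset H -> mp3 W1 \in H -> mp3 W2 \in H ->
    forall v, mT v \in H.
  move=> /meH sEH HW1 HW2; apply: (mT_gen mH) => //.
  have eqW : mp3 W2 = mp3 (0, sqV, 0)%R * mp3 (0, 0, qc_adj c.2)%R by rewrite mp3M.
  have Hadj : mp3 (0, 0, qc_adj c.2)%R \in H := sEH (0, qc_adj c.2)%R.
  by move: HW2; rewrite eqW groupMr.
have inE0 (H : {group {perm V * V}}) (w : seq {perm V * V}) :
    me @: setT \subset H -> all (mem H) w -> <<me @: setT :|: [set:: w]>> \subset H.
  move=> sEH /allP wH; rewrite gen_subG subUset sEH.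
  by apply/subsetP=> x; rewrite inE; apply: wH.
have sEP : me @: setT \subset P by apply/subsetP=> _ /imsetP[u _ ->]; apply: inP.
have sEG : me @: setT \subset closed_model.
  by apply/subsetP=> _ /imsetP[u _ ->]; apply: (modperm_in mH); rewrite ?mem_Vs.
have inG n v d k : k \in cL c -> modperm actv actn (fun _ _ => 0%R) (qq c.2) n v d k \in closed_model.
  by move=> Lk; apply: (modperm_in mH); rewrite ?mem_Vs.
split; [ | | exact: closed_P_card | exact: closed_model_card].
- apply/eqP; rewrite eqEsubset inE0 ?sEG //= ?inG // andbT.
  pose ws := [:: mp3 W1; mp3 W2; mh (ct1 c); mh (ct2 c)].
  pose H := <<me @: setT :|: [set:: ws]>>%G.
  rewrite -[<<_>>]/(gval H).
  have sEH : me @: setT \subset H by rewrite (subset_trans _ (subset_gen _)) ?subsetUl.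
  have wH i : (i < 4)%N -> nth 1 ws i \in H.
    by move=> lti; apply: mem_gen; rewrite inE [_ \in [set:: _]]inE mem_nth ?orbT.
  have [HW1 HW2] := (wH 0%N isT, wH 1%N isT).
  have [Hh1 Hh2] : mh (ct1 c) \in H /\ mh (ct2 c) \in H := conj (wH 2%N isT) (wH 3%N isT).
  apply/subsetP=> _ /modsetP[n [v [d [k [Dd Lk ->]]]]].
  rewrite (modperm_decomp mH n v Dd Lk); apply: groupM (meH H sEH _).
  apply: groupM (mTH H sEH HW1 HW2 _); apply: groupM (meH H sEH _).
  case/allpairsP: Lk => -[i j] /= [_ _ ->].
  have [Hi Li] := mh_tripow i Lt1 Hh1; have [Hj Lj] := mh_tripow j Lt2 Hh2.
  by rewrite -[X in X \in _](mhM mH Li Lj); apply: groupM.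
apply/eqP; rewrite eqEsubset inE0 ?sEP //= ?inP // andbT.
pose ws := [:: mp3 W1; mp3 W2].
pose H := <<me @: setT :|: [set:: ws]>>%G.
rewrite -[<<_>>]/(gval H).
have sEH : me @: setT \subset H by rewrite (subset_trans _ (subset_gen _)) ?subsetUl.
have wH i : (i < 2)%N -> nth 1 ws i \in H.
  by move=> lti; apply: mem_gen; rewrite inE [_ \in [set:: _]]inE mem_nth ?orbT.
have [HW1 HW2] := (wH 0%N isT, wH 1%N isT).
apply/subsetP=> _ /modsetP[n [v [d [k [Dd Lk ->]]]]].
rewrite (modperm_decomp closed_P_hyp n v Dd Lk); apply: groupM (meH H sEH _).
apply: groupM (mTH H sEH HW1 HW2 _); apply: groupM (meH H sEH _).
move: Lk; rewrite mem_seq1 => /eqP->.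
by rewrite (_ : mh tri1 = 1) //; apply: mp3E.
Qed.

Lemma conj_shift (gT : finGroupType) (x y : gT) : x ^ y = x * ((y^-1) ^ x * y).
Proof. by rewrite !conjgE !mulgA mulgV mul1g. Qed.

Lemma closed_model_Isaacs : Isaacs_group 25 closed_model /\ p_closed 5 closed_model.
Proof.
have okL := okc; case/and5P: okL => L1 _ _ _ /and5P[_ _ /allP fpf /allP trans _].
have eM : {morph me : u v / (u + v)%R >-> u * v}.
  by move=> u v; apply: (meM mH); apply: mem_Vs.
have e0 : me 0%R = 1 by apply: (mulgI (me 0%R)); rewrite -eM addr0 mulg1.
have eV u : (me u)^-1 = me (- u)%R.
  by apply: (mulgI (me u)); rewrite mulgV -eM subrr.
have eJ u n v d k : k \in cL c -> me u ^ modperm actv actn (fun _ _ => 0%R) (qq c.2) n v d k =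
    me (actn k u.1 + mulV (actd k u.2) v, actd k u.2)%R.
  by move=> Lk; apply: (meJ mH); rewrite ?mem_Vs.
have meG u : me u \in closed_model by apply: (modperm_in mH); rewrite ?mem_Vs.
pose nn x := me (x, 0)%R.
have nnJ x n v d k : k \in cL c -> nn x ^ modperm actv actn (fun _ _ => 0%R) (qq c.2) n v d k = nn (actn k x).
  by move=> Lk; rewrite eJ //= /actd sactV0 mul0V addr0.
have gN : group_set (nn @: [set: V]).
  apply/group_setP; split; first by apply/imsetP; exists 0%R.
  by move=> _ _ /imsetP[u _ ->] /imsetP[v _ ->]; rewrite -eM (imset_f nn).
pose N := Group gN.
have sNG : N \subset closed_model by apply/subsetP=> _ /imsetP[x _ ->]; apply: meG.
have nsN : N <| closed_model.
  rewrite /normal sNG; apply/subsetP=> _ /modsetP[n [v [d [k [Dd Lk ->]]]]].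
  rewrite inE; apply/subsetP=> _ /imsetP[_ /imsetP[y _ ->] ->]; rewrite nnJ //; exact: (imset_f nn).
have inj_nn : injective nn by move=> x y /(me_inj mH)[].
have oN : #|N| = 25%N by rewrite /= card_imset // cardsT card_V.
split.
  apply: (Isaacs_of_Camina nsN closed_model_card oN) => [x y | g z].
    case/setD1P=> nx /imsetP[x' _ dx] /setD1P[ny /imsetP[y' _ dy]].
    have act1 w : nn w != 1 -> exists2 t, t \in cL c & actn t oneV = w.
      move=> nw; have := trans w (mem_Vs w); case: eqP => [w0 | _ /hasP[t Lt /eqP]]; last by exists t.
      by rewrite w0 /nn e0 eqxx in nw.
    have cl w : nn w != 1 -> nn w \in nn oneV ^: closed_model.
      case/act1=> t Lt <-; apply/imsetP; exists (mh t); first exact: (mh_in mH).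
      by rewrite nnJ.
    by rewrite dx dy in nx ny *; rewrite (class_eqP (cl _ ny)) cl.
  case/setDP=> /modsetP[n [v [d [k [Dd Lk ->]]]]] nNx /imsetP[m _ ->].
  suffices [y Gy def_z]: exists2 y, y \in closed_model & (y^-1) ^ modperm actv actn (fun _ _ => 0%R) (qq c.2) n v d k * y = nn m.
    by apply/imsetP; exists y; rewrite // conj_shift def_z.
  (* If k is not 1 it has no fixed point on N^#, so x - k x is onto and y can be taken in N. If k =
     1 and v is nonzero, y is an element of D built from m / v; if only d is nonzero, y is the lift
     of m / d. *)
  have [eq_k | ne_k] := eqVneq k tri1; last first.
    have inj_f : injective (fun x => x - actn k x)%R.
      move=> x y eqxy; have aN w : (actn k (- w) = - actn k w)%R.
        by apply: (addrI (actn k w)); rewrite -sactVD !subrr sactV0.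
      have fixxy : actn k (x - y)%R = (x - y)%R.
        rewrite [LHS]sactVD -[sactV _ _ (- y)]/(actn k (- y)) aN; apply/eqP; rewrite -subr_eq0; apply/eqP.
        transitivity ((y - actn k y) - (x - actn k x))%R; first by rewrite /actn; ring.
        by rewrite eqxy subrr.
      have := fpf k Lk; rewrite (negPf ne_k) => /allP/(_ (x - y)%R (mem_Vs _)).
      by rewrite fixxy eqxx orbF subr_eq0 => /eqP.
    exists (nn (invF inj_f m)); first exact: meG.
    have aN w : (actn k (- w) = - actn k w)%R.
      by apply: (addrI (actn k w)); rewrite -sactVD !subrr sactV0.
    rewrite /nn eV eJ //= oppr0 /actd sactV0 mul0V addr0 -eM.
    apply: (congr1 me); apply: (congr2 pair); last exact: addr0.
    by rewrite aN [LHS]addrC; apply: (f_invF inj_f m).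
  rewrite {}eq_k in nNx *; have L1' : tri1 \in cL c by [].
  have [eq_v | ne_v] := eqVneq v 0%R; last first.
    exists (me (0, - mulV m (invV v)))%R => //.
    rewrite eV eJ //= oppr0 opprK; case: (acts_tri1 (mulV m (invV v))) => -> _ _.
    rewrite /actn sactV0 add0r -mulVA (mulVC (invV v)) mulfVV // mulV1 -eM; congr me.
    by congr (_, _) => /=; rewrite ?addr0 ?subrr.
  rewrite {}eq_v in nNx *; have ne_d : d != 0%R.
    by apply: contraNneq nNx => ->; apply/imsetP; exists n.
  exists (mT (mulV m (invV d))); first by apply: (mT_in mH).
  set u := me (n, d); rewrite -[modperm _ _ _ _ _ _ _ _]/u.
  have -> : (mT (mulV m (invV d)))^-1 ^ u * mT (mulV m (invV d)) =
     u^-1 * (u ^ mT (mulV m (invV d))).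
    by rewrite !conjgE !mulgA.
  rewrite eV eJ //= -eM; congr me; congr (_, _) => /=.
    case: (acts_tri1 d) => -> _ _; case: (acts_tri1 n) => _ _ ->.
    by rewrite mulVC -mulVA (mulVC (invV d)) mulfVV // mulV1 addKr.
  by case: (acts_tri1 d) => -> _ _; rewrite addNr.
pose P := modgroup closed_P_hyp; have oP := closed_P_card.
have defP : P = 'C_closed_model(N) :> {set _}.
  apply/setP=> x; apply/idP/setIP=> [| [Gx cNx]].
    case/modsetP=> [n [v [d [k [Dd]]]]]; rewrite mem_seq1 => /eqP-> ->; split.
      by apply: (modperm_in mH); rewrite ?mem_Vs.
    apply/centP=> _ /imsetP[y _ ->]; apply/commute_sym/commgP/conjg_fixP; rewrite nnJ //.
    by case: (acts_tri1 y) => _ _ ->.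
  case/modsetP: Gx cNx => [n [v [d [k [Dd Lk ->]]]]] cNx.
  rewrite (closed_model_regular Lk) => [|y]; first by apply: (modperm_in closed_P_hyp); rewrite ?mem_seq1 ?mem_Vs.
  have : nn y \in N by rewrite (imset_f nn).
  by move/(centP cNx)/commute_sym/commgP/conjg_fixP; rewrite nnJ // => /inj_nn.
exists P.
  rewrite pHallE; apply/andP; split; first by rewrite defP subsetIl.
  rewrite oP closed_model_card p_part lognM ?expn_gt0 // (lognX 5 6 5) //.
have := subcent_normal closed_model N.
have -> : 'N_closed_model(N) = closed_model by apply/setIidPl; apply: normal_norm nsN.
by rewrite -defP.
Qed.

End ClosedModel.

(** * Groups with the same closed data are isomorphic *)

Lemma card_joing_cycle (gT : finGroupType) (H : {group gT}) (x : gT) p :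
  (0 < p)%N -> x \in 'N(H) -> x ^+ p \in H -> (#|H <*> <[x]>| <= #|H| * p)%N.
Proof.
move=> p_gt0 nHx Hxp; have nHX : <[x]> \subset 'N(H) by rewrite cycle_subG.
have sHY : H \subset H <*> <[x]> by apply: joing_subl.
have nHY : H <*> <[x]> \subset 'N(H) by rewrite join_subG normG.
rewrite -(Lagrange sHY) leq_mul2l -card_quotient // quotientYidl // quotient_cycle //.
rewrite dvdn_leq ?orbT // order_dvdn -morphX //; apply/eqP/coset_id; exact: Hxp.
Qed.

Lemma norm_joing_cycle (gT : finGroupType) (H : {group gT}) (x y : gT) :
  x \in 'N(H) -> y ^ x \in H <*> <[y]> -> x \in 'N(H <*> <[y]>).
Proof.
move=> nHx Hyx; rewrite inE /joing -genJ gen_subG conjUg subUset.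
rewrite (normP nHx) -/(H <*> <[y]>) joing_subl /= -cycleJ cycle_subG; exact: Hyx.
Qed.

Lemma VV_mul5 (u : V * V) : (u *+ 5 = 0)%R.
Proof.
have [h1 h2] := (V_mul5 u.1, V_mul5 u.2); rewrite !mulrS mulr0n !addr0 in h1 h2 *.
by case: u h1 h2 => x y /= h1 h2; congr (_, _).
Qed.

Lemma Sylow5_of_order (gT : finGroupType) (G P : {group gT}) :
  #|G| = (24 * 5 ^ 6)%N -> P \subset G -> #|P| = (5 ^ 6)%N -> 5.-Sylow(G) P.
Proof.
move=> oG sPG oP; rewrite pHallE sPG oP oG p_part lognM ?expn_gt0 // (lognX 5 6 5) //.
Qed.

(** The matched relations make the pairs of lifts extend the graph L by two steps of index at most
    5, so the group they generate has order at most 625 * 5 * 5 = |P|. *)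
Lemma closed_data_isog t1 t2 dl p1 p2 (gT1 gT2 : finGroupType)
    (G1 : {group gT1}) (G2 : {group gT2}) :
  closed_data t1 t2 dl p1 p2 G1 -> closed_data t1 t2 dl p1 p2 G2 -> G1 \isog G2.
Proof.
case=> e [E [P [w1 [w2 [h1 [h2 []]]]]]].
move=> [eM inj_e defE cE] [ew1 ew2 ww w1p w2p] [eh1 eh2] [defG defP oP oG].
case=> e' [E' [P' [w1' [w2' [h1' [h2' []]]]]]].
move=> [eM' inj_e' defE' cE'] [ew1' ew2' ww' w1p' w2p'] [eh1' eh2'] [defG' defP' oP' oG'].
have sPG : P \subset G1.
  by rewrite defP defG genS // setUS //; apply/subsetP=> x; rewrite !inE => /orP[]->; rewrite ?orbT.
have gL : group_set [set (e u, e' u) | u : (V * V)%type].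
  apply/group_setP; split.
    apply/imsetP; exists 0%R => //; congr (_, _).
      by apply: (mulgI (e 0%R)); rewrite -eM addr0 mulg1.
    by apply: (mulgI (e' 0%R)); rewrite -eM' addr0 mulg1.
  by move=> _ _ /imsetP[u _ ->] /imsetP[v _ ->]; apply/imsetP; exists (u + v)%R; rewrite // eM eM'.
pose L := Group gL.
have inL u : (e u, e' u) \in L by apply/imsetP; exists u.
have oL : (#|L| <= 625)%N by rewrite (leq_trans (leq_imset_card _ _)) // (card_prod V V) card_V.
have nL x f : (forall u, e u ^ x.1 = e (f u)) -> (forall u, e' u ^ x.2 = e' (f u)) -> x \in 'N(L).
  move=> ex ex'; apply: (@norm_gen_imset _ _ (fun u => (e u, e' u)) L x f) => // u.
  by rewrite -ex -ex'; case: x {ex ex'}.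
pose x1 := (w1, w1'); pose x2 := (w2, w2').
have nL1 : x1 \in 'N(L) by exact: (nL x1 (fun u => (u.1 + u.2, u.2)%R) ew1 ew1').
have nL2 : x2 \in 'N(L) by exact: (nL x2 (fun u => (u.1 + mulV u.2 sqV, u.2)%R) ew2 ew2').
have L1p : x1 ^+ 5 \in L.
  have -> : x1 ^+ 5 = (w1 ^+ 5, w1' ^+ 5) by [].
  by rewrite w1p w1p'.
have L2p : x2 ^+ 5 \in L.
  have -> : x2 ^+ 5 = (w2 ^+ 5, w2' ^+ 5) by [].
  by rewrite w2p w2p'.
have nQ : x2 \in 'N(L <*> <[x1]>).
  apply: norm_joing_cycle => //; rewrite conjg_mulR groupM //.
    by apply: (subsetP (joing_subr _ _)); apply: cycle_id.
  apply: (subsetP (joing_subl _ _)); have -> : [~ x1, x2] = ([~ w1, w2], [~ w1', w2']) by [].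
  by rewrite ww ww'.
apply: (@isog_of_ext_data 5 (V * V)%type _ _ G1 E P G2 E' e e' [:: x1; x2] [:: (h1, h1'); (h2, h2')]) => //.
- exact: VV_mul5.
- by rewrite defE; apply/setP=> x; apply/imsetP/imsetP=> [] [u _ ->]; exists u.
- by rewrite defE'; apply/setP=> x; apply/imsetP/imsetP=> [] [u _ ->]; exists u.
- move=> x; rewrite !inE => /or4P[] /eqP->.
  + by exists (fun u : V * V => (u.1 + u.2, u.2)%R).
  + by exists (fun u : V * V => (u.1 + mulV u.2 sqV, u.2)%R).
  + by exists (acte t1).
  by exists (acte t2).
- exact: Sylow5_of_order.
rewrite oP; apply: (@leq_trans (#|L <*> <[x1]> <*> <[x2]>|)).
  apply/subset_leq_card; rewrite gen_subG subUset; apply/andP; split.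
    exact: subset_trans (joing_subl L <[x1]>) (joing_subl _ _).
  apply/subsetP=> x; rewrite !inE => /orP[] /eqP->.
    by apply: (subsetP (joing_subl _ _)); apply: (subsetP (joing_subr _ _)); apply: cycle_id.
  by apply: (subsetP (joing_subr _ _)); apply: cycle_id.
have L2q : x2 ^+ 5 \in L <*> <[x1]> := subsetP (joing_subl L <[x1]>) _ L2p.
apply: leq_trans (card_joing_cycle (isT : 0 < 5)%N nQ L2q) _.
have := card_joing_cycle (isT : 0 < 5)%N nL1 L1p => le1.
rewrite -[(5 ^ 6)%N]/(5 ^ 4 * 5 * 5)%N.
apply: leq_mul => //; apply: leq_trans le1 _; apply: leq_mul => //.
Qed.

(** * Invariants separating the 5-closed models *)

Section ClosedSylow.
Variable c : cparam.
Hypothesis okc : cok c.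
Notation mH := (closed_model_hyp okc).
Notation G := (closed_model okc).
Notation P := (modgroup (closed_P_hyp okc)).
Notation mp := (modperm actv actn (fun _ _ => 0%R) (qq c.2)).
Notation me := (me actv actn (fun _ _ => 0%R) (qq c.2) tri1).
Notation mT := (mT actv actn (fun _ _ => 0%R) (qq c.2) tri1).
Notation mh := (mh actv actn (fun _ _ => 0%R) (qq c.2)).

Lemma closed_P_sub : P \subset G.
Proof.
apply/subsetP=> x /modsetP[n [v [d [k [_]]]]].
rewrite mem_seq1 => /eqP-> ->; apply: (modperm_in mH); rewrite ?mem_Vs //.
by have := okc; case/and5P.
Qed.

Lemma closed_P_Sylow : 5.-Sylow(G) P.
Proof. exact: Sylow5_of_order (closed_model_card okc) closed_P_sub (closed_P_card okc). Qed.

Lemma closed_P_pcore : 'O_5(G) = P.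
Proof.
have [_ [Q sylQ nsQ]] := closed_model_Isaacs okc.
rewrite (normal_Hall_pcore sylQ nsQ); apply/esym/eqP; rewrite eqEcard.
rewrite (sub_normal_Hall sylQ nsQ (closed_P_sub)) (pHall_pgroup closed_P_Sylow).
by rewrite (card_Hall sylQ) (card_Hall closed_P_Sylow) leqnn.
Qed.

Lemma mp_P n v d : mp n v d tri1 \in P.
Proof. by apply: (modperm_in (closed_P_hyp okc)); rewrite ?mem_Vs ?mem_seq1. Qed.

Lemma mhX t n : t \in cL c -> mh t ^+ n = mh (tripow t n) /\ tripow t n \in cL c.
Proof.
have := okc; case/and5P=> L1 _ _ _ /and5P[_ /allP LM _ _ _] Lt.
elim: n => [|n [IH1 IH2]]; first by split; rewrite // expg0; apply/esym/(modperm1 mH).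
split; last exact: (allP (LM _ IH2)).
by rewrite expgSr IH1 (mhM mH).
Qed.

Lemma mh_eq1 t : t \in cL c -> (mh t == 1) = (t == tri1).
Proof.
have := okc; case/and5P=> L1 _ _ _ _ Lt; apply/eqP/eqP=> [|->]; last exact: (modperm1 mH).
by rewrite -(modperm1 mH : mp 0%R 0%R 0%R tri1 = 1) => /(modperm_inj mH Lt L1)[].
Qed.

Lemma group_set_closed_H : group_set [set x in map mh (cL c)].
Proof.
have := okc; case/and5P=> L1 _ _ _ /and5P[_ /allP LM _ _ _].
apply/group_setP; split; first by rewrite inE; apply/mapP; exists tri1; [|apply/esym/(modperm1 mH)].
move=> x y; rewrite !inE => /mapP[t Lt ->] /mapP[t' Lt' ->].
rewrite (mhM mH) //; apply: map_f; exact: (allP (LM _ Lt)).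
Qed.
Definition closed_H := Group group_set_closed_H.

Lemma closed_H_card : #|closed_H| = 24%N.
Proof.
have := okc; case/and5P=> L1 uL /eqP szL _ _; rewrite /= cardsE (card_uniqP _) ?size_map //.
by rewrite map_inj_in_uniq // => t t' Lt Lt' /(modperm_inj mH Lt Lt')[].
Qed.

Lemma closed_H_Hall : 5%N^'.-Hall(G) closed_H.
Proof.
have sHG : closed_H \subset G.
  by apply/subsetP=> x; rewrite inE => /mapP[t Lt ->]; apply: (mh_in mH).
rewrite /pHall sHG /pgroup closed_H_card -divgS // closed_H_card closed_model_card.
by rewrite mulKn // pnatNK pnatX.
Qed.

Lemma closed_model_sol : solvable G.
Proof.
have nsP : P <| G by rewrite -closed_P_pcore pcore_normal.
have solQ : solvable (G / P).
  apply: Burnside_p_a_q_b; rewrite card_quotient ?normal_norm // -divgS ?normal_sub //.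
  by rewrite closed_model_card closed_P_card mulnK ?expn_gt0.
by rewrite (series_sol nsP) solQ (pgroup_sol (pHall_pgroup closed_P_Sylow)).
Qed.

Lemma mh_tripowX t n : t \in cL c -> tripow t n = tri1 <-> mh t ^+ n = 1.
Proof.
move=> Lt; have [eqX LX] := mhX n Lt; rewrite eqX; split=> [-> | /eqP]; first exact: (modperm1 mH).
by rewrite (mh_eq1 LX) => /eqP.
Qed.

Lemma closed_P_commute_me u t : t \in cL c -> actd t u = u -> commute (me (0%R, u)) (mh t).
Proof.
move=> Lt du; apply/commgP/conjg_fixP; rewrite (meJ mH) ?mem_Vs //.
by rewrite mulV0 addr0 du [actn _ _]sactV0.
Qed.

Lemma closed_commute_mod t n z : t \in cL c -> actd (tripow t n) z = z ->
  commute (me (0%R, z)) (mh t ^+ n).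
Proof.
by move=> Lt dz; have [-> LX] := mhX n Lt; apply: closed_P_commute_me.
Qed.

Lemma mp_J n v d t : t \in cL c ->
  mp n v d tri1 ^ mh t = mp (actn t n) (actv t v) (actd t d) tri1.
Proof.
move=> Lt; have L1 : tri1 \in cL c by case/and5P: okc.
apply: (mulgI (mh t)); rewrite -conjgC !(modpermM mH) ?mem_Vs //.
have [qd0 qk0] := moddl0r mH (actv t v); have [qd0' qk0'] := moddl0l mH (actv t v).
have [d0 v0 n0] := acts_tri1 0%R; have dt0 : actd t 0%R = 0%R := sactV0 _ _.
rewrite (modkMk1 mH Lt) (modk1Mk mH Lt) d0 v0 n0 qd0 qk0 qd0' qk0' mul0V mulV0 !oppr0.
by rewrite !addr0 !add0r.
Qed.

Lemma me_mp_commg z n v d : [~ me (0%R, z), mp n v d tri1] = me (mulV z v, 0%R).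
Proof.
have L1 : tri1 \in cL c by case/and5P: okc.
rewrite commgEl (meJ mH) ?mem_Vs //.
have [-> _ _] := acts_tri1 z; have [_ _ ->] := acts_tri1 0%R; rewrite add0r.
have eM u w : me (u + w)%R = me u * me w by apply: (meM mH); rewrite mem_Vs.
apply: (mulgI (me (0%R, z))); rewrite mulKVg -eM; congr (me (_, _)) => /=; ring.
Qed.

Lemma closed_slope_eq t k : t \in cL c ->
  ([~ me (0%R, oneV), mT oneV ^ mh t] == [~ me (0%R, oneV), mT oneV] ^ (mh t ^+ k)) =
  (actv t oneV == actn (tripow t k) oneV).
Proof.
move=> Lt; have [-> LX] := mhX k Lt.
rewrite (mTJ mH) // (_ : me (0%R, 0%R) = 1) ?mulg1; last exact: (modperm1 mH).
rewrite !me_mp_commg (meJ mH) ?mem_Vs //= mulV0 addr0 !mul1V [actd _ _]sactV0.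
apply/eqP/eqP=> [/(me_inj mH)/(congr1 fst) | ->]; by [].
Qed.
End ClosedSylow.

(** In a model the witness is the generator [ct1]: the involution h^(n/2) singles out D, and the
    equation says that h acts on P / E as its k-th power acts on N. This turns the exponent of a
    parameter into an isomorphism invariant. *)
Definition slope n k (gT : finGroupType) (G : {group gT}) :=
  exists h, [/\ h \in G, #[h] = n
    & {in 'O_5(G) &, forall d v, commute d (h ^+ n./2) -> [~ d, v ^ h] = [~ d, v] ^ (h ^+ k)}].

Lemma slope_isog n k (gT rT : finGroupType) (G : {group gT}) (H : {group rT}) :
  G \isog H -> slope n k G -> slope n k H.
Proof.
case/isogP=> f inj_f defH [h [Gh oh slh]]; exists (f h); split.
- by rewrite -defH mem_morphim.
- by rewrite order_injm.
have sOG : 'O_5(G) \subset G := pcore_sub _ _.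
have -> : 'O_5(H) = f @* 'O_5(G) by rewrite injm_pcore // defH.
move=> _ _ /morphimP[d _ Od ->] /morphimP[v _ Ov ->] cdh.
have [Gd Gv] : d \in G /\ v \in G by split; apply: (subsetP sOG).
have Ghk := groupX k Gh; have Ghn := groupX n./2 Gh; have Gvh := groupJ Gv Gh.
rewrite -(morphX f k Gh) -(morphJ f Gv Gh) -(morphR f Gd Gvh) -(morphR f Gd Gv).
rewrite -(morphJ f (groupR Gd Gv) Ghk); congr (f _); apply: slh => //.
move: cdh; rewrite -(morphX f _ Gh) /commute -!(morphM f) // => /(injmP inj_f) -> //; exact: groupM.
Qed.

Definition tri_order n (t : tri) :=
  [&& tripow t n == tri1, tripow t (n %/ 2)%N != tri1 & tripow t (n %/ 3)%N != tri1].
Definition corder (c : cparam) := if c.1.1 then 12%N else 24%N.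
Definition slope_test n k (t : tri) := tri_order n t &&
  ((actd (tripow t n./2) oneV == oneV) ==> (actv t oneV == actn (tripow t k) oneV)).
Definition slope_ok c := let t := ct1 c in let p := tripow t c.1.2 in let m := tripow t (corder c)./2 in
  [&& tri_order (corder c) t, ~~ t.2, mulV p.1.1 p.1.2 == t.1.2, ~~ p.2
    & m == (oneV, - oneV, false)%R].
Lemma all_slope_ok : all slope_ok cparams. Proof. by vm_compute. Qed.

(** One direction is enough: in list order, no complement element of a later slot passes the test of
    an earlier one. *)
Definition slope_sep (x y : bool * nat) :=
  ~~ has (slope_test (corder (x, Q0)) x.2) (cL (y, Q0)).
Lemma all_slope_sep : pairwise slope_sep (undup [seq c.1 | c <- cparams]).
Proof. by vm_compute. Qed.

Lemma closed_P_elt (c : cparam) (okc : cok c) x : x \in 'O_5(closed_model okc) ->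
  exists n v d, x = modperm actv actn (fun _ _ => 0%R) (qq c.2) n v d tri1.
Proof.
rewrite closed_P_pcore => /modsetP[n [v [d [k [_]]]]]; rewrite mem_seq1 => /eqP-> ->.
by exists n, v, d.
Qed.

Lemma order_mh c (okc : cok c) n t : (n == 12%N) || (n == 24%N) -> t \in cL c ->
  (#[mh actv actn (fun _ _ => 0%R) (qq c.2) t] == n) = tri_order n t.
Proof.
move=> n12 Lt; set h := mh _ _ _ _ _.
have eqX m : (tripow t m == tri1) = (#[h] %| m)%N.
  by rewrite order_dvdn; apply/eqP/eqP; case: (mh_tripowX okc m Lt).
rewrite /tri_order !eqX; set d := #[h].
have [dn | ndn] /= := boolP (d %| n)%N; last by apply: contraNF ndn => /eqP->.
have : d \in divisors n by rewrite -dvdn_divisors //; case/orP: n12 => /eqP->.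
by case/orP: n12 => /eqP->; move: d {dn} => d; do !rewrite inE => /orP[/eqP-> //|]; rewrite inE => /eqP->.
Qed.

Lemma corder_cases c : (corder c == 12%N) || (corder c == 24%N).
Proof. by rewrite /corder; case: ifP. Qed.

Lemma slope_model c (okc : cok c) : slope_ok c -> slope (corder c) c.1.2 (closed_model okc).
Proof.
have mH := closed_model_hyp okc; have okL := okc; case/and5P: okL => L1 _ _ /andP[Lt _] _.
set t := ct1 c in Lt *; case/and5P => ot t2 /eqP kt k2 /eqP mt.
exists (mh actv actn (fun _ _ => 0%R) (qq c.2) t); split; first exact: (mh_in mH).
  by apply/eqP; rewrite order_mh ?corder_cases.
move=> _ _ /closed_P_elt[nd [vd [zd ->]]] /closed_P_elt[n [v [z ->]]].
have [-> Lm] := mhX okc (corder c)./2 Lt; have [-> Lk] := mhX okc c.1.2 Lt.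
rewrite mt in Lm *; move/commgP/conjg_fixP; rewrite (mp_J okc) //.
case/(modperm_inj mH L1 L1) => en ev _ _.
have opp0 x : (mulV (- oneV) x = x -> x = 0)%R.
  move=> xE; apply/eqP; rewrite -[_ == _]orbF -(negbF (introT eqP xE)).
  by move: x {xE}; apply: V_all; vm_compute.
have -> : nd = 0%R by apply: opp0; rewrite -[RHS]en /actn /sactV /= mul1V.
have -> : vd = 0%R by apply: opp0; rewrite -[RHS]ev.
rewrite (mp_J okc) // !(me_mp_commg okc) (meJ mH) ?mem_Vs //=.
rewrite mulV0 addr0 [actd _ 0%R]sactV0; congr (me _ _ _ _ _ (_, _)).
by rewrite /actv /actn /sactV (negPf t2) (negPf k2) kt mulVA (mulVC zd) -mulVA.
Qed.

Lemma slope_modelP n k c (okc : cok c) : (n == 12%N) || (n == 24%N) ->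
  slope n k (closed_model okc) -> has (slope_test n k) (cL c).
Proof.
have mH := closed_model_hyp okc; move=> n12 [h [Gh oh slh]].
(* Hall's theorem in the solvable model conjugates <h> into the listed complement, which makes the
   invariant decidable by inspection. *)
have [x Gx sHx] : exists2 x, x \in closed_model okc & <[h]> :^ x \subset closed_H okc.
  apply: Hall_Jsub (closed_model_sol okc) (closed_H_Hall okc) _ _; first by rewrite cycle_subG.
  by rewrite /pgroup -orderE oh; case/orP: n12 => /eqP->.
have /mapP[t Lt ht] : h ^ x \in map (mh actv actn (fun _ _ => 0%R) (qq c.2)) (cL c).
  by have := subsetP sHx (h ^ x); rewrite memJ_conjg cycle_id inE => ->.
apply/hasP; exists t => //; apply/andP; split; first by rewrite -(order_mh okc) // -ht orderJ oh.
apply/implyP=> /eqP d1; rewrite -(closed_slope_eq okc) // -ht.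
set d := me _ _ _ _ _ _; set v := mT _ _ _ _ _ _.
have [Od Ov] : d \in 'O_5(closed_model okc) /\ v \in 'O_5(closed_model okc).
  by rewrite closed_P_pcore; split; apply: mp_P.
have cdh : commute d ((h ^ x) ^+ n./2) by rewrite ht; apply: closed_commute_mod.
have nOx : x^-1 \in 'N('O_5(closed_model okc)).
  by rewrite groupV (subsetP (normal_norm (pcore_normal _ _))).
rewrite -conjXg in cdh *; rewrite -(conjgKV x d) -(conjgKV x v).
rewrite -conjJg -!conjRg -conjXg -conjJg; apply/eqP; congr (_ ^ x).
rewrite conjRg; apply: slh; rewrite ?memJ_norm //; apply: (conjg_inj x). rewrite [LHS]conjMg [RHS]conjMg conjgKV; exact: cdh.
Qed.

Lemma cL_fst c : cL (c.1, Q0) = cL c. Proof. by case: c => [[]]. Qed.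

Lemma closed_model_isog_slope c c' (okc : cok c) (okc' : cok c') :
    c \in cparams -> c' \in cparams -> closed_model okc \isog closed_model okc' -> c.1 = c'.1.
Proof.
move=> Cc Cc' isoG; apply/eqP; apply: contraT => ne_c; set s := undup [seq x.1 | x <- cparams].
have sep x y (okx : cok x) (oky : cok y) : x \in cparams -> y \in cparams ->
    closed_model okx \isog closed_model oky -> (index x.1 s < index y.1 s)%N -> false.
  move=> Cx Cy isoxy ltxy; have /pairwiseP P := all_slope_sep.
  have ins z : z \in cparams -> z.1 \in s by move=> Cz; rewrite mem_undup map_f.
  have := P (false, 0%N) (index x.1 s) (index y.1 s).
  rewrite !inE !index_mem !ins // !nth_index ?ins // => /(_ isT isT ltxy)/negP[].
  rewrite cL_fst; apply: (@slope_modelP (corder x) x.1.2 y oky (corder_cases _)).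
  exact: (slope_isog isoxy) (slope_model okx (allP all_slope_ok _ _)).
have /orP[] : (index c.1 s < index c'.1 s)%N || (index c'.1 s < index c.1 s)%N.
- rewrite -neq_ltn; apply: contraNneq ne_c => eq_i.
  by rewrite -[c.1](@nth_index _ (false, 0%N) _ s) ?eq_i ?nth_index ?mem_undup ?map_f.
- exact: sep.
by apply: sep => //; rewrite isog_sym.
Qed.

(** Among the parameters this holds exactly for the kind [Q0], and so separates two parameters with
    the same complement action. *)
Definition class2_exp5 (gT : finGroupType) (P : {group gT}) :=
  ((nil_class P <= 2) && (exponent P %| 5))%N.

Lemma closed_nonsplit c (okc : cok c) :
    (if c.2 is Qd k then k != 0%R else c.2 != Q0) ->
  class2_exp5 'O_5(closed_model okc) = false.
Proof.
have mH := closed_model_hyp okc; move=> kc.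
have inP n v d : modperm actv actn (fun _ _ => 0%R) (qq c.2) n v d tri1 \in 'O_5(closed_model okc).
  by rewrite closed_P_pcore mp_P.
have [W12 W1 _] := closed_model_rel okc.
have e0 : me actv actn (fun _ _ => 0%R) (qq c.2) tri1 (0%R, 0%R) = 1 := modperm1 mH.
apply/negP=> /andP[]; rewrite nil_class2 => /subsetP dP /exponentP eP.
have /eP := inP 0%R oneV 0%R; rewrite [_ ^+ 5]W1 -e0 => /(me_inj mH)[p1].
have in3 t : mp3 c t \in 'O_5(closed_model okc) by apply: inP.
have := dP _ (mem_commg (in3 (0, oneV, 0)%R) (in3 (pck c.2 (0, sqV, 0) (0, 0, qc_adj c.2))%R)).
rewrite W12 => /centerP[_ /(_ _ (inP 0%R oneV 0%R))/commgP].
rewrite (me_mp_commg okc) mulV1 -e0 => /eqP/(me_inj mH)[dl1].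
move: p1 dl1 kc; case: (c.2) => //= k _ k3; apply/negP; rewrite negbK.
have: (k *+ 6 = 0)%R by rewrite (mulrnA k 3 2) k3 mul0rn.
by rewrite mulrS V_mul5 addr0 => ->.
Qed.

Lemma closed_split c (okc : cok c) : c.2 = Q0 -> class2_exp5 'O_5(closed_model okc).
Proof.
move=> cQ; have mH := closed_model_hyp okc; have okL := okc; case/and5P: okL => L1 _ _ _ _.
have e0 : me actv actn (fun _ _ => 0%R) (qq c.2) tri1 (0%R, 0%R) = 1 := modperm1 mH.
have OP x : x \in 'O_5(closed_model okc) -> exists t, x = mp3 c t.
  by case/closed_P_elt=> n [v [d ->]]; exists (n, v, d).
have inO t : mp3 c t \in 'O_5(closed_model okc) by rewrite closed_P_pcore mp_P.
have cE t t' : pc c t t' = (t.1.1 - mulV t'.2 t.1.2 + t'.1.1, t.1.2 + t'.1.2, t.2 + t'.2)%R.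
  by rewrite /pc cQ /pck /= !addr0.
apply/andP; split.
  rewrite nil_class2 gen_subG; apply/subsetP=> _ /imset2P[_ _ /OP[t ->] /OP[t' ->] ->].
  have comE : [~ mp3 c t, mp3 c t'] = mp3 c (mulV t.2 t'.1.2 - mulV t'.2 t.1.2, 0, 0)%R.
    apply: (mulgI (mp3 c t' * mp3 c t)); rewrite -commgC !(mp3M okc); congr (mp3 c _).
    by rewrite !cE /= mul0V !(addr0, oppr0); congr (_, _, _); ring.
  apply/centerP; split; first by rewrite comE inO.
  move=> _ /OP[s ->]; rewrite /commute comE !(mp3M okc); congr (mp3 c _).
  by rewrite !cE /= mul0V mulV0 !(addr0, add0r, oppr0) [(_ + s.1.1)%R]addrC.
apply/exponentP=> _ /OP[t ->]; rewrite !expgS expg0 mulg1 !(mp3M okc) -[RHS]e0.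
rewrite -[me _ _ _ _ _ _]/(mp3 c (0, 0, 0)%R); congr (mp3 c _); rewrite !cE /=.
have [n5 v5] := (V_mul5 t.1.1, V_mul5 t.1.2); have d5 := V_mul5 t.2.
rewrite !mulVDl; congr (_, _, _); last 2 first.
- by rewrite -[RHS]v5; ring.
- by rewrite -[RHS]d5; ring.
transitivity (t.1.1 *+ 5 - mulV t.2 t.1.2 *+ 5 *+ 2)%R; first by ring.
by rewrite n5 V_mul5 mul0rn subr0.
Qed.

Lemma cparams_sep : all (fun c => all (fun c' => [|| c.1 != c'.1, c == c' |
  (c.2 == Q0) && (if c'.2 is Qd k then k != 0%R else c'.2 != Q0) || 
  (c'.2 == Q0) && (if c.2 is Qd k then k != 0%R else c.2 != Q0)]) cparams) cparams.
Proof. by vm_compute. Qed.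

Lemma closed_model_isog_inj c c' (okc : cok c) (okc' : cok c') :
    c \in cparams -> c' \in cparams -> closed_model okc \isog closed_model okc' -> c = c'.
Proof.
move=> Cc Cc' isoG; have isoP := isog_pcore 5%N isoG.
have eqC : class2_exp5 'O_5(closed_model okc) = class2_exp5 'O_5(closed_model okc').
  by rewrite /class2_exp5 (isog_nil_class isoP) (exponent_isog isoP).
have := allP (allP cparams_sep _ Cc) _ Cc'.
rewrite (closed_model_isog_slope Cc Cc' isoG) eqxx => /or3P[//|/eqP // |].
case/orP=> /andP[/eqP s ns]; move: eqC.
  by rewrite (closed_split okc s) (closed_nonsplit okc' ns).
by rewrite (closed_split okc' s) (closed_nonsplit okc ns).
Qed.

(** * Involutions acting on 5-groups; the complement in the 5-closed case *)

Lemma semireg_card_dvd (aT : finGroupType) (rT : finType) (to : {action aT &-> rT})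
    (Q : {group aT}) (S : {set rT}) :
  [acts Q, on S | to] -> {in S, forall x, 'C_Q[x | to] = 1} -> (#|Q| %| #|S|)%N.
Proof.
move=> actS regS; rewrite -(acts_sum_card_orbit actS); apply: dvdn_sum => _ /imsetP[x Sx ->].
by rewrite card_orbit regS // indexg1.
Qed.

Lemma dvd8_pow5 c : (8 %| 5 ^ c - 1)%N -> ~~ odd c.
Proof.
rewrite -[c]odd_double_half -mul2n oddD oddM addbF oddb; case: (odd c) => //=.
rewrite expnD expnM expn1 -eqn_mod_dvd ?muln_gt0 ?expn_gt0 // => /eqP.
by rewrite -modnMmr -modnXm exp1n.
Qed.

(* A Sylow 2-subgroup with a unique involution t acts semiregularly on the    *)
(* conjugates of t other than t itself.                                       *)
Lemma cent_involution_index (gT : finGroupType) (X Q : {group gT}) (t : gT) a :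
    Q \subset 'N(X) -> t \in Q -> #|Q| = 8%N -> Q \subset 'C[t] -> #[t] = 2%N ->
    {in Q^#, forall s, exists n, s ^+ n = t} -> #|X| = (5 ^ a)%N ->
  exists b, #|X| = (#|'C_X[t]| * 25 ^ b)%N.
Proof.
move=> nXQ Qt oQ cQt ot powt oX; have /dvdn_pfactor[//|c _ oS] : (#|X : 'C_X[t]| %| 5 ^ a)%N.
  by rewrite -oX dvdn_indexg.
(* Modulo 8 only the even powers of 5 are 1, so the number of conjugates of t is a power of 25. *)
suffices /dvd8_pow5 evc : (8 %| 5 ^ c - 1)%N.
  exists c./2; rewrite -(Lagrange (subsetIl X 'C[t])) oS -[25%N]/(5 ^ 2)%N -expnM mul2n.
  by rewrite -{1}[c]odd_double_half (negPf evc).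
have tS : t \in t ^: X := class_refl X t.
rewrite -oS index_cent1 (cardsD1 t (t ^: X)) tS addKn -oQ.
have tts s : s \in Q -> t ^ s = t.
  by move=> Qs; apply/conjg_fixP/commgP/cent1P; rewrite cent1C (subsetP cQt).
have fix_t s x : s \in Q -> (t ^ x) ^ s = t ^ (x ^ s) by move=> Qs; rewrite conjJg (tts s Qs).
apply: (semireg_card_dvd (to := 'J)).
  apply/subsetP=> s Qs; rewrite !inE; apply/subsetP=> y; rewrite !inE => /andP[ny /imsetP[x Xx def_y]].
  rewrite /= -{1}(tts s Qs) (inj_eq (conjg_inj s)) ny def_y fix_t //; apply: imset_f.
  by rewrite memJ_norm // (subsetP nXQ).
move=> y /setD1P[ny /imsetP[x Xx def_y]]; apply/trivgP/subsetP=> s /setIP[Qs].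
move=> /astab1P/= /conjg_fixP/commgP cys; rewrite inE; apply: contraNT ny => nts.
have [n def_t] : exists n, s ^+ n = t by apply: powt; rewrite !inE nts.
have cyt : commute y t by rewrite -def_t; apply: commuteX.
(* If s fixes the conjugate y, then y commutes with t, a power of s, and y t^-1 has order dividing 2
   in the 5-group X; hence y = t. *)
have Xyt : y * t^-1 \in X.
  have nXt : t \in 'N(X) by apply: (subsetP nXQ).
  have -> : y * t^-1 = x^-1 * x ^ t^-1 by rewrite def_y !conjgE invgK !mulgA.
  by rewrite groupM ?groupV // memJ_norm ?groupV.
have: (y * t^-1) ^+ 2 = 1.
  rewrite expgMn; last by apply: commuteV.
  by rewrite def_y -conjXg expgVn -ot expg_order conj1g invg1 mulg1.
move/eqP; rewrite -order_dvdn => o2; rewrite eq_mulgV1 -order_eq1 -dvdn1.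
have : (#[y * t^-1] %| gcdn 2 (5 ^ a))%N by rewrite dvdn_gcd o2 -oX order_dvdG.
by rewrite (eqP (_ : coprime 2 (5 ^ a))) // coprimeXr.
Qed.

(** Commutator collection in class at most 3, where 5-groups are regular: c = [y, x] and its
    commutators n, m with x and y end up with exponents 10, 10 and 30. *)
Lemma expMg_5 (gT : finGroupType) (x y c n m : gT) :
    y ^ x = y * c -> c ^ x = c * n -> n ^ x = n -> c ^ y = c * m -> commute y n -> commute y m ->
    commute c n -> commute c m -> commute n m -> c ^+ 5 = 1 -> n ^+ 5 = 1 -> m ^+ 5 = 1 ->
  (x * y) ^+ 5 = x ^+ 5 * y ^+ 5.
Proof.
move=> yx cx nx cy yn ym cn cm nm c5 n5 m5.
have y1 : y ^ (x ^+ 1) = y * c ^+ 1 * n ^+ 0 by rewrite !expg1 mulg1.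
have conjx k i j : y ^ (x ^+ k) = y * c ^+ i * n ^+ j -> y ^ (x ^+ k.+1) = y * c ^+ i.+1 * n ^+ (i + j).
  move=> eqk; rewrite expgSr conjgM eqk !conjMg !conjXg yx cx nx expgMn // expgS expgD !mulgA.
  by rewrite -(mulgA y).
have y2 := conjx _ _ _ y1; have y3 := conjx _ _ _ y2; have y4 := conjx _ _ _ y3.
pose w a b d e := y ^+ a * c ^+ b * n ^+ d * m ^+ e.
have cX (u v : gT) p q : commute u v -> u ^+ p * v ^+ q = v ^+ q * u ^+ p by move=> cuv; apply/commuteX/commute_sym/commuteX/commute_sym.
have wy a b d e : w a b d e * y = w a.+1 b d (b + e)%N.
  have cby : c ^+ b * y = y * (c ^+ b * m ^+ b) by rewrite conjgC conjXg cy expgMn.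
  rewrite /w -mulgA (cX m y e 1%N (commute_sym ym)) -mulgA (mulgA (n ^+ d)) (cX n y d 1%N (commute_sym yn)).
  by rewrite expg1 !mulgA -(mulgA _ _ y) cby !mulgA expgSr -!mulgA (mulgA (m ^+ b)) -(cX n m d b nm) -!mulgA expgD.
have wc a b d e i : w a b d e * c ^+ i = w a (b + i)%N d e.
  by rewrite /w -!mulgA -(cX c m i e cm) (mulgA (n ^+ d)) -(cX c n i d cn) !mulgA -(mulgA _ (c ^+ b)) -expgD.
have wn a b d e j : w a b d e * n ^+ j = w a b (d + j)%N e.
  by rewrite /w -!mulgA -(cX n m j e nm) !mulgA -(mulgA _ (n ^+ d)) -expgD.
have wE a b d e i j : w a b d e * (y * c ^+ i * n ^+ j) = w a.+1 (b + i)%N (d + j)%N (b + e)%N.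
  by rewrite !mulgA wy wc wn.
have -> : (x * y) ^+ 5 = x ^+ 5 * (y ^ (x ^+ 4) * y ^ (x ^+ 3) * y ^ (x ^+ 2) * y ^ (x ^+ 1) * y ^ (x ^+ 0)).
  by rewrite !conjgE !expgS expg0 !mulg1 invg1 !invMg !mul1g -!mulgA !(mulKg, mulKVg).
congr (_ * _); rewrite y4 y3 y2 y1 (expg0 x) conjg1.
have w0 : w 0%N 0%N 0%N 0%N = 1 by rewrite /w !expg0 !mulg1.
rewrite -[y * c ^+ 4 * _]mul1g -[X in X * (y * c ^+ 4 * _)]w0 !wE wy /w.
have c10 : c ^+ 10 = 1 by rewrite (expgM c 5 2) c5 expg1n.
have n10 : n ^+ 10 = 1 by rewrite (expgM n 5 2) n5 expg1n.
have m30 : m ^+ 30 = 1 by rewrite (expgM m 5 6) m5 expg1n.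
by rewrite c10 n10 /= m30 !mulg1.
Qed.

(** Since Z(P) meets N and N^# is one class, P centralizes N; so the Schur-Zassenhaus complement is
    transitive on the 24 elements of N^#, hence regular. For an involution s, n n^s is fixed by s,
    so s inverts N; by regularity there is only one involution, which is central in H. *)
Lemma closed_frame (gT : finGroupType) (G N P : {group gT}) :
    #|G| = (24 * 5 ^ 6)%N -> N <| G -> #|N| = 25%N -> {in N^# &, forall x y, x \in y ^: G} ->
    5.-Sylow(G) P -> P <| G ->
  exists (H : {group gT}) (t : gT),
    [/\ [/\ N \subset 'Z(P), P :&: H = 1, P * H = G & #|H| = 24%N],
        [/\ t \in H, #[t] = 2%N, H \subset 'C[t] & {in N, forall n, n ^ t = n^-1}],
        {in N^# &, forall x y, exists2 h, h \in H & x ^ h = y},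
        {in N^#, forall x, 'C_H[x] = 1}
      & forall X : {group gT}, H \subset 'N(X) -> 5.-group X ->
          exists b, #|X| = (#|'C_X[t]| * 25 ^ b)%N].
Proof.
move=> oG nsN oN trN sylP nsP; have oP := order_Sylow5 oG sylP; have pP := pHall_pgroup sylP.
have pN : 5.-group N by rewrite /pgroup oN -[25%N]/(5 ^ 2)%N pnatX.
have sNP : N \subset P by rewrite (sub_normal_Hall sylP nsP) ?normal_sub.
have sNZ : N \subset 'Z(P).
  have ntN : N != 1 :> {set _} by rewrite -cardG_gt1 oN.
  have nsNP : N <| P := normalS sNP (normal_sub nsP) nsN.
  have /trivgPn[z /setIP[Nz Zz] ntz] := meet_center_nil (pgroup_nil pP) nsNP ntN.
  apply/subsetP=> n Nn; have [-> // | ntn] := eqVneq n 1.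
  have /imsetP[g Gg ->] : n \in z ^: G by apply: trN; rewrite !inE ?ntn ?ntz.
  by rewrite memJ_norm // (subsetP (gFnorm_trans _ (normal_norm nsP))).
have /splitsP[H /complP[tiPH defG]] : [splits G, over P].
  by apply: SchurZassenhaus_split nsP; apply: pHall_Hall sylP.
have oH : #|H| = 24%N.
  have := TI_cardMg tiPH; rewrite defG oG oP => /eqP.
  by rewrite mulnC eqn_pmul2l ?expn_gt0 // => /eqP.
have sHG : H \subset G by rewrite -defG mulG_subr.
have trH : {in N^# &, forall x y, exists2 h, h \in H & x ^ h = y}.
  move=> x y Nx Ny; have /imsetP[g] := trN y x Ny Nx.
  rewrite -defG => /imset2P[p h Pp Hh ->] ->; exists h => //; rewrite conjgM; congr (_ ^ h).
  apply/esym/conjg_fixP/commgP; case/setD1P: Nx => _ /(subsetP sNZ)/centerP[_]; exact.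
have oN1 : #|N^#| = 24%N by have := cardsD1 1 N; rewrite group1 oN => -[].
have nNH : H \subset 'N(N) := subset_trans sHG (normal_norm nsN).
have regH : {in N^#, forall x, 'C_H[x] = 1}.
  move=> x Nx; apply: card1_trivg.
  have oC : #|H : 'C_H[x]| = 24%N.
    rewrite index_cent1 -oN1; apply: eq_card => y; apply/imsetP/idP=> [[k Hk ->] | Ny].
      by rewrite memJ_norm // normD1 (subsetP nNH).
    by have [k Hk <-] := trH _ _ Nx Ny; exists k.
  have := Lagrange (subsetIl H 'C[x]); rewrite oC oH => /eqP.
  by rewrite -[X in _ == X]mul1n eqn_pmul2r // => /eqP.
have [Q sylQ] := Sylow_exists 2 H; have sQH := pHall_sub sylQ.
have oQ : #|Q| = 8%N by rewrite (card_Hall sylQ) oH p_part.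
have fixH h n : h \in H -> n \in N -> n ^ h = n -> n != 1 -> h = 1.
  move=> Hh Nn nh ntn; have: h \in 'C_H[n].
    by apply/setIP; split=> //; apply/cent1P/commute_sym/commgP/conjg_fixP.
  by rewrite regH => [/set1P | ]; rewrite // !inE ntn.
have invN s : s \in H -> #[s] = 2%N -> {in N, forall n, n ^ s = n^-1}.
  move=> Hs os n Nn; have Nns : n ^ s \in N by rewrite memJ_norm // (subsetP nNH).
  have cNN : commute n (n ^ s).
    by have /centerP[_] := subsetP sNZ _ Nn; apply; apply: (subsetP sNP).
  apply: (mulgI n); rewrite mulgV; apply/eqP; apply: contraT => nt.
  have := fixH s (n * n ^ s) Hs; rewrite groupM // conjMg -conjgM -[s * s]/(s ^+ 2) -os expg_order conjg1.
  by move=> /(_ isT (esym cNN) nt) s1; rewrite s1 order1 in os.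
have [t Qt ot] : {t | t \in Q & #[t] = 2%N} by apply: (@Cauchy _ 2 Q); rewrite ?oQ.
have Ht := subsetP sQH t Qt.
have [n Nn ntn] : exists2 n, n \in N & n != 1 by apply/trivgPn; rewrite -cardG_gt1 oN.
have uniqt s : s \in H -> #[s] = 2%N -> s = t.
  move=> Hs os; apply/eqP; rewrite eq_mulgV1; apply/eqP/(fixH _ n) => //; first by rewrite groupM ?groupV.
  have tV : t^-1 = t by apply/eqP; rewrite eq_invg_mul -[t * t]/(t ^+ 2) -ot expg_order.
  by rewrite tV conjgM (invN s) // conjVg (invN t) // invgK.
have cHt : H \subset 'C[t].
  apply/subsetP=> h Hh; apply/cent1P/commute_sym/commgP/conjg_fixP/uniqt; first by rewrite groupJ.
  by rewrite orderJ.
exists H, t; split=> //; first by split=> //; apply: invN.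
move=> X nXH pX; apply: (@cent_involution_index _ X Q t (logn 5 #|X|)) => //.
- exact: subset_trans sQH nXH.
- exact: subset_trans sQH cHt.
- move=> s /setD1P[nts Qs]; have pQ := pHall_pgroup sylQ.
  have nts1 : <[s]> != 1 :> {set _} by rewrite cycle_eq1.
  have [_ _ [k os]] := pgroup_pdiv (mem_p_elt pQ Qs : 2.-group <[s]>) nts1.
  have Hs := subsetP sQH s Qs; exists (2 ^ k)%N; apply: uniqt; first exact: groupX.
  by rewrite (orderXexp k os) subSnn.
exact: card_pgroup pX.
Qed.

Lemma class_full_commg (gT : finGroupType) (P N : {group gT}) (x : gT) :
    x \in P -> N \subset P -> {in P, forall y, [~ x, y] \in N} ->
    {in N, forall z, exists2 y, y \in P & [~ x, y] = z} ->
  #|P| = (#|'C_P[x]| * #|N|)%N.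
Proof.
move=> Px sNP xN Nx; rewrite -(Lagrange (subsetIl P 'C[x])) index_cent1 -(card_lcoset N x).
congr (_ * _)%N; apply: eq_card => y; rewrite mem_lcoset; apply/imsetP/idP=> [[z Pz ->] | Nxy].
  by rewrite -commgEl xN.
by have [z Pz def_z] := Nx _ Nxy; exists z; rewrite // conjg_mulR def_z mulKVg.
Qed.

(* An automorphism of order 2 without fixed points inverts, so the group is abelian. *)
Lemma abelian_fixfree_involution (gT : finGroupType) (P : {group gT}) (t : gT) :
  t \in 'N(P) -> t ^+ 2 = 1 -> 'C_P[t] = 1 -> abelian P.
Proof.
move=> nPt t2 cPt; pose f x := x^-1 * x ^ t.
have fP : {in P, forall x, f x \in P} by move=> x Px; rewrite groupM ?groupV // memJ_norm.
have inj_f : {in P &, injective f}.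
  move=> x y Px Py eqf; apply/eqP; rewrite eq_mulgV1; apply/eqP/set1P; rewrite -[[set 1]]cPt.
  rewrite inE groupM ?groupV //=; apply/cent1P/commgP/conjg_fixP.
  have xt : x ^ t = x * (y^-1 * y ^ t) by rewrite -/(f y) -eqf mulKVg.
  by rewrite conjMg conjVg xt (mulgA x) mulgK.
have fim : f @: P = P.
  apply/eqP; rewrite eqEcard card_in_imset // leqnn andbT.
  by apply/subsetP=> _ /imsetP[x Px ->]; apply: fP.
have inv x : x \in P -> x ^ t = x^-1.
  rewrite -{1}fim => /imsetP[y Py ->]; rewrite /f conjMg conjVg -conjgM.
  by rewrite -[t * t]/(t ^+ 2) t2 conjg1 (invMg y^-1) invgK.
apply/centsP=> x Px y Py; apply: invg_inj; rewrite -inv ?groupM // conjMg !inv //.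
by rewrite invMg.
Qed.

(** * The centralizer D of the involution in a normal Sylow subgroup *)

Section ClosedD.
Variables (gT : finGroupType) (N P H : {group gT}) (t : gT).
Hypotheses (pP : 5.-group P) (oP : #|P| = (5 ^ 6)%N) (oN : #|N| = 25%N) (sNZ : N \subset 'Z(P)).
Hypotheses (nPH : H \subset 'N(P)) (nNH : H \subset 'N(N)).
Hypotheses (Ht : t \in H) (ot : #[t] = 2%N) (cHt : H \subset 'C[t]) (invN : {in N, forall n, n ^ t = n^-1}).
Hypothesis trH : {in N^# &, forall x y, exists2 h, h \in H & x ^ h = y}.
Hypothesis parity : forall X : {group gT}, H \subset 'N(X) -> 5.-group X ->
          exists b, #|X| = (#|'C_X[t]| * 25 ^ b)%N.
Hypothesis camP : forall x z, x \in P :\: N -> z \in N -> exists2 y, y \in P & [~ x, y] = z.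

Definition cD := 'C_P[t]%G.
Notation D := cD.

Lemma cd_sNP : N \subset P. Proof. exact: subset_trans sNZ (center_sub P). Qed.

Lemma cd_cN n y : n \in N -> y \in P -> commute n y.
Proof. by move=> /(subsetP sNZ)/centerP[_ cn] /cn. Qed.

Lemma cd_fixt x : x \in D -> x ^ t = x.
Proof. by case/setIP=> _ /cent1P ctx; apply/conjg_fixP/commgP. Qed.

Lemma cd_tiND : N :&: D = 1.
Proof.
apply/trivgP/subsetP=> n /setIP[Nn Dn]; rewrite inE -order_eq1 -dvdn1.
have n2 : n ^+ 2 = 1.
  by apply: (mulgI n^-1); rewrite mulKg mulg1 -{1}(cd_fixt Dn) invN.
have : (#[n] %| gcdn 2 25)%N by rewrite dvdn_gcd order_dvdn n2 eqxx -oN order_dvdG.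
by [].
Qed.

Lemma cd_sDP : D \subset P. Proof. exact: subsetIl. Qed.

Lemma cd_nDH : H \subset 'N(D).
Proof.
apply/subsetP=> h Hh; rewrite inE; apply/subsetP=> _ /imsetP[x Dx ->].
have [Px ctx] := setIP Dx; apply/setIP; split; first by rewrite memJ_norm // (subsetP nPH).
have th : t ^ h = t by apply/conjg_fixP/commgP/cent1P; rewrite cent1C (subsetP cHt).
apply/cent1P/commgP; rewrite -th -conjRg; apply/eqP; have /commgP/eqP-> : commute x t by apply/cent1P.
by rewrite conj1g.
Qed.

Lemma cd_mulND (X : {group gT}) : X \subset D -> #|N * X| = (25 * #|X|)%N.
Proof.
move=> sXD; rewrite TI_cardMg ?oN //; apply/trivgP; rewrite -cd_tiND; exact: setIS.
Qed.

Lemma cd_notN x : x \in D -> x != 1 -> x \notin N.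
Proof.
by move=> Dx; apply: contra => Nx; have: x \in N :&: D by [apply/setIP]; rewrite cd_tiND => /set1P->.
Qed.

Lemma cd_exN : exists2 n, n \in N & n != 1.
Proof. by apply/trivgPn; rewrite -cardG_gt1 oN. Qed.

Lemma pow5_leq a b : (5 ^ a == 5 ^ b)%N = (a == b).
Proof. by rewrite eqn_exp2l. Qed.

(** By parity |D| = 5^a with a even. If a = 0, t inverts P and P is abelian; if a > 2, N D is all of
    P and the commutators of D that lie in N are in N :&: D = 1. Both contradict the Camina
    property. *)
Lemma cd_oD : #|D| = 25%N.
Proof.
have [b] := parity nPH pP; rewrite oP -/D => def_b.
have /dvdn_pfactor[//|a _ oDa] : (#|D| %| 5 ^ 6)%N by rewrite -oP cardSg ?cd_sDP.
move: def_b; rewrite oDa -[25%N]/(5 ^ 2)%N -expnM -expnD => /eqP; rewrite pow5_leq => /eqP def6.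
have [n Nn ntn] := cd_exN.
suffices /andP[a0 a3] : (0 < a)%N && (a < 4)%N by congr (5 ^ _)%N; lia.
apply/andP; split.
  rewrite lt0n; apply: contraNneq ntn => a0; rewrite a0 in oDa.
  have cPt := card1_trivg oDa.
  have abP : abelian P.
    by apply: abelian_fixfree_involution cPt; rewrite ?(subsetP nPH) // -ot expg_order.
  have [x PNx] : exists x, x \in P :\: N.
    by apply/set0Pn; rewrite setD_eq0; apply/negP=> /subset_leq_card; rewrite oP oN -[25%N]/(5 ^ 2)%N leq_exp2l.
  have [y Py <-] := camP PNx Nn; apply/commgP.
  by apply: (centsP abP) => //; case/setDP: PNx.
have ltD : (#|(N * D)%g| <= 5 ^ 6)%N by rewrite -oP subset_leq_card ?mul_subG ?cd_sNP ?cd_sDP.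
rewrite cd_mulND // oDa -[25%N]/(5 ^ 2)%N -expnD leq_exp2l // in ltD.
rewrite ltn_neqAle; apply/andP; split; last by lia.
apply: contraNneq ntn => a4; rewrite a4 in oDa.
have defP : N * D = P.
  by apply/eqP; rewrite eqEcard mul_subG ?cd_sNP ?cd_sDP // cd_mulND // oDa oP.
have [x Dx ntx] : exists2 x, x \in D & x != 1 by apply/trivgPn; rewrite -cardG_gt1 oDa.
have PNx : x \in P :\: N by rewrite inE cd_notN // (subsetP cd_sDP).
have [y] := camP PNx Nn; rewrite -defP => /imset2P[m d Nm Dd ->] def_n.
have : n \in N :&: D.
  apply/setIP; split; rewrite // -def_n commgMJ.
  have /commgP/eqP-> : commute x m by apply/commute_sym/cd_cN => //; apply: (subsetP cd_sDP).
  by rewrite conj1g mulg1 groupR.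
by rewrite cd_tiND => /set1P->.
Qed.

Lemma cd_abD : abelian D.
Proof. by apply: (@card_p2group_abelian _ 5); rewrite ?cd_oD. Qed.

Lemma cd_sED : N * D \subset P.
Proof. by rewrite mul_subG ?cd_sNP ?cd_sDP. Qed.

Lemma cd_abE : {in N * D &, forall x y, commute x y}.
Proof.
have sDP := subsetP cd_sDP; move=> _ _ /imset2P[m d Nm Dd ->] /imset2P[m' d' Nm' Dd' ->].
have c1 : commute m (m' * d') by apply: cd_cN (groupM (subsetP cd_sNP m' Nm') (sDP d' Dd')).
have c2 : commute d m' by apply/commute_sym/cd_cN; rewrite ?sDP.
have c3 : commute d d' by apply: (centsP cd_abD).
by apply/commute_sym/commuteM; apply/commute_sym => //; apply: commuteM.
Qed.

Lemma cd_cent_commg x : x \in D -> x != 1 -> {in P, forall y, [~ x, y] \in N} ->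
  'C_P[x] = N * D.
Proof.
move=> Dx ntx xN; have Px := subsetP cd_sDP x Dx.
have oC : (5 ^ 6)%N = (#|'C_P[x]| * 25)%N.
  rewrite -oP -oN; apply: class_full_commg => //; first exact: cd_sNP.
  by move=> z Nz; apply: camP; rewrite // inE cd_notN.
apply/esym/eqP; rewrite eqEcard subsetI cd_sED; apply/andP; split.
  apply/subsetP=> y Ey; apply/cent1P/cd_abE => //; exact: (subsetP (mulG_subr N D)).
rewrite cd_mulND // cd_oD -(leq_pmul2r (_ : 0 < 25)%N) // -oC.
by rewrite -[(25 * 25 * 25)%N]/(5 ^ 2 * 5 ^ 2 * 5 ^ 2)%N -!expnD.
Qed.

Lemma cd_Z2_subproof : group_set [set x in P | [forall y in P, [~ x, y] \in N]].
Proof.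
apply/group_setP; split; first by rewrite inE group1; apply/forall_inP=> y _; rewrite comm1g group1.
move=> x y; rewrite !inE => /andP[Px /forall_inP xN] /andP[Py /forall_inP yN].
rewrite groupM //=; apply/forall_inP=> z Pz; rewrite commMgJ groupM ?yN //.
have Nxz := xN z Pz; by have -> : [~ x, z] ^ y = [~ x, z] by apply/conjg_fixP/commgP/cd_cN.
Qed.
Definition cZ2 := Group cd_Z2_subproof.
Notation Z2 := cZ2.

Lemma cd_Z2P x : reflect (x \in P /\ {in P, forall y, [~ x, y] \in N}) (x \in Z2).
Proof. by rewrite inE; apply: (iffP andP) => [] [Px /forall_inP]. Qed.

Lemma cd_sZ2P : Z2 \subset P. Proof. by apply/subsetP=> x /cd_Z2P[]. Qed.

Lemma cd_sNZ2 : N \subset Z2.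
Proof.
apply/subsetP=> n Nn; apply/cd_Z2P; split; first exact: (subsetP cd_sNP).
by move=> y Py; have /commgP/eqP-> := cd_cN Nn Py; rewrite group1.
Qed.

Lemma cd_nZ2H : H \subset 'N(Z2).
Proof.
apply/subsetP=> h Hh; rewrite inE; apply/subsetP=> _ /imsetP[x /cd_Z2P[Px xN] ->].
have [nP nN] := (subsetP nPH h Hh, subsetP nNH h Hh).
apply/cd_Z2P; split=> [|y Py]; first by rewrite memJ_norm.
by rewrite -(conjgKV h y) -conjRg memJ_norm ?xN // memJ_norm ?groupV.
Qed.

Lemma cd_Z2_proper : exists2 x, x \in Z2 & x \notin N.
Proof.
have nsNP : N <| P by rewrite /normal cd_sNP cents_norm // centsC (subset_trans sNZ) // subsetIr.
have ntQ : P / N != 1.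
  apply/negP=> /eqP/trivgP; rewrite quotient_sub1 ?normal_norm // => /subset_leq_card.
  by rewrite oP oN -[25%N]/(5 ^ 2)%N leq_exp2l.
have pQ : 5.-group (P / N) by rewrite quotient_pgroup.
have : 'Z(P / N) != 1 by rewrite center_nil_eq1 ?(pgroup_nil pQ).
case/trivgPn=> xb /centerP[/morphimP[x nNx Px ->] cx] ntx; exists x; last first.
  by apply: contraNN ntx => Nx; apply/eqP/coset_id.
apply/cd_Z2P; split=> // y Py; have nNy := subsetP (normal_norm nsNP) y Py.
apply: coset_idr; first by rewrite groupR.
by rewrite morphR //; apply/eqP/commgP/cx; apply: (mem_morphim (coset_morphism N)).
Qed.

(** If only a proper part of D is central modulo N, then either this part is trivial and parity
    makes [Z2] too large, or it has order 5 and yields a proper nontrivial H-invariant subgroup of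
    N, which transitivity forbids. *)
Lemma cd_DZ2 : D \subset Z2.
Proof.
apply: contraT => nDZ; have [sDP sZP] := (subsetP cd_sDP, subsetP cd_sZ2P).
have ltDZ : (#|D :&: Z2| < 25)%N.
  rewrite -cd_oD proper_card //; apply/properP; split; first exact: subsetIl.
  by case/subsetPn: nDZ => d Dd nZd; exists d; rewrite // inE Dd.
have [b oZ] := parity cd_nZ2H (pgroupS cd_sZ2P pP).
have defDZ : 'C_Z2[t] = D :&: Z2.
  by rewrite [in RHS]setIC [RHS]setIA (setIidPl cd_sZ2P).
(* When the intersection is trivial, |Z2| is a power of 25 larger than |N|, so Z2 D = P; then D,
   being abelian, is central modulo N. *)
rewrite defDZ in oZ; have [tiDZ | ] := eqVneq (D :&: Z2) 1.
  rewrite tiDZ cards1 mul1n in oZ.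
  have ltNZ : (25 < #|Z2|)%N.
    rewrite -oN; apply: proper_card; apply/properP; split; first exact: cd_sNZ2.
    by have [x] := cd_Z2_proper; exists x.
  have b2 : (1 < b)%N by rewrite oZ -{1}[25%N]/(25 ^ 1)%N ltn_exp2l in ltNZ.
  have defP : Z2 * D = P.
    apply/eqP; rewrite eqEcard mul_subG ?cd_sZ2P ?cd_sDP // TI_cardMg ?[Z2 :&: D]setIC //.
    by rewrite cd_oD oZ oP -[(5 ^ 6)%N]/(25 ^ 2 * 25)%N leq_pmul2r // leq_exp2l.
  case/negP: nDZ; apply/subsetP=> d Dd; apply/cd_Z2P; split=> [|y]; first exact: sDP.
  rewrite -defP => /imset2P[z e Zz De ->]; rewrite commgMJ.
  have /commgP/eqP-> : commute d e by apply: (centsP cd_abD).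
  case/cd_Z2P: (Zz) => Pz zN; have Nzd : [~ d, z] \in N by rewrite -groupV invg_comm zN ?sDP.
  have -> : [~ d, z] ^ e = [~ d, z] by apply/conjg_fixP/commgP/cd_cN; rewrite ?sDP.
  by rewrite mul1g.
case/trivgPn=> x /setIP[Dx Zx] ntx; case/cd_Z2P: (Zx) => Px xN.
have oDZ : #|D :&: Z2| = 5%N.
  have : (#|D :&: Z2| %| 5 ^ 2)%N by rewrite -[(5 ^ 2)%N]/25%N -cd_oD cardSg ?subsetIl.
  case/dvdn_pfactor=> // m; case: m => [|[|[|m]]] // _ oDZ; last 1 first.
  - by rewrite oDZ in ltDZ.
  have : x \in D :&: Z2 by apply/setIP.
  by rewrite (card1_trivg oDZ) => /set1P x1; rewrite x1 eqxx in ntx.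
have cPx := cd_cent_commg Dx ntx xN.
have oE : #|'C_P[x]| = (5 ^ 4)%N by rewrite cPx cd_mulND // cd_oD.
have [d Dd nZd] := subsetPn nDZ; have Pd := sDP d Dd.
have nsNP : N <| P by rewrite /normal cd_sNP cents_norm // centsC (subset_trans sNZ) // subsetIr.
have nNP := normal_norm nsNP.
have defX : <[x]> = D :&: Z2.
  have sX : <[x]> \subset D :&: Z2 by rewrite cycle_subG; apply/setIP.
  apply/eqP; rewrite eqEcard sX oDZ -orderE dvdn_leq //.
  have : (#[x] %| 5)%N by rewrite -oDZ order_dvdG //; apply/setIP.
  by rewrite dvdn_divisors // !inE order_eq1 (negPf ntx) => /eqP->.
have defDxd e : e \in D -> exists i j, e = x ^+ i * d ^+ j.
  have cxd : <[d]> \subset 'C(<[x]>).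
    by rewrite cycle_subG; apply/centP=> _ /cycleP[i ->]; apply/commuteX/(centsP cd_abD).
  have sXD : <[x]> <*> <[d]> \subset D by rewrite join_subG !cycle_subG Dx.
  suffices defD : D \subset <[x]> * <[d]>.
    by move=> /(subsetP defD)/imset2P[_ _ /cycleP[i ->] /cycleP[j ->] ->]; exists i, j.
  rewrite -cent_joinEr //; suffices /eqP-> : <[x]> <*> <[d]> == D by [].
  rewrite eqEcard sXD cd_oD /=.
  have : (#|<[x]> <*> <[d]>| %| 5 ^ 2)%N by rewrite -[(5 ^ 2)%N]/25%N -cd_oD cardSg.
  case/dvdn_pfactor=> // m; case: m => [|[|[|m]]] // _ oJ; last by rewrite oJ.
    by have := subset_leq_card (joing_subl <[x]> <[d]>); rewrite oJ defX oDZ.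
  have eqJ : <[x]> = <[x]> <*> <[d]> by apply/eqP; rewrite eqEcard joing_subl oJ defX oDZ.
  case/negP: nZd; have : d \in <[x]> by rewrite eqJ mem_gen // inE cycle_id orbT.
  by rewrite defX => /setIP[].
have nN y : y \in P -> y \in 'N(N) := subsetP nNP y.
have comN u y : u \in P -> y \in P -> ([~ u, y] \in N) = (coset N y \in 'C[coset N u]).
  move=> Pu Py; apply/idP/cent1P=> [Nuy | cuy].
    by apply/commute_sym/commgP; rewrite -morphR ?nN //=; apply/eqP/coset_id.
  by apply: coset_idr; rewrite ?groupR ?morphR ?nN //; apply/eqP/commgP/commute_sym.
(* K is the centralizer of D modulo N. It is larger than C_P(x) = N D because the class of d modulo
   N stays in N D / N and misses 1, so has fewer than 25 elements; it is not P because d is outside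
   [Z2]. *)
pose K := (P :&: coset N @*^-1 'C_(P / N)[coset N d])%G.
have KP y : reflect (y \in P /\ [~ d, y] \in N) (y \in K).
  apply: (iffP setIP) => [[Py /morphpreP[_ /setIP[_]]] | [Py Ndy]]; first by rewrite -comN.
  split=> //; apply/morphpreP; split; first exact: nN.
  by apply/setIP; split; rewrite -?comN //; apply: (mem_morphim (coset_morphism N)) => //; apply: nN.
have nEP : 'C_P[x] <| P.
  rewrite /normal subsetIl; apply/subsetP=> y Py; rewrite inE; apply/subsetP=> _ /imsetP[e /setIP[Pe /cent1P cex] ->].
  apply/setIP; split; first by rewrite groupJ.
  have cxe : commute e (x ^ y^-1).
    by rewrite conjg_mulR; apply: commuteM => //; apply/commute_sym/cd_cN; rewrite ?xN ?groupV.
  apply/cent1P; apply: (conjg_inj y^-1); rewrite [LHS]conjMg [RHS]conjMg conjgK; exact: cxe.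
have sNE : N \subset 'C_P[x].
  by apply/subsetP=> n Nn; rewrite inE (subsetP cd_sNP) //=; apply/cent1P/cd_cN.
have sEP := normal_sub nEP.
have oK : (5 ^ 4 < #|K|)%N.
  have -> : K = (coset N @*^-1 'C_(P / N)[coset N d])%G.
    apply/val_inj/setIidPr; apply: subset_trans (_ : coset N @*^-1 (P / N) \subset P).
      by apply: morphpreS; apply: subsetIl.
    by rewrite quotientGK.
  rewrite card_cosetpre oN.
  have oQ : #|P / N| = (5 ^ 4)%N.
    by rewrite card_quotient // -divgS ?cd_sNP // oP oN -[25%N]/(5 ^ 2)%N -expnB.
  have oEN : #|'C_P[x] / N| = 25%N.
    by rewrite card_quotient ?(subset_trans sEP) // -divgS // oE oN.
  have ltcl : (#|coset N d ^: (P / N)| < 25)%N.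
    rewrite -oEN; apply: proper_card; apply/properP; split.
      rewrite class_sub_norm; last by rewrite normal_norm // quotient_normal.
      apply: (mem_morphim (coset_morphism N)); first exact: nN.
      by rewrite inE Pd; apply/cent1P/(centsP cd_abD).
    exists 1; first exact: group1.
    apply/negP=> /imsetP[z _ /eqP]; rewrite eq_sym conjg_eq1 => /eqP d1.
    case/negP: nZd; apply: (subsetP cd_sNZ2); apply: coset_idr; rewrite ?nN //.
  have := Lagrange (subsetIl (P / N) 'C[coset N d]); rewrite index_cent1 oQ => eq5.
  have lt0 : (0 < #|'C_(P / N)[coset N d]|)%N := cardG_gt0 _.
  rewrite -[(5 ^ 4)%N]/(25 * 25)%N in eq5 *.
  rewrite ltn_pmul2l // ltnNge; apply/negP=> le25.
  have : (#|'C_(P / N)[coset N d]| * #|coset N d ^: (P / N)| < 25 * 25)%N.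
    by apply: leq_ltn_trans (_ : _ <= 25 * #|coset N d ^: (P / N)|)%N _; rewrite ?leq_mul2r ?le25 ?orbT ?ltn_pmul2l.
  by rewrite eq5 ltnn.
have KD y e : y \in K -> e \in D -> [~ e, y] \in N.
  case/KP=> Py Ndy /defDxd[i [j ->]]; rewrite comN ?groupM ?groupX //.
  rewrite morphM ?groupX ?nN // !morphX ?nN //= cent1C groupM ?groupX //= cent1C -comN //; exact: xN.
have nKH : H \subset 'N(K).
  apply/subsetP=> h Hh; rewrite inE; apply/subsetP=> _ /imsetP[y Ky ->]; have [Py _] := KP y Ky.
  apply/KP; split; first by rewrite memJ_norm // (subsetP nPH).
  rewrite -(conjgKV h d) -conjRg memJ_norm ?(subsetP nNH) // KD //.
  by rewrite memJ_norm // groupV (subsetP cd_nDH).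
have ltK : (#|K| < 5 ^ 6)%N.
  rewrite -oP; apply: proper_card; rewrite properE subsetIl; apply/negP=> sPK.
  by case/negP: nZd; apply/cd_Z2P; split=> // y /(subsetP sPK)/KP[].
have sEK : 'C_P[x] \subset K.
  apply/subsetP=> e Ee; apply/KP; split; first exact: (subsetP sEP).
  rewrite cPx in Ee; have /commgP/eqP-> : commute d e; last exact: group1.
  by apply: cd_abE => //; apply: (subsetP (mulG_subr N D)).
(* As N is central, y -> [x, y] is multiplicative on K with kernel N D. Its image W is neither 1 nor
   N, and it is H-invariant because H normalizes both K and <x>. *)
have gW : group_set [set [~ x, y] | y in K].
  apply/group_setP; split; first by apply/imsetP; exists 1; rewrite ?group1 // commg1.
  move=> _ _ /imsetP[y Ky ->] /imsetP[z Kz ->]; apply/imsetP; exists (z * y); first exact: groupM.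
  have [Pz _] := KP z Kz; have [Py _] := KP y Ky.
  rewrite commgMJ; congr (_ * _); apply/esym/conjg_fixP/commgP/cd_cN => //; exact: xN.
pose W := Group gW.
have sWN : W \subset N.
  by apply/subsetP=> _ /imsetP[y /KP[Py _] ->]; apply: xN.
have W1 : W != 1 :> {set _}.
  have /subsetPn[y Ky nEy] : ~~ (K \subset 'C_P[x]).
    by apply/negP=> /subset_leq_card; rewrite oE leqNgt oK.
  have [Py _] := KP y Ky; apply/trivgPn; exists [~ x, y]; first by apply/imsetP; exists y.
  by apply: contra nEy => /commgP cxy; rewrite inE Py; apply/cent1P/commute_sym.
have WN : W != N :> {set _}.
  apply: contraTneq ltK => eqW; rewrite -leqNgt -(Lagrange sEK) oE.
  have eqC : 'C_K[x] = 'C_P[x].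
    apply/setP=> y; apply/setIP/idP=> [[/KP[Py _] cy] | Ey]; first by apply/setIP.
    by split; [apply: (subsetP sEK) | case/setIP: Ey].
  have oI : #|K : 'C_P[x]| = #|x ^: K| by rewrite -eqC index_cent1.
  rewrite [X in (_ <= _ * X)%N]oI; suffices -> : x ^: K = x *: W by rewrite card_lcoset eqW oN -[25%N]/(5 ^ 2)%N -expnD.
  apply/setP=> y; rewrite mem_lcoset; apply/imsetP/imsetP=> [[z Kz ->] | [z Kz eqy]]; exists z => //.
  by rewrite conjg_mulR -eqy mulKVg.
have nWH : H \subset 'N(W).
  apply/subsetP=> h Hh; rewrite inE; apply/subsetP=> _ /imsetP[_ /imsetP[y Ky ->] ->].
  have Kyh : y ^ h \in K by rewrite memJ_norm // (subsetP nKH).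
  have /cycleP[i xh] : x ^ h \in <[x]>.
    by rewrite defX; apply/setIP; split; rewrite memJ_norm // ?(subsetP cd_nDH) ?(subsetP cd_nZ2H).
  rewrite conjRg xh commXg; first by apply: groupX; apply/imsetP; exists (y ^ h).
  by apply/commute_sym/cd_cN => //; apply: xN; case/KP: Kyh.
have [w Ww ntw] := trivgPn _ W1.
case/eqP: WN; apply/eqP; rewrite eqEsubset sWN; apply/subsetP=> n Nn.
have [-> | ntn] := eqVneq n 1; first exact: group1.
have Nw : w \in N^# by rewrite !inE ntw (subsetP sWN).
have Nn1 : n \in N^# by rewrite !inE ntn.
have [h Hh <-] := trH Nw Nn1; rewrite memJ_norm //; exact: (subsetP nWH).
Qed.

Lemma cd_dN d y : d \in D -> y \in P -> [~ d, y] \in N.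
Proof. by move=> /(subsetP cd_DZ2)/cd_Z2P[_ dN] /dN. Qed.

Lemma cd_commDP d y : d \in D -> y \in P -> d != 1 -> commute d y -> y \in N * D.
Proof.
move=> Dd Py ntd cdy; rewrite -(cd_cent_commg Dd ntd (fun y Py => cd_dN Dd Py)).
by rewrite inE Py; apply/cent1P/commute_sym.
Qed.

Lemma cd_N5 n : n \in N -> n ^+ 5 = 1.
Proof.
move=> Nn; have [-> | ntn] := eqVneq n 1; first exact: expg1n.
have [z Nz oz] : {z | z \in N & #[z] = 5%N} by apply: (@Cauchy _ 5 N); rewrite ?oN.
have ntz : z != 1 by rewrite -order_eq1 oz.
have [||h _ <-] := trH (x := z) (y := n); rewrite ?in_setD1 ?ntz ?ntn //.
by rewrite -conjXg -oz expg_order conj1g.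
Qed.

Lemma cd_commgX d y k : d \in D -> y \in P -> [~ d, y ^+ k] = [~ d, y] ^+ k /\ [~ d ^+ k, y] = [~ d, y] ^+ k.
Proof.
move=> Dd Py; have Ndy := cd_dN Dd Py; split.
  by apply: commgX; apply/commute_sym/cd_cN.
by apply: commXg; apply/commute_sym/cd_cN => //; apply: (subsetP cd_sDP).
Qed.

(** Since [d^5, y] = [d, y]^5 = 1, all of P commutes with d^5, whereas a nontrivial element of D has
    centralizer N D. *)
Lemma cd_D5 d : d \in D -> d ^+ 5 = 1.
Proof.
move=> Dd; apply/eqP; apply: contraT => nt5.
have sPE : P \subset N * D.
  apply/subsetP=> y Py; apply: (cd_commDP (groupX 5 Dd) Py nt5); apply/commgP.
  by case: (cd_commgX 5 Dd Py) => _ ->; rewrite cd_N5 ?cd_dN.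
have := subset_leq_card sPE; rewrite oP cd_mulND // cd_oD -[25%N]/(5 ^ 2)%N -expnD.
by rewrite leq_exp2l.
Qed.

(** y^5 commutes with D, so it lies in N D. A nontrivial component in D would commute with y and put
    y itself in N D, where fifth powers are trivial. *)
Lemma cd_P5 y : y \in P -> y ^+ 5 \in N.
Proof.
move=> Py; have [d Dd ntd] : exists2 d, d \in D & d != 1.
  by apply/trivgPn; rewrite -cardG_gt1 cd_oD.
have : y ^+ 5 \in N * D.
  apply: (cd_commDP Dd (groupX 5 Py) ntd); apply/commgP.
  by case: (cd_commgX 5 Dd Py) => -> _; rewrite cd_N5 ?cd_dN.
case/imset2P=> n e Nn De def_y; have [e1 | nte] := eqVneq e 1; first by rewrite def_y e1 mulg1.
have : y \in N * D.
  apply: (cd_commDP De Py nte); have -> : e = n^-1 * y ^+ 5 by rewrite def_y mulKg.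
  apply/commute_sym/commuteM; first by apply/commute_sym/cd_cN; rewrite ?groupV.
  by apply: commuteX.
case/imset2P=> m f Nm Df ->; rewrite expgMn; last by apply: cd_cN => //; apply: (subsetP cd_sDP).
by rewrite cd_N5 // cd_D5 // mulg1.
Qed.

Lemma cd_cDN : D \subset 'C(N).
Proof. by apply/centsP=> d Dd n Nn; apply/commute_sym/cd_cN => //; apply: (subsetP cd_sDP). Qed.

Lemma cd_commPP x y : x \in P -> y \in P -> [~ x, y] \in N * D.
Proof.
move=> Px Py; have defE : N <*> D = N * D by rewrite cent_joinEr ?cd_cDN.
have nEP : P \subset 'N(N <*> D).
  apply/subsetP=> z Pz; rewrite inE defE; apply/subsetP=> _ /imsetP[_ /imset2P[n d Nn Dd ->] ->].
  have Ndz := cd_dN Dd Pz; have nz : n ^ z = n by apply/conjg_fixP/commgP/cd_cN.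
  rewrite [_ ^ z]conjMg nz conjg_mulR -(cd_cN Ndz (subsetP cd_sDP d Dd)) mulgA.
  by apply: mem_mulg => //; apply: groupM.
have oQ : #|P / (N <*> D)| = (5 ^ 2)%N.
  have oE : #|N <*> D| = (5 ^ 2 * 5 ^ 2)%N by rewrite defE cd_mulND // cd_oD.
  have sEP : N <*> D \subset P by rewrite defE cd_sED.
  by rewrite card_quotient // -divgS // oP oE -expnD -expnB.
have abQ : abelian (P / (N <*> D)) by apply: (@card_p2group_abelian _ 5).
by have := subsetP (der1_min nEP abQ) _ (mem_commg Px Py); rewrite /= defE.
Qed.
End ClosedD.

(** * F_25 coordinates on the Sylow subgroup *)

Definition gx (gT : finGroupType) (x : gT) (c : GF5) := x ^+ GF5_nat c.

Lemma GF5_natD c c' : GF5_nat (c + c')%R = ((GF5_nat c + GF5_nat c') %% 5)%N.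
Proof. by case: c c' => [] []. Qed.

Lemma gxD (gT : finGroupType) (x : gT) c c' : x ^+ 5 = 1 -> gx x (c + c')%R = gx x c * gx x c'.
Proof. by move=> x5; rewrite /gx GF5_natD expg_mod // expgD. Qed.

Lemma gxX (gT : finGroupType) (f : V -> gT) : {morph f : u v / (u + v)%R >-> u * v} ->
  forall c z, gx (f z) c = f (scV c z).
Proof.
move=> fM c z; have f0 : f 0%R = 1 by apply: (mulgI (f 0%R)); rewrite -fM addr0 mulg1.
have fX n : f z ^+ n = f (z *+ n)%R by elim: n => [|n IHn]; rewrite ?mulr0n // expgS IHn -fM mulrS.
by rewrite /gx fX; congr f; apply/eqP; move: z {fX}; apply: V_all; case: c; vm_compute.
Qed.

Lemma gx_mem (gT : finGroupType) (A : {group gT}) (x : gT) c :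
  x ^+ 5 = 1 -> c != 0%R -> gx x c \in A -> x \in A.
Proof.
move=> x5 ntc Ac; have mod5 n : x ^+ n = x ^+ (n %% 5) by rewrite expg_mod.
suffices [k eqk] : exists k, gx x c ^+ k = x by rewrite -eqk groupX.
by case: c ntc {Ac} => // _; [exists 1%N | exists 3%N | exists 2%N | exists 4%N]; rewrite /gx -expgM mod5.
Qed.

Lemma card_GF5 : #|{: GF5}| = 5%N. Proof. by rewrite cardT enumT unlock. Qed.

Definition pw (gT : finGroupType) (x y : gT) (z : V) := gx x z.1 * gx y z.2.

Lemma pwD (gT : finGroupType) (x y : gT) : x ^+ 5 = 1 -> y ^+ 5 = 1 -> commute x y ->
  {morph pw x y : u v / (u + v)%R >-> u * v}.
Proof.
move=> x5 y5 cxy u v; rewrite /pw !gxD // -!mulgA; congr (_ * _); rewrite !mulgA; congr (_ * _).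
by apply: commuteX2.
Qed.

Lemma additive_V (gT : finGroupType) (f : V -> gT) : {morph f : u v / (u + v)%R >-> u * v} ->
  forall z, f z = pw (f oneV) (f sqV) z.
Proof.
move=> fM z; rewrite /pw !gxX // -fM; congr f.
by apply/eqP; move: z; apply: V_all; vm_compute.
Qed.

Definition lin2 (a1 a2 z : V) : V := (scV z.1 a1 + scV z.2 a2)%R.
Definition quad (a1 a2 : V) (a b : GF5) (z : V) : V := (scV b (lin2 a1 a2 z) + scV a z)%R.
Lemma lin2D a1 a2 u v : lin2 a1 a2 (u + v)%R = (lin2 a1 a2 u + lin2 a1 a2 v)%R.
Proof. by case: a1 a2 u v => [? ?] [? ?] [? ?] [? ?]; congr (_, _) => /=; ring. Qed.
Lemma quad_lin2 a1 a2 a b x y z :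
  quad a1 a2 a b (lin2 x y z) = lin2 (quad a1 a2 a b x) (quad a1 a2 a b y) z.
Proof.
by case: a1 a2 x y z => [? ?] [? ?] [? ?] [? ?] [? ?]; congr (_, _) => /=; ring.
Qed.
(* A 2 x 2 matrix over F_5 without eigenvalue has an affine combination with the *)
(* identity whose square is 2.                                                   *)
Definition eigenfree (a1 a2 : V) :=
  all (fun z => all (fun c => lin2 a1 a2 z != scV c z) GF5s) (oneV :: [seq (c, f1) | c <- GF5s]).
Definition quad_test (a1 a2 : V) (ab : V) := let q := quad a1 a2 ab.1 ab.2 in
  if q (q oneV) == (f2, f0) then
    all (fun z => (z == 0%R) || (lin2 oneV (q oneV) z != 0%R)) Vs else false.
Lemma eigenfree_quad a1 a2 : if eigenfree a1 a2 then has (quad_test a1 a2) Vs else true.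
Proof. move: a1 a2; apply: V_all2; vm_compute. reflexivity. Qed.

Lemma quad_testP a1 a2 ab : quad_test a1 a2 ab -> let q := quad a1 a2 ab.1 ab.2 in
  q (q oneV) = (f2, f0) /\ forall z, z != 0%R -> lin2 oneV (q oneV) z != 0%R.
Proof.
rewrite /quad_test; case: eqP => // qq1 /allP qn; split=> // z ntz.
by have := qn z (mem_Vs z); rewrite (negPf ntz).
Qed.

Section Coords.
Variables (gT : finGroupType) (N D P : {group gT}).
Hypotheses (oN : #|N| = 25%N) (oD : #|D| = 25%N) (oP : #|P| = (5 ^ 6)%N).
Hypotheses (sNP : N \subset P) (sDP : D \subset P) (cNP : {in N & P, forall n y, commute n y}).
Hypotheses (abD : abelian D) (D5 : {in D, forall d, d ^+ 5 = 1}) (N5 : {in N, forall d, d ^+ 5 = 1}).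
Hypothesis dN : {in D & P, forall d y, [~ d, y] \in N}.
Hypothesis dreg : {in D & P, forall d y, d != 1 -> [~ d, y] = 1 -> y \in N * D}.

Lemma bracketMl d d' y : d \in D -> d' \in D -> y \in P -> [~ d * d', y] = [~ d, y] * [~ d', y].
Proof.
move=> Dd Dd' Py; rewrite commMgJ; congr (_ * _); apply/conjg_fixP/commgP/cNP; first exact: dN.
exact: (subsetP sDP).
Qed.

Lemma bracketMr d y y' : d \in D -> y \in P -> y' \in P -> [~ d, y * y'] = [~ d, y] * [~ d, y'].
Proof.
move=> Dd Py Py'; rewrite commgMJ (_ : [~ d, y] ^ y' = [~ d, y]).
  by apply: cNP; rewrite ?dN // (subsetP sNP) ?dN.
by apply/conjg_fixP/commgP/cNP; rewrite ?dN.
Qed.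

Lemma bracketXr d y n : d \in D -> y \in P -> [~ d, y ^+ n] = [~ d, y] ^+ n.
Proof. by move=> Dd Py; apply: commgX; apply/commute_sym/cNP; rewrite ?dN. Qed.

Definition is_coords (dd nn : V -> gT) (v1 v2 : gT) :=
  [/\ v1 \in P, v2 \in P,
      [/\ {morph dd : u v / (u + v)%R >-> u * v}, injective dd & D = dd @: setT :> {set gT}],
      [/\ {morph nn : u v / (u + v)%R >-> u * v}, injective nn & N = nn @: setT :> {set gT}]
    & forall z, [~ dd z, v1] = nn z /\ [~ dd z, v2] = nn (mulV z sqV)].

Lemma morph_V_inj (f : V -> gT) : {morph f : u v / (u + v)%R >-> u * v} ->
  (forall z, f z = 1 -> z = 0%R) -> injective f.
Proof.
move=> fM f0 x y eqf; apply/eqP; rewrite -subr_eq0; apply/eqP/f0.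
by apply: (mulIg (f y)); rewrite -fM subrK mul1g.
Qed.

Lemma morph_V_onto (f : V -> gT) (A : {group gT}) : #|A| = 25%N -> injective f ->
  (forall z, f z \in A) -> A = f @: setT :> {set gT}.
Proof.
move=> oA inj_f fA; apply/esym/eqP; rewrite eqEcard card_imset // cardsT card_V oA leqnn andbT.
by apply/subsetP=> _ /imsetP[z _ ->].
Qed.

(** Identify D with N through [., v1]. Then [., v2] becomes a matrix over F_5 without eigenvector,
    because no nontrivial element of D commutes with any v2 v1^c; an affine combination with the
    identity squares to 2, and so acts as multiplication by s. *)
Lemma coords_exist : exists dd nn v1 v2, is_coords dd nn v1 v2.
Proof.
have oND : (#|(N * D)%g| <= 25 * 25)%N by rewrite -{1}oN -oD mul_cardG leq_pmulr.
have [v1 Pv1 nv1] : exists2 v1, v1 \in P & v1 \notin N * D.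
  apply/subsetPn/negP=> /subset_leq_card; rewrite oP => /leq_trans/(_ oND).
  by rewrite -[(25 * 25)%N]/(5 ^ 2 * 5 ^ 2)%N -expnD leq_exp2l.
(* The choices of v2 to avoid are those with some v2 v1^c in N D; there are at most 5 * 625 of
   them. *)
pose X := [set u.1 * (gx v1 u.2)^-1 | u in setX (N * D) [set: GF5]].
have [v2 Pv2 nv2] : exists2 v2, v2 \in P & v2 \notin X.
  apply/subsetPn/negP=> /subset_leq_card; rewrite oP => /leq_trans/(_ (leq_imset_card _ _)).
  rewrite cardsX cardsT card_GF5 => /leq_trans/(_ (leq_mul oND (leqnn 5))).
  by rewrite -[(25 * 25 * 5)%N]/(5 ^ 2 * 5 ^ 2 * 5 ^ 1)%N -!expnD leq_exp2l.
have {}nv2 c : v2 * gx v1 c \notin N * D.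
  apply: contra nv2 => Ec; apply/imsetP; exists (v2 * gx v1 c, c); last by rewrite mulgK.
  by rewrite !inE Ec.
have [d1 Dd1 ntd1] : exists2 d1, d1 \in D & d1 != 1 by apply/trivgPn; rewrite -cardG_gt1 oD.
have [d2 Dd2 nd2] : exists2 d2, d2 \in D & d2 \notin <[d1]>.
  apply/subsetPn/negP=> /subset_leq_card; rewrite oD leqNgt => /negP[].
  by rewrite -orderE (@leq_ltn_trans 5) // dvdn_leq // order_dvdn D5.
have cD : {in D &, forall d d', commute d d'} by move=> x y Dx Dy; apply: (centsP abD).
pose dd0 := pw d1 d2; have Ddd0 z : dd0 z \in D by rewrite groupM ?groupX.
have dd0M : {morph dd0 : u v / (u + v)%R >-> u * v} by apply: pwD; rewrite ?D5 //; apply: cD.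
have dd0I : injective dd0.
  apply: morph_V_inj => // -[a b] /=; rewrite /dd0 /pw /= => ab1.
  have [b0 | ntb] := eqVneq b 0%R; last first.
    case/negP: nd2; apply: (gx_mem (D5 Dd2) ntb); have -> : gx d2 b = (gx d1 a)^-1.
      by apply: (mulgI (gx d1 a)); rewrite ab1 mulgV.
    by rewrite groupV mem_cycle.
  rewrite b0 [gx d2 _]expg0 mulg1 in ab1 *; have [-> // | nta] := eqVneq a 0%R.
  have : d1 \in [1 gT] by apply: (gx_mem (D5 Dd1) nta); rewrite ab1 group1.
  by move/set1P=> d11; rewrite d11 eqxx in ntd1.
pose nn0 z := [~ dd0 z, v1]; have Nnn0 z : nn0 z \in N by apply: dN.
have nn0M : {morph nn0 : u v / (u + v)%R >-> u * v}.
  by move=> u v; rewrite /nn0 dd0M bracketMl.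
have nn0I : injective nn0.
  apply: morph_V_inj => // z nz; apply/eqP; apply: contraT => nt_z; case/negP: nv1.
  apply: (dreg (Ddd0 z)) => //; apply: contraNneq nt_z => ddz.
  by rewrite -(inj_eq dd0I) ddz; apply/eqP/esym/(mulgI (dd0 0%R)); rewrite -dd0M addr0 mulg1.
have defN := morph_V_onto oN nn0I Nnn0.
have al z : {y | nn0 y == [~ dd0 z, v2]}.
  by apply: sigW; have := dN (Ddd0 z) Pv2; rewrite defN => /imsetP[y _ ->]; exists y.
pose alf z := sval (al z); have alE z : nn0 (alf z) = [~ dd0 z, v2] := eqP (svalP (al z)).
have alM u v : alf (u + v)%R = (alf u + alf v)%R.
  by apply: nn0I; rewrite nn0M !alE dd0M bracketMl.
have alL z : alf z = lin2 (alf oneV) (alf sqV) z.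
  by apply: nn0I; rewrite alE [LHS](@additive_V _ (fun z => [~ dd0 z, v2])) ?nn0M -?gxX ?alE // => u v; rewrite dd0M bracketMl.
have := eigenfree_quad (alf oneV) (alf sqV); rewrite ifT; last first.
  apply/allP=> z z_in; have ntz : z != 0%R by move: z z_in; apply/allP.
  apply/allP=> c _; rewrite -alL.
  apply: contra (nv2 (- c)%R) => /eqP eq_al; apply: (dreg (Ddd0 z)).
  - by rewrite groupM ?groupX.
  - apply: contraNneq ntz => ddz.
    by rewrite -(inj_eq dd0I) ddz; apply/eqP/esym/(mulgI (dd0 0%R)); rewrite -dd0M addr0 mulg1.
  rewrite bracketMr ?groupX // -alE eq_al bracketXr // -[_ ^+ _]/(gx (nn0 z) (- c)%R).
  by rewrite -(gxX nn0M) -gxD ?N5 // subrr.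
case/hasP=> ab _ /quad_testP[]; set a := ab.1; set b := ab.2; set q := quad _ _ _ _ => qq1 qn.
(* Change of basis to 1, q 1, in which q has the matrix of multiplication by s. *)
pose T := lin2 oneV (q oneV); pose v2' := gx v1 a * gx v2 b.
have qE z : [~ dd0 z, v2'] = nn0 (q z).
  rewrite bracketMr ?groupX // !bracketXr // -/(nn0 z) -alE -[_ ^+ GF5_nat a]/(gx _ _) -[_ ^+ GF5_nat b]/(gx _ _).
  by rewrite !(gxX nn0M) -nn0M /q /quad -alL addrC.
have TM : {morph T : u v / (u + v)%R}.
  by move=> u v; apply: lin2D.
exists (fun z => dd0 (T z)), (fun z => nn0 (T z)), v1, v2'.
have TI : injective T.
  move=> u v eqT; apply/eqP; rewrite -subr_eq0; apply: contraT => ntuv.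
  case/eqP: (qn _ ntuv); rewrite -/T.
  by apply: (addIr (T v)); rewrite -TM subrK add0r.
split; rewrite ?groupM ?groupX //.
- split=> [u v | |]; first by rewrite TM dd0M.
    exact: inj_comp dd0I TI.
  by apply: morph_V_onto => //; apply: inj_comp dd0I TI.
- split=> [u v | |]; first by rewrite TM nn0M.
    exact: inj_comp nn0I TI.
  by apply: morph_V_onto => //; apply: inj_comp nn0I TI.
move=> z; split=> //; rewrite qE; congr nn0; rewrite [q _]quad_lin2 -/q qq1.
by rewrite /T; apply/eqP; move: z (q oneV); apply: V_all2; vm_compute.
Qed.
End Coords.

(** * Action of the complement: autotopisms and coordinate changes *)

(** Divided by their values at 1, A and B become one and the same map S, which is additive and
    multiplicative. As S s squares to 2, it is s or -s, and S is the identity or the Frobenius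
    map. *)
Lemma autotopism (A B C : V -> V) :
    {morph C : u v / (u + v)%R} -> (forall z y, C (mulV z y) = mulV (A z) (B y)) ->
    A oneV != 0%R -> B oneV != 0%R ->
  exists sg, [/\ forall z, A z = sactV (A oneV) sg z, forall y, B y = sactV (B oneV) sg y
    & forall x, C x = sactV (mulV (A oneV) (B oneV)) sg x].
Proof.
move=> CD CM; set a := A oneV; set b := B oneV => nta ntb.
have CA z : C z = mulV (A z) b by rewrite -CM mulV1.
have CB y : C y = mulV a (B y) by rewrite -CM mul1V.
pose S z := mulV (invV a) (A z).
have AS z : A z = mulV a (S z) by rewrite /S mulVA mulfVV // mul1V.
have BS y : B y = mulV b (S y).
  by apply: (mulIV nta); rewrite mulVC -CB CA AS -mulVA [mulV (S y) b]mulVC mulVC.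
have SM z y : S (mulV z y) = mulV (S z) (S y).
  apply: (mulIV nta); rewrite mulVC -AS; apply: (mulIV ntb); rewrite -CA CM AS BS.
  by rewrite mulVACA -[RHS]mulVA [RHS]mulVC.
have SD z y : S (z + y)%R = (S z + S y)%R.
  apply: (mulIV nta); rewrite mulVDl ![mulV (S _) a]mulVC -!AS; apply: (mulIV ntb).
  by rewrite mulVDl -!CA.
have S1 : S oneV = oneV by rewrite /S mulVC mulfVV.
have Ss2 : mulV (S sqV) (S sqV) = (S oneV + S oneV)%R by rewrite -SM -SD.
have SL z : S z = lin2 oneV (S sqV) z.
  have S0 : S 0%R = 0%R by apply: (addrI (S 0%R)); rewrite -SD !addr0.
  have Sx n y : S (y *+ n) = S y *+ n by elim: n => [|n IHn]; rewrite ?mulr0n // !mulrS SD IHn.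
  have -> : z = (oneV *+ GF5_nat z.1 + sqV *+ GF5_nat z.2)%R.
    by apply/eqP; move: z; apply: V_all; vm_compute.
  rewrite SD !Sx S1; move: (S sqV) => q; apply/eqP; move: z q; apply: V_all2; vm_compute. reflexivity.
have [sg Sg] : exists sg, forall z, S z = if sg then frobV z else z.
  have : (S sqV == sqV) || (S sqV == - sqV)%R.
    move: Ss2; rewrite S1; move: (S sqV) => q /eqP; apply/implyP; move: q; apply: V_all; vm_compute. reflexivity.
  case/orP=> /eqP eqs; [exists false | exists true] => z; rewrite SL eqs; apply/eqP; move: z; apply: V_all; vm_compute; reflexivity.
exists sg; split=> [z|y|x]; rewrite ?CA ?AS ?BS Sg // /sactV -/a.
by rewrite -mulVA [mulV _ b]mulVC mulVA.
Qed.

Section Frame.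
Variables (gT : finGroupType) (N D P H : {group gT}).
Hypotheses (oN : #|N| = 25%N) (oD : #|D| = 25%N) (oP : #|P| = (5 ^ 6)%N).
Hypotheses (sNP : N \subset P) (sDP : D \subset P) (cNP : {in N & P, forall n y, commute n y}).
Hypotheses (abD : abelian D) (D5 : {in D, forall d, d ^+ 5 = 1}) (N5 : {in N, forall d, d ^+ 5 = 1}).
Hypothesis dN : {in D & P, forall d y, [~ d, y] \in N}.
Hypothesis dreg : {in D & P, forall d y, d != 1 -> [~ d, y] = 1 -> y \in N * D}.
Hypothesis (tiND : N :&: D = 1).
Hypothesis P5 : {in P, forall y, y ^+ 5 \in N}.
Hypothesis PP : {in P &, forall x y, [~ x, y] \in N * D}.
Hypotheses (nPH : H \subset 'N(P)) (nNH : H \subset 'N(N)) (nDH : H \subset 'N(D)).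

Let bMl d d' y : d \in D -> d' \in D -> y \in P -> [~ d * d', y] = [~ d, y] * [~ d', y].
Proof. by move=> *; apply: (@bracketMl gT N D P). Qed.
Let bMr d y y' : d \in D -> y \in P -> y' \in P -> [~ d, y * y'] = [~ d, y] * [~ d, y'].
Proof. by move=> *; apply: (@bracketMr gT N D P). Qed.
Let bXr d y n : d \in D -> y \in P -> [~ d, y ^+ n] = [~ d, y] ^+ n.
Proof. by move=> *; apply: (@bracketXr gT N D P). Qed.

Section Chart.
Variables (dd nn : V -> gT) (v1 v2 : gT).
Hypothesis crd : is_coords N D P dd nn v1 v2.

Definition ww y := gx v1 y.1 * gx v2 y.2.
Definition ee (u : V * V) := nn u.1 * dd u.2.

Let ddM : {morph dd : u v / (u + v)%R >-> u * v}. Proof. by case: crd => _ _ [] *. Qed.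
Let nnM : {morph nn : u v / (u + v)%R >-> u * v}. Proof. by case: crd => _ _ _ [] *. Qed.
Let ddI : injective dd. Proof. by case: crd => _ _ [] *. Qed.
Let nnI : injective nn. Proof. by case: crd => _ _ _ [] *. Qed.
Let defD : D = dd @: setT :> {set _}. Proof. by case: crd => _ _ []. Qed.
Let defN : N = nn @: setT :> {set _}. Proof. by case: crd => _ _ _ []. Qed.
Let Pv1 : v1 \in P. Proof. by case: crd. Qed.
Let Pv2 : v2 \in P. Proof. by case: crd. Qed.
Let br1 z : [~ dd z, v1] = nn z. Proof. by case: crd => _ _ _ _ /(_ z)[]. Qed.
Let br2 z : [~ dd z, v2] = nn (mulV z sqV). Proof. by case: crd => _ _ _ _ /(_ z)[]. Qed.
Let Ddd z : dd z \in D. Proof. by rewrite defD imset_f. Qed.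
Let Nnn z : nn z \in N. Proof. by rewrite defN imset_f. Qed.
Let Pdd z : dd z \in P. Proof. exact: (subsetP sDP). Qed.
Let Pnn z : nn z \in P. Proof. exact: (subsetP sNP). Qed.
Let dd0 : dd 0%R = 1. Proof. by apply: (mulgI (dd 0%R)); rewrite -ddM addr0 mulg1. Qed.
Let nn0 : nn 0%R = 1. Proof. by apply: (mulgI (nn 0%R)); rewrite -nnM addr0 mulg1. Qed.
Let nnV x : (nn x)^-1 = nn (- x)%R. Proof. by apply: (mulgI (nn x)); rewrite mulgV -nnM subrr. Qed.
Let nnX x n : nn x ^+ n = nn (x *+ n)%R.
Proof. by elim: n => [|n IHn]; rewrite ?mulr0n // expgS IHn -nnM mulrS. Qed.

Lemma ww_in y : ww y \in P. Proof. by rewrite groupM ?groupX. Qed.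

Lemma ww_bracket z y : [~ dd z, ww y] = nn (mulV z y).
Proof.
rewrite bMr ?groupX // !bXr // br1 br2 -[_ ^+ _]/(gx _ _) -[X in _ * X]/(gx _ _) !(gxX nnM) -nnM.
by congr nn; apply/eqP; move: z y; apply: V_all2; vm_compute.
Qed.

Lemma ee_morph : {morph ee : u v / (u + v)%R >-> u * v}.
Proof.
move=> u v; rewrite /ee nnM ddM -!mulgA; congr (_ * _); rewrite !mulgA; congr (_ * _).
exact: cNP.
Qed.

Lemma ee_inj : injective ee.
Proof.
move=> [x z] [x' z']; rewrite /ee /= => eqe.
have eqn : nn (x - x')%R = dd (z' - z)%R.
  have eqd : nn x = nn x' * dd (z' - z)%R by apply: (mulIg (dd z)); rewrite -mulgA -ddM subrK.
  by rewrite addrC nnM -nnV eqd mulKg.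
have : nn (x - x')%R \in N :&: D by apply/setIP; rewrite {2}eqn.
rewrite tiND => /set1P n1; have d1 := n1; rewrite eqn -dd0 in d1; rewrite -nn0 in n1.
by move/nnI/eqP: n1; move/ddI/eqP: d1; rewrite !subr_eq0 => /eqP-> /eqP->.
Qed.

Lemma ee_image : N * D = ee @: setT.
Proof.
apply/setP=> x; apply/idP/imsetP=> [/imset2P[n d] | [u _ ->]]; last by rewrite mem_mulg.
by rewrite defN defD => /imsetP[y _ ->] /imsetP[z _ ->] ->; exists (y, z).
Qed.

Lemma ND_P x : x \in N * D -> x \in P.
Proof. by rewrite ee_image => /imsetP[u _ ->]; rewrite groupM. Qed.
Lemma ND_cent u v : commute (ee u) (ee v).
Proof. by rewrite /commute -!ee_morph addrC. Qed.

Lemma bracket_ND z x : x \in N * D -> [~ dd z, x] = 1.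
Proof.
rewrite ee_image => /imsetP[u _ ->]; apply/eqP/commgP.
by have := ND_cent (0, z)%R u; rewrite /ee /= nn0 mul1g.
Qed.

(** The coordinate is read from the commutator with one element of D; the quotient of w by the
    corresponding [ww y] then centralizes that element, so lies in N D and commutes with all of
    D. *)
Lemma chart_coord w : w \in P -> exists y, [/\ forall z, [~ dd z, w] = nn (mulV z y)
  & w * ww (- y)%R \in N * D].
Proof.
move=> Pw; have /imsetP[y _ bw] : [~ dd oneV, w] \in nn @: setT by rewrite -defN dN.
exists y.
have Ew : w * ww (- y)%R \in N * D.
  apply: (dreg (Ddd oneV)); first by rewrite groupM ?ww_in.
    by rewrite -dd0 (inj_eq ddI).
  by rewrite bMr ?ww_in // bw ww_bracket mul1V -nnM subrr nn0.
split=> // z; have := bracket_ND z Ew; rewrite bMr ?ww_in // ww_bracket mulVN -nnV => /eqP.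
by rewrite -eq_mulgV1 => /eqP.
Qed.

Definition has_type (tau : tri) (h : gT) :=
  [/\ tau.1.1 != 0%R, tau.1.2 != 0%R, forall z, dd z ^ h = dd (actd tau z)
    & forall x, nn x ^ h = nn (actn tau x)].

(** Conjugation by h preserves the commutator pairing of D and P / E into N, which in coordinates is
    multiplication in F_25; it is thus an autotopism. *)
Lemma type_exists h : h \in H -> exists tau, has_type tau h.
Proof.
move=> Hh; have [nP [nN nD]] := (subsetP nPH h Hh, (subsetP nNH h Hh, subsetP nDH h Hh)).
have exA z : {y | dd y == dd z ^ h}.
  apply: sigW; have : dd z ^ h \in D by rewrite memJ_norm.
  by rewrite defD => /imsetP[y _ ->]; exists y.
have exC z : {y | nn y == nn z ^ h}.
  apply: sigW; have : nn z ^ h \in N by rewrite memJ_norm.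
  by rewrite defN => /imsetP[y _ ->]; exists y.
have exB z : {y | nn y == [~ dd oneV ^ h, ww z ^ h]}.
  apply: sigW; have : [~ dd oneV ^ h, ww z ^ h] \in N by rewrite dN ?memJ_norm ?ww_in.
  by rewrite defN => /imsetP[y _ ->]; exists y.
pose A z := sval (exA z); have AE z : dd (A z) = dd z ^ h := eqP (svalP (exA z)).
pose C z := sval (exC z); have CE z : nn (C z) = nn z ^ h := eqP (svalP (exC z)).
pose B0 z := sval (exB z); have BE z : nn (B0 z) = [~ dd oneV ^ h, ww z ^ h] := eqP (svalP (exB z)).
have nt1 : A oneV != 0%R.
  by rewrite -(inj_eq ddI) AE dd0 conjg_eq1 -dd0 (inj_eq ddI).
pose B y := mulV (invV (A oneV)) (B0 y).
have BM z y : [~ dd z, ww y ^ h] = nn (mulV z (B y)).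
  have Pwh : ww y ^ h \in P by rewrite memJ_norm ?ww_in.
  have [y' [by' _]] := chart_coord Pwh; rewrite by'; congr (nn (mulV _ _)).
  have : nn (B0 y) = nn (mulV (A oneV) y') by rewrite BE -AE by'.
  by move/nnI=> eqB; rewrite /B eqB mulVA [mulV (invV _) _]mulVC mulfVV // mul1V.
have CM z y : C (mulV z y) = mulV (A z) (B y).
  by apply: nnI; rewrite CE -ww_bracket conjRg -AE BM.
have CD : {morph C : u v / (u + v)%R} by move=> u v; apply: nnI; rewrite nnM !CE nnM conjMg.
have ntB : B oneV != 0%R.
  apply: contraTneq (oner_neq0 F25) => B1; rewrite negbK -[1%R]/oneV -(inj_eq nnI) nn0.
  by rewrite -(conjg_eq1 _ h) -CE -[oneV]mulV1 CM B1 mulV0 nn0.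
have [sg [eA eB eC]] := autotopism CD CM nt1 ntB.
exists (A oneV, B oneV, sg); split=> //= [z | x]; first by rewrite -AE eA.
by rewrite -CE eC.
Qed.

Lemma type_coord tau h w y : h \in H -> has_type tau h -> w \in P ->
  (forall z, [~ dd z, w] = nn (mulV z y)) -> forall z, [~ dd z, w ^ h] = nn (mulV z (actv tau y)).
Proof.
move=> Hh [nta ntb tD tN] Pw bw z.
have inj_a : injective (actd tau) by apply: sactV_inj.
rewrite -[z](f_invF inj_a); set z' := invF _ _.
by rewrite -tD -conjRg bw tN /actn sactV_mulV.
Qed.

Lemma typeX tau h n : has_type tau h ->
  (forall z, dd z ^ (h ^+ n) = dd (iter n (actd tau) z)) /\
  (forall x, nn x ^ (h ^+ n) = nn (iter n (actn tau) x)).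
Proof.
case=> _ _ tD tN; elim: n => [|n [IH1 IH2]]; first by split=> z; rewrite expg0 conjg1.
by split=> z; rewrite expgSr conjgM ?IH1 ?IH2 ?tD ?tN.
Qed.

Lemma pow5M : {in P &, forall x y, (x * y) ^+ 5 = x ^+ 5 * y ^+ 5}.
Proof.
have eN d y : d \in N * D -> y \in P -> [~ d, y] \in N.
  case/imset2P=> n e Nn De -> Py; rewrite commMgJ.
  have /commgP/eqP-> := cNP Nn Py; rewrite conj1g mul1g; exact: dN.
have e5 d : d \in N * D -> d ^+ 5 = 1.
  case/imset2P=> n e Nn De ->; rewrite expgMn; first by rewrite N5 // D5 // mulg1.
  by apply: cNP => //; apply: (subsetP sDP).
have NE n : n \in N -> n \in N * D by apply: (subsetP (mulG_subl D N)).
move=> x y Px Py; have Ec := PP Py Px.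
have Nn := eN _ _ Ec Px; have Nm := eN _ _ Ec Py; have Pc := ND_P Ec.
apply: (@expMg_5 _ x y [~ y, x] [~ y, x, x] [~ y, x, y]).
- by rewrite -conjg_mulR.
- by rewrite -conjg_mulR.
- by apply/conjg_fixP/commgP/cNP.
- by rewrite -conjg_mulR.
- exact/commute_sym/cNP.
- exact/commute_sym/cNP.
- exact/commute_sym/cNP.
- exact/commute_sym/cNP.
- by apply: cNP => //; apply: (subsetP sNP).
- exact: e5.
- exact: N5.
exact: N5.
Qed.

Lemma pow5_coord p1 p2 w y : w \in P -> v1 ^+ 5 = nn p1 -> v2 ^+ 5 = nn p2 ->
  (forall z, [~ dd z, w] = nn (mulV z y)) -> w ^+ 5 = nn (lin2 p1 p2 y).
Proof.
move=> Pw e1 e2 bw; have [y' [bw' Ew]] := chart_coord Pw.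
have {bw'} -> : y = y'.
  by have := bw oneV; rewrite bw' !mul1V => /nnI.
have e5 : (w * ww (- y')%R) ^+ 5 = 1.
  case/imset2P: Ew => n e Nn De ->; rewrite expgMn; first by rewrite N5 // D5 // mulg1.
  by apply: cNP => //; apply: (subsetP sDP).
have pX v c p : v \in P -> v ^+ 5 = nn p -> gx v c ^+ 5 = nn (scV c p).
  by move=> Pv ep; rewrite /gx -expgM mulnC expgM ep -[_ ^+ _]/(gx _ _) (gxX nnM).
move: e5; rewrite pow5M ?ww_in // /ww pow5M ?groupX // !(pX _ _ _ _ e1) // !(pX _ _ _ _ e2) // -nnM.
move/eqP; rewrite -eq_invg_mul => /eqP eqw; rewrite -[LHS]invgK eqw nnV; congr nn.
by apply/eqP; move: p1 p2 y' {e1 e2 Ew eqw bw}; apply: V_all3; vm_compute.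
Qed.

(** The alternating map from P / E to E / N induced by commutators, expressed in the coordinates of
    D. *)
Definition Kap w w' z := exists2 n, n \in N & [~ w, w'] = n * dd z.

Lemma Kap_ex w w' : w \in P -> w' \in P -> exists z, Kap w w' z.
Proof.
move=> Pw Pw'; have /imset2P[n d Nn Dd eqk] := PP Pw Pw'.
have [z def_d] : exists z, d = dd z by move: Dd; rewrite defD => /imsetP[z _ ->]; exists z.
by exists z, n; rewrite // -def_d.
Qed.

Lemma Kap_uniq w w' z z' : Kap w w' z -> Kap w w' z' -> z = z'.
Proof.
have nnP n : n \in N -> exists x, n = nn x by rewrite defN => /imsetP[x _ ->]; exists x.
case=> n /nnP[x ->] e1 [n' /nnP[x' ->] e2].
have eqe : ee (x, z) = ee (x', z') by rewrite /ee /= -e1.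
exact: (congr1 snd (ee_inj eqe)).
Qed.

Lemma Kap_Ml w1 w2 w' z1 z2 : w2 \in P -> Kap w1 w' z1 -> Kap w2 w' z2 -> Kap (w1 * w2) w' (z1 + z2)%R.
Proof.
move=> Pw2 [n1 Nn1 e1] [n2 Nn2 e2]; have Nb := dN (Ddd z1) Pw2.
exists (n1 * [~ dd z1, w2] * n2); first exact: groupM (groupM Nn1 Nb) Nn2.
have n1w : n1 ^ w2 = n1 by apply/conjg_fixP/commgP/cNP.
have nb : [~ dd z1, w2] * n2 * dd z1 = dd z1 * ([~ dd z1, w2] * n2).
  by apply: (cNP (groupM Nb Nn2)).
rewrite commMgJ e1 e2 [(n1 * dd z1) ^ w2]conjMg n1w (conjg_mulR (dd z1)) ddM.
move: [~ dd z1, w2] Nb nb => b Nb nb; rewrite -!mulgA; congr (n1 * _).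
by rewrite !mulgA nb mulgA.
Qed.

Lemma Kap_sym w w' z : Kap w w' z -> Kap w' w (- z)%R.
Proof.
case=> n Nn eqk; exists n^-1; first by rewrite groupV.
have -> : dd (- z)%R = (dd z)^-1 by apply: (mulgI (dd z)); rewrite mulgV -ddM subrr.
by rewrite -invg_comm eqk invMg; apply/esym/cNP; rewrite ?groupV.
Qed.

Lemma Kap_gx w w' z c : w \in P -> Kap w w' z -> Kap (gx w c) w' (scV c z).
Proof.
move=> Pw K1; have KX n : Kap (w ^+ n) w' (z *+ n)%R.
  elim: n => [|n IHn]; first by exists 1; rewrite ?group1 // expg0 comm1g mulr0n dd0 mulg1.
  by rewrite expgS mulrS; apply: Kap_Ml => //; apply: groupX.
have -> : scV c z = (z *+ GF5_nat c)%R; last exact: KX.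
by apply/eqP; move: z {K1 KX}; apply: V_all; case: c; vm_compute.
Qed.

Lemma Kap_E w w' : w \in N * D -> w' \in P -> Kap w w' 0%R.
Proof.
case/imset2P=> n d Nn Dd -> Pw'; exists [~ d, w']; first exact: dN.
by rewrite dd0 mulg1 commMgJ; have /commgP/eqP-> := cNP Nn Pw'; rewrite conj1g mul1g.
Qed.

Lemma Kap_coord_l w w' y z1 z2 : w \in P -> w' \in P ->
  (forall z, [~ dd z, w] = nn (mulV z y)) ->
  Kap v1 w' z1 -> Kap v2 w' z2 -> Kap w w' (lin2 z1 z2 y).
Proof.
move=> Pw Pw' bw K1 K2; have [y' [bw' Ew]] := chart_coord Pw.
have -> : y = y' by have := bw oneV; rewrite bw' !mul1V => /nnI.
have [z Kz] := Kap_ex Pw Pw'; have K0 := Kap_E Ew Pw'.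
have Kw : Kap (ww (- y')%R) w' (lin2 z1 z2 (- y')%R).
  by apply: Kap_Ml; rewrite ?groupX //; apply: Kap_gx.
have /eqP := Kap_uniq (Kap_Ml (ww_in _) Kz Kw) K0.
have -> : lin2 z1 z2 (- y')%R = (- lin2 z1 z2 y')%R.
  by case: z1 z2 y' {K1 K2 bw' Ew K0 Kw} => [? ?] [? ?] [? ?]; congr (_, _) => /=; ring.
by rewrite subr_eq0 => /eqP <-.
Qed.

Lemma br1' z : [~ dd z, v1] = nn (mulV z oneV). Proof. by rewrite mulV1. Qed.

(** An alternating map on a plane is the determinant times its value on a basis. *)
Lemma Kap_coord w w' y y' dl : w \in P -> w' \in P -> Kap v1 v2 dl ->
    (forall z, [~ dd z, w] = nn (mulV z y)) -> (forall z, [~ dd z, w'] = nn (mulV z y')) ->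
  Kap w w' (scV (dt y y') dl).
Proof.
move=> Pw Pw' K12 bw bw'.
have K0 v : Kap v v 0%R by exists 1; rewrite ?group1 // commgg dd0 mulg1.
have Kw1 : Kap w' v1 (lin2 0%R (- dl)%R y') by apply: Kap_coord_l => //; apply: Kap_sym.
have Kw2 : Kap w' v2 (lin2 dl 0%R y') by apply: Kap_coord_l.
have := Kap_coord_l Pw Pw' bw (Kap_sym Kw1) (Kap_sym Kw2).
congr (Kap _ _ _).
by case: y y' dl {K12 bw bw' Kw1 Kw2} => [? ?] [? ?] [? ?]; congr (_, _) => /=; rewrite /dt /=; ring.
Qed.

Definition rel_d (tau : tri) (dl : V) := actd tau dl == scV (dt (actv tau oneV) (actv tau sqV)) dl.
Definition rel_p (tau : tri) (p1 p2 : V) :=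
  (lin2 p1 p2 (actv tau oneV) == actn tau p1) && (lin2 p1 p2 (actv tau sqV) == actn tau p2).

(** Conjugate [v1, v2], v1^5 and v2^5 by h, and compute the same quantities from the coordinates of
    v1^h and v2^h: the comparison gives equations for (dl, p1, p2). *)
Lemma type_relations tau h dl p1 p2 : h \in H -> has_type tau h -> Kap v1 v2 dl ->
  v1 ^+ 5 = nn p1 -> v2 ^+ 5 = nn p2 -> rel_d tau dl && rel_p tau p1 p2.
Proof.
move=> Hh ht K12 e1 e2; have [_ _ tD tN] := ht.
have nP := subsetP nPH h Hh; have nN := subsetP nNH h Hh.
have c1 := type_coord Hh ht Pv1 br1'; have c2 := type_coord Hh ht Pv2 br2.
have Ph1 : v1 ^ h \in P by rewrite memJ_norm.
have Ph2 : v2 ^ h \in P by rewrite memJ_norm.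
apply/and3P; split.
- apply/eqP/(@Kap_uniq (v1 ^ h) (v2 ^ h)); last exact: Kap_coord.
  by case: K12 => n Nn eqk; exists (n ^ h); rewrite ?memJ_norm // -conjRg eqk conjMg tD.
- by apply/eqP/nnI; rewrite -(pow5_coord Ph1 e1 e2 c1) -conjXg e1 tN.
by apply/eqP/nnI; rewrite -(pow5_coord Ph2 e1 e2 c2) -conjXg e2 tN.
Qed.

Lemma chart_scale mu nu : mu != 0%R -> nu != 0%R ->
  is_coords N D P (fun z => dd (mulV mu z)) (fun x => nn (mulV (mulV mu nu) x)) (ww nu) (ww (mulV nu sqV)).
Proof.
move=> ntm ntn; have ntmn : mulV mu nu != 0%R by rewrite mulV_eq0 (negPf ntm) (negPf ntn).
have mulI m x y : m != 0%R -> mulV m x = mulV m y -> x = y.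
  by move=> ntm0; rewrite ![mulV m _]mulVC; apply: mulIV.
split; rewrite ?ww_in //.
- split=> [u v | u v /ddI/(mulI _ _ _ ntm) // |]; first by rewrite mulVDr ddM.
  by apply: morph_V_onto => // u v /ddI/(mulI _ _ _ ntm).
- split=> [u v | u v /nnI/(mulI _ _ _ ntmn) // |]; first by rewrite mulVDr nnM.
  by apply: morph_V_onto => // u v /nnI/(mulI _ _ _ ntmn).
move=> z; rewrite !ww_bracket; split; congr nn; rewrite -!mulVA; congr (mulV mu _).
  by rewrite mulVC.
by rewrite mulVC -mulVA; congr (mulV nu _); rewrite mulVC.
Qed.

Lemma ee_conj w y u : w \in P -> (forall z, [~ dd z, w] = nn (mulV z y)) ->
  ee u ^ w = ee (u.1 + mulV u.2 y, u.2)%R.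
Proof.
move=> Pw bw; rewrite /ee [_ ^ w]conjMg (conjg_mulR (dd _)) bw /=.
have -> : nn u.1 ^ w = nn u.1 by apply/conjg_fixP/commgP/cNP.
by rewrite nnM -mulgA; congr (_ * _); apply/esym/cNP.
Qed.

Lemma chart_closed_data (G : {group gT}) t1 t2 h1 h2 dl p1 p2 :
    #|G| = (24 * 5 ^ 6)%N -> P * H = G -> 'C_G(N) \subset P ->
    h1 \in H -> h2 \in H -> has_type t1 h1 -> has_type t2 h2 ->
    (forall K : {group gT}, h1 \in K -> h2 \in K -> H \subset K) ->
    Kap v1 v2 dl -> v1 ^+ 5 = nn p1 -> v2 ^+ 5 = nn p2 ->
  closed_data t1 t2 dl p1 p2 G.
Proof.
move=> oG defG cGN Hh1 Hh2 ty1 ty2 genH [n Nn eqk] e1 e2.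
have [x def_n] : exists x, n = nn x by move: Nn; rewrite defN => /imsetP[x _ ->]; exists x.
(* Multiplying v2 by an element of D changes [v1, v2] by an arbitrary element of N; this one cancels
   [n]. *)
pose w2 := v2 * dd x; have Pw2 : w2 \in P by rewrite groupM.
have bw2 z : [~ dd z, w2] = nn (mulV z sqV).
  by rewrite bMr // br2 bracket_ND ?mulg1 // (subsetP (mulG_subr N D)).
have gE : group_set (ee @: setT).
  apply/group_setP; split; first by apply/imsetP; exists 0%R; rewrite // /ee nn0 dd0 mulg1.
  by move=> _ _ /imsetP[u _ ->] /imsetP[v _ ->]; rewrite -ee_morph imset_f.
have [sPG sHG] : P \subset G /\ H \subset G by rewrite -defG mulG_subl mulG_subr.
have sEP : ee @: setT \subset P by apply/subsetP=> _ /imsetP[u _ ->]; rewrite groupM.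
have genP (K : {group gT}) : ee @: setT \subset K -> v1 \in K -> w2 \in K -> P \subset K.
  move=> sEK Kv1 Kw2; have Kdd z : dd z \in K.
    by apply: (subsetP sEK); apply/imsetP; exists (0, z)%R; rewrite // /ee nn0 mul1g.
  have Kv2 : v2 \in K by rewrite -(mulgK (dd x) v2) groupM ?groupV.
  apply/subsetP=> w Pw; have [y [_ Ew]] := chart_coord Pw.
  have Kww y' : ww y' \in K by rewrite groupM ?groupX.
  rewrite -(mulgK (ww (- y)%R) w) groupM ?groupV //; apply: (subsetP sEK).
  by rewrite -ee_image.
have inE1 (A : {set gT}) : A \subset <<A>> := subset_gen A.
exists ee, (Group gE), P, v1, w2, h1, h2; split.
- split=> //; [exact: ee_morph | exact: ee_inj | ].
  apply/subsetP=> g /setIP[Gg cEg]; rewrite -[_ \in _]/(g \in ee @: setT) -ee_image.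
  have Pg : g \in P.
    apply: (subsetP cGN); apply/setIP; split=> //; apply/centP=> m Nm; apply: (centP cEg).
    by move: Nm; rewrite defN => /imsetP[y _ ->]; apply/imsetP; exists (y, 0)%R; rewrite // /ee dd0 mulg1.
  apply: (dreg (Ddd oneV)) => //; first by rewrite -dd0 (inj_eq ddI).
  apply/eqP/commgP/commute_sym/(centP cEg); apply/imsetP; exists (0, oneV)%R => //.
  by rewrite /ee nn0 mul1g.
- split.
  + by move=> u; rewrite (ee_conj u Pv1 br1') mulV1.
  + by move=> u; rewrite (ee_conj u Pw2 bw2).
  + rewrite commgMJ eqk def_n (_ : (_ * _) ^ dd x = nn x * dd dl).
      rewrite -invg_comm br1 mulgA nnV -nnM addNr nn0 mul1g /ee /= nn0 mul1g //.
    by apply/conjg_fixP/commgP; have := ND_cent (x, dl) (0, x)%R; rewrite /ee /= nn0 mul1g.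
  + by rewrite e1 /ee /= dd0 mulg1.
  by rewrite pow5M // e2 D5 // mulg1 /ee /= dd0 mulg1.
- have tyE t h : has_type t h -> forall u, ee u ^ h = ee (acte t u).
    by case=> _ _ tD tN u; rewrite /ee [_ ^ h]conjMg tN tD.
  by split; apply: tyE.
split=> //.
- apply/eqP; rewrite eqEsubset gen_subG subUset (subset_trans sEP) //= andbC.
  apply/andP; split; first by apply/subsetP=> g; rewrite !inE => /or4P[] /eqP->; [exact: (subsetP sPG) | exact: (subsetP sPG) | exact: (subsetP sHG) | exact: (subsetP sHG)].
  pose K := <<ee @: setT :|: [set:: [:: v1; w2; h1; h2]]>>%G; rewrite -[<<_>>]/(gval K).
  have Kg g : g \in [:: v1; w2; h1; h2] -> g \in K.
    by move=> g_in; apply: mem_gen; rewrite inE orbC [g \in [set:: _]]inE g_in.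
  rewrite -defG mul_subG //; last by apply: genH; apply: Kg; rewrite !inE eqxx ?orbT.
  apply: genP; try by apply: Kg; rewrite !inE eqxx ?orbT.
  by apply: subset_trans (inE1 _); apply: subsetUl.
apply/eqP; rewrite eqEsubset gen_subG subUset sEP /= andbC.
apply/andP; split; first by apply/subsetP=> g; rewrite !inE => /orP[] /eqP->.
pose K := <<ee @: setT :|: [set:: [:: v1; w2]]>>%G; rewrite -[<<_>>]/(gval K).
have Kg g : g \in [:: v1; w2] -> g \in K.
  by move=> g_in; apply: mem_gen; rewrite inE orbC [g \in [set:: _]]inE g_in.
apply: genP; try by apply: Kg; rewrite !inE eqxx ?orbT.
by apply: subset_trans (inE1 _); apply: subsetUl.
Qed.
End Chart.
End Frame.

(** * Normal forms of the complement and of its invariant relations *)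

Definition slots := undup [seq c.1 | c <- cparams].
Definition fr (b : bool) (x : V) := if b then frobV x else x.

Lemma omV_log x : x != 0%R -> exists2 j, (j < 24)%N & expV omV j = x.
Proof.
move=> ntx; have /hasP[j] : has (fun j => expV omV j == x) (iota 0 24).
  by apply/(implyP _ ntx); move: x {ntx}; apply: V_all; vm_compute.
by rewrite mem_iota => /andP[_ ltj] /eqP; exists j.
Qed.

Lemma cyclic_types a b : mulV a b = omV -> expV a 12 = oneV ->
  exists2 k, (false, k) \in slots & (a, b, false) = ct1 (false, k, Q0).
Proof.
move=> ab a12; have /hasP[x sx /andP[/eqP x1 /eqP eqx]] :
    has (fun x => (x.1 == false) && ((a, b, false) == ct1 (x, Q0))) slots; last first.
  by exists x.2; case: x x1 eqx sx => /= ? ? ->.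
move/eqP: a12; apply/implyP; move/eqP: ab; apply/implyP; move: a b; apply: V_all2; vm_compute. reflexivity.
Qed.

(** Here a and c are the multipliers on D of the semilinear and the linear generator: c^6 = 1
    because the involution fixes D, and a a^5 = c^3 because h^2 = r^3. Scaling D by mu and P / E by
    its inverse preserves the action on N and reaches the standard pair. *)
Definition M_test (a c : V) :=
  if [&& a != 0%R, c != 0%R, expV c 6 == oneV & mulV a (frobV a) == expV c 3] then
    let b := mulV omV (invV a) in let d := mulV (expV omV 2) (invV c) in
    has (fun x => if x.1 then if (c, d, false) == ct1 (x, Q0) then
        has (fun mu => [&& mu != 0%R, mulV (mulV a (frobV mu)) (invV mu) == (ct2 (x, Q0)).1.1
          & mulV (mulV b (frobV (invV mu))) mu == (ct2 (x, Q0)).1.2]) [seq expV omV l | l <- iota 0 6]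
      else false else false) slots
  else true.
Lemma M_testP a c : M_test a c. Proof. move: a c; apply: V_all2; vm_compute. reflexivity. Qed.

(** Every (dl, p1, p2) invariant under the complement is a multiple of one from the list. With a
    semilinear complement the scalar has to be fixed by Frobenius, or rescaling would disturb the
    normal form of the action. *)
Definition rel_test (x : bool * nat) :=
  let t1 := ct1 (x, Q0) in let t2 := ct2 (x, Q0) in
  let cD := filter (fun d => rel_d t1 d && rel_d t2 d) Vs in
  let cP := filter (fun p : V * V => rel_p t1 p.1 p.2 && rel_p t2 p.1 p.2) [seq (p, q) | p <- Vs, q <- Vs] in
  let cs := filter (fun c : cparam => c.1 == x) cparams in
  all (fun d => all (fun p : V * V => has (fun c => has (fun mu =>
    [&& mu != 0%R, x.1 ==> (frobV mu == mu), d == mulV mu (qc_dl c.2), p.1 == mulV mu (qc_p1 c.2)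
       & p.2 == mulV mu (qc_p2 c.2)]) Vs) cs) cP) cD.
Lemma rel_testP : all rel_test slots. Proof. vm_compute. reflexivity. Qed.

Lemma mulV_scale1 a m mi m' z : mulV m mi = oneV ->
  mulV a (mulV m' z) = mulV m (mulV (mulV (mulV a m') mi) z).
Proof.
move=> mmi; rewrite -[LHS]mul1V -mmi.
have eqF (a' b' c' d' e' : F25) : (b' * c' * (a' * (d' * e')) = b' * (a' * d' * c' * e') :> F25)%R by ring.
exact: (eqF a m mi m' z).
Qed.

Lemma mulV_scale2 a b m mi m' n ni n' z : mulV m mi = oneV -> mulV n ni = oneV ->
  mulV (mulV a b) (mulV (mulV m' n') z) =
  mulV (mulV m n) (mulV (mulV (mulV (mulV a m') mi) (mulV (mulV b n') ni)) z).
Proof.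
move=> mmi nni; rewrite -[LHS]mul1V -[oneV]mulV1 -{1}mmi -nni.
have eqF (a' b' m1 m2 m3 n1 n2 n3 z1 : F25) :
  (m1 * m2 * (n1 * n2) * (a' * b' * (m3 * n3 * z1)) =
   m1 * n1 * (a' * m3 * m2 * (b' * n3 * n2) * z1) :> F25)%R by ring.
exact: (eqF a b m mi m' n ni n' z).
Qed.

Section Types.
Variables (gT : finGroupType) (H : {group gT}) (dd nn : V -> gT) (t : gT).
Hypotheses (ddI : injective dd) (nnI : injective nn).
Hypothesis tyH : {in H, forall h, exists tau, has_type dd nn tau h}.
Hypothesis regH : {in H &, forall g g', nn oneV ^ g = nn oneV ^ g' -> g = g'}.
Hypothesis trH : forall x, x != 0%R -> exists2 h, h \in H & nn oneV ^ h = nn x.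
Hypothesis ntH : {in H, forall g x, nn oneV ^ g = nn x -> x != 0%R}.
Hypotheses (Ht : t \in H) (tN : nn oneV ^ t = nn (- oneV)%R) (tD : forall z, dd z ^ t = dd z).

Lemma type_scale a b sg h mu nu : mu != 0%R -> nu != 0%R -> has_type dd nn (a, b, sg) h ->
  has_type (fun z => dd (mulV mu z)) (fun x => nn (mulV (mulV mu nu) x))
    (mulV (mulV a (fr sg mu)) (invV mu), mulV (mulV b (fr sg nu)) (invV nu), sg) h.
Proof.
move=> ntm ntn [/= nta ntb hD hN]; have mm := mulfVV ntm; have nn1 := mulfVV ntn.
have nti x : x != 0%R -> invV x != 0%R.
  by move=> ntx; apply/(implyP _ ntx); move: x {ntx}; apply: V_all; vm_compute.
have ntf x : x != 0%R -> fr sg x != 0%R by rewrite /fr; case: (sg); rewrite ?frobV_eq0.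
have ntM x y : x != 0%R -> y != 0%R -> mulV x y != 0%R.
  by move=> ntx nty; rewrite mulV_eq0 negb_or ntx.
split=> /=.
- exact: ntM (ntM _ _ nta (ntf _ ntm)) (nti _ ntm).
- exact: ntM (ntM _ _ ntb (ntf _ ntn)) (nti _ ntn).
- move=> z; rewrite hD; congr dd; rewrite /actd /sactV /= -(mulV_scale1 _ _ _ mm).
  by rewrite /fr; case: (sg); rewrite ?frobVM.
move=> x; rewrite hN; congr nn; rewrite /actn /sactV /= -(mulV_scale2 _ _ _ _ _ mm nn1).
by rewrite /fr; case: (sg); rewrite ?frobVM.
Qed.

(** By regularity an element of H is determined by its image of 1 in N. If the element h taking 1 to
    omega acts linearly, it generates H; otherwise the element r taking 1 to omega^2 is linear, and
    r and h generate H. *)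
Lemma types_normal : exists mu x h1 h2, [/\ mu != 0%R, x \in slots, h1 \in H & h2 \in H] /\
  [/\ has_type (fun z => dd (mulV mu z)) (fun x => nn (mulV (mulV mu (invV mu)) x)) (ct1 (x, Q0)) h1,
      has_type (fun z => dd (mulV mu z)) (fun x => nn (mulV (mulV mu (invV mu)) x)) (ct2 (x, Q0)) h2
    & forall K : {group gT}, h1 \in K -> h2 \in K -> H \subset K].
Proof.
have one1 : oneV != 0%R by [].
have actn1 a b sg : actn (a, b, sg) oneV = mulV a b.
  by rewrite /actn /sactV /=; case: sg; rewrite ?mulV1.
have inv1 : invV oneV = oneV by apply/eqP; vm_compute.
have iterD a b n : iter n (actd (a, b, false)) oneV = expV a n by elim: n => //= n ->.
have [h Hh hN1] : exists2 h, h \in H & nn oneV ^ h = nn omV by apply: trH.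
have [[[a b] sg] ty] := tyH Hh; have [nta' ntb' hD hN] := ty; have nta : a != 0%R := nta'; have ntb : b != 0%R := ntb'.
have ab : mulV a b = omV by apply: nnI; rewrite -hN1 hN actn1.
case: sg ty hD hN {nta' ntb'} => ty hD hN; last first.
  have [XD XN] := typeX 12 ty.
  have def_t : h ^+ 12 = t.
    apply: regH; rewrite ?groupX // tN XN; congr nn.
    have iterE n x : iter n (actn (a, b, false)) x = mulV (expV omV n) x.
      elim: n => [|n IHn] /=; first by rewrite mul1V.
      by rewrite IHn /actn /sactV /= ab mulVA.
    by rewrite iterE; apply/eqP; vm_compute.
  have a12 : expV a 12 = oneV.
    by apply: ddI; rewrite -[RHS]tD -def_t XD iterD.
  have [k sk ct] := cyclic_types ab a12.
  exists oneV, (false, k), h, 1; split; split=> //; rewrite ?group1 //.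
  - rewrite -ct; have := type_scale one1 one1 ty; congr (has_type _ _ _ _); congr (_, _, _).
      by rewrite /fr inv1 !mulV1.
    by rewrite /fr inv1 !mulV1.
  - split=> // x; rewrite conjg1; first by case: (acts_tri1 x) => ->.
    by case: (acts_tri1 x) => _ _ ->.
  move=> K Kh _; apply/subsetP=> g Hg; have [[[a' b'] s'] [_ _ _ gN]] := tyH Hg.
  have gN1 := gN oneV; have [j _ def_x] := omV_log (ntH Hg gN1).
  suffices -> : g = h ^+ j by apply: groupX.
  apply: regH; rewrite ?groupX // gN1 -def_x; have [_ ->] := typeX j ty; congr nn.
  have iterE n x : iter n (actn (a, b, false)) x = mulV (expV omV n) x.
    elim: n => [|n IHn] /=; first by rewrite mul1V.
    by rewrite IHn /actn /sactV /= ab mulVA.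
  by rewrite iterE mulV1.
have [r Hr rN1] : exists2 r, r \in H & nn oneV ^ r = nn (expV omV 2) by apply: trH.
have [[[c d] sr] tyr] := tyH Hr; have [ntc' _ rD rN] := tyr; have ntc : c != 0%R := ntc'.
have cd : mulV c d = expV omV 2 by apply: nnI; rewrite -rN1 rN actn1.
have sr0 : sr = false.
  apply/negbTE/negP=> sr1; rewrite sr1 in rN.
  (* Were r semilinear, h r would be multiplication by omega^7 and its seventh power multiplication
     by omega^49 = omega; by regularity that power would be h, which is semilinear. *)
  have hrN x : nn x ^ (h * r) = nn (mulV (expV omV 7) x).
    rewrite conjgM hN rN; congr nn; rewrite /actn /sactV /= ab cd frobVM frobVK mulVA.
    by congr (mulV _ _); apply/eqP; vm_compute.
  have hrX n x : nn x ^ ((h * r) ^+ n) = nn (iter n (mulV (expV omV 7)) x).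
    by elim: n => [|n IHn]; rewrite ?expg0 ?conjg1 // expgSr conjgM IHn hrN.
  have def_h : (h * r) ^+ 7 = h.
    apply: regH; rewrite ?groupX ?groupM // hrX hN1; congr nn; by apply/eqP; vm_compute.
  have e7 : iter 7 (mulV (expV omV 7)) sqV = mulV omV sqV by apply/eqP; vm_compute.
  have es : actn (a, b, true) sqV = mulV omV (frobV sqV) by rewrite -ab.
  have := hrX 7%N sqV; rewrite def_h hN e7 es => /nnI eq7.
  have : mulV omV (frobV sqV) != mulV omV sqV by vm_compute.
  by rewrite eq7 eqxx.
rewrite sr0 in tyr rD rN; clear ntc'.
have rIter n x : iter n (actn (c, d, false)) x = mulV (expV (expV omV 2) n) x.
  elim: n => [|n IHn] /=; first by rewrite mul1V.
  by rewrite IHn /actn /sactV /= cd mulVA.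
have rtX n := typeX n tyr.
have def_t : r ^+ 6 = t.
  apply: regH; rewrite ?groupX // tN; have [_ ->] := rtX 6%N; congr nn.
  by rewrite rIter; apply/eqP; vm_compute.
have c6 : expV c 6 = oneV.
  by apply: ddI; rewrite -[RHS]tD -def_t; have [-> _] := rtX 6%N; rewrite iterD.
have def_h2 : h ^+ 2 = r ^+ 3.
  apply: regH; rewrite ?groupX //; have [_ ->] := rtX 3%N; have [_ ->] := typeX 2 ty.
  by rewrite rIter; congr nn; rewrite /= /actn /sactV /= ab; apply/eqP; vm_compute.
have aa : mulV a (frobV a) = expV c 3.
  apply: ddI; transitivity (dd oneV ^ (h ^+ 2)).
    have [-> _] := typeX 2 ty; congr dd; rewrite /= /actd /sactV /=; congr (mulV _ (frobV _)).
    by rewrite [frobV oneV](_ : _ = oneV) ?mulV1.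
  by rewrite def_h2; have [-> _] := rtX 3%N; rewrite iterD.
have def_b : mulV omV (invV a) = b by rewrite -ab [mulV a b]mulVC -mulVA mulfVV // mulV1.
have def_d : mulV (expV omV 2) (invV c) = d by rewrite -cd [mulV c d]mulVC -mulVA mulfVV // mulV1.
have := M_testP a c; rewrite /M_test ifT; last by rewrite nta ntc c6 aa !eqxx.
cbv zeta; rewrite def_b def_d.
case/hasP=> x sx; case Mx: x.1 => //; case: eqP => // ct.
case/hasP=> mu _ /and3P[ntm /eqP e1 /eqP e2].
have nti : invV mu != 0%R by apply/(implyP _ ntm); move: (mu); apply: V_all; vm_compute.
have invK : invV (invV mu) = mu.
  by apply/eqP/(implyP _ ntm); move: (mu); apply: V_all; vm_compute.
exists mu, x, r, h; split; split=> //.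
- rewrite -ct; have := type_scale ntm nti tyr; congr (has_type _ _ _ _); congr (_, _, _); rewrite /fr.
    by rewrite -mulVA mulfVV ?mulV1.
  by rewrite -mulVA mulfVV ?mulV1.
- have := type_scale ntm nti ty; congr (has_type _ _ _ _); rewrite invK /fr e1 e2.
  by case: (x) Mx => ? ? /= ->.
move=> K Kr Kh; apply/subsetP=> g Hg; have [[[a' b'] s'] [_ _ _ gN]] := tyH Hg.
have gN1 := gN oneV; have ntx := ntH Hg gN1; set x0 := actn _ _ in gN1 ntx.
have /hasP[j _ /orP[] /eqP def_x] : has (fun j => (x0 == mulV (expV (expV omV 2) j) oneV)
    || (x0 == mulV omV (frobV (mulV (expV (expV omV 2) j) oneV)))) (iota 0 12).
- by apply/(implyP _ ntx); move: x0 {gN1 ntx}; apply: V_all; vm_compute.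
- suffices -> : g = r ^+ j by apply: groupX.
  by apply: regH; rewrite ?groupX // gN1 def_x; have [_ ->] := rtX j; rewrite rIter.
suffices -> : g = r ^+ j * h by rewrite groupM ?groupX.
apply: regH; rewrite ?groupM ?groupX // gN1 def_x conjgM; have [_ ->] := rtX j.
by rewrite rIter hN /actn /sactV /= ab.
Qed.
End Types.

(** * Every 5-closed group carries one of the 24 data *)

Lemma closed_structure (gT : finGroupType) (G : {group gT}) :
    Isaacs_group 25 G -> p_closed 5 G ->
  exists2 c, c \in cparams & closed_data (ct1 c) (ct2 c) (qc_dl c.2) (qc_p1 c.2) (qc_p2 c.2) G.
Proof.
case=> _; rewrite Isaacs25_order => oG [i chi1] [P sylP nsP].
have [N [nsN oN chiN chiG]] := small_normal_exists oG chi1.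
have trN := small_normal_trans chi1 nsN chiN chiG.
have trN' : {in N^# &, forall x y, x \in y ^: G} by move=> x y; apply: trN.
have [H [t [[sNZ tiPH defG oH] [Ht ot cHt invN] trH regH parity]]] := closed_frame oG nsN oN trN' sylP nsP.
have oP := order_Sylow5 oG sylP; have pP := pHall_pgroup sylP.
have sNP : N \subset P := subset_trans sNZ (center_sub P).
have sHG : H \subset G by rewrite -defG mulG_subr.
have nPH := subset_trans sHG (normal_norm nsP); have nNH := subset_trans sHG (normal_norm nsN).
have camP x z : x \in P :\: N -> z \in N -> exists2 y, y \in P & [~ x, y] = z.
  move=> PNx Nz; have cNP1 : [~: N, P] \subset 1%G.
    by have /commG1P-> : N \subset 'C(P) by rewrite (subset_trans sNZ) // subsetIr.
  have [y Py] := Camina_Sylow oG chi1 nsN oN chiN chiG sylP (sub1G N) (normal1 P) sNP cNP1 PNx Nz.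
  by move/set1P=> eq1; exists y => //; apply/eqP; rewrite eq_sym eq_mulVg1 eq1.
pose D := cD P t.
have tiND : N :&: D = 1 by apply: cd_tiND.
have oD : #|D| = 25%N by apply: (cd_oD (N := N) (H := H)).
have abD : abelian D by apply: (cd_abD (N := N) (H := H)).
have sDP : D \subset P := subsetIl _ _.
have cNP : {in N & P, forall n y, commute n y} by move=> n y Nn Py; apply: (cd_cN sNZ).
have D5 : {in D, forall d, d ^+ 5 = 1} by move=> d Dd; apply: (cd_D5 (N := N) (P := P) (H := H) (t := t)).
have N5 : {in N, forall n, n ^+ 5 = 1} by move=> n Nn; apply: (cd_N5 oN trH).
have dN : {in D & P, forall d y, [~ d, y] \in N} by move=> d y Dd Py; apply: (cd_dN (H := H) (t := t) (P := P)).
have dreg : {in D & P, forall d y, d != 1 -> [~ d, y] = 1 -> y \in N * D}.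
  by move=> d y Dd Py ntd /eqP/commgP cdy; apply: (cd_commDP pP oP oN sNZ nPH nNH Ht ot cHt invN trH parity camP Dd Py ntd cdy).
have P5 : {in P, forall y, y ^+ 5 \in N} by move=> y Py; apply: (cd_P5 (H := H) (t := t) (P := P)).
have PP : {in P &, forall x y, [~ x, y] \in N * D} by move=> x y Px Py; apply: (cd_commPP (H := H)).
have nDH : H \subset 'N(D) by apply: cd_nDH.
have [dd0 [nn0 [v1 [v2 crd0]]]] := coords_exist oN oD oP sNP sDP cNP abD D5 N5 dN dreg.
have [_ _ [ddM ddI defD] [nnM nnI defN] _] := crd0.
have Nnn x : nn0 x \in N by rewrite defN imset_f.
have nn1 : nn0 0%R = 1 by apply: (mulgI (nn0 0%R)); rewrite -nnM addr0 mulg1.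
have Nn1 x : x != 0%R -> nn0 x \in N^# by move=> ntx; rewrite in_setD1 Nnn andbT -nn1 (inj_eq nnI).
have regH' : {in H &, forall g g', nn0 oneV ^ g = nn0 oneV ^ g' -> g = g'}.
  move=> g g' Hg Hg' eqg; apply/eqP; rewrite eq_mulgV1.
  have : g * g'^-1 \in 'C_H[nn0 oneV].
    apply/setIP; split; first by rewrite groupM ?groupV.
    by apply/cent1P/commute_sym/commgP/conjg_fixP; rewrite conjgM eqg conjgK.
  by rewrite regH ?Nn1 // => /set1P->.
have trH' y : y != 0%R -> exists2 h, h \in H & nn0 oneV ^ h = nn0 y.
  by move=> nty; have [h Hh eqh] := trH _ _ (Nn1 oneV isT) (Nn1 y nty); exists h.
have ntH' : {in H, forall g y, nn0 oneV ^ g = nn0 y -> y != 0%R}.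
  move=> g Hg y eqg; rewrite -(inj_eq nnI) nn1 -eqg conjg_eq1 -nn1 (inj_eq nnI) //.
have tN' : nn0 oneV ^ t = nn0 (- oneV)%R.
  by rewrite invN //; apply: (mulgI (nn0 oneV)); rewrite mulgV -nnM subrr.
have tD' z : dd0 z ^ t = dd0 z.
  have : dd0 z \in cD P t by rewrite -/D defD imset_f.
  by case/setIP=> _ /cent1P cz; apply/conjg_fixP/commgP.
have tyH' : {in H, forall h, exists tau, has_type dd0 nn0 tau h}.
  by move=> h Hh; apply: (type_exists sNP sDP cNP dN dreg nPH nNH nDH crd0 Hh).
have [mu [x [h1 [h2 [[ntm sx Hh1 Hh2] [ty1 ty2 genH]]]]]] :=
  types_normal ddI nnI tyH' regH' trH' ntH' Ht tN' tD'.
have nti : invV mu != 0%R by apply/(implyP _ ntm); move: (mu); apply: V_all; vm_compute.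
have crd1 := chart_scale oN oD sNP cNP dN crd0 ntm nti.
set dd := fun z => dd0 _ in crd1 ty1 ty2; set nn := fun z => nn0 _ in crd1 ty1 ty2.
set w1 := ww _ _ _ in crd1; set w2 := ww _ _ _ in crd1.
have [Pw1 Pw2 _ [_ _ defN1] _] := crd1.
have [p1 e1] : exists p, w1 ^+ 5 = nn p by have := P5 _ Pw1; rewrite defN1 => /imsetP[p _ ->]; exists p.
have [p2 e2] : exists p, w2 ^+ 5 = nn p by have := P5 _ Pw2; rewrite defN1 => /imsetP[p _ ->]; exists p.
have [dl K12] := Kap_ex PP crd1 Pw1 Pw2.
have /andP[rd1 rp1] := type_relations sNP sDP cNP D5 N5 dN dreg tiND PP nPH nNH crd1 Hh1 ty1 K12 e1 e2.
have /andP[rd2 rp2] := type_relations sNP sDP cNP D5 N5 dN dreg tiND PP nPH nNH crd1 Hh2 ty2 K12 e1 e2.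
(* The relations are standard up to a scalar m, which a last rescaling of D absorbs. *)
have := allP rel_testP x sx; rewrite /rel_test => /allP/(_ dl).
rewrite mem_filter rd1 rd2 mem_Vs => /(_ isT)/allP/(_ (p1, p2)).
rewrite mem_filter rp1 rp2 => /(_ (allpairs_f _ (mem_Vs _) (mem_Vs _)))/hasP[c].
rewrite mem_filter => /andP[/eqP cx cc] /hasP[m _ /and5P[nt_m frm /eqP edl /eqP ep1 /eqP ep2]].
have ep1' : p1 = mulV m (qc_p1 c.2) := ep1.
have ep2' : p2 = mulV m (qc_p2 c.2) := ep2.
exists c => //; have one1 : oneV != 0%R by [].
have crd2 := chart_scale oN oD sNP cNP dN crd1 nt_m one1.
have ct1c : ct1 c = ct1 (x, Q0) by case: (c) cx => [[? ?] ?] /= <-.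
have ct2c : ct2 c = ct2 (x, Q0) by case: (c) cx => [[? ?] ?] /= <-.
have ww1 : ww w1 w2 oneV = w1 by rewrite /ww /gx /= expg1 expg0 mulg1.
have ww2 : ww w1 w2 (mulV oneV sqV) = w2 by rewrite /ww /gx /= expg1 expg0 mul1g.
have tyS tau h : fr tau.2 m = m -> has_type dd nn tau h ->
    has_type (fun z => dd (mulV m z)) (fun y => nn (mulV (mulV m oneV) y)) tau h.
  case: tau => [[a b] sg] /= frE ty; have := type_scale nt_m one1 ty.
  congr (has_type _ _ _ _); congr (_, _, _); first by rewrite frE -mulVA mulfVV ?mulV1.
  by rewrite [fr sg oneV](_ : _ = oneV) ?mulV1 //; case: (sg).
rewrite ww1 ww2 in crd2.
apply: (chart_closed_data (H := H) (h1 := h1) (h2 := h2) oP sNP sDP cNP D5 N5 dN dreg tiND PP crd2 oG) => //.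
- apply/subsetP=> g /setIP[]; rewrite -defG => /imset2P[p h Pp Hh ->] cNg.
  suffices -> : h = 1 by rewrite mulg1.
  have : h \in 'C_H[nn0 oneV].
    rewrite inE Hh; apply/cent1P; have -> : h = p^-1 * (p * h) by rewrite mulKg.
    apply/commute_sym/commuteM; first by apply: cNP; rewrite ?groupV.
    exact/commute_sym/(centP cNg).
  by rewrite regH ?Nn1 // => /set1P.
- by rewrite ct1c; apply: tyS ty1; case: (x) => [[] k].
- rewrite ct2c; apply: tyS ty2; move: frm; case: (x) => [[] k] //= /eqP; exact.
- by case: K12 => n Nn eqk; exists n; rewrite // -edl.
- by rewrite e1 ep1' mulV1.
by rewrite e2 ep2' mulV1.
Qed.

(** * Data and normalization for the groups that are not 5-closed *)

(** E is N times the group generated by z = e (0, 1); w1, w2 lift a basis of C / E, and u, b act on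
    N as elementary shears. Relations are listed only inside the Sylow subgroup generated by E, w1,
    w2, u, as [isog_of_ext_data] requires. *)
Definition nc_data (gam : GF5) (gT : finGroupType) (G : {group gT}) : Prop :=
  exists (e : V * GF5 -> gT) (E P : {group gT}) (w1 w2 u b : gT),
  [/\ [/\ {morph e : x y / (x + y)%R >-> x * y}, injective e,
          E = e @: setT :> {set gT} & 'C_G(E) \subset E],
      [/\ forall x, e x ^ w1 = e (x.1 + (x.2, 0), x.2)%R,
          forall x, e x ^ w2 = e (x.1 + (0, x.2), x.2)%R,
          forall x, e x ^ u = e ((x.1.1 + x.1.2, x.1.2), x.2)%R
        & forall x, e x ^ b = e ((x.1.1, x.1.2 + x.1.1), x.2)%R],
      [/\ w2 ^ u = w2 * w1, w1 ^ u = w1 * e ((0, 1), 0)%R & [~ w1, w2] = e ((0, gam), gam)%R],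
      [/\ w1 ^+ 5 = 1, w2 ^+ 5 = 1 & u ^+ 5 = 1]
    & [/\ G = <<E :|: [set:: [:: w1; w2; u; b]]>> :> {set gT},
          P = <<E :|: [set:: [:: w1; w2; u]]>> :> {set gT},
          #|P| = (5 ^ 6)%N & #|G| = (24 * 5 ^ 6)%N]].

Lemma VF_mul5 (x : V * GF5) : (x *+ 5 = 0)%R.
Proof.
have h1 := V_mul5 x.1; have h2 : (x.2 *+ 5 = 0)%R by case: (x.2).
rewrite !mulrS mulr0n !addr0 in h1 h2 *.
by case: x h1 h2 => y c /= h1 h2; congr (_, _).
Qed.

Lemma nc_data_isog gam (gT1 gT2 : finGroupType) (G1 : {group gT1}) (G2 : {group gT2}) :
  nc_data gam G1 -> nc_data gam G2 -> G1 \isog G2.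
Proof.
case=> e [E [P [w1 [w2 [u [b []]]]]]].
move=> [eM inj_e defE cE] [ew1 ew2 eu eb] [wu1 wu2 ww] [w15 w25 u5] [defG defP oP oG].
case=> e' [E' [P' [w1' [w2' [u' [b' []]]]]]].
move=> [eM' inj_e' defE' cE'] [ew1' ew2' eu' eb'] [wu1' wu2' ww'] [w15' w25' u5'] [defG' defP' oP' oG'].
have sPG : P \subset G1.
  by rewrite defP defG genS // setUS //; apply/subsetP=> x; rewrite !inE => /or3P[]->; rewrite ?orbT.
have gL : group_set [set (e x, e' x) | x : (V * GF5)%type].
  apply/group_setP; split.
    apply/imsetP; exists 0%R => //; congr (_, _).
      by apply: (mulgI (e 0%R)); rewrite -eM addr0 mulg1.
    by apply: (mulgI (e' 0%R)); rewrite -eM' addr0 mulg1.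
  by move=> _ _ /imsetP[x _ ->] /imsetP[y _ ->]; apply/imsetP; exists (x + y)%R; rewrite // eM eM'.
pose L := Group gL.
have inL x : (e x, e' x) \in L by apply/imsetP; exists x.
have oL : (#|L| <= 125)%N.
  by rewrite (leq_trans (leq_imset_card _ _)) // (card_prod V GF5) card_V cardT enumT unlock.
have nL x f : (forall y, e y ^ x.1 = e (f y)) -> (forall y, e' y ^ x.2 = e' (f y)) -> x \in 'N(L).
  move=> ex ex'; apply: (@norm_gen_imset _ _ (fun y => (e y, e' y)) L x f) => // y.
  by rewrite -ex -ex'; case: x {ex ex'}.
pose x1 := (w1, w1'); pose x2 := (w2, w2'); pose x3 := (u, u').
have nL1 : x1 \in 'N(L) := nL x1 (fun x => (x.1 + (x.2, 0), x.2)%R) ew1 ew1'.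
have nL2 : x2 \in 'N(L) := nL x2 (fun x => (x.1 + (0, x.2), x.2)%R) ew2 ew2'.
have nL3 : x3 \in 'N(L) := nL x3 (fun x => ((x.1.1 + x.1.2, x.1.2), x.2)%R) eu eu'.
pose Q1 := (L <*> <[x1]>)%G; pose Q2 := (Q1 <*> <[x2]>)%G.
have sLQ1 : {subset L <= Q1} := subsetP (joing_subl L <[x1]>).
have Q1x1 : x1 \in Q1 by apply: (subsetP (joing_subr _ _)); apply: cycle_id.
have sQ12 : {subset Q1 <= Q2} := subsetP (joing_subl Q1 <[x2]>).
have Q2x2 : x2 \in Q2 by apply: (subsetP (joing_subr _ _)); apply: cycle_id.
have nQ2 : x2 \in 'N(Q1).
  apply: norm_joing_cycle => //; rewrite conjg_mulR groupM //; apply: sLQ1.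
  have -> : [~ x1, x2] = ([~ w1, w2], [~ w1', w2']) by [].
  by rewrite ww ww'.
have nQ31 : x3 \in 'N(Q1).
  apply: norm_joing_cycle => //; have -> : x1 ^ x3 = (w1 ^ u, w1' ^ u') by [].
  rewrite wu2 wu2'; have -> : (w1 * e (0, 1, 0)%R, w1' * e' (0, 1, 0)%R) = x1 * (e (0, 1, 0)%R, e' (0, 1, 0)%R) by [].
  exact: groupM Q1x1 (sLQ1 _ (inL _)).
have nQ3 : x3 \in 'N(Q2).
  apply: norm_joing_cycle => //; have -> : x2 ^ x3 = (w2 ^ u, w2' ^ u') by [].
  rewrite wu1 wu1'; have -> : (w2 * w1, w2' * w1') = x2 * x1 by [].
  exact: groupM Q2x2 (sQ12 _ Q1x1).
apply: (@isog_of_ext_data 5 (V * GF5)%type _ _ G1 E P G2 E' e e' [:: x1; x2; x3] [:: (b, b')]) => //.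
- exact: VF_mul5.
- by rewrite defE; apply/setP=> x; apply/imsetP/imsetP=> [] [y _ ->]; exists y.
- by rewrite defE'; apply/setP=> x; apply/imsetP/imsetP=> [] [y _ ->]; exists y.
- move=> x; rewrite !inE => /or4P[] /eqP->.
  + by exists (fun x => (x.1 + (x.2, 0), x.2)%R).
  + by exists (fun x => (x.1 + (0, x.2), x.2)%R).
  + by exists (fun x => ((x.1.1 + x.1.2, x.1.2), x.2)%R).
  by exists (fun x => ((x.1.1, x.1.2 + x.1.1), x.2)%R).
- exact: Sylow5_of_order.
have one_in (A : {group gT1 * gT2}) x : x.1 ^+ 5 = 1 -> x.2 ^+ 5 = 1 -> x ^+ 5 \in A.
  by case: x => x y /= x5 y5; have -> : (x, y) ^+ 5 = (x ^+ 5, y ^+ 5) by []; rewrite x5 y5 group1.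
rewrite oP; apply: (@leq_trans (#|Q2 <*> <[x3]>|)).
  apply/subset_leq_card; rewrite gen_subG subUset; apply/andP; split.
    exact: subset_trans (subset_trans (joing_subl L <[x1]>) (joing_subl Q1 <[x2]>)) (joing_subl Q2 <[x3]>).
  have sQ : {subset Q2 <= Q2 <*> <[x3]>} := subsetP (joing_subl Q2 <[x3]>).
  apply/subsetP=> x; rewrite !inE => /or3P[] /eqP->; [exact/sQ/sQ12 | exact: sQ | ].
  by apply: (subsetP (joing_subr _ _)); apply: cycle_id.
apply: leq_trans (card_joing_cycle (isT : 0 < 5)%N nQ3 (one_in Q2 x3 u5 u5')) _.
rewrite -[(5 ^ 6)%N]/(5 ^ 3 * 5 * 5 * 5)%N leq_mul2r /=.
apply: leq_trans (card_joing_cycle (isT : 0 < 5)%N nQ2 (one_in Q1 x2 w25 w25')) _.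
rewrite leq_mul2r /=; apply: leq_trans (card_joing_cycle (isT : 0 < 5)%N nL1 (one_in L x1 w15 w15')) _.
by rewrite leq_mul2r.
Qed.

(*BEGIN*)
Definition su (v : V) : V := (v.1 + v.2, v.2)%R.
Definition sb (v : V) : V := (v.1, v.2 + v.1)%R.
Lemma shear_gen : all (fun v => (v == 0%R) || has (fun i => has (fun j => has (fun k =>
   iter k sb (iter j su (iter i sb (f1, f0))) == v) (iota 0 5)) (iota 0 5)) (iota 0 5)) Vs.
Proof. by vm_compute. Qed.

Definition e_shift (gT : finGroupType) (e : V * GF5 -> gT) (w1 w2 u b : gT) : Prop :=
  [/\ forall x, e x ^ w1 = e (x.1 + (x.2, 0), x.2)%R, forall x, e x ^ w2 = e (x.1 + (0, x.2), x.2)%R,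
      forall x, e x ^ u = e (su x.1, x.2)%R & forall x, e x ^ b = e (sb x.1, x.2)%R].

Lemma swap4 (gT : finGroupType) (x y z t : gT) : commute y z -> x * y * (z * t) = x * z * (y * t).
Proof. by move=> c; have c' : y * z = z * y := c; rewrite !mulgA -(mulgA x) c' !mulgA. Qed.

Lemma basis_exists (gT : finGroupType) (n1 n2 z w1 w2 u b : gT) :
    commute n1 n2 -> commute n1 z -> commute n2 z -> n1 ^+ 5 = 1 -> n2 ^+ 5 = 1 -> z ^+ 5 = 1 ->
    n1 ^ w1 = n1 -> n2 ^ w1 = n2 -> z ^ w1 = z * n1 -> n1 ^ w2 = n1 -> n2 ^ w2 = n2 -> z ^ w2 = z * n2 ->
    n1 ^ u = n1 -> n2 ^ u = n2 * n1 -> z ^ u = z -> n1 ^ b = n1 * n2 -> n2 ^ b = n2 -> z ^ b = z ->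
  let e := fun x : V * GF5 => pw n1 n2 x.1 * gx z x.2 in
  {morph e : x y / (x + y)%R >-> x * y} /\ e_shift e w1 w2 u b.
Proof.
move=> c12 c1z c2z n15 n25 z5 n1w1 n2w1 zw1 n1w2 n2w2 zw2 n1u n2u zu n1b n2b zb e.
have cpz v c : pw n1 n2 v * gx z c = gx z c * pw n1 n2 v.
  apply/commute_sym/commuteM; apply/commuteX/commute_sym/commuteX => //.
have pJ w v : pw n1 n2 v ^ w = pw (n1 ^ w) (n2 ^ w) v by rewrite /pw conjMg !conjXg.
have gJ w c : gx z c ^ w = gx (z ^ w) c by rewrite /gx conjXg.
have gM x y c : commute x y -> gx (x * y) c = gx x c * gx y c by move=> cxy; apply: expgMn.
have eM : {morph e : x y / (x + y)%R >-> x * y}.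
  move=> [v c] [v' c']; rewrite /e /= pwD // gxD //; exact: swap4 (cpz _ _).
have p1 c : pw n1 n2 (c, 0%R) = gx n1 c by rewrite /pw /= /gx expg0 mulg1.
have p2 c : pw n1 n2 (0%R, c) = gx n2 c by rewrite /pw /= /gx expg0 mul1g.
split=> //; split=> -[[a d] c]; rewrite /e /= ?pwD // conjMg pJ gJ.
- rewrite n1w1 n2w1 zw1 gM; last exact: commute_sym.
  by rewrite -[RHS]mulgA cpz p1.
- rewrite n1w2 n2w2 zw2 gM; last exact: commute_sym.
  by rewrite -[RHS]mulgA cpz p2.
- rewrite n1u n2u zu; congr (_ * _); rewrite /pw /su /= gM // gxD // -mulgA; congr (_ * _).
  by apply/commuteX/commute_sym/commuteX.
rewrite n1b n2b zb; congr (_ * _); rewrite /pw /sb /= gM // gxD // -mulgA; congr (_ * _).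
by rewrite -!gxD // addrC.
Qed.

Lemma pow5_sub2 (gT : finGroupType) (A B : {group gT}) : A \proper B -> 5.-group B -> (5 * #|A| <= #|B|)%N.
Proof.
move=> prAB pB; have /p_natP[i oA] := pgroupS (proper_sub prAB) pB; have /p_natP[j oB] := pB.
by have := proper_card prAB; rewrite oA oB -expnS ltn_exp2l // leq_exp2l.
Qed.

Section Final.
Variables (gT : finGroupType) (G N C : {group gT}).
Hypotheses (oG : #|G| = (24 * 5 ^ 6)%N) (sCG : C \subset G) (C5 : {in C, forall c, c ^+ 5 = 1}).
Hypothesis oP : {in N^#, forall n, #|'C_G[n]| = (5 ^ 6)%N}.

Definition nc_pre (gam x mu : GF5) : Prop := exists (e : V * GF5 -> gT) (w1 w2 u b : gT),
  [/\ [/\ {morph e : y y' / (y + y')%R >-> y * y'}, e ((1, 0), 0)%R \in N, e ((1, 0), 0)%R != 1 & forall y, e y \in C],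
      e_shift e w1 w2 u b,
      [/\ w2 ^ u = w2 * w1, w1 ^ u = w1 * e ((x, 1), 0)%R & [~ w1, w2] = e ((mu, gam), gam)%R]
    & [/\ w1 \in C, w2 \in C, u \in G, b \in G & u ^+ 5 = 1]].

Lemma e_facts (e : V * GF5 -> gT) : {morph e : y y' / (y + y')%R >-> y * y'} ->
  [/\ e 0%R = 1, forall y, (e y)^-1 = e (- y)%R, forall y y', e y ^ e y' = e y
    & forall w y (f : V * GF5 -> V * GF5), (forall y, e y ^ w = e (f y)) -> w ^ e y = w * e (y - f y)%R].
Proof.
move=> eM; have e0 : e 0%R = 1 by apply: (mulgI (e 0%R)); rewrite -eM addr0 mulg1.
have eV y : (e y)^-1 = e (- y)%R by apply: (mulgI (e y)); rewrite mulgV -eM subrr e0.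
split=> // [y y' | w y f ef].
  by rewrite conjgE -eM addrC eM mulKg.
by rewrite conj_shift conjVg ef eV -eM addrC.
Qed.

Lemma push_e (e : V * GF5 -> gT) w y (f : V * GF5 -> V * GF5) : (forall y, e y ^ w = e (f y)) -> e y * w = w * e (f y).
Proof. by move=> ef; rewrite conjgC ef. Qed.

(** Multiplying w1, w2 and u by elements of E changes the relations only along N; [y1], [y2], [y3]
    solve the linear equations that cancel x and mu. *)
Lemma nc_pre_norm gam x mu : nc_pre gam x mu -> nc_pre gam 0%R 0%R.
Proof.
case=> e [w1 [w2 [u [b [[eM N1 nt1 eC] [ew1 ew2 eu eb] [wu2 wu1 ww] [Cw1 Cw2 Gu Gb u5]]]]]].
have [e0 eV eeJ wJ] := e_facts eM.
pose s := (x + x + x)%R; pose y1 : V * GF5 := ((- mu - s, - s), 0)%R; pose y2 : V * GF5 := (0, mu)%R; pose y3 : V * GF5 := (0, s)%R.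
have p1 y := push_e y ew1; have p2 y := push_e y ew2.
exists e, (w1 * e y1), (w2 * e y2), (u * e y3), b; split=> //.
- by split=> y; rewrite ?conjgM ?ew1 ?ew2 ?eu ?eeJ.
- split.
  + rewrite conjMg !conjgM wu2 eu eeJ conjMg (wJ _ _ _ ew1) (wJ _ _ _ ew2).
    rewrite -!mulgA (mulgA (e _) w1) p1 (mulgA (e y2) w1) p1 -!mulgA -!eM.
    congr (_ * (_ * e _)); rewrite /y1 /y2 /y3 /s /su /=; by case: (x); case: (mu).
  + rewrite conjMg !conjgM wu1 eu eeJ conjMg (wJ _ _ _ ew1) eeJ -!mulgA -!eM.
    congr (_ * e _); rewrite /y1 /y3 /s /su /=; by case: (x); case: (mu).
  apply: (mulgI (w2 * e y2 * (w1 * e y1))); rewrite -commgC.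
  rewrite -!mulgA (mulgA (e y1) w2) p2 (mulgA (e y2) w1) p1 -!mulgA -!eM.
  rewrite (mulgA w1 w2) (commgC w1 w2) ww -!mulgA -!eM.
  congr (_ * (_ * e _)); rewrite /y1 /y2 /s /=; by case: (x); case: (mu); case: (gam).
split=> //; try exact: groupM.
  by rewrite groupM // (subsetP sCG).
rewrite expgMn ?u5 ?C5 ?mulg1 //; apply/commute_sym/commgP/conjg_fixP; rewrite eu; congr (e _).
Qed.

(** Replacing u by u^2 and b by b^3 agrees with scaling n1, n2, z by 3, 4, 4; the effect on gam is
    multiplication by 3. *)
Lemma nc_pre_scale gam : nc_pre gam 0%R 0%R -> nc_pre (gam + gam + gam)%R f3 (gam + gam)%R.
Proof.
case=> e [w1 [w2 [u [b [[eM N1 nt1 eC] [ew1 ew2 eu eb] [wu2 wu1 ww] [Cw1 Cw2 Gu Gb u5]]]]]].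
have [e0 eV eeJ wJ] := e_facts eM; have p1 y := push_e y ew1; have p2 y := push_e y ew2.
pose sc (y : V * GF5) : V * GF5 := ((f3 * y.1.1, f4 * y.1.2), f4 * y.2)%R.
pose e01 : V * GF5 := ((0, 1), 0)%R.
exists (fun y => e (sc y)), (w1 * w1 * e e01), w2, (u * u), (b * b * b); split.
- split=> //.
  + by move=> [[a1 a2] a3] [[b1 b2] b3]; rewrite -eM; congr (e _); congr (_, _, _) => /=; ring.
  + have -> : sc ((1, 0), 0)%R = (((1, 0), 0) + ((1, 0), 0) + ((1, 0), 0))%R by [].
    by rewrite !eM !groupM.
  apply: contra nt1 => /eqP h; apply/eqP; have -> : (((1, 0), 0) = sc ((1, 0), 0) + sc ((1, 0), 0))%R by [].
  by rewrite eM h mulg1.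
- split=> -[[y1 y2] y3]; rewrite ?conjgM ?ew1 ?ew2 ?eu ?eb ?eeJ; congr (e _); rewrite /sc /su /sb /=.
  + by case: (y1); case: (y2); case: (y3).
  + by case: (y1); case: (y2); case: (y3).
  + by case: (y1); case: (y2).
  by case: (y1); case: (y2).
- split.
  + by rewrite conjgM wu2 conjMg wu2 wu1 -!mulgA.
  + have W : w1 ^ (u * u) = w1 * e ((1, 1 + 1), 0)%R.
      by rewrite conjgM wu1 conjMg wu1 eu -mulgA -eM; congr (_ * e _).
    rewrite !conjMg W conjgM !eu -!mulgA (mulgA (e _) w1) p1 -!mulgA -!eM; congr (_ * (_ * e _)).
  apply: (mulgI (w2 * (w1 * w1 * e e01))); rewrite -commgC.
  have c w : w1 * (w2 * w) = w2 * (w1 * (e ((0%R, gam), gam) * w)).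
    by rewrite !mulgA (commgC w1 w2) ww.
  rewrite -!mulgA p2 c c (mulgA (e _) w1) p1 -!mulgA -!eM; congr (_ * (_ * (_ * e _))).
  by rewrite /sc /e01 /=; case: (gam).
split=> //; try by rewrite !groupM.
by rewrite expgMn ?u5 ?mulg1.
Qed.

(** As 3 generates the multiplicative group of F_5, every nonzero gam is carried to 1. *)
Lemma nc_pre_cases gam x mu : nc_pre gam x mu -> nc_pre f0 0%R 0%R \/ nc_pre f1 0%R 0%R.
Proof.
have step g : nc_pre g 0%R 0%R -> nc_pre (g + g + g)%R 0%R 0%R by move/nc_pre_scale/nc_pre_norm.
move/nc_pre_norm; case: gam => h; [by left | by right | right; exact: (step f2 h)| right | right].
  exact: (step f2 (step f4 (step f3 h))).
exact: (step f2 (step f4 h)).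
Qed.

Lemma nc_pre_data gam : nc_pre gam 0%R 0%R -> nc_data gam G.
Proof.
case=> e [w1 [w2 [u [b [[eM N1 nt1 eC] [ew1 ew2 eu eb] [wu2 wu1 ww] [Cw1 Cw2 Gu Gb u5]]]]]].
have [e0 eV eeJ wJ] := e_facts eM; have Gn := subsetP sCG.
set n1 := e ((1, 0), 0)%R in N1 nt1.
have n1X c : e ((c, 0), 0)%R = gx n1 c.
  have fM : {morph (fun v : V => e (v, 0)%R) : v w / (v + w)%R >-> v * w}.
    by move=> v w; rewrite -eM; congr (e _); congr (_, _); rewrite /= addr0.
  have -> : n1 = (fun v : V => e (v, 0)%R) oneV by [].
  by rewrite (gxX fM); congr (e _); case: (c).
have k0 c : e ((c, 0), 0)%R = 1 -> c = 0%R.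
  move=> ec; apply/eqP; apply: contraT => ntc; case/negP: nt1; rewrite -in_set1 -[[set 1]]/(gval 1%G).
  by apply: (gx_mem (C5 (eC _)) ntc); rewrite -n1X ec group1.
have ker y : e y = 1 -> y = 0%R.
  case: y => [[a d] c] ey; have c0 : c = 0%R.
    have h : e ((a, d), c) ^ w1 = 1 by rewrite ey conj1g.
    apply: k0; apply: (mulgI (e ((a, d), c))); rewrite -eM mulg1 ey -[RHS]h ew1.
    by congr (e _); congr (_, _) => /=; rewrite ?addr0.
  rewrite {}c0 in ey *; have d0 : d = 0%R.
    have h : e ((a, d), 0)%R ^ u = 1 by rewrite ey conj1g.
    apply: k0; apply: (mulgI (e ((a, d), 0)%R)); rewrite -eM mulg1 ey -[RHS]h eu.
    by congr (e _); congr (_, _) => /=; rewrite ?addr0 //; congr (_, _) => /=; rewrite ?addr0.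
  by rewrite {}d0 in ey *; rewrite (k0 a ey).
have inj_e : injective e.
  by move=> y y' eqe; apply/eqP; rewrite -subr_eq0; apply/eqP/ker; rewrite eM -eV eqe mulgV.
have gE : group_set (e @: setT).
  apply/group_setP; split; first by apply/imsetP; exists 0%R; rewrite // e0.
  by move=> _ _ /imsetP[v _ ->] /imsetP[v' _ ->]; rewrite -eM (imset_f e).
pose E := Group gE; pose P := 'C_G[n1]%G.
have inE' y : e y \in E by apply: imset_f.
have oE : #|E| = 125%N by rewrite /= card_imset // cardsT (card_prod V GF5) card_V card_GF5.
have oP' : #|P| = (5 ^ 6)%N by apply: oP; rewrite !inE nt1.
have pP : 5.-group P by rewrite /pgroup oP' pnatX.
have inP y : y \in G -> n1 ^ y = n1 -> y \in P.
  by move=> Gy fy; rewrite inE Gy; apply/cent1P/commute_sym/commgP/conjg_fixP.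
have Pw1 : w1 \in P by rewrite inP ?Gn // /n1 ew1; congr (e _); congr (_, _); rewrite /= addr0.
have Pw2 : w2 \in P by rewrite inP ?Gn // /n1 ew2; congr (e _); congr (_, _); rewrite /= addr0.
have Pu : u \in P by rewrite inP // /n1 eu; congr (e _).
have sEP : E \subset P by apply/subsetP=> _ /imsetP[y _ ->]; rewrite inP ?Gn // /n1 eeJ.
have Pn1 y : y \in P -> n1 ^ y = n1 by case/setIP=> _ /cent1P cy; apply/conjg_fixP/commgP/commute_sym.
(* Each adjunction gains a factor 5: w1 moves z, w2 does not preserve the coset z <n1> that X and w1
   preserve, and u moves n2, which X, w1 and w2 fix. With X = E the chain fills P; with X = C_G(E)
   it bounds |X| by 125. *)
have chain (X : {group gT}) : X \subset P -> {in X, forall x, e (0, 1)%R ^ x = e (0, 1)%R} ->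
    {in X, forall x, e ((0, 1), 0)%R ^ x = e ((0, 1), 0)%R} ->
    (5 * (5 * (5 * #|X|)) <= #|((X <*> <[w1]>) <*> <[w2]>) <*> <[u]>|)%N /\
    ((X <*> <[w1]>) <*> <[w2]>) <*> <[u]> \subset P.
  move=> sXP fz f2'; pose X1 := (X <*> <[w1]>)%G; pose X2 := (X1 <*> <[w2]>)%G; pose X3 := (X2 <*> <[u]>)%G.
  have s1 : X1 \subset P by rewrite join_subG sXP cycle_subG.
  have s2 : X2 \subset P by rewrite join_subG s1 cycle_subG.
  have s3 : X3 \subset P by rewrite join_subG s2 cycle_subG.
  have pr (A : {group gT}) w : w \notin A -> A \proper A <*> <[w]>.
    by move=> nAw; rewrite properE joing_subl join_subG cycle_subG (negPf nAw) andbF.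
  have nX1 : w1 \notin X by apply/negP=> /fz; rewrite ew1 => /inj_e[].
  pose A := [set e ((c, 0), 1)%R | c : GF5].
  have nX2 : w2 \notin X1.
    have sNA : X1 \subset 'N(A).
      rewrite join_subG cycle_subG; apply/andP; split.
        apply/subsetP=> x Xx; rewrite inE; apply/subsetP=> _ /imsetP[_ /imsetP[c _ ->] ->].
        have -> : (((c, 0), 1) = ((c, 0), 0) + (0, 1) :> V * GF5)%R by congr (_, _) => /=; rewrite ?addr0 ?add0r.
        rewrite eM conjMg (fz x Xx) n1X /gx conjXg (Pn1 x (subsetP sXP x Xx)) -/(gx n1 c) -n1X -eM.
        by apply/imsetP; exists c => //; congr (e _); congr (_, _) => /=; rewrite ?addr0 ?add0r.
      rewrite inE; apply/subsetP=> _ /imsetP[_ /imsetP[c _ ->] ->]; rewrite ew1; apply/imsetP; exists (c + 1)%R => //.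
    apply/negP=> /(subsetP sNA) nA; have A0 : e ((0, 0), 1)%R \in A by apply/imsetP; exists 0%R.
    have : e ((0, 0), 1)%R ^ w2 \in A by rewrite memJ_norm.
    case/imsetP=> c _.
    by rewrite ew2 => /inj_e[].
  have nX3 : u \notin X2.
    have sC : X2 \subset 'C[e ((0, 1), 0)%R].
      have cc w : e ((0, 1), 0)%R ^ w = e ((0, 1), 0)%R -> w \in 'C[e ((0, 1), 0)%R].
        by move=> fw; apply/cent1P/commute_sym/commgP/conjg_fixP.
      rewrite !join_subG !cycle_subG !cc ?ew1 ?ew2 ?andbT; last 2 first.
      + by congr (e _); congr (_, _); rewrite /= addr0.
      + by congr (e _); congr (_, _); rewrite /= addr0.
      by apply/subsetP=> x /f2'/cc.
    apply/negP=> /(subsetP sC)/cent1P/commute_sym/commgP/conjg_fixP; rewrite eu => /inj_e[] //.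
  split=> //; apply: leq_trans (pow5_sub2 (pr X2 u nX3) (pgroupS s3 pP)); rewrite leq_mul2l /=.
  apply: leq_trans (pow5_sub2 (pr X1 w2 nX2) (pgroupS s2 pP)); rewrite leq_mul2l /=.
  exact: (pow5_sub2 (pr X w1 nX1) (pgroupS s1 pP)).
have [cE1 cE2] : _ := chain E sEP (fun _ h => let: ex_intro2 y _ h' := imsetP h in etrans (congr1 _ h') (eeJ _ _))
   (fun _ h => let: ex_intro2 y _ h' := imsetP h in etrans (congr1 _ h') (eeJ _ _)).
have defP : ((E <*> <[w1]>) <*> <[w2]>) <*> <[u]> = P.
  apply/eqP; rewrite eqEcard cE2 oP' (leq_trans _ cE1) // oE -[125%N]/(5 ^ 3)%N -!expnS //.
have cE : 'C_G(E) \subset E.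
  have eC' y x : x \in 'C_G(E) -> e y ^ x = e y.
    by case/setIP=> _ /centP cx; apply/conjg_fixP/commgP/commute_sym/cx.
  have sXP : 'C_G(E) \subset P by apply/subsetP=> x Cx; rewrite inP ?(eC' _ x Cx) //; case/setIP: Cx.
  have [c1 c2] := chain 'C_G(E)%G sXP (fun x => eC' (0, 1)%R x) (fun x => eC' ((0, 1), 0)%R x).
  have sEC : E \subset 'C_G(E).
    apply/subsetP=> _ /imsetP[y _ ->]; rewrite inE Gn // ; apply/centP=> _ /imsetP[y' _ ->].
    by apply/commgP/conjg_fixP.
  suffices <- : E = 'C_G(E) :> {set _} by [].
  apply/eqP; rewrite eqEcard sEC oE; have := leq_trans c1 (subset_leq_card c2).
  by rewrite oP' -[125%N]/(5 ^ 3)%N !expnS !leq_mul2l.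
exists e, E, P, w1, w2, u, b; split=> //; first by split=> //; apply: C5.
split=> //.
- pose L := <<E :|: [set:: [:: w1; w2; u; b]]>>%G; rewrite -[<<_>>]/(gval L).
  have LA x : x \in [:: w1; w2; u; b] -> x \in L by move=> Ax; rewrite mem_gen // inE inE Ax orbT.
  have Lu : u \in L by apply: LA; rewrite !inE eqxx ?orbT.
  have Lb : b \in L by apply: LA; rewrite !inE eqxx ?orbT.
  have sEL : E \subset L by rewrite (subset_trans _ (subset_gen _)) ?subsetUl.
  have sPL : P \subset L.
    by rewrite -defP !join_subG !cycle_subG sEL Lu !LA // !inE eqxx ?orbT.
  have sLG : L \subset G.
    rewrite gen_subG subUset (subset_trans sEP) ?subsetIl //=.
    by apply/subsetP=> x; rewrite !inE => /or4P[]/eqP->; [exact: Gn | exact: Gn | exact: Gu | exact: Gb].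
  (* The generated group contains P = C_G(n1), and by [shear_gen] it moves n1 to all 24 nonzero
     vectors. *)
  apply/esym/eqP; rewrite eqEcard sLG /= oG.
  rewrite -(Lagrange (subsetIl L 'C[n1])) mulnC index_cent1; apply: leq_mul.
    by rewrite -oP' subset_leq_card // subsetI sPL subsetIr.
  have oA : #|[set e (v, 0)%R | v in [set~ 0%R : V]]| = 24%N.
    by rewrite card_imset => [|v v' /inj_e[] //]; rewrite cardsC1 card_V.
  apply: (@leq_trans #|[set e (v, 0)%R | v in [set~ 0%R : V]]|); first by rewrite oA.
  apply/subset_leq_card/subsetP=> _ /imsetP[v ntv ->].
  rewrite !inE in ntv; have := allP shear_gen v (mem_Vs _); rewrite (negPf ntv) orFb.
  case/hasP=> i _ /hasP[j _ /hasP[k _ /eqP <-]].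
  have uX w m : e (w, 0)%R ^ (u ^+ m) = e (iter m su w, 0)%R.
    by elim: m => [|m IHm]; rewrite ?expg0 ?conjg1 // expgSr conjgM IHm eu.
  have bX w m : e (w, 0)%R ^ (b ^+ m) = e (iter m sb w, 0)%R.
    by elim: m => [|m IHm]; rewrite ?expg0 ?conjg1 // expgSr conjgM IHm eb.
  apply/imsetP; exists (b ^+ i * u ^+ j * b ^+ k); first by rewrite !groupM ?groupX.
  by rewrite !conjgM [n1 ^ _](bX (f1, f0)) uX bX.
rewrite -[RHS]/(gval <<E :|: [set:: [:: w1; w2; u]]>>%G); set L := <<_>>%G.
have LA x : x \in [:: w1; w2; u] -> x \in L by move=> Ax; rewrite mem_gen // inE inE Ax orbT.
apply/eqP; rewrite eqEsubset; apply/andP; split.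
  rewrite -defP !join_subG !cycle_subG !LA ?inE ?eqxx ?orbT // !andbT.
  by rewrite (subset_trans _ (subset_gen _)) ?subsetUl.
rewrite gen_subG subUset sEP; apply/subsetP=> x Ax.
have {Ax}: [|| x == w1, x == w2 | x == u] by move: Ax; rewrite inE !in_cons in_nil orbF.
by case/or3P=> /eqP->; [exact: Pw1 | exact: Pw2 | exact: Pu].
Qed.
End Final.

(*BEGIN*)
Lemma pow5_subset (gT : finGroupType) (A B : {group gT}) k :
  A \proper B -> #|A| = (5 ^ k)%N -> 5.-group B -> (5 ^ k.+1 <= #|B|)%N.
Proof.
move=> prAB oA /p_natP[j oB]; have := proper_card prAB; rewrite oA oB ltn_exp2l // => lt_kj.
by rewrite leq_exp2l.
Qed.

Lemma prime_sub_cycle (gT : finGroupType) (x y : gT) p : prime p -> #[y] = p -> x \in <[y]> -> x != 1 -> <[x]> = <[y]>.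
Proof.
move=> pr_p oy yx ntx; apply/eqP; rewrite eqEsubset cycle_subG yx /=; apply: prime_meetG; first by rewrite -orderE oy.
by apply/trivgPn; exists x => //; rewrite inE yx cycle_id.
Qed.

(** * Shears and an involution when the Sylow subgroup is not normal *)

Section Frame.
Variables (gT : finGroupType) (G N : {group gT}).
Hypotheses (oG : #|G| = (24 * 5 ^ 6)%N) (nsN : N <| G) (oN : #|N| = 25%N).
Hypothesis trN : {in N^# &, forall x y, x \in y ^: G}.
Hypothesis ncl : ~ p_closed 5 G.
Let sNG : N \subset G := normal_sub nsN.
Let C := 'C_G(N)%G.

Lemma nf_pN : 5.-group N. Proof. by rewrite /pgroup oN -[25%N]/(5 ^ 2)%N pnatX. Qed.
Lemma nf_abN : abelian N. Proof. exact: (@card_p2group_abelian _ 5%N). Qed.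

Lemma nf_N5 n : n \in N -> n ^+ 5 = 1.
Proof.
move=> Nn; have [-> | ntn] := eqVneq n 1; first by rewrite expg1n.
have [m Nm om] : {m | m \in N & #[m] = 5%N} by apply: (@Cauchy _ 5 N); rewrite ?oN.
have ntm : m != 1 by rewrite -order_gt1 om.
have /imsetP[g Gg ->] : n \in m ^: G by apply: trN; rewrite !inE ?ntn ?ntm.
by rewrite -conjXg -om expg_order conj1g.
Qed.

Lemma nf_order n : n \in N -> n != 1 -> #[n] = 5%N.
Proof. by move=> Nn ntn; apply: nt_prime_order => //; apply: nf_N5. Qed.

Lemma nf_oC n : n \in N^# -> #|'C_G[n]| = (5 ^ 6)%N.
Proof.
move=> Nn; have clN : n ^: G = N^#.
  apply/setP=> y; apply/imsetP/idP=> [[g Gg ->]|Ny]; last by have /imsetP := trN Ny Nn.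
  by rewrite memJ_norm // normD1 (subsetP (normal_norm nsN)).
have oN1 : #|N^#| = 24%N by have := cardsD1 1 N; rewrite group1 oN => -[].
have := Lagrange (subsetIl G 'C[n]); rewrite index_cent1 clN oN1 oG => /eqP.
by rewrite mulnC eqn_pmul2l // => /eqP.
Qed.

Lemma nf_nsC : C <| G.
Proof.
have := subcent_normal G N; have -> //: 'N_G(N) = G by apply/setIidPl; apply: normal_norm nsN.
Qed.

Lemma nf_sNC : N \subset C.
Proof. by rewrite subsetI sNG; apply: nf_abN. Qed.

Lemma nf_syl n : n \in N^# -> 5.-Sylow(G) 'C_G[n].
Proof. by move=> Nn; apply: Sylow5_of_order oG (subsetIl _ _) (nf_oC Nn). Qed.

Lemma nf_sCP n : n \in N -> C \subset 'C_G[n].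
Proof. by move=> Nn; apply: setIS; rewrite -cent_set1 centS // sub1set. Qed.

Lemma nf_sNP n : n \in N -> N \subset 'C_G[n].
Proof. by move=> Nn; apply: subset_trans nf_sNC (nf_sCP Nn). Qed.

Lemma nf_CneP n : n \in N^# -> C \proper 'C_G[n].
Proof.
move=> Nn; have /setD1P[_ Nn'] := Nn; rewrite properEneq nf_sCP // andbT; apply/eqP=> eqC; case: ncl.
by exists 'C_G[n]%G; [apply: nf_syl | rewrite /= -eqC nf_nsC].
Qed.

Lemma nf_gen n1 n : n1 \in N^# -> n \in N -> n \notin <[n1]> -> <[n1]> <*> <[n]> = N.
Proof.
case/setD1P=> nt1 N1 Nn nKn; apply/eqP; rewrite eqEcard join_subG !cycle_subG N1 Nn /= oN.
have prK : <[n1]> \proper <[n1]> <*> <[n]>.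
  by rewrite properE joing_subl /= join_subG negb_and cycle_subG cycle_subG nKn orbT.
apply: (@pow5_subset _ <[n1]>%G (<[n1]> <*> <[n]>)%G 1) => //; first by rewrite -orderE nf_order.
by apply: pgroupS nf_pN; rewrite join_subG !cycle_subG N1.
Qed.

Lemma nf_cent2 n1 n : n1 \in N^# -> n \in N -> n \notin <[n1]> -> 'C_('C_G[n1])[n] \subset C.
Proof.
move=> Nn1 Nn nKn; rewrite -setIA setIS // centsC -(nf_gen Nn1 Nn nKn) join_subG !cycle_subG.
by rewrite -!sub_cent1 subsetIl subsetIr.
Qed.

(** By nilpotence [N, P] is proper in N, and if nontrivial it contains a nontrivial element of Z(P).
    Such an element lies in <n1>, for otherwise P would centralize N and equal C. *)
Lemma nf_comm n1 : n1 \in N^# -> [~: N, 'C_G[n1]] \subset <[n1]>.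
Proof.
move=> Nn1; set P := 'C_G[n1]; have /setD1P[nt1 N1] := Nn1.
have pP : 5.-group P := pHall_pgroup (nf_syl Nn1).
have nNP : P \subset 'N(N) := subset_trans (subsetIl _ _) (normal_norm nsN).
have ZK : {subset N :&: 'Z(P) <= <[n1]>}.
  move=> n /setIP[Nn /centerP[_ cPn]]; apply: contraT => nKn.
  have := proper_subn (nf_CneP Nn1); rewrite -/P => /negP[]; apply: subset_trans (nf_cent2 Nn1 Nn nKn).
  by apply/subsetP=> x Px; rewrite inE Px; apply/cent1P/commute_sym/cPn.
have prR : [~: N, P] \proper N.
  apply: nil_comm_properl (pgroup_nil pP) (nf_sNP N1) _ _; first by rewrite -cardG_gt1 oN.
  by rewrite subsetI nNP subxx.
have [-> | ntR] := eqVneq [~: N, P] 1; first exact: sub1G.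
have nsRP : [~: N, P] <| P.
  by rewrite /normal commg_normr andbT (subset_trans (proper_sub prR)) ?nf_sNP.
have /trivgPn[r /setIP[Rr Zr] ntr] := meet_center_nil (pgroup_nil pP) nsRP ntR.
have Nr := subsetP (proper_sub prR) r Rr.
have defK : <[r]> = <[n1]> by apply: (@prime_sub_cycle _ r n1 5) => //; [apply: nf_order | apply: ZK; rewrite inE Nr].
suffices -> : [~: N, P] = <[r]> by rewrite defK.
apply/esym/eqP; rewrite eqEcard cycle_subG Rr /= -orderE nf_order // leqNgt.
apply/negP=> lt5; have : (25 <= #|[~: N, P]|)%N.
  apply: (@pow5_subset _ <[r]>%G [~: N, P]%G 1); last exact: pgroupS (proper_sub prR) nf_pN.
    by rewrite properEcard cycle_subG Rr -orderE nf_order.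
  by rewrite -orderE nf_order.
by rewrite -oN leqNgt proper_card.
Qed.

Lemma nf_ex_out n1 : n1 \in N^# -> exists2 n, n \in N & n \notin <[n1]>.
Proof.
case/setD1P=> nt1 N1; apply/subsetPn/negP=> /subset_leq_card.
by rewrite oN -orderE nf_order.
Qed.

(** By [nf_comm], P acts on N by shears along n1, so |P : C| is at most 5; it is not 1 because C is
    normal in G and P is not. *)
Lemma nf_cardC : #|C| = (5 ^ 5)%N.
Proof.
have [n1 N1 nt1] : exists2 n, n \in N & n != 1 by apply/trivgPn; rewrite -cardG_gt1 oN.
have Nn1 : n1 \in N^# by rewrite !inE nt1.
have [n Nn nKn] := nf_ex_out Nn1; set P := 'C_G[n1]%G.
have pP : 5.-group P := pHall_pgroup (nf_syl Nn1).
have defC : 'C_P[n] = C.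
  apply/eqP; rewrite eqEsubset nf_cent2 // subsetI nf_sCP //=.
  exact: subset_trans (nf_sCP Nn) (subsetIr _ _).
have le5 : (#|P : C| <= 5)%N.
  rewrite -defC index_cent1; apply: (@leq_trans #|n *: <[n1]>|); last by rewrite card_lcoset -orderE nf_order.
  apply/subset_leq_card/subsetP=> _ /imsetP[x Px ->]; rewrite mem_lcoset -commgEl.
  by apply: (subsetP (nf_comm Nn1)); rewrite mem_commg.
have /p_natP[k oC] := pgroupS (proper_sub (nf_CneP Nn1)) pP.
have oPk := pow5_subset (nf_CneP Nn1) oC pP; rewrite nf_oC // leq_exp2l // in oPk.
have := Lagrange (proper_sub (nf_CneP Nn1)); rewrite nf_oC // oC => oPC.
have : (5 ^ 6 <= 5 ^ k.+1)%N by rewrite -oPC mulnC expnS leq_mul2r le5 orbT.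
by rewrite leq_exp2l // ltnS => ge5; congr (5 ^ _)%N; apply/eqP; rewrite eqn_leq -ltnS oPk.
Qed.

(** Elements outside C in the centralizers of two independent vectors act as shears with different
    axes; taking n1 = [n2, u] and a power of b normalizes both. *)
Lemma nf_shears : exists n1 n2 u b, [/\ [/\ n1 \in N, n2 \in N & n1 != 1],
  [/\ u \in 'C_G[n1], u \notin C & n2 ^ u = n2 * n1] & [/\ b \in 'C_G[n2], n2 != 1 & n1 ^ b = n1 * n2]].
Proof.
have [n0 N0 nt0] : exists2 n, n \in N & n != 1 by apply/trivgPn; rewrite -cardG_gt1 oN.
have Nn0 : n0 \in N^# by rewrite !inE nt0.
have [n2 N2 nKn2] := nf_ex_out Nn0; have [_ [u Pu nCu]] := properP (nf_CneP Nn0).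
have K1 : [~ n2, u] \in <[n0]> by apply: (subsetP (nf_comm Nn0)); rewrite mem_commg.
set n1 := [~ n2, u] in K1; have N1 : n1 \in N by move: K1; apply/subsetP; rewrite cycle_subG.
have nt1 : n1 != 1.
  apply: contraNneq nCu => /eqP/commgP cu; apply: (subsetP (nf_cent2 Nn0 N2 nKn2)).
  by rewrite inE Pu; apply/cent1P.
have eqK : <[n1]> = <[n0]> by apply: (@prime_sub_cycle _ n1 n0 5) => //; apply: nf_order.
have nt2 : n2 != 1 by apply: contraNneq nKn2 => ->.
have Nn2 : n2 \in N^# by rewrite !inE nt2.
have nK1 : n1 \notin <[n2]>.
  apply: contra nKn2 => K21; rewrite -eqK (@prime_sub_cycle _ n1 n2 5) ?cycle_id //; exact: nf_order.
have [_ [b Pb nCb]] := properP (nf_CneP Nn2); have [Gb cb] := setIP Pb.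
have K2 : [~ n1, b] \in <[n2]> by apply: (subsetP (nf_comm Nn2)); rewrite mem_commg.
have ntb : [~ n1, b] != 1.
  apply: contraNneq nCb => /eqP/commgP cub; apply: (subsetP (nf_cent2 Nn2 N1 nK1)).
  by rewrite inE Pb; apply/cent1P.
have /cycleP[j def2] : n2 \in <[[~ n1, b]]>.
  by rewrite (@prime_sub_cycle _ _ n2 5) ?cycle_id //; apply: nf_order.
have cb2 : commute [~ n1, b] b.
  by case/cycleP: K2 => i ->; apply/commute_sym/commuteX/cent1P.
exists n1, n2, u, (b ^+ j); split=> //; split=> //; try by rewrite conjg_mulR.
- have [Gu cu] := setIP Pu; rewrite inE Gu; apply/cent1P; case/cycleP: K1 => i ->.
  exact/commuteX/cent1P.
- by rewrite groupX.
by rewrite conjg_mulR commgX // -def2.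
Qed.

(** Centralizers of elements of N^# are 5-groups, so a Sylow 2-subgroup, of order 8, acts
    semiregularly on N^#; it has a single involution, which inverts N. *)
Lemma nf_involution : exists t : gT,
  [/\ [/\ t \in G, t ^+ 2 = 1 & {in N, forall n, n ^ t = n^-1}] & forall X : {group gT}, X <| G -> 5.-group X ->
    exists b, #|X| = (#|'C_X[t]| * 25 ^ b)%N].
Proof.
have [Q sylQ] := Sylow_exists 2 G; have sQG := pHall_sub sylQ; have pQ := pHall_pgroup sylQ.
have oQ : #|Q| = 8%N.
  by rewrite (card_Hall sylQ) oG partnM ?expn_gt0 // (@part_p'nat 2%N (5 ^ 6)%N) ?pnatX // p_part.
have fixQ s n : s \in Q -> n \in N -> n ^ s = n -> n != 1 -> s = 1.
  move=> Qs Nn ns ntn; have: s \in 'C_G[n].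
    by apply/setIP; split; [apply: (subsetP sQG) | apply/cent1P/commute_sym/commgP/conjg_fixP].
  move/order_dvdG; rewrite nf_oC ?inE ?ntn // => o5; apply/eqP; rewrite -order_eq1 -dvdn1.
  have : (#[s] %| gcdn 8 (5 ^ 6))%N by rewrite dvdn_gcd o5 -oQ order_dvdG.
  by rewrite (eqP (coprimeXr 6 (isT : coprime 8 5))).
have invN s : s \in Q -> #[s] = 2%N -> {in N, forall n, n ^ s = n^-1}.
  move=> Qs os n Nn; have Nns : n ^ s \in N by rewrite memJ_norm // (subsetP (normal_norm nsN)) ?(subsetP sQG).
  have cNN : commute n (n ^ s) by apply: (centsP nf_abN).
  apply: (mulgI n); rewrite mulgV; apply/eqP; apply: contraT => nt.
  have := fixQ s (n * n ^ s) Qs; rewrite groupM // conjMg -conjgM -[s * s]/(s ^+ 2) -os expg_order conjg1.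
  by move=> /(_ isT (esym cNN) nt) s1; rewrite s1 order1 in os.
have [t Qt ot] : {t | t \in Q & #[t] = 2%N} by apply: (@Cauchy _ 2 Q); rewrite ?oQ.
have [n Nn ntn] : exists2 n, n \in N & n != 1 by apply/trivgPn; rewrite -cardG_gt1 oN.
have uniqt s : s \in Q -> #[s] = 2%N -> s = t.
  move=> Qs os; apply/eqP; rewrite eq_mulgV1; apply/eqP/(fixQ _ n) => //; first by rewrite groupM ?groupV.
  have tV : t^-1 = t by apply/eqP; rewrite eq_invg_mul -[t * t]/(t ^+ 2) -ot expg_order.
  by rewrite tV conjgM (invN s) // conjVg (invN t) // invgK.
exists t; split; first by split; [exact: (subsetP sQG) | by rewrite -ot expg_order | exact: invN].
move=> X nsX pX; apply: (@cent_involution_index _ X Q t (logn 5 #|X|)) => //.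
- exact: subset_trans sQG (normal_norm nsX).
- apply/subsetP=> h Qh; apply/cent1P/commute_sym/commgP/conjg_fixP/uniqt; first by rewrite groupJ.
  by rewrite orderJ.
- move=> s /setD1P[nts Qs].
  have nts1 : <[s]> != 1 :> {set _} by rewrite cycle_eq1.
  have [_ _ [k os]] := pgroup_pdiv (mem_p_elt pQ Qs : 2.-group <[s]>) nts1.
  exists (2 ^ k)%N; apply: uniqt; first exact: groupX.
  by rewrite (orderXexp k os) subSnn.
exact: card_pgroup pX.
Qed.

(** Since t acts on N as -1, [t, g] centralizes N and t permutes the coset g C; its 5^5 elements are
    odd in number, so one is fixed. *)
Lemma nf_fixt t : t \in G -> t ^+ 2 = 1 -> {in N, forall n, n ^ t = n^-1} ->
  {in G, forall g, exists2 c, c \in C & (g * c) ^ t = g * c}.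
Proof.
move=> Gt t2 invN g Gg; have tV : t^-1 = t by apply/eqP; rewrite eq_invg_mul -[t * t]/(t ^+ 2) t2.
have nNG x : x \in G -> x \in 'N(N) := subsetP (normal_norm nsN) x.
have Ctg : [~ t, g] \in C.
  rewrite inE groupR //; apply/centP=> n Nn; apply/commute_sym/commgP/conjg_fixP.
  have NnV : n ^ g^-1 \in N by rewrite memJ_norm // nNG ?groupV.
  have ng (m : gT) : m \in N -> m ^ (t ^ g) = m^-1.
    move=> Nm; have Nm' : m ^ g^-1 \in N by rewrite memJ_norm // nNG ?groupV.
    by rewrite [t ^ g]conjgE !conjgM invN // conjVg conjgKV.
  by rewrite commgEl tV conjgM invN // conjVg ng // invgK.
have Cgt : [~ g, t] \in C by rewrite -invg_comm groupV.
have p2 : 2.-group <[t]> by rewrite -[_.-group _]/(2.-elt t) /p_elt (pnat_dvd (_ : #[t] %| 2)%N) // order_dvdn t2.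
have acts : [acts <[t]>, on g *: C | 'J].
  rewrite cycle_subG inE inE; apply/andP; split=> //; apply/subsetP=> _ /lcosetP[c Cc ->]; rewrite inE /=.
  rewrite mem_lcoset conjMg mulgA -commgEl groupM // memJ_norm // (subsetP (normal_norm nf_nsC)) //.
have := pgroup_fix_mod p2 acts; rewrite card_lcoset nf_cardC => /eqP modE.
have /set0Pn[x /setIP[Sx /afixP fx]] : 'Fix_(g *: C | 'J)(<[t]>) != set0.
  by apply/negP=> /eqP F0; rewrite F0 cards0 !modn2 oddX in modE.
case/lcosetP: Sx fx => c Cc -> /(_ t (cycle_id t)) /= fx; by exists c.
Qed.
End Frame.

Lemma five_eq k c : (5 = k + 2 * c)%N -> [\/ c = 0%N /\ k = 5%N, c = 1%N /\ k = 3%N | k = 1%N].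
Proof.
case: c => [|[|[|c]]] kc; [by apply: Or31; split; lia | by apply: Or32; split; lia | by apply: Or33; lia | lia].
Qed.

Lemma even_eq j c : (2 + j = 2 * c)%N -> (0 < j <= 3)%N -> j = 2%N.
Proof. lia. Qed.

Lemma six_eq g : (2 * (3 * g) = g + 5 * g)%N. Proof. lia. Qed.

Lemma commg_shift (gT : finGroupType) (s u w e eps nu : gT) :
  s = w^-1 * eps -> w ^ u = w * e -> eps ^ u = nu * eps -> nu ^ eps = nu -> [~ s, u] = (e^-1) ^ s * nu.
Proof.
move=> -> wu eu nuJ; have -> : [~ w^-1 * eps, u] = (w^-1 * eps)^-1 * (w^-1 ^ u * eps ^ u) by rewrite -conjMg.
by rewrite conjVg wu eu (conjgC nu eps) nuJ conjgE !invMg invgK !mulgA.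
Qed.

Lemma square_eq (gT : finGroupType) (m y q nu : gT) : commute y (q * m^-1) ->
  m^-1 * y = (m * y * q)^-1 * nu -> (m * (q * m^-1))^-1 * nu = y * y.
Proof.
move=> cy eqe; apply: (mulgI (m * (q * m^-1))); rewrite mulKVg; have cy' : y * (q * m^-1) = q * m^-1 * y := cy.
transitivity (m * (y * (q * m^-1)) * y); last by rewrite cy' !mulgA.
by rewrite -[LHS](mulKVg (m * y * q)) -eqe !mulgA.
Qed.

Lemma reorg (gT : finGroupType) (a y nu yj nj : gT) : commute y nu -> commute yj nj -> commute y nj ->
  a * y * (nu * (yj * nj)) = a * (nu * nj) * (y * yj).
Proof.
move=> c1 c2 c3; have c2' : yj * nj = nj * yj := c2.
have c4 : y * (nu * nj) = nu * nj * y := commuteM c1 c3.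
transitivity (a * (y * (nu * nj)) * yj); first by rewrite c2' !mulgA.
by rewrite c4 !mulgA.
Qed.

Lemma gx_div i y : (0 < y < 5)%N -> exists c : GF5, forall (gT : finGroupType) (n : gT), n ^+ 5 = 1 -> n ^+ i = gx (n ^+ y) c.
Proof.
move=> lty; have [c ec] : exists c : GF5, ((y * GF5_nat c) %% 5 = i %% 5)%N.
  have := ltn_pmod i (isT : (0 < 5)%N); move: (i %% 5)%N => r.
  by case: y lty => [|[|[|[|[|y]]]]] //; case: r => [|[|[|[|[|r]]]]] // _ _;
    first [by exists f0 | by exists f1 | by exists f2 | by exists f3 | by exists f4].
exists c => gT n n5; rewrite /gx -expgM -(expg_mod i n5) -ec expg_mod //.
Qed.

Lemma commVV (gT : finGroupType) (x y : gT) : [~ x^-1, y^-1] = [~ x, y] ^ (x^-1 * y^-1).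
Proof. by rewrite /commg /conjg !invMg !invgK -!mulgA !mulKVg. Qed.

(** * Structure of C = C_G(N) when the group is not 5-closed *)

Section Core.
Variables (gT : finGroupType) (G N C P : {group gT}) (n1 n2 u b t : gT).
Hypotheses (pC : 5.-group C) (oC : #|C| = (5 ^ 5)%N) (oN : #|N| = 25%N) (nsC : C <| G) (nsN : N <| G) (sNC : N \subset C).
Hypotheses (cCN : {in C & N, forall x y, commute x y}) (N5 : {in N, forall n, n ^+ 5 = 1}).
Hypothesis trN : {in N^# &, forall x y, x \in y ^: G}.
Hypotheses (N1 : n1 \in N) (N2 : n2 \in N) (nt1 : n1 != 1) (genN : <[n1]> <*> <[n2]> = N).
Hypotheses (Pu : u \in P) (nCu : u \notin C) (n2u : n2 ^ u = n2 * n1) (n1u : n1 ^ u = n1).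
Hypotheses (Gb : b \in G) (n1b : n1 ^ b = n1 * n2) (n2b : n2 ^ b = n2) (pb : 5.-elt b).
Hypotheses (pP : 5.-group P) (oP : #|P| = (5 ^ 6)%N) (sCP : C \subset P) (sPG : P \subset G).
Hypothesis n1P : {in P, forall x, commute n1 x}.
Hypothesis camP : forall x m, x \in P -> x \notin N -> m \in N -> exists2 y, y \in P & m^-1 * [~ x, y] \in <[n1]>.
Hypotheses (Gt : t \in G) (t2 : t ^+ 2 = 1) (invN : {in N, forall n, n ^ t = n^-1}) (ut : u ^ t = u) (bt : b ^ t = b).
Hypothesis fixt : {in G, forall g, exists2 c, c \in C & (g * c) ^ t = g * c}.
Hypothesis parC : forall X : {group gT}, X <| G -> 5.-group X -> exists b0, #|X| = (#|'C_X[t]| * 25 ^ b0)%N.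
Let D := 'C_C[t]%G.

Lemma co_nC g : g \in G -> g \in 'N(C). Proof. exact: (subsetP (normal_norm nsC)). Qed.
Lemma co_nN g : g \in G -> g \in 'N(N). Proof. exact: (subsetP (normal_norm nsN)). Qed.
Lemma co_Gu : u \in G. Proof. exact: (subsetP sPG). Qed.
Lemma co_CN x : x \in N -> x \in C. Proof. exact: (subsetP sNC). Qed.
Lemma co_sK : <[n1]> \subset N. Proof. by rewrite cycle_subG. Qed.
Lemma co_K x : x \in <[n1]> -> x \in N. Proof. exact: (subsetP co_sK). Qed.

Lemma co_n2K : n2 \notin <[n1]>.
Proof.
apply: contra nt1 => /cycleP[i e]; have fx : n2 ^ u = n2 by rewrite e conjXg n1u.
by rewrite -(mulKg n2 n1) -n2u fx mulVg.
Qed.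

Lemma co_genP y : y \in P -> exists i, exists2 c, c \in C & y = u ^+ i * c.
Proof.
have nCu' : <[u]> \subset 'N(C) by rewrite cycle_subG co_nC ?co_Gu.
have sJP : <[u]> <*> C \subset P by rewrite join_subG cycle_subG Pu.
have prJ : C \proper <[u]> <*> C by rewrite properE joing_subr join_subG cycle_subG (negPf nCu).
have defJ : <[u]> <*> C = P.
  apply/eqP; rewrite eqEcard sJP oP; exact: (@pow5_subset _ C (<[u]> <*> C)%G 5 prJ oC (pgroupS sJP pP)).
by rewrite -{1}defJ norm_joinEl // => /imset2P[_ c /cycleP[i ->] Cc ->]; exists i, c.
Qed.

Lemma co_Dt x : x \in D -> x ^ t = x.
Proof. by case/setIP=> _ /cent1P ctx; apply/conjg_fixP/commgP. Qed.
Lemma co_inD x : x \in C -> x ^ t = x -> x \in D.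
Proof. by move=> Cx xt; rewrite inE Cx; apply/cent1P/commgP/conjg_fixP. Qed.
Lemma co_DC x : x \in D -> x \in C. Proof. by case/setIP. Qed.

Lemma co_DJ g x : g \in G -> g ^ t = g -> x \in D -> x ^ g \in D.
Proof.
move=> Gg gt Dx; apply: co_inD; first by rewrite memJ_norm ?co_nC ?co_DC.
by rewrite conjJg gt (co_Dt Dx).
Qed.

Lemma co_tiND x : x \in N -> x \in D -> x = 1.
Proof.
move=> Nx Dx; apply/eqP; rewrite -order_eq1 -dvdn1.
have x2 : x ^+ 2 = 1 by apply: (mulgI x^-1); rewrite mulKg mulg1 -{1}(co_Dt Dx) invN.
have : (#[x] %| gcdn 2 25)%N by rewrite dvdn_gcd order_dvdn x2 eqxx -oN order_dvdG.
by [].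
Qed.

(** If x centralized C, the Camina property would express n2 modulo <n1> as some [x, u^i], an
    element of D; but D meets N trivially. *)
Lemma co_dz x : x \in D -> {in C, forall y, commute x y} -> x = 1.
Proof.
move=> Dx cx; apply/eqP; apply: contraT => ntx; have Cx := co_DC Dx.
have nNx : x \notin N by apply: contra ntx => Nx; rewrite (co_tiND Nx Dx).
have [y Py] := camP (subsetP sCP x Cx) nNx N2.
have [i [c Cc ->]] := co_genP Py; rewrite commgMJ (_ : [~ x, c] = 1) ?mul1g; last exact/eqP/commgP/cx.
have Gui : u ^+ i \in G by rewrite groupX ?co_Gu.
have cxu : commute (x ^ u ^+ i) c.
  rewrite -[c](conjgKV (u ^+ i)); apply/commgP; rewrite -conjRg.
  have /cx/commgP/eqP-> : c ^ (u ^+ i)^-1 \in C by rewrite memJ_norm ?groupV ?co_nC.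
  by rewrite conj1g.
have Dq : [~ x, u ^+ i] \in D by rewrite commgEl groupM ?groupV // co_DJ // conjXg ut.
have -> : [~ x, u ^+ i] ^ c = [~ x, u ^+ i].
  apply/conjg_fixP/commgP; rewrite commgEl; apply/commute_sym/commuteM; last exact: commute_sym.
  exact/commuteV/commute_sym/cx.
move=> Kq; have Nq : [~ x, u ^+ i] \in N by have := groupM N2 (co_K Kq); rewrite mulKVg.
by case/negP: co_n2K; rewrite -groupV; rewrite (co_tiND Nq Dq) mulg1 in Kq.
Qed.

(** Parity allows 5, 5^3 and 5^5. The last contradicts that t inverts N; with 5^3, C = N D and a
    central element of D is central in C, against [co_dz]. *)
Lemma co_oD : #|D| = 5%N.
Proof.
have [b0 eqC] := parC nsC pC; have pD : 5.-group D := pgroupS (subsetIl _ _) pC.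
have /p_natP[k oD] := pD.
have {eqC} kE : 5%N = (k + 2 * b0)%N.
  by apply/eqP; rewrite -(eqn_exp2l _ _ (isT : (1 < 5)%N)) expnD expnM -oD -oC eqC.
case: (five_eq kE) => [[_ k5] | [_ k3] | k1]; last by rewrite oD k1.
- have eqD : D = C :> {set _} by apply/eqP; rewrite eqEcard subsetIl oC oD k5.
  by case/eqP: nt1; apply: co_tiND N1 _; have := co_CN N1; rewrite -eqD.
have tiND : N :&: D = 1 by apply/trivgP/subsetP=> x /setIP[Nx Dx]; rewrite inE (co_tiND Nx Dx).
have defC : N * D = C.
  apply/eqP; rewrite eqEcard mul_subG ?subsetIl //= TI_cardMg // oC oN oD k3 -[25%N]/(5 ^ 2)%N -expnD //.
have : 'Z(D) != 1 by rewrite (center_nil_eq1 (pgroup_nil pD)) -cardG_gt1 oD k3.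
case/trivgPn=> x /centerP[Dx cx] ntx; have Cx := co_DC Dx; case/eqP: ntx; apply: (co_dz Dx) => y; rewrite -defC => /imset2P[n d Nn Dd ->].
by apply: commuteM; [exact: cCN | exact: cx].
Qed.

Lemma co_exz : exists2 z, z \in D & z != 1.
Proof. by apply/trivgPn; rewrite -cardG_gt1 co_oD. Qed.

Section Center.
Variable z : gT.
Hypotheses (Dz : z \in D) (ntz : z != 1).
Let Cz : z \in C := co_DC Dz.

Lemma co_oz : #[z] = 5%N.
Proof.
have : (#[z] %| 5)%N by rewrite -co_oD order_dvdG.
by rewrite dvdn_prime2 ?order_eq1 // => /(pdivP _) || (case/primeP: (isT : prime 5) => _ h /h; rewrite order_eq1 (negPf ntz) => /eqP).
Qed.

Lemma co_z5 : z ^+ 5 = 1. Proof. by rewrite -co_oz expg_order. Qed.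

Lemma co_defD : D = <[z]> :> {set gT}.
Proof. by apply/esym/eqP; rewrite eqEcard cycle_subG Dz co_oD -orderE co_oz. Qed.

Lemma co_fix5 g : g \in G -> g ^ t = g -> 5.-elt g -> z ^ g = z.
Proof.
move=> Gg gt pg; have nDg : <[g]> \subset 'N(D).
  by rewrite cycle_subG inE; apply/subsetP=> _ /imsetP[x Dx ->]; apply: co_DJ.
have pJ : 5.-group (<[g]> <*> D) by rewrite norm_joinEl // pgroupM; apply/andP; split; [exact: pg | exact: pgroupS (subsetIl _ _) pC].
have nsDJ : D <| <[g]> <*> D by rewrite /normal joing_subr join_subG nDg normG.
have ntD : D != 1 :> {set _} by rewrite -cardG_gt1 co_oD.
have sDZ : D \subset 'Z(<[g]> <*> D).
  by apply: prime_meetG; [rewrite co_oD | apply: meet_center_nil (pgroup_nil pJ) nsDJ ntD].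
have /centerP[_ cz] := subsetP sDZ z Dz.
by apply/conjg_fixP/commgP/cz; rewrite (subsetP (joing_subl _ _)) ?cycle_id.
Qed.

Lemma co_zu : z ^ u = z. Proof. exact: co_fix5 co_Gu ut (mem_p_elt pP Pu). Qed.
Lemma co_zb : z ^ b = z. Proof. exact: co_fix5. Qed.
Lemma co_zt : z ^ t = z. Proof. exact: co_Dt. Qed.

(** Let X be the preimage of Z(C / N). If z were not in X, t would have no nontrivial fixed point
    there, and parity would force |X| = 25^2; then X D = C, and z is central modulo N after all. *)
Lemma co_zN y : y \in C -> [~ z, y] \in N.
Proof.
have nCN : C \subset 'N(N) := subset_trans (normal_sub nsC) (normal_norm nsN).
have nsNC : N <| C by rewrite /normal sNC.
pose X := (coset N @*^-1 'Z(C / N))%G.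
suffices Zz : coset N z \in 'Z(C / N).
  move=> Cy; have /centerP[_ cz] := Zz; have Nz := subsetP nCN z Cz; have Ny := subsetP nCN y Cy.
  apply: coset_idr; first by rewrite groupR.
  by rewrite morphR //; apply/eqP/commgP/cz/mem_quotient.
have sXC : X \subset C by rewrite -(quotientGK nsNC) morphpreS ?center_sub.
have nsX : X <| G.
  by rewrite -(quotientGK nsN) cosetpre_normal gFnormal_trans ?quotient_normal.
have pX : 5.-group X := pgroupS sXC pC.
have oX : #|X| = (25 * #|'Z(C / N)|)%N by rewrite /= card_cosetpre oN.
apply: contraT => nZz; have [b0 eqX] := parC nsX pX.
have inX x : x \in X -> coset N x \in 'Z(C / N) by case/morphpreP.
have tiXt : 'C_X[t] = 1.
  apply/eqP; apply: contraT => ntX; case/negP: nZz; apply: inX.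
  have sXD : 'C_X[t] \subset D by rewrite setSI.
  suffices /subsetP/(_ z Dz)/setIP[] : D \subset 'C_X[t] by [].
  by apply: prime_meetG; rewrite ?co_oD // (setIidPr sXD).
have ntCN : C / N != 1.
  apply/eqP=> CN1; have : C \subset N by rewrite -quotient_sub1 // CN1.
  by move/subset_leq_card; rewrite oC oN -[25%N]/(5 ^ 2)%N leq_exp2l.
have pCN : 5.-group (C / N) := quotient_pgroup N pC.
have ntZ : 'Z(C / N) != 1 by rewrite (center_nil_eq1 (pgroup_nil pCN)).
have /p_natP[j oZ] := pgroupS (center_sub _) pCN.
have j1 : (0 < j)%N by rewrite lt0n; apply: contra ntZ => /eqP j0; rewrite trivg_card1 oZ j0.
have j3 : (j <= 3)%N.
  by have := subset_leq_card sXC; rewrite oX oZ oC -[25%N]/(5 ^ 2)%N -expnD leq_exp2l.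
have j2 : j = 2%N.
  move: eqX; rewrite tiXt cards1 mul1n oX oZ -[25%N]/(5 ^ 2)%N -expnD -expnM => /eqP.
  by rewrite eqn_exp2l // => /eqP/even_eq; apply; rewrite j1.
have tiXD : X :&: D = 1.
  by apply/trivgP; rewrite -tiXt; apply/subsetP=> x /setIP[Xx /setIP[_ tx]]; apply/setIP.
have defC : X * D = C.
  apply/eqP; rewrite eqEcard mul_subG ?subsetIl //= TI_cardMg // oC co_oD oX oZ j2 -[25%N]/(5 ^ 2)%N.
  by rewrite -expnD -expnSr.
case/negP: nZz; apply/centerP; split=> [|_ /morphimP[y' _ Cy ->]]; first exact: mem_quotient.
move: Cy; rewrite -defC => /imset2P[x d Xx Dd ->].
have nX := subsetP nCN _ (subsetP sXC x Xx); have nD := subsetP nCN _ (co_DC Dd).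
rewrite morphM //; apply: commuteM.
  by have /centerP[_ cx] := inX x Xx; apply/commute_sym/cx/mem_quotient.
by move: Dd; rewrite co_defD => /cycleP[i ->]; rewrite morphX ?(subsetP nCN) //; apply: commuteX.
Qed.

Lemma co_bM x y : x \in C -> y \in C -> [~ z, x * y] = [~ z, x] * [~ z, y].
Proof.
move=> Cx Cy; have fx : [~ z, x] ^ y = [~ z, x].
  by apply/conjg_fixP/commgP/commute_sym/cCN; rewrite ?co_zN.
by rewrite commgMJ fx; apply: cCN; rewrite ?co_zN // co_CN ?co_zN.
Qed.

Lemma co_bV x : x \in C -> [~ z, x^-1] = [~ z, x]^-1.
Proof. by move=> Cx; apply: (mulgI [~ z, x]); rewrite mulgV -co_bM ?groupV // mulgV commg1. Qed.

Lemma co_bX x i : x \in C -> [~ z, x ^+ i] = [~ z, x] ^+ i.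
Proof. by move=> Cx; apply: commgX; apply: cCN; rewrite ?co_zN. Qed.

Lemma co_Xb x i : x \in C -> [~ z ^+ i, x] = [~ z, x] ^+ i.
Proof. by move=> Cx; apply: commXg; apply: cCN; rewrite ?co_zN. Qed.

(** Cosets of C have representatives commuting with t, which therefore normalize <z>; so the values
    [z, y] are stable under G, which is transitive on N^#. *)
Lemma co_surj m : m \in N -> exists2 y, y \in C & [~ z, y] = m.
Proof.
have [-> _ | ntm Nm] := eqVneq m 1; first by exists 1; rewrite ?group1 // commg1.
have [y0 Cy0 nty0] : exists2 y0, y0 \in C & [~ z, y0] != 1.
  apply/exists_inP; apply: contraT; rewrite negb_exists_in => /forall_inP cz; case/eqP: ntz.
  by apply: co_dz => // y Cy; apply/commgP; have := cz y Cy; rewrite negbK.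
have /imsetP[g Gg ->] : m \in [~ z, y0] ^: G by apply: trN; rewrite !inE ?ntm ?nty0 ?co_zN.
have [c Cc gt] := fixt Gg; set g' := g * c in gt.
have Gg' : g' \in G by rewrite groupM // (subsetP (normal_sub nsC)).
have -> : [~ z, y0] ^ g = [~ z, y0] ^ g'.
  rewrite conjgM; apply/esym/conjg_fixP/commgP/commute_sym/cCN => //.
  by rewrite memJ_norm ?co_nN // co_zN.
have : z ^ g' \in D by apply: co_DJ.
rewrite conjRg co_defD => /cycleP[i ->]; have Cy : y0 ^ g' \in C by rewrite memJ_norm ?co_nC.
by exists ((y0 ^ g') ^+ i); rewrite ?groupX // co_bX // co_Xb.
Qed.

Lemma co_cz x : x \in C -> [~ z, x] = 1 -> exists m i, [/\ m \in N, (i < 5)%N & x = m * z ^+ i].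
Proof.
move=> Cx cx; have oCz : #|'C_C[z]| = 125%N.
  have := class_full_commg Cz sNC co_zN co_surj; rewrite oC oN -[25%N]/(5 ^ 2)%N -[(5 ^ 5)%N]/(5 ^ 3 * 5 ^ 2)%N.
  by move/eqP; rewrite eqn_pmul2r // => /eqP <-.
have tiND : N :&: D = 1 by apply/trivgP/subsetP=> y /setIP[Ny Dy]; rewrite inE (co_tiND Ny Dy).
have defE : N * D = 'C_C[z].
  apply/eqP; rewrite eqEcard oCz TI_cardMg // oN co_oD andbT.
  apply/subsetP=> _ /imset2P[m d Nm Dd ->]; apply/setIP; split; first exact: groupM (co_CN Nm) (co_DC Dd).
  rewrite groupM //; first by apply/cent1P/commute_sym/cCN.
  by move: Dd; rewrite co_defD => /cycleP[i ->]; apply/cent1P/commute_sym/commuteX.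
have : x \in N * D by rewrite defE inE Cx; apply/cent1P/commute_sym/commgP/eqP.
case/imset2P=> m d Nm; rewrite co_defD => /cyclePmin[i lt_i ->] ->.
by exists m, i; split=> //; rewrite -co_oz.
Qed.

Lemma co_CR x y : x \in C -> y \in C -> [~ z, [~ x, y]] = 1.
Proof.
move=> Cx Cy; have -> : [~ x, y] = x^-1 * (y^-1 * (x * y)) by [].
rewrite !co_bM ?groupM ?groupV // !co_bV //.
have cN a b' : a \in C -> b' \in C -> commute [~ z, a] [~ z, b'] by move=> Ca Cb; exact: cCN (co_CN (co_zN Ca)) (co_zN Cb).
by rewrite (cN x y) // mulKg mulVg.
Qed.

Lemma co_EJ x m i s : m \in N -> x = m * z ^+ i -> s \in C -> x ^ s = x * [~ z, s] ^+ i.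
Proof.
move=> Nm -> Cs; have fm : m ^ s = m by apply/conjg_fixP/commgP/commute_sym/cCN.
rewrite conjMg fm conjXg conjg_mulR expgMn ?mulgA //; by apply: cCN; rewrite ?co_zN.
Qed.

Lemma co_ER x s : x \in C -> [~ z, x] = 1 -> s \in C -> [~ x, s] \in N.
Proof.
move=> Cx cx Cs; have [m [i [Nm _ def_x]]] := co_cz Cx cx.
by rewrite commgEl (co_EJ Nm def_x Cs) mulKg groupX ?co_zN.
Qed.

Lemma co_E5 x : x \in C -> [~ z, x] = 1 -> x ^+ 5 = 1.
Proof.
move=> Cx cx; have [m [i [Nm _ ->]]] := co_cz Cx cx; have cm : commute m (z ^+ i) by apply/commute_sym/cCN; rewrite // groupX.
by rewrite expgMn // N5 // mul1g -expgM mulnC expgM co_z5 expg1n.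
Qed.

Lemma co_C5 x y : x \in C -> y \in C -> (x * y) ^+ 5 = x ^+ 5 * y ^+ 5.
Proof.
move=> Cx Cy; have Cc : [~ y, x] \in C by rewrite groupR.
have cc := co_CR Cy Cx; have Nn := co_ER Cc cc Cx; have Nm := co_ER Cc cc Cy.
have cN a w : a \in N -> w \in C -> w ^ a = w by move=> Na Cw; apply/conjg_fixP/commgP/cCN.
apply: (@expMg_5 _ x y [~ y, x] [~ [~ y, x], x] [~ [~ y, x], y]); rewrite -?conjg_mulR //; try by apply: cCN.
- by apply/conjg_fixP/commgP/commute_sym/cCN.
- by apply: cCN; rewrite ?co_CN.
- exact: co_E5.
- exact: N5.
exact: N5.
Qed.

Lemma co_exw2 : exists w2, [/\ w2 \in C, w2 ^ t = w2^-1 & [~ z, w2] = n2].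
Proof.
(* The square of n2 is used because v^-1 v^t multiplies the exponent by -2, and -4 = 1 modulo 5. *)
have [v Cv def_v] := co_surj (groupX 2 N2); have Cvt : v ^ t \in C by rewrite memJ_norm ?co_nC.
have tt x : (x ^ t) ^ t = x by rewrite -conjgM -[t * t]/(t ^+ 2) t2 conjg1.
exists (v^-1 * v ^ t); split; first by rewrite groupM ?groupV.
  by rewrite conjMg conjVg tt [RHS]invMg invgK.
rewrite co_bM ?groupV // co_bV // -{2}co_zt -conjRg def_v invN ?groupX // -expgVn -expgD.
by rewrite expgVn; apply: (mulgI (n2 ^+ 4)); rewrite mulgV -expgSr N5.
Qed.

Variable w2 : gT.
Hypotheses (Cw2 : w2 \in C) (w2t : w2 ^ t = w2^-1) (zw2 : [~ z, w2] = n2).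
Let w1 := [~ w2, u].

Lemma co_w2u : w2 ^ u = w2 * w1. Proof. exact: conjg_mulR. Qed.
Lemma co_Cw1 : w1 \in C.
Proof. by rewrite /w1 commgEl groupM ?groupV // memJ_norm ?co_nC ?co_Gu. Qed.
Let Cw1 := co_Cw1.

Lemma co_zw1 : [~ z, w1] = n1.
Proof.
have zw2u : [~ z, w2 ^ u] = n2 ^ u by rewrite -zw2 conjRg co_zu.
have -> : w1 = w2^-1 * w2 ^ u by [].
by rewrite co_bM ?groupV ?memJ_norm ?co_nC ?co_Gu // co_bV // zw2 zw2u n2u mulKg.
Qed.

Lemma co_w1t : w1 ^ t = (w1^-1) ^ w2^-1.
Proof. by rewrite /w1 conjRg w2t ut /commg /conjg !invMg !invgK -!mulgA mulgV mulg1. Qed.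

(** Write the commutator as m z^g. As t inverts w2, and w1 up to conjugation, comparison with the
    image under t gives m^2 = (n1 n2^2)^g, whose cube is m. *)
Lemma co_rel : exists2 g, (g < 5)%N & [~ w1, w2] = n1 ^+ (3 * g) * n2 ^+ g * z ^+ g.
Proof.
have [m [g [Nm lt_g def_a]]] := co_cz (groupR Cw1 Cw2) (co_CR Cw1 Cw2); exists g => //.
set s := w1^-1 * w2^-1 * w2^-1; have Cs : s \in C by rewrite !groupM ?groupV.
have at1 : [~ w1, w2] ^ t = [~ w1, w2] ^ s.
  rewrite conjRg co_w1t w2t; have {2}-> : w2^-1 = (w2^-1) ^ (w2^-1) by rewrite conjgE mulKg.
  by rewrite -conjRg commVV -conjgM.
set r := n1 * n2 ^+ 2; have Nr : r \in N by rewrite groupM // groupX.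
have c12 : commute n1 n2 by apply: cCN; rewrite ?co_CN.
have zs : [~ z, s] = r^-1.
  rewrite !co_bM ?groupM ?groupV // !co_bV // co_zw1 zw2 /r invMg expgS expg1 invMg.
  rewrite -mulgA; apply: cCN; rewrite ?groupM ?groupV // co_CN //.
move: at1; rewrite (co_EJ Nm def_a Cs) def_a conjMg invN // conjXg co_zt zs => eqm.
have Nq : r^-1 ^+ g \in N by rewrite groupX ?groupV.
have cq : commute (z ^+ g) (r^-1 ^+ g) by apply: cCN => //; exact: groupX.
have {}eqm : m^-1 = m * r^-1 ^+ g by apply: (mulIg (z ^+ g)); rewrite eqm -!mulgA cq.
have cNN x y : x \in N -> y \in N -> commute x y by move=> Nx Ny; apply: cCN; rewrite ?co_CN.
have mm : m * m = r ^+ g.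
  apply: (mulIg (r^-1 ^+ g)); rewrite -mulgA -eqm mulgV expgVn mulgV //.
have -> : m = (m * m) ^+ 3 by rewrite -[m * m]/(m ^+ 2) -expgM expgS N5 ?mulg1.
rewrite mm -expgM mulnC /r expgMn; last by apply: cNN; rewrite ?groupX.
congr (_ * _ * _); rewrite -expgM -[X in _ = X]mulg1 -[X in _ = _ * X](expg1n _ g) -(N5 N2) -expgM -expgD.
by rewrite six_eq.
Qed.

Lemma co_ND5 i : z ^+ i \in N -> (5 %| i)%N.
Proof. by move=> Nz; rewrite -co_oz order_dvdn (co_tiND Nz) ?groupX. Qed.

(** The commutator centralizes z, so it is m z^d with m in N; comparing it with its image under t
    puts z^(2 d) in N, so d = 0. *)
Lemma co_e : [~ w1, u] \in N.
Proof.
set e := [~ w1, u]; have Gu := co_Gu; have Gn := subsetP (normal_sub nsC).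
have Cw1u : w1 ^ u \in C by rewrite memJ_norm ?co_nC.
have Ce : e \in C by rewrite /e commgEl groupM ?groupV.
have ze : [~ z, e] = 1.
  have -> : e = w1^-1 * w1 ^ u by []. 
  have zz : [~ z, w1 ^ u] = n1 by rewrite -{1}co_zu -conjRg co_zw1.
  by rewrite co_bM ?groupV // co_bV // co_zw1 zz mulVg.
have [m [d [Nm lt_d def_e]]] := co_cz Ce ze.
have Cw1t : w1 ^ t \in C by rewrite memJ_norm ?co_nC.
pose eps := w1 * w1 ^ t; have Ceps : eps \in C by rewrite groupM.
have zeps : [~ z, eps] = 1.
  have zz : [~ z, w1 ^ t] = n1^-1 by rewrite -{1}co_zt -conjRg co_zw1 invN.
  by rewrite co_bM // co_zw1 zz mulgV.
have [m' [k [Nm' _ def_eps]]] := co_cz Ceps zeps.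
pose nu := m' ^ u * m'^-1; have Nnu : nu \in N by rewrite groupM ?groupV // memJ_norm ?co_nN.
have eps_u : eps ^ u = nu * eps by rewrite def_eps conjMg conjXg co_zu /nu -!mulgA mulKg.
pose s := w1^-1 * eps; have Cs : s \in C by rewrite groupM ?groupV.
have w1tE : w1 ^ t = s by rewrite /s /eps mulKg.
have et : e ^ t = (e^-1) ^ s * nu.
  have -> : e ^ t = [~ s, u] by rewrite /e conjRg ut w1tE.
  apply: (commg_shift (erefl _) _ eps_u); first exact: conjg_mulR.
  by apply/conjg_fixP/commgP/commute_sym/cCN.
move: et; rewrite conjVg (co_EJ Nm def_e Cs) def_e conjMg invN // conjXg co_zt.
set q := [~ z, s] ^+ d; have Nq : q \in N by rewrite groupX ?co_zN.
move=> eqe; have Nz2 : z ^+ d * z ^+ d \in N.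
  have cz : commute (z ^+ d) (q * m^-1) by apply: cCN; rewrite ?groupX // groupM ?groupV.
  by rewrite -(square_eq cz eqe) groupM ?groupV // groupM // groupM ?groupV.
rewrite -expgD in Nz2; have := co_ND5 Nz2.
by case: (d) lt_d => [|[|[|[|[|]]]]] //; rewrite expg0 mulg1.
Qed.

Lemma co_o1 : #[n1] = 5%N. Proof. by apply: nt_prime_order => //; apply: N5. Qed.
Lemma co_o2 : #[n2] = 5%N.
Proof. by apply: nt_prime_order; rewrite ?N5 //; apply: contraNneq co_n2K => ->. Qed.

Lemma co_Nab m : m \in N -> exists a d, [/\ (a < 5)%N, (d < 5)%N & m = n1 ^+ a * n2 ^+ d].
Proof.
have cn : <[n1]> \subset 'C(<[n2]>) by rewrite cycle_subG; apply/centP=> _ /cycleP[i ->]; apply/commuteX/cCN; rewrite ?co_CN.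
rewrite -{1}genN cent_joinEl // => /imset2P[_ _ /cyclePmin[a lta ->] /cyclePmin[d ltd ->] ->].
by rewrite co_o1 in lta; rewrite co_o2 in ltd; exists a, d.
Qed.

Lemma co_KJ x y : x \in <[n1]> -> y \in P -> x ^ y = x.
Proof.
by case/cycleP=> i -> Py; rewrite conjXg; congr (_ ^+ _); apply/conjg_fixP/commgP/n1P.
Qed.

(** Otherwise the Camina property for w1 reduces, modulo <n1>, to reaching n2 by some [w1, w2^d].
    Its component z^(g d) must vanish, which forces g = 0 or d = 0 and makes the commutator
    trivial. *)
Lemma co_eK : [~ w1, u] \notin <[n1]>.
Proof.
apply/negP=> Ke; have [g lt_g rel] := co_rel; have CP c : c \in C -> c \in P := subsetP sCP c.
have nNw1 : w1 \notin N.
  apply: contra nt1 => Nw1; rewrite -co_zw1; apply/eqP/eqP/commgP; exact: cCN.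
have [y0 Py] := camP (CP _ Cw1) nNw1 N2; have [i [c Cc def_y]] := co_genP Py.
rewrite def_y commgMJ; have cue : commute u [~ w1, u].
  by apply/commute_sym/commgP/conjg_fixP/co_KJ.
rewrite commgX // mulgA groupMr; last by rewrite co_KJ ?groupX ?CP.
have [a [d [_ lt_d def_zc]]] := co_Nab (co_zN Cc).
pose v := w1 ^+ a * w2 ^+ d; have Cv : v \in C by rewrite groupM ?groupX.
pose eps := c * v^-1; have Ceps : eps \in C by rewrite groupM ?groupV.
have zeps : [~ z, eps] = 1.
  by rewrite co_bM ?groupV // co_bV // co_bM ?groupX // !co_bX // co_zw1 zw2 def_zc mulgV.
have [m [k [Nm _ def_eps]]] := co_cz Ceps zeps.
have K1 : [~ w1, eps] \in <[n1]>.
  by rewrite -invg_comm groupV commgEl (co_EJ Nm def_eps Cw1) mulKg co_zw1 groupX ?cycle_id.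
have -> : c = eps * v by rewrite mulgKV.
rewrite commgMJ mulgA groupMr; last by rewrite co_KJ ?CP.
have cw1 : [~ w1, w1 ^+ a] = 1 by apply/eqP/commgP/commuteX.
rewrite /v commgMJ cw1 conj1g mulg1 => Kf.
have Nf : [~ w1, w2 ^+ d] \in N by have := groupM N2 (co_K Kf); rewrite mulKVg.
have f j : exists2 nu, nu \in N & w1 ^ (w2 ^+ j) = w1 * (nu * z ^+ (g * j)).
  elim: j => [|j [nu Nnu IH]]; first by exists 1; rewrite ?group1 // muln0 expg0 conjg1 !mulg1.
  have zw : (z ^+ (g * j)) ^ w2 = z ^+ (g * j) * n2 ^+ (g * j).
    by rewrite conjXg conjg_mulR zw2 expgMn //; apply: cCN.
  have nw : nu ^ w2 = nu by apply/conjg_fixP/commgP/commute_sym/cCN.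
  exists (n1 ^+ (3 * g) * n2 ^+ g * (nu * n2 ^+ (g * j))); first by rewrite !groupM ?groupX.
  have w1w : w1 ^ w2 = w1 * (n1 ^+ (3 * g) * n2 ^+ g * z ^+ g) by rewrite conjg_mulR rel.
  rewrite expgSr conjgM IH conjMg w1w (conjMg nu) zw nw mulnS (expgD z) -mulgA; congr (_ * _).
  by apply: reorg; apply: cCN; rewrite ?groupX.
have [nu Nnu fd] := f d; move: Nf; rewrite commgEl fd mulKg groupMl // => /co_ND5.
rewrite Euclid_dvdM // => /orP[] g0.
  have g00 : g = 0%N by case: (g) g0 lt_g => [|[|[|[|[|]]]]].
  have c12 : commute w1 w2 by apply/commgP; rewrite rel g00 muln0 !expg0 !mulg1.
  have c12' : [~ w1, w2 ^+ d] = 1 by apply/eqP/commgP/commuteX.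
  by move: Kf; rewrite c12' mulg1 groupV (negPf co_n2K).
have d0 : d = 0%N by case: (d) g0 lt_d => [|[|[|[|[|]]]]].
by move: Kf; rewrite d0 expg0 commg1 mulg1 groupV (negPf co_n2K).
Qed.

(** As t fixes u^5, it equals some z^j. Conjugation by w2 sends u to u w1^-1 and yields w1^-5 =
    n2^j; u fixes the left side but moves n2, so 5 divides j. *)
Lemma co_u5 : u ^+ 5 = 1 /\ w1 ^+ 5 = 1.
Proof.
set e := [~ w1, u]; have Ne : e \in N := co_e; have Gu := co_Gu.
have nCP : P \subset 'N(C) := subset_trans sPG (normal_norm nsC).
have Cu5 : u ^+ 5 \in C.
  have oPC : #|P / C| = 5%N.
    rewrite card_quotient //; have := Lagrange sCP; rewrite oC oP (expnSr 5 5) => /eqP.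
    by rewrite eqn_pmul2l ?expn_gt0 // => /eqP.
  have Nu : u \in 'N(C) := subsetP nCP u Pu.
  apply: coset_idr; first by rewrite groupX.
  by rewrite morphX // -oPC expg_cardG ?mem_quotient.
have /cycleP[j def_u5] : u ^+ 5 \in <[z]> by rewrite -co_defD co_inD // conjXg ut.
have cNC n c : n \in N -> c \in C -> commute n c by move=> Nn Cc; apply/commute_sym/cCN.
have w1u : w1 ^ u = w1 * e := conjg_mulR _ _.
have Neu : e ^ u \in N by rewrite memJ_norm ?co_nN.
have Cw1V : w1^-1 \in C by rewrite groupV.
have NeV : e^-1 \in N by rewrite groupV.
have [a [d [_ _ def_e]]] := co_Nab Ne.
have c12 : commute n1 n2 by apply: cNC; rewrite ?co_CN.
have eu : e ^ u = e * n1 ^+ d.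
  by rewrite def_e conjMg !conjXg n1u n2u expgMn ?mulgA //; apply: commute_sym.
have Nn : (n1 ^+ d)^-1 \in N by rewrite groupV groupX.
have pw : (u * w1^-1) ^+ 5 = u ^+ 5 * w1^-1 ^+ 5.
  apply: (@expMg_5 _ u w1^-1 e^-1 (n1 ^+ d)^-1 1).
  - by rewrite conjVg w1u invMg; apply: cNC.
  - by rewrite conjVg eu invMg; apply: cNC; rewrite ?co_CN.
  - by rewrite conjVg conjXg n1u.
  - by rewrite mulg1; apply/conjg_fixP/commgP/cNC.
  - exact/commute_sym/cNC.
  - by rewrite /commute mulg1 mul1g.
  - by apply: cNC; rewrite ?co_CN.
  - by apply: cNC; rewrite ?co_CN ?group1.
  - by apply: cNC; rewrite ?co_CN ?group1.
  - by rewrite N5.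
  - by rewrite N5.
  exact: expg1n.
have uw2 : u ^ w2 = u * w1^-1.
  by rewrite /w1 invg_comm -conjg_mulR.
have z5w : w1^-1 ^+ 5 = n2 ^+ j.
  apply: (mulgI (u ^+ 5)); rewrite -pw -uw2 -conjXg def_u5 conjXg conjg_mulR zw2 expgMn //.
  by apply: cCN.
have w15 : (w1^-1 ^+ 5) ^ u = w1^-1 ^+ 5.
  rewrite conjXg conjVg w1u invMg expgMn; last exact: cNC.
  by rewrite (N5 NeV) mul1g.
have j5 : (5 %| j)%N.
  rewrite -co_o1 order_dvdn; apply/eqP; move: w15; rewrite z5w conjXg n2u expgMn; last exact: commute_sym.
  by move/(canRL (mulKg _)); rewrite mulVg.
have /dvdnP[j' def_j] := j5; rewrite def_j in def_u5 z5w.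
have u51 : u ^+ 5 = 1 by rewrite def_u5 mulnC expgM co_z5 expg1n.
split=> //; apply: invg_inj; by rewrite invg1 -expgVn z5w mulnC expgM N5 // expg1n.
Qed.

(** Modulo C_C(z), conjugation by b takes w1 to w1 w2, and taking fifth powers is multiplicative on
    C. *)
Lemma co_w25 : w2 ^+ 5 = 1.
Proof.
have [_ w15] := co_u5; have Cw1b : w1 ^ b \in C by rewrite memJ_norm ?co_nC.
pose eps := w1 ^ b * (w1 * w2)^-1; have Ceps : eps \in C := groupM Cw1b (groupVr (groupM Cw1 Cw2)).
have zeps : [~ z, eps] = 1.
  have zz : [~ z, w1 ^ b] = n1 * n2 by rewrite -{1}co_zb -conjRg co_zw1.
  have C12 := groupM Cw1 Cw2.
  by rewrite co_bM ?groupV // zz co_bV // co_bM // co_zw1 zw2 mulgV.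
have : (w1 ^ b) ^+ 5 = eps ^+ 5 * (w1 ^+ 5 * w2 ^+ 5).
  have eq1 : w1 ^ b = eps * (w1 * w2) := esym (mulgKV _ _).
  by rewrite {1}eq1 (co_C5 Ceps (groupM Cw1 Cw2)) (co_C5 Cw1 Cw2).
by rewrite -conjXg w15 conj1g (co_E5 Ceps zeps) !mul1g.
Qed.

Lemma co_exp5 c : c \in C -> c ^+ 5 = 1.
Proof.
move=> Cc; have [_ w15] := co_u5; have [a [d [_ _ def_zc]]] := co_Nab (co_zN Cc).
pose v := w1 ^+ a * w2 ^+ d; have Cv : v \in C by rewrite groupM ?groupX.
pose eps := c * v^-1; have Ceps : eps \in C by rewrite groupM ?groupV.
have zeps : [~ z, eps] = 1.
  by rewrite co_bM ?groupV // co_bV // co_bM ?groupX // !co_bX // co_zw1 zw2 def_zc mulgV.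
have -> : c = eps * v by rewrite mulgKV.
rewrite co_C5 // (co_E5 Ceps zeps) mul1g co_C5 ?groupX // -!expgM mulnC (mulnC d) !expgM w15 co_w25.
by rewrite !expg1n mulg1.
Qed.

(** The exponent y of n2 in [w1, u] is nonzero by [co_eK]; with the y-th powers of n1, n2, z as
    basis it becomes 1. *)
Lemma co_pre : exists gam x mu, nc_pre G N C gam x mu.
Proof.
have [g lt_g rel] := co_rel; have [i [y [_ lt_y def_e]]] := co_Nab co_e.
have y0 : (0 < y)%N.
  rewrite lt0n; apply: contra co_eK => /eqP y0; by rewrite def_e y0 expg0 mulg1 mem_cycle.
have lty : (0 < y < 5)%N by rewrite y0.
have [X hX] := gx_div i lty; have [gm hg] := gx_div g lty; have [mu hmu] := gx_div (3 * g) lty.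
have cNC n c : n \in N -> c \in C -> commute n c by move=> Nn Cc; apply/commute_sym/cCN.
have c12 : commute n1 n2 by apply: cNC; rewrite ?co_CN.
have c1z : commute n1 z by apply: cNC.
have c2z : commute n2 z by apply: cNC.
have cX (p q : gT) : commute p q -> commute (p ^+ y) (q ^+ y).
  by move=> c; apply/commuteX/commute_sym/commuteX/commute_sym.
have x5 (p : gT) : p ^+ 5 = 1 -> (p ^+ y) ^+ 5 = 1 by move=> p5; rewrite -expgM mulnC expgM p5 expg1n.
have fixN n c : n \in N -> c \in C -> n ^ c = n by move=> Nn Cc; apply/conjg_fixP/commgP/cNC.
have n15 := N5 N1; have n25 := N5 N2.
have JX (p q w : gT) : p ^ w = q -> (p ^+ y) ^ w = q ^+ y by move=> <-; rewrite conjXg.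
have zw1J : z ^ w1 = z * n1 by rewrite conjg_mulR co_zw1.
have zw2J : z ^ w2 = z * n2 by rewrite conjg_mulR zw2.
have [eM sh] : _ := @basis_exists _ (n1 ^+ y) (n2 ^+ y) (z ^+ y) w1 w2 u b
  (cX _ _ c12) (cX _ _ c1z) (cX _ _ c2z) (x5 _ n15) (x5 _ n25) (x5 _ co_z5)
  (JX _ _ _ (fixN _ _ N1 Cw1)) (JX _ _ _ (fixN _ _ N2 Cw1)) (etrans (JX _ _ _ zw1J) (expgMn y (commute_sym c1z)))
  (JX _ _ _ (fixN _ _ N1 Cw2)) (JX _ _ _ (fixN _ _ N2 Cw2)) (etrans (JX _ _ _ zw2J) (expgMn y (commute_sym c2z)))
  (JX _ _ _ n1u) (etrans (JX _ _ _ n2u) (expgMn y (commute_sym c12))) (JX _ _ _ co_zu)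
  (etrans (JX _ _ _ n1b) (expgMn y c12)) (JX _ _ _ n2b) (JX _ _ _ co_zb).
set e := fun x : V * GF5 => _ in eM sh.
exists gm, X, mu, e, w1, w2, u, b; split=> //.
- have e10 : e ((1, 0), 0)%R = n1 ^+ y by rewrite /e /pw /gx /= !expg0 expg1 !mulg1.
  split=> // [||x]; rewrite ?e10 ?groupX //.
    rewrite -order_dvdn co_o1; by case: (y) lty => [|[|[|[|[|]]]]].
  by rewrite /e /pw /gx !groupM ?groupX // co_CN ?groupX.
- split; first exact: co_w2u.
    by rewrite conjg_mulR def_e (hX _ _ n15) /e /pw /gx /= expg0 expg1 mulg1.
  by rewrite rel (hmu _ _ n15) (hg _ _ n25) (hg _ _ co_z5).
by split; rewrite ?co_Gu //; case: co_u5.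
Qed.
End Center.

Lemma co_pre_ex : (exists gam x mu, nc_pre G N C gam x mu) /\ {in C, forall c, c ^+ 5 = 1}.
Proof.
have [z Dz ntz] := co_exz; have [w2 [Cw2 w2t zw2]] := co_exw2 Dz ntz.
split; first exact: (co_pre Dz ntz Cw2 w2t zw2).
by move=> c Cc; exact: (co_exp5 Dz ntz Cw2 zw2 Cc).
Qed.
End Core.

(** * Models over SL_2(5): matrices, twists and exhaustive checks *)

Definition ncode := ((V * V) * (V * V))%type.
Definition nA (k : ncode) (x : V) := lin2 k.1.1 k.1.2 x.
Definition nL (k : ncode) (x : V) := lin2 k.2.1 k.2.2 x.
(** The product of block triangular matrices with equal diagonal blocks [nA] and off-diagonal block
    [nL]. *)
Definition nM (k k' : ncode) : ncode :=
  ((nA k' k.1.1, nA k' k.1.2), ((nA k' k.2.1 + nL k' k.1.1)%R, (nA k' k.2.2 + nL k' k.1.2)%R)).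
Definition n1 : ncode := ((oneV, sqV), (0, 0))%R.
(** The twists are chosen so that [nU] and [nB] generate only 120 codes, one over each matrix. *)
Definition nU : ncode := (((f1, f0), (f1, f1)), ((f0, f1), (f0, f1))).
Definition nB : ncode := (((f1, f1), (f0, f1)), ((f0, f2), (f1, f1))).
Definition nstep (s : seq ncode * seq ncode) : seq ncode * seq ncode :=
  let new := undup (filter (fun k => k \notin s.1) ([seq nM k nU | k <- s.2] ++ [seq nM k nB | k <- s.2])) in
  (s.1 ++ new, new).
(* A complement SL_2(5) to C in each of the two groups; the code records its     *)
(* action on N and a twist.                                                      *)
Definition nS : seq ncode := Eval vm_compute in (iter 20 nstep ([:: n1], [:: n1])).1.
Definition nDD : seq V := [seq (c, f0) | c <- GF5s].

(** The last clause, that each code after the first is an earlier one times a generator, supports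
    the induction on indices in [nc_genG]. *)
Definition nS_ok := [&& n1 \in nS, uniq [seq k.1 | k <- nS], (nU \in nS) && (nB \in nS),
  all (fun k => all (fun k' => nM k k' \in nS) nS) nS,
  all (fun k : ncode => dt k.1.1 k.1.2 == 1%R) nS &
  all (fun i => (i == 0%N) || has (fun j => (nth n1 nS i == nM (nth n1 nS j) nU)
      || (nth n1 nS i == nM (nth n1 nS j) nB)) (iota 0 i)) (iota 0 120)].
Lemma nS_okP : nS_ok. Proof. by vm_compute. Qed.

Lemma nS_size : size nS = 120%N. Proof. by []. Qed.
Lemma inj_in_uniq_map (T1 T2 : eqType) (f : T1 -> T2) (s : seq T1) :
  uniq (map f s) -> {in s &, injective f}.
Proof.
elim: s => //= x s IHs /andP[nfx us] y z; rewrite !inE.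
case/predU1P=> [-> | sy] /predU1P[-> | sz] // eqf; last exact: IHs us y z sy sz eqf.
  by rewrite eqf map_f in nfx.
by rewrite -eqf map_f in nfx.
Qed.

Definition m2 (a b : V * V) : V * V := (lin2 b.1 b.2 a.1, lin2 b.1 b.2 a.2).
Definition m2i (a : V * V) : V * V := ((a.2.2, - a.1.2), (- a.2.1, a.1.1))%R.
Definition m2id : V * V := (oneV, sqV).
Definition m2x a m := iter m (fun x => m2 x a) m2id.
Definition m2c a b := m2 (m2 (m2i a) (m2i b)) (m2 a b).
Definition scal (a : V * V) := (a == m2id) || (a == (- oneV, - sqV)%R).
(** A computable substitute for the simplicity of PSL_2(5): commutators c with a nonscalar a supply
    nonscalar elements whose fifth power is 1 (c^6 when c^10 = 1) or whose cube is 1 (c^4 when c^6 =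
    1), and some [a, [a, b]] is nonscalar. *)
Definition commutator_test (Ms : seq (V * V)) := all (fun a => if scal a then true else
  [&& has (fun b => let c := m2c a b in ~~ scal (m2x c 6) && (m2x c 10 == m2id)) Ms,
      has (fun b => let c := m2c a b in ~~ scal (m2x c 4) && (m2x c 6 == m2id)) Ms
    & has (fun b => ~~ scal (m2c a (m2c a b))) Ms]) Ms.
Lemma commutator_testP : commutator_test [seq k.1 | k <- nS]. Proof. by vm_compute. Qed.
Lemma m2_inv_test : all (fun k : ncode => (m2 k.1 (m2i k.1) == m2id) && (m2 (m2i k.1) k.1 == m2id)) nS.
Proof. by vm_compute. Qed.
Lemma trans_test : all (fun w => (w == 0%R) || has (fun k => nA k oneV == w) nS) Vs.
Proof. by vm_compute. Qed.
Lemma unip_conj_test : all (fun k => if k == n1 then true else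
  if all (fun x => (x == 0%R) || (nA k x != x)) Vs then true else
  has (fun s => (nM k s == nM s nU) || (nM k s == nM s (nM nU nU))) nS) nS.
Proof. by vm_compute. Qed.
Lemma unip_test : all (fun k : ncode =>
  let fx := filter (fun g => nA k g == g) Vs in let ws := [seq scV c oneV | c <- GF5s] ++ [seq scV c sqV | c <- GF5s] in
  all (fun v => all (fun d => all (fun m =>
     has (fun w => has (fun c => w - nA k w - scV c v == m)%R GF5s) ws ||
     has (fun w => has (fun g => (dt v g == 0%R) && (mulV d g - nL k g + w - nA k w == m)%R) fx) ws)
     [:: oneV; sqV]) nDD) Vs) [:: nU; nM nU nU].
Proof. by vm_compute. Qed.
(** Over the stabilizer of v, the twist applied to v takes every value modulo the line of v, while
    the matrices move n only along that line. *)
Lemma shear_test : all (fun v => if v == 0%R then true else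
  let st := filter (fun k => nA k v == v) nS in
  all (fun m => has (fun k => has (fun c => nL k v + scV c v == m)%R GF5s) st) Vs &&
  all (fun k => all (fun n => has (fun c => nA k n - n == scV c v)%R GF5s) Vs) st) Vs.
Proof. by vm_compute. Qed.
Opaque nS.

Lemma nM_act k k' x : nA (nM k k') x = nA k' (nA k x) /\
  nL (nM k k') x = (nA k' (nL k x) + nL k' (nA k x))%R.
Proof.
case: k k' x => [[[? ?] [? ?]] [[? ?] [? ?]]] [[[? ?] [? ?]] [[? ?] [? ?]]] [? ?].
by rewrite /nM /nA /nL /lin2 /scV /=; split; congr (_, _) => /=; ring.
Qed.

Lemma nA_dt k v w : dt (nA k v) (nA k w) = (dt k.1.1 k.1.2 * dt v w)%R.
Proof. by case: k v w => [[[? ?] [? ?]] ?] [? ?] [? ?]; rewrite /dt /nA /lin2 /scV /=; ring. Qed.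

Lemma nA_inj k : k \in nS -> injective (nA k).
Proof.
case/and5P: nS_okP => _ _ _ _ /andP[/allP dt1 _] /dt1/eqP dk v w eqA.
have dv x : dt v x = dt w x by have := nA_dt k v x; rewrite eqA nA_dt dk !mul1r.
apply/eqP; rewrite -subr_eq0; move: v w {eqA} dv => [v1 v2] [w1 w2] dv.
have := dv oneV; have := dv sqV; rewrite /dt /=; clear dv.
by case: v1; case: v2; case: w1; case: w2.
Qed.

Section NC.
Variable kap : GF5.
Notation qk := (Qd (kap, f0)).
Definition ndJ (d : V) (k : ncode) := d.

Lemma nc_hyp : model_hyp nA nA nL nS nDD (qq qk) (qdl qk) (qka qk) n1 nM ndJ.
Proof.
case/and5P: nS_okP => nS1 uS /andP[SU SB] /allP SM /andP[/allP dt1 _].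
have DDP d : reflect (exists c, d = (c, f0)) (d \in nDD).
  by apply: (iffP mapP) => [[c _ ->] | [c ->]]; exists c; rewrite ?mem_F5s.
split.
- by move=> k _ x y; apply: lin2D.
- by move=> k _ x y; apply: lin2D.
- by move=> k _ x y; apply: lin2D.
- exact: nA_inj.
- exact: nA_inj.
- by split=> // x; apply/eqP; move: x; apply: V_all; vm_compute.
- move=> k k' Sk Sk'; split; first exact: (allP (SM _ Sk)).
  + by move=> x; case: (nM_act k k' x).
  + by move=> x; case: (nM_act k k' x).
  by move=> x; case: (nM_act k k' x).
- by apply/DDP; exists f0.
- by move=> _ _ /DDP[c ->] /DDP[c' ->]; apply/DDP; exists (c + c')%R.
- move=> _ k /DDP[c ->] _; split; first by apply/DDP; exists c.
  move=> y; rewrite /ndJ -!scV_mulV; case: k y => [[[? ?] [? ?]] ?] [? ?].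
  by rewrite /nA /lin2 /scV /=; congr (_, _) => /=; ring.
- move=> k Sk v y /=; rewrite nA_dt (eqP (dt1 _ Sk)) mul1r -!scV_mulV.
  case: k {Sk} v y => [[[? ?] [? ?]] ?] [? ?] [? ?]; move: (dt _ _) => dd.
  by rewrite !mulrS mulr0n !addr0 /nA /lin2 /scV /=; congr (_, _) => /=; ring.
- exact: qqD.
- move=> v w /=; apply/DDP; exists (- (dt v w * kap))%R; congr (_, _) => /=.
  by case: (dt v w).
- exact: qq0.
move=> k k' Sk Sk' eqA _; have eqk : k.1 = k'.1.
  have A1 (x : ncode) : nA x oneV = x.1.1 /\ nA x sqV = x.1.2.
    case: x => [[x y] ?]; rewrite /nA /=; split; apply/eqP; move: x y; apply: V_all2; vm_compute; reflexivity.
  have [a1 a2] := A1 k; have [b1 b2] := A1 k'.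
  by rewrite [k.1]surjective_pairing [k'.1]surjective_pairing -a1 -a2 -b1 -b2 !eqA.
exact: (inj_in_uniq_map uS Sk Sk').
Qed.

Definition nc_model := modgroup nc_hyp.
Notation mH := nc_hyp.
Notation mp := (modperm nA nA nL (qq qk)).
Notation me := (me nA nA nL (qq qk) n1).
Notation mT := (mT nA nA nL (qq qk) n1).
Notation mh := (mh nA nA nL (qq qk)).

Lemma nS1 : n1 \in nS. Proof. by case/and5P: nS_okP. Qed.
Lemma nS_uniq : uniq nS. Proof. by case/and5P: nS_okP => _ /map_uniq. Qed.
Lemma n1A x : nA n1 x = x. Proof. by case: (modk1 mH). Qed.
Lemma n1L x : nL n1 x = 0%R. Proof. by case: (modk1 mH). Qed.
Lemma nDDP d : reflect (exists c, d = (c, f0)) (d \in nDD).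
Proof. by apply: (iffP mapP) => [[c _ ->] | [c ->]]; exists c; rewrite ?mem_F5s. Qed.
Lemma nDDc c : (c, f0) \in nDD. Proof. by apply/nDDP; exists c. Qed.

Lemma card_arith (m a b c : nat) : (5 ^ a * (5 ^ b * (m * 5 ^ c)) = m * 5 ^ (a + (b + c)))%N.
Proof. by rewrite (mulnCA (5 ^ b)%N) mulnCA -!expnD. Qed.

Lemma nS_inj : {in nS &, injective (fun k : ncode => k.1)}.
Proof. by case/and5P: nS_okP => _ uS _ _ _; apply: inj_in_uniq_map uS. Qed.

Lemma nc_card : #|nc_model| = (24 * 5 ^ 6)%N.
Proof.
have oG : #|nc_model| = (625 * (size nDD * size nS))%N := card_modgroup mH isT nS_uniq.
rewrite oG nS_size -[size nDD]/(5 ^ 1)%N -[625%N]/(5 ^ 4)%N -[120%N]/(24 * 5 ^ 1)%N.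
exact: (card_arith 24 4 1 1).
Qed.

Lemma nc_C_hyp : model_hyp nA nA nL [:: n1] nDD (qq qk) (qdl qk) (qka qk) n1 nM ndJ.
Proof.
apply: model_hyp_sub mH _ _ _; rewrite ?mem_seq1 //.
  by move=> t; rewrite mem_seq1 => /eqP->; apply: nS1.
by move=> t t'; rewrite !mem_seq1 => /eqP-> /eqP->.
Qed.
Definition nc_C := modgroup nc_C_hyp.

Lemma nc_C_card : #|nc_C| = (5 ^ 5)%N.
Proof. by rewrite (card_modgroup nc_C_hyp) // -[size nDD]/(5 ^ 1)%N -[625%N]/(5 ^ 4)%N muln1 -expnD. Qed.

Lemma mp_C n v c : mp n v (c, f0) n1 \in nc_C.
Proof. by apply: (modperm_in nc_C_hyp); rewrite ?nDDc ?mem_seq1. Qed.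

Lemma mp_G n v c k : k \in nS -> mp n v (c, f0) k \in nc_model.
Proof. by move=> Sk; apply: (modperm_in mH); rewrite ?nDDc. Qed.

Lemma nc_modelP g : g \in nc_model -> exists n v c k, k \in nS /\ g = mp n v (c, f0) k.
Proof. by case/modsetP=> n [v [d [k [/nDDP[c ->] Sk ->]]]]; exists n, v, c, k. Qed.

Lemma nc_CP g : g \in nc_C -> exists n v c, g = mp n v (c, f0) n1.
Proof. by case/modsetP=> n [v [d [k [/nDDP[c ->]]]]]; rewrite mem_seq1 => /eqP-> ->; exists n, v, c. Qed.

Lemma nc_sCG : nc_C \subset nc_model.
Proof. by apply/subsetP=> g /nc_CP[n [v [c ->]]]; apply: mp_G nS1. Qed.

Definition Apart (g : {perm V * V}) : V * V :=
  let z := (g (0, 0)%R).2 in ((g (0%R, oneV)).2 - z, (g (0%R, sqV)).2 - z)%R.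

Lemma ApartE n v d k : k \in nS -> Apart (mp n v d k) = k.1.
Proof.
move=> Sk; rewrite /Apart !(modpermE mH) // /modfun /= (modA0 mH Sk) add0r !addrK.
by case: k {Sk} => [[x y] z]; congr (_, _); rewrite /nA /=; apply/eqP; move: x y; apply: V_all2; vm_compute.
Qed.

Lemma Apart_in g : g \in nc_model -> Apart g \in [seq k.1 | k <- nS].
Proof. by case/nc_modelP=> n [v [c [k [Sk ->]]]]; rewrite ApartE ?map_f. Qed.

Lemma ApartM : {in nc_model &, forall g h, Apart (g * h) = m2 (Apart g) (Apart h)}.
Proof.
move=> _ _ /nc_modelP[n [v [c [k [Sk ->]]]]] /nc_modelP[n' [v' [c' [k' [Sk' ->]]]]].
by rewrite (modpermM mH) ?nDDc // !ApartE //; case: (modkM mH Sk Sk').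
Qed.

Lemma Apart1 : Apart 1 = m2id. Proof. by rewrite -(modperm1 mH) ApartE ?nS1. Qed.

Lemma m2A a b c : m2 (m2 a b) c = m2 a (m2 b c).
Proof.
case: a b c => [[? ?] [? ?]] [[? ?] [? ?]] [[? ?] [? ?]]; rewrite /m2 /lin2 /scV /=.
by congr (_, _); congr (_, _) => /=; ring.
Qed.

Lemma m2id_l a : m2 m2id a = a.
Proof. by case: a => x y; rewrite /m2 /=; congr (_, _); apply/eqP; move: x y; apply: V_all2; vm_compute. Qed.
Lemma m2id_r a : m2 a m2id = a.
Proof. by case: a => x y; rewrite /m2 /=; congr (_, _); apply/eqP; move: (x) (y); apply: V_all2; vm_compute. Qed.

Lemma ApartV g : g \in nc_model -> Apart g^-1 = m2i (Apart g).
Proof.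
move=> Gg; have /mapP[k Sk eqk] := Apart_in Gg.
have /andP[_ /eqP inv] := allP m2_inv_test k Sk; rewrite -eqk in inv.
by rewrite -[LHS]m2id_l -inv m2A -ApartM ?groupV // mulgV Apart1 m2id_r.
Qed.

Lemma ApartX g m : g \in nc_model -> Apart (g ^+ m) = m2x (Apart g) m.
Proof.
by move=> Gg; elim: m => [|m IHm]; rewrite ?expg0 ?Apart1 // expgSr ApartM ?groupX // IHm.
Qed.

Lemma ApartR : {in nc_model &, forall g h, Apart [~ g, h] = m2c (Apart g) (Apart h)}.
Proof.
move=> g h Gg Gh; have -> : [~ g, h] = g^-1 * h^-1 * (g * h) by rewrite commgEl conjgE !mulgA.
by rewrite !ApartM ?groupM ?groupV // !ApartV.
Qed.

Lemma Apart_surj a : a \in [seq k.1 | k <- nS] -> exists2 g, g \in nc_model & Apart g = a.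
Proof.
case/mapP=> k Sk ->; exists (mh k); last exact: ApartE.
exact: (mh_in mH).
Qed.

Lemma Apart_C g : g \in nc_model -> (g \in nc_C) = (Apart g == m2id).
Proof.
move=> Gg; apply/idP/eqP=> [/nc_CP[n [v [c ->]]] | ]; first by rewrite ApartE ?nS1.
case/nc_modelP: Gg => n [v [c [k [Sk ->]]]]; rewrite ApartE // => eqk.
rewrite (nS_inj Sk nS1 eqk).
exact: mp_C.
Qed.

Lemma nc_C_normal : nc_C <| nc_model.
Proof.
rewrite /normal nc_sCG; apply/subsetP=> g Gg; rewrite inE; apply/subsetP=> _ /imsetP[c Cc ->].
have Gc := subsetP nc_sCG c Cc; rewrite Apart_C ?groupJ // conjgE !ApartM ?groupM ?groupV //.
rewrite Apart_C // in Cc; rewrite (eqP Cc) m2id_l -ApartM ?groupV // mulVg Apart1 //.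
Qed.

(** Normality keeps commutators with x inside U; suitable powers of those from [commutator_testP]
    have a nonscalar matrix and the required order. *)
Lemma nonscal_split (U : {group {perm V * V}}) x : U \subset nc_model -> nc_model \subset 'N(U) ->
    x \in U -> ~~ scal (Apart x) ->
  [/\ exists y, [/\ y \in U, 5.-elt y & ~~ scal (Apart y)],
      exists y, [/\ y \in U, y ^+ 3 = 1 & ~~ scal (Apart y)]
    & exists h, h \in U /\ ~~ scal (Apart [~ x, h])].
Proof.
move=> sUG nUG Ux nsx; have Gx := subsetP sUG x Ux.
have := allP commutator_testP _ (Apart_in Gx); rewrite (negPf nsx).
have Uc h : h \in nc_model -> [~ x, h] \in U.
  by move=> Gh; rewrite commgEl groupM ?groupV // memJ_norm // (subsetP nUG).
have C5 y : y \in nc_C -> y ^+ (5 ^ 5) = 1 by move=> Cy; apply/eqP; rewrite -order_dvdn -nc_C_card order_dvdG.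
case/and3P=> /hasP[a Ma /andP[ns5 c5]] /hasP[b Mb /andP[ns6 c6]] /hasP[d Md nsd]; split.
- have [h Gh def_a] := Apart_surj Ma; have Gc := subsetP sUG _ (Uc h Gh).
  have Ac : Apart [~ x, h] = m2c (Apart x) a by rewrite ApartR ?def_a.
  exists ([~ x, h] ^+ 6); split; [by rewrite groupX ?Uc | | by rewrite ApartX // Ac].
  have C10 : [~ x, h] ^+ 10 \in nc_C by rewrite Apart_C ?groupX // ApartX // Ac.
  have /C5 : ([~ x, h] ^+ 6) ^+ 5 \in nc_C by rewrite -expgM (expgM _ 10 3); apply: groupX.
  rewrite -expgM => /eqP; rewrite -order_dvdn -expnS => o5.
  by rewrite /p_elt (pnat_dvd o5) // pnatX.
- have [h Gh def_b] := Apart_surj Mb; have Gc := subsetP sUG _ (Uc h Gh).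
  have Ac : Apart [~ x, h] = m2c (Apart x) b by rewrite ApartR ?def_b.
  have C6 : [~ x, h] ^+ 6 \in nc_C by rewrite Apart_C ?groupX // ApartX // Ac.
  exists ([~ x, h] ^+ (2 * 5 ^ 5)); split; first by rewrite groupX ?Uc.
    by rewrite -expgM mulnAC (expgM _ 6) C5.
  (* The exponent is 4 modulo 6, so the matrix is that of c^4, while 5^5 kills the sixth power,
     which lies in C. *)
  have -> : (2 * 5 ^ 5 = 6 * 1041 + 4)%N by [].
  rewrite expgD ApartM ?groupX // expgM.
  have C61 : ([~ x, h] ^+ 6) ^+ 1041 \in nc_C by apply: groupX.
  have /eqP-> : Apart (([~ x, h] ^+ 6) ^+ 1041) == m2id by rewrite -(Apart_C (subsetP nc_sCG _ C61)).
  by rewrite m2id_l ApartX // Ac.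
have [h Gh def_d] := Apart_surj Md; exists [~ x, h]; split; first exact: Uc.
by rewrite ApartR ?ApartR ?def_d // (subsetP sUG) ?Uc.
Qed.

Lemma scal_id : scal m2id. Proof. by []. Qed.

Lemma nc_nonscal : exists2 x, x \in nc_model & ~~ scal (Apart x).
Proof.
have SU : nU \in nS by case/and5P: nS_okP => _ _ /andP[].
by exists (mh nU); [apply: (mh_in mH) | rewrite ApartE].
Qed.

Lemma nc_nsol : ~~ solvable nc_model.
Proof.
apply/derivedP=> -[n]; suffices [x Dx nsx] : exists2 x, x \in nc_model^`(n) & ~~ scal (Apart x).
  by move/trivgP/subsetP=> /(_ x Dx)/set1P x1; rewrite x1 Apart1 scal_id in nsx.
elim: n => [|n [x Dx nsx]]; first exact: nc_nonscal.
have [_ _ [h [Dh nsh]]] := nonscal_split (der_sub n _) (der_norm n _) Dx nsx.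
by exists [~ x, h]; rewrite // dergSn mem_commg.
Qed.

Lemma nc_pC : 5.-group nc_C. Proof. by rewrite /pgroup nc_C_card pnatX. Qed.

Lemma pow2_inj (x : {perm V * V}) : odd #[x] -> x = (x ^+ 2) ^+ (#[x].+1)./2.
Proof.
by move=> oddx; rewrite -expgM mul2n -[X in _ ^+ X]add0n -[0%N]/(false : nat) -(_ : odd #[x].+1 = false) ?odd_double_half ?expgS ?expg_order ?mulg1 //= oddx.
Qed.

(** A nonscalar element of O_5 would bring in one of order 3. Squares of scalar elements lie in C,
    and an element of odd order is a power of its square. *)
Lemma nc_pcore : 'O_5(nc_model) = nc_C.
Proof.
apply/eqP; rewrite eqEsubset; apply/andP; split; last exact: pcore_max nc_pC nc_C_normal.
apply/subsetP=> x Ox; have Gx := subsetP (pcore_sub _ _) x Ox; rewrite Apart_C //.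
have p5 := pcore_pgroup 5%N nc_model.
have [sx | nsx] := boolP (scal (Apart x)); last first.
  have [_ [y [Oy y3 nsy]] _] := nonscal_split (pcore_sub _ _) (gFnorm _ _) Ox nsx.
  have y1 : y = 1.
    apply/eqP; rewrite -order_eq1 -dvdn1 -[1%N]/(gcdn 3 5); have /p_natP[j oy] := mem_p_elt p5 Oy.
    have : (#[y] %| gcdn 3 (5 ^ j))%N by rewrite dvdn_gcd order_dvdn y3 eqxx -oy dvdnn.
    by rewrite (eqP (coprimeXr j (isT : coprime 3 5))).
  by rewrite y1 Apart1 scal_id in nsy.
have C2 : x ^+ 2 \in nc_C.
  by rewrite Apart_C ?groupX // ApartX //; case/orP: sx => /eqP->.
have /p_natP[j ox] := mem_p_elt p5 Ox.
have oddx : odd #[x] by rewrite ox oddX orbT.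
by rewrite -Apart_C // (pow2_inj oddx); apply: groupX.
Qed.

(** The first term with a nonscalar element has nonscalar elements both of order 3 and of 5-power
    order. The factor is a 5-group or a 5'-group, so one of them already lies in the previous
    term. *)
Lemma nc_npsol : ~ p_solvable 5 nc_model.
Proof.
case=> s srs lst; have [x Gx nsx] := nc_nonscal.
have sub (U : {group {perm V * V}}) s0 : (p_or_p'_factor 5 nc_model).-series U s0 -> U \subset last U s0.
  elim: s0 U => //= U' s0 IHs U /andP[/andP[/and3P[_ _ nVU] _] /IHs].
  exact: subset_trans (normal_sub nVU).
suffices T (V0 : {group {perm V * V}}) : (p_or_p'_factor 5 nc_model).-series V0 s -> last V0 s = nc_model ->
    (forall y, y \in V0 -> scal (Apart y)) -> forall y, y \in last V0 s -> scal (Apart y).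
  by case/negP: nsx; apply: (T 1%G srs lst); rewrite ?lst // => y /set1P->; rewrite Apart1.
elim: s V0 {srs lst} => //= U s IHs V0 /andP[/andP[/and3P[nV nU nVU] pU] sU] lst TV; apply: IHs => // y Uy.
have sUG : U \subset nc_model by rewrite -lst sub.
apply: contraT => nsy.
have [[y5 [U5 e5 ns5]] [y3 [U3 e3 ns3]] _] := nonscal_split sUG nU Uy nsy.
have NV w : w \in U -> w \in 'N(V0) by move=> Uw; apply: (subsetP (normal_norm nVU)).
have trivV w : w \in U -> #[coset V0 w] = 1%N -> scal (Apart w).
  move=> Uw /eqP; rewrite order_eq1 => /eqP c1; apply: TV; exact: (coset_idr (NV w Uw) c1).
case/orP: pU => pU.
  case/negP: ns3; apply: trivV => //; apply/eqP; rewrite -dvdn1.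
  have /p_natP[j oy] := mem_p_elt pU (mem_quotient V0 U3).
  have : (#[coset V0 y3] %| gcdn 3 (5 ^ j))%N.
    by rewrite dvdn_gcd -oy dvdnn andbT order_dvdn -morphX ?NV // e3 morph1.
  by rewrite (eqP (coprimeXr j (isT : coprime 3 5))).
case/negP: ns5; apply: trivV => //; apply/eqP.
have o5 : 5.-elt (coset V0 y5) by apply: morph_p_elt e5; apply: NV.
have o5' := mem_p_elt pU (mem_quotient V0 U5).
by apply/eqP; apply: (pnat_1 o5 o5').
Qed.
End NC.

Arguments nA : simpl never.
Arguments nL : simpl never.
Arguments qka : simpl never.
Arguments qdl : simpl never.
(*BEGIN*)
Lemma scVN c v : scV (- c)%R v = (- scV c v)%R.
Proof. by case: v => [? ?]; congr (_, _) => /=; ring. Qed.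
Lemma nAD k : {morph nA k : x y / (x + y)%R}. Proof. by move=> x y; apply: lin2D. Qed.
Lemma nA0 k : nA k 0%R = 0%R. Proof. by apply: (addrI (nA k 0%R)); rewrite -nAD !addr0. Qed.
Lemma nAN k x : nA k (- x)%R = (- nA k x)%R.
Proof. by apply: (addrI (nA k x)); rewrite -nAD !subrr nA0. Qed.
Lemma nD0 : 0%R \in nDD. Proof. exact: (nDDc f0). Qed.
Lemma SU : nU \in nS. Proof. by case/and5P: nS_okP => _ _ /andP[]. Qed.
Lemma SB : nB \in nS. Proof. by case/and5P: nS_okP => _ _ /andP[]. Qed.
Lemma mulV_sc c v : mulV (c, f0) v = scV c v. Proof. by rewrite scV_mulV. Qed.
Lemma qka_sym kap v g : dt v g = 0%R -> let k := Qd (kap, f0) in qka k v g = qka k g v /\ qdl k v g = qdl k g v.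
Proof.
suffices h : all (fun kp => let k := Qd (kp, f0) in (dt v g != 0%R) || ((qka k v g == qka k g v) && (qdl k v g == qdl k g v))) GF5s.
  by move=> dt0; have := allP h kap (mem_F5s _); rewrite /= dt0 eqxx /= => /andP[/eqP-> /eqP->].
by move: v g; apply: V_all2; vm_compute.
Qed.

Lemma nA_cols (k : ncode) : nA k oneV = k.1.1 /\ nA k sqV = k.1.2.
Proof.
case: k => [[x y] z]; rewrite /nA /=.
by split; apply/eqP; move: x y; apply: V_all2; vm_compute; reflexivity.
Qed.
Lemma nA1 x : nA n1 x = x. Proof. exact: (n1A f0). Qed.
Lemma nL1 x : nL n1 x = 0%R. Proof. exact: (n1L f0). Qed.

(** * The Camina property, data and nilpotence class of the SL_2(5) models *)

Section NCI.
Variable kap : GF5.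
Notation qk := (Qd (kap, f0)).
Notation mH := (nc_hyp kap).
Notation mp := (modperm nA nA nL (qq qk)).
Notation me := (me nA nA nL (qq qk) n1).
Notation mT := (mT nA nA nL (qq qk) n1).
Notation mh := (mh nA nA nL (qq qk)).
Notation G := (nc_model kap).
Notation C := (nc_C kap).
Let nn x := me (x, 0)%R.

Lemma nc_eM c c' x y : me (x + y, (c + c', f0))%R = me (x, (c, f0)) * me (y, (c', f0)).
Proof. by rewrite -(meM mH) ?nDDc. Qed.
Lemma nc_nnM : {morph nn : x y / (x + y)%R >-> x * y}.
Proof. by move=> x y; rewrite -[RHS](nc_eM f0 f0). Qed.
Lemma nc_me0 : me (0, 0)%R = 1. Proof. exact: (modperm1 mH). Qed.
Lemma nc_eV c x : (me (x, (c, f0)))^-1 = me (- x, (- c, f0))%R.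
Proof. by apply: (mulgI (me (x, (c, f0)))); rewrite mulgV -nc_eM !subrr -nc_me0. Qed.
Lemma nc_eJ x c n v c' k : k \in nS ->
  me (x, (c, f0)) ^ mp n v (c', f0) k = me (nA k x + scV c v, (c, f0))%R.
Proof. by move=> Sk; rewrite (meJ mH) ?nDDc // mulV_sc. Qed.
Lemma nc_nnJ x n v c' k : k \in nS -> nn x ^ mp n v (c', f0) k = nn (nA k x).
Proof. by move=> Sk; rewrite [LHS](nc_eJ x f0) // sc0V addr0. Qed.
Lemma nc_eC x c : me (x, (c, f0)) \in C. Proof. exact: mp_C. Qed.
Lemma nc_nnC x : nn x \in C. Proof. exact: (nc_eC x f0). Qed.
Lemma nc_TC v : mT v \in C. Proof. exact: (mp_C kap 0%R v f0). Qed.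
Lemma nc_CG g : g \in C -> g \in G. Proof. exact: (subsetP (nc_sCG kap)). Qed.
Lemma nc_CnnJ x g : g \in C -> nn x ^ g = nn x.
Proof. by case/nc_CP=> n [v [c ->]]; rewrite nc_nnJ ?nS1 ?nA1. Qed.

Lemma nc_mpnn n v c k a : k \in nS -> mp n v (c, f0) k * nn a = mp (n + a)%R v (c, f0) k.
Proof.
move=> Sk; rewrite (modpermM mH) ?nDDc ?nD0 ?nS1 // !nA1 nL1 mul0V (moddl0r mH _).1 (moddl0r mH _).2.
by rewrite !addr0 (modkMk1 mH).
Qed.

Lemma nc_shiftE n v c k x c' : k \in nS ->
  mp n v (c, f0) k ^ me (x, (c', f0)) = mp n v (c, f0) k * nn (x - nA k x - scV c' v)%R.
Proof.
move=> Sk; rewrite conj_shift; congr (_ * _); rewrite nc_eV nc_eJ // -nc_eM.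
rewrite nAN scVN addNr; congr (_ _); congr (_, _); ring.
Qed.

Lemma nc_shiftT n v c k g : k \in nS -> nA k g = g -> dt v g = 0%R ->
  mp n v (c, f0) k ^ mT g = mp n v (c, f0) k * nn (mulV (c, f0) g - nL k g)%R.
Proof.
move=> Sk Ag dt0; have [eka edl] := qka_sym kap dt0.
apply: (mulgI (mT g)); rewrite -conjgC nc_mpnn //.
rewrite !(modpermM mH) ?nDDc ?nD0 ?nS1 // !nA1 nL1 mul0V (modkMk1 mH) // (modk1Mk mH) // nA0 Ag.
rewrite (addrC v g) eka edl; congr (modperm _ _ _ _ _ _ _ _); first by ring.
by rewrite /ndJ addr0 add0r.
Qed.

Lemma nc_shifth n v c k : k \in nS ->
  mp n v (c, f0) n1 ^ mh k = mp (nA k n + nL k v)%R (nA k v) (c, f0) n1.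
Proof.
move=> Sk; apply: (mulgI (mh k)); rewrite -conjgC.
rewrite !(modpermM mH) ?nDDc ?nD0 ?nS1 // !nA1 nL1 mul0V (modkMk1 mH) // (modk1Mk mH) // mulV0.
rewrite (moddl0r mH _).1 (moddl0r mH _).2 (moddl0l mH _).1 (moddl0l mH _).2 /ndJ !addr0 !add0r.
by [].
Qed.

Definition nc_Camina g := forall m, exists2 y, y \in G & g ^ y = g * nn m.

Lemma nc_Camina_free n v c k : k \in nS -> (forall x, nA k x = x -> x = 0%R) -> nc_Camina (mp n v (c, f0) k).
Proof.
move=> Sk fpf m; have inj_f : injective (fun x => x - nA k x)%R.
  move=> x y eqxy; apply/eqP; rewrite -subr_eq0; apply/eqP/fpf; rewrite nAD nAN.
  apply/eqP; rewrite -subr_eq0; apply/eqP.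
  transitivity ((y - nA k y) - (x - nA k x))%R; first by ring.
  by rewrite eqxy subrr.
exists (me (invF inj_f m, (f0, f0))); first exact: nc_CG (nc_eC _ _).
by rewrite nc_shiftE // sc0V subr0 (f_invF inj_f m).
Qed.

(** Conjugators can be found in C, which centralizes N; so the attained m are closed under addition
    and [unip_test] on a basis suffices. *)
Lemma nc_Camina_unip n v c k : k \in [:: nU; nM nU nU] -> nc_Camina (mp n v (c, f0) k).
Proof.
move=> kU; have Sk : k \in nS.
  by move: kU; rewrite !inE => /orP[/eqP-> | /eqP->]; rewrite ?SU //; case: (modkM mH SU SU).
set g := mp _ _ _ _; pose S m := exists2 y, y \in C & g ^ y = g * nn m.
suffices SS : forall m, S m by move=> m; have [y Cy eqy] := SS m; exists y; rewrite // nc_CG.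
have Sm m : m \in [:: oneV; sqV] -> S m.
  move=> mm; have := allP unip_test k kU => /allP/(_ v (mem_Vs _))/allP/(_ _ (nDDc c))/allP/(_ m mm).
  case/orP=> /hasP[w _ /hasP[]] => [c' _ /eqP eqm | h].
    by exists (me (w, (c', f0))); [apply: nc_eC | rewrite nc_shiftE // eqm].
  rewrite mem_filter => /andP[/eqP Ah _] /andP[/eqP dt0 /eqP eqm].
  exists (mT h * nn w); first exact: groupM (nc_TC _) (nc_nnC _).
  rewrite conjgM nc_shiftT // conjMg (nc_CnnJ _ (nc_nnC _)) [g ^ nn w](nc_shiftE _ _ _ _ f0) // sc0V subr0.
  by rewrite -mulgA -nc_nnM; congr (_ * nn _); rewrite -eqm; ring.
apply: V_span; [by exists 1; rewrite ?group1 // conjg1 /nn nc_me0 mulg1 | exact: Sm | exact: Sm | ].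
move=> x y [a Ca eqa] [b Cb eqb]; exists (a * b); first exact: groupM.
by rewrite conjgM eqa conjMg eqb (nc_CnnJ _ Cb) -mulgA -nc_nnM addrC.
Qed.

Lemma nc_Camina_conj g s k : g \in G -> k \in nS -> s = mh k -> nc_Camina (g ^ s) -> nc_Camina g.
Proof.
move=> Gg Sk -> cam m; have Gs : mh k \in G := mh_in mH Sk.
have [y Gy eqy] := cam (nA k m).
exists (mh k * y * (mh k)^-1); first by rewrite !groupM ?groupV.
by rewrite !conjgM eqy -(nc_nnJ m 0%R 0%R f0 Sk) -conjMg conjgK.
Qed.

(** A suitable k fixing v adds m to the first component up to a multiple of v, by [shear_test];
    conjugation by a power of z removes that multiple. *)
Lemma nc_Camina_shear n v c : v != 0%R -> nc_Camina (mp n v (c, f0) n1).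
Proof.
move=> ntv m; have := allP shear_test v (mem_Vs _); rewrite (negPf ntv) => /andP[/allP t1 /allP t2].
have /hasP[k st /hasP[c1 _ /eqP eq1]] := t1 m (mem_Vs _).
have /allP/(_ n (mem_Vs _))/hasP[c2 _ /eqP eq2] := t2 k st.
move: st; rewrite mem_filter => /andP[/eqP Av Sk].
exists (mh k * me (0%R, ((c2 - c1)%R, f0))); first exact: groupM (mh_in mH Sk) (nc_CG (nc_eC _ _)).
rewrite conjgM nc_shifth // Av.
have -> : (nA k n + nL k v = n + (m + scV c2 v - scV c1 v))%R.
  by rewrite -eq2 -eq1; ring.
rewrite -nc_mpnn ?nS1 // conjMg (nc_CnnJ _ (nc_eC _ _)) nc_shiftE ?nS1 // -mulgA -nc_nnM; congr (_ * nn _).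
have -> : (scV (c2 - c1) v = scV c2 v - scV c1 v)%R.
  by rewrite -scVN; case: (v) => [? ?]; congr (_, _) => /=; ring.
by rewrite nA1; ring.
Qed.

Lemma nc_Camina_z n c : c != f0 -> nc_Camina (mp n 0%R (c, f0) n1).
Proof.
move=> ntc m; have ntd : (c, f0) != 0%R :> V by apply: contraNneq ntc => -[->].
exists (mT (mulV m (invV (c, f0)))); first exact: nc_CG (nc_TC _).
have -> : mp n 0%R (c, f0) n1 ^ mT (mulV m (invV (c, f0))) = me (nA n1 n + mulV (c, f0) (mulV m (invV (c, f0))), (c, f0))%R.
  exact: (@meJ _ _ _ _ _ _ _ _ _ _ _ _ mH (n, (c, f0)) 0%R (mulV m (invV (c, f0))) 0%R n1 (nDDc c) nD0 nS1).
rewrite nA1.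
have <- := nc_eM c f0 n m.
rewrite addr0 /ndJ mulVC -mulVA (mulVC (invV (c, f0))) mulfVV // mulV1 //.
Qed.

(** The matrix of g is fixed-point-free, conjugate to [nU] or its square, or the identity; in the
    last case v or c is nonzero because g is outside N. *)
Lemma nc_Camina_all g : g \in G -> (forall x, g != nn x) -> nc_Camina g.
Proof.
case/nc_modelP=> n [v [c [k [Sk ->]]]] notN; have [eqk | nek] := eqVneq k n1.
  rewrite eqk in notN *; have [v0 | ntv] := eqVneq v 0%R; last exact: nc_Camina_shear.
  rewrite v0 in notN *; apply: nc_Camina_z; apply: contraNneq (notN n) => -> //.
have := allP unip_conj_test k Sk; rewrite (negPf nek); case: ifP => [/allP fpf _ | _ /hasP[s Ss]].
  by apply: nc_Camina_free => // x Ax; have := fpf x (mem_Vs _); rewrite Ax eqxx orbF => /eqP.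
move=> eqs; have [r rU eqr] : exists2 r, r \in [:: nU; nM nU nU] & nM k s = nM s r.
  by case/orP: eqs => /eqP->; [exists nU | exists (nM nU nU)]; rewrite ?inE ?eqxx ?orbT.
have Sr : r \in nS.
  by move: rU; rewrite !inE => /orP[/eqP-> | /eqP->]; rewrite ?SU //; case: (modkM mH SU SU).
set g0 := mp _ _ _ _; have Gg : g0 \in G by apply: mp_G.
apply: (nc_Camina_conj Gg Ss (erefl _)).
have Gs : mh s \in G := mh_in mH Ss; have /nc_modelP[n' [v' [c' [k' [Sk' eqj]]]]] : g0 ^ mh s \in G by rewrite groupJ.
rewrite eqj; suffices -> : k' = r by apply: nc_Camina_unip.
have : mh s * (g0 ^ mh s) = g0 * mh s by rewrite -conjgC.
rewrite eqj !(modpermM mH) ?nDDc ?nD0 // => /(modperm_inj mH) [||_ _ _ eqM]; try by case: (modkM mH Ss Sk').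
  by case: (modkM mH Sk Ss).
have : mh s * mh k' = mh s * mh r by rewrite !(mhM mH) // eqM eqr.
by move/mulgI/(modperm_inj mH) => [].
Qed.

Lemma nc_Isaacs : Isaacs_group 25 G /\ ~ p_closed 5 G.
Proof.
have gN : group_set (nn @: [set: V]).
  apply/group_setP; split; first by apply/imsetP; exists 0%R; rewrite // -nc_me0.
  by move=> _ _ /imsetP[u _ ->] /imsetP[v _ ->]; rewrite -nc_nnM (imset_f nn).
pose N := Group gN.
have sNG : N \subset G by apply/subsetP=> _ /imsetP[x _ ->]; apply: nc_CG (nc_nnC _).
have nsN : N <| G.
  rewrite /normal sNG; apply/subsetP=> _ /nc_modelP[n [v [c [k [Sk ->]]]]].
  rewrite inE; apply/subsetP=> _ /imsetP[_ /imsetP[y _ ->] ->]; rewrite nc_nnJ //; exact: (imset_f nn).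
have inj_nn : injective nn by move=> x y /(me_inj mH)[].
have oN : #|N| = 25%N by rewrite /= card_imset // cardsT card_V.
split.
  apply: (Isaacs_of_Camina nsN (nc_card kap) oN) => [x y | g z].
    case/setD1P=> nx /imsetP[x' _ dx] /setD1P[ny /imsetP[y' _ dy]].
    have cl w : nn w != 1 -> nn w \in nn oneV ^: G.
      move=> nw; have := allP trans_test w (mem_Vs w); case: eqP => [w0 | _ /hasP[k Sk /eqP <-]].
        by rewrite w0 -nc_me0 eqxx in nw.
      apply/imsetP; exists (mh k); first exact: (mh_in mH).
      by rewrite [RHS](nc_nnJ _ 0%R 0%R f0 Sk).
    by rewrite dx dy in nx ny *; rewrite (class_eqP (cl _ ny)) cl.
  case/setDP=> Gg nNg /imsetP[m _ ->]; have [|y Gy <-] := nc_Camina_all Gg _ m.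
    by move=> x; apply: contraNneq nNg => ->; apply: (imset_f nn).
  exact: imset_f.
case=> P sylP nsP; have sPO : P \subset 'O_5(G) := pcore_max (pHall_pgroup sylP) nsP.
have := subset_leq_card sPO; rewrite nc_pcore nc_C_card (order_Sylow5 (nc_card kap) sylP).
by rewrite leq_exp2l.
Qed.

(** Coordinates in which products are evaluated by [pc4], so that relations are checked by
    computation. *)
Definition nc4 := (V * V * GF5 * ncode)%type.
Definition mp4 (t : nc4) := mp t.1.1.1 t.1.1.2 (t.1.2, f0) t.2.
Definition pc4 (t t' : nc4) : nc4 :=
  let w := nA t'.2 t.1.1.2 in
  (nA t'.2 t.1.1.1 + nL t'.2 t.1.1.2 - scV t'.1.2 w + qka qk w t'.1.1.2 + t'.1.1.1,
   w + t'.1.1.2, t.1.2 + t'.1.2 + (qdl qk w t'.1.1.2).1, nM t.2 t'.2)%R.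

Lemma pc4_in t t' : t.2 \in nS -> t'.2 \in nS -> (pc4 t t').2 \in nS.
Proof. by move=> S1' S2'; case: (modkM mH S1' S2'). Qed.

Lemma mp4M t t' : t.2 \in nS -> t'.2 \in nS -> mp4 t * mp4 t' = mp4 (pc4 t t').
Proof.
move=> S1' S2'; rewrite [LHS](modpermM mH) ?nDDc // mulV_sc; congr (modperm _ _ _ _ _ _ _ _).
have h (x : V) : x \in nDD -> ((t.1.2, f0) + (t'.1.2, f0) + x = (t.1.2 + t'.1.2 + x.1, f0))%R by case/nDDP=> c ->.
exact: h (moddl mH _ _).
Qed.

Lemma mp4X5 t : t.2 \in nS -> mp4 t ^+ 5 = mp4 (pc4 (pc4 (pc4 (pc4 t t) t) t) t).
Proof. by move=> St; rewrite !expgSr expg0 mul1g !mp4M ?pc4_in. Qed.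

Lemma nc_genP (H : {group {perm V * V}}) : (forall x c, me (x, (c, f0)) \in H) -> mT oneV \in H -> mT sqV \in H ->
  forall k n v c, k \in nS -> mh k \in H -> mp n v (c, f0) k \in H.
Proof.
move=> He H1 Hs k n v c Sk Hk; rewrite (modperm_decomp mH) ?nDDc //.
have HT : mT v \in H by apply: (mT_gen mH) => // -[x d] /= /nDDP[c' ->].
by rewrite !groupM // He.
Qed.

Lemma nc_genG (H : {group {perm V * V}}) : (forall x c, me (x, (c, f0)) \in H) -> mT oneV \in H -> mT sqV \in H ->
  mh nU \in H -> mh nB \in H -> G \subset H.
Proof.
move=> He H1 Hs HU HB; apply/subsetP=> _ /nc_modelP[n [v [c [k [Sk ->]]]]]; apply: nc_genP => //.
rewrite -(nth_index n1 Sk); have : (index k nS < 120)%N by rewrite -nS_size index_mem.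
move: (index k nS) => i; elim/ltn_ind: i => i IHi lt_i.
have : has (fun j => (nth n1 nS i == nM (nth n1 nS j) nU) || (nth n1 nS i == nM (nth n1 nS j) nB)) (iota 0 i) || (i == 0%N).
  by case/and5P: nS_okP => _ _ _ _ /andP[_ /allP/(_ i)]; rewrite mem_iota lt_i orbC => ->.
case/orP=> [/hasP[j] | /eqP-> //]; last first.
  have -> : nth n1 nS 0 = n1 by [].
  by rewrite -[mh _]/(me (0, (f0, f0))%R) He.
rewrite mem_iota => /= lt_j; have Sj : nth n1 nS j \in nS by rewrite mem_nth // nS_size (ltn_trans lt_j).
have Hj := IHi j lt_j (ltn_trans lt_j lt_i).
by case/orP=> /eqP->; rewrite -(mhM mH) ?SU ?SB // groupM.
Qed.

Definition nU5 := [:: n1; nU; nM nU nU; nM (nM nU nU) nU; nM (nM (nM nU nU) nU) nU].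
Lemma nU5_closed : all (fun k => all (fun k' => nM k k' \in nU5) nU5) nU5 && uniq nU5. Proof. by vm_compute. Qed.
Lemma nU5_sub : {subset nU5 <= nS}.
Proof.
have S2 : nM nU nU \in nS by case: (modkM mH SU SU).
have S3 : nM (nM nU nU) nU \in nS by case: (modkM mH S2 SU).
have S4 : nM (nM (nM nU nU) nU) nU \in nS by case: (modkM mH S3 SU).
move=> k Uk; rewrite !inE in Uk.
by case/or4P: Uk => [||| /orP[]] /eqP->; [exact: nS1 | exact: SU | exact: S2 | exact: S3 | exact: S4].
Qed.
Lemma nc_P_hyp : model_hyp nA nA nL nU5 nDD (qq qk) (qdl qk) (qka qk) n1 nM ndJ.
Proof.
apply: model_hyp_sub mH nU5_sub _ _; first by rewrite inE eqxx.
by move=> t t' Ut Ut'; case/andP: nU5_closed => /allP/(_ t Ut)/allP/(_ t' Ut').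
Qed.
Lemma nc_P_card : #|modgroup nc_P_hyp| = (5 ^ 6)%N.
Proof.
have /andP[_ uU] := nU5_closed.
by rewrite (card_modgroup nc_P_hyp) // -[size nDD]/(5 ^ 1)%N -[625%N]/(5 ^ 4)%N -[size nU5]/(5 ^ 1)%N -!expnD.
Qed.

Definition nc_rel gam (W1 W2 U : nc4) :=
  let pc5 t := pc4 (pc4 (pc4 (pc4 t t) t) t) t in let e0 : nc4 := (0%R, 0%R, f0, n1) in
  [&& pc4 W2 U == pc4 U (pc4 W2 W1), pc4 W1 U == pc4 U (pc4 W1 ((f0, f1), 0%R, f0, n1)),
      pc4 W1 W2 == pc4 (pc4 W2 W1) ((f0, gam), 0%R, gam, n1), pc5 W1 == e0, pc5 W2 == e0, pc5 U == e0
    & [&& W1.1.1.2 == oneV, W2.1.1.2 == sqV, U.1.1.2 == 0%R & [&& W1.2 == n1, W2.2 == n1 & U.2 == nU]]].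

Lemma nc_model_data gam W1 W2 U : nc_rel gam W1 W2 U -> nc_data gam G.
Proof.
case/and5P=> /eqP r1 /eqP r2 /eqP r3 /eqP r4 /and3P[/eqP r5 /eqP r6].
case/and4P=> /eqP v1 /eqP v2 /eqP vu /and3P[/eqP k1 /eqP k2 /eqP ku].
pose e (x : V * GF5) := me (x.1, (x.2, f0)).
have eM : {morph e : x y / (x + y)%R >-> x * y} by move=> x y; rewrite /e -nc_eM.
have inj_e : injective e by move=> [x c] [y c'] /(me_inj mH)[-> ->].
have e0 : e 0%R = 1 by exact: nc_me0.
have gE : group_set (e @: setT).
  apply/group_setP; split; first by apply/imsetP; exists 0%R; rewrite // e0.
  by move=> _ _ /imsetP[u _ ->] /imsetP[v _ ->]; rewrite -eM (imset_f e).
pose w1 := mp4 W1; pose w2 := mp4 W2; pose u := mp4 U; pose b := mh nB.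
have S1W : W1.2 \in nS by rewrite k1 nS1. have S2W : W2.2 \in nS by rewrite k2 nS1. have SUW : U.2 \in nS by rewrite ku SU.
have Ew x c v n c' : e (x, c) ^ mp n v (c', f0) n1 = e (x + scV c v, c)%R.
  by rewrite [LHS]nc_eJ ?nS1 // nA1.
have eJ x c v n c' k : k \in nS -> e (x, c) ^ mp n v (c', f0) k = e (nA k x + scV c v, c)%R.
  by move=> Sk; rewrite [LHS]nc_eJ.
have genE (X : {group {perm V * V}}) : e @: setT \subset X -> w1 \in X -> w2 \in X ->
    [/\ forall x c, me (x, (c, f0)) \in X, mT oneV \in X, mT sqV \in X & u \in X -> mh nU \in X].
  move=> sEX X1 X2; have Xe x c : me (x, (c, f0)) \in X by apply: (subsetP sEX); apply/imsetP; exists (x, c).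
  have fixw W v : W.2 = n1 -> W.1.1.2 = v -> mp4 W \in X -> mT v \in X.
    move=> kW vW XW; have -> : mT v = mp4 W * me (0%R, (- W.1.2, f0)%R) * nn (- (W.1.1.1 + scV W.1.2 v))%R.
      rewrite [mp4 W * _](modpermM mH) ?nDDc ?nS1 ?kW //= ?nA1 nL1 (moddl0r mH _).1 (moddl0r mH _).2 mulV_sc scVN opprK vW.
      rewrite (modkMk1 mH) ?nS1 //; have -> : (ndJ (W.1.2, f0) n1 + (- W.1.2, f0) + 0 = (f0, f0) :> V)%R.
        by rewrite addr0; apply: (congr2 pair); [exact: subrr | ].
      rewrite nc_mpnn ?nS1 //; congr (modperm _ _ _ _ _ _ _ _); [ring | by rewrite addr0].
    by rewrite !groupM // Xe.
  split=> //; [exact: (fixw W1) | exact: (fixw W2) | move=> Xu].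
  have -> : mh nU = u * me (0%R, (- U.1.2, f0)%R) * nn (- U.1.1.1)%R.
    rewrite /u /mp4 ku vu [mp _ _ _ _ * _](modpermM mH) ?nDDc ?nS1 ?SU //= ?nA1 nL1 (moddl0r mH _).1 (moddl0r mH _).2 mulV0.
    rewrite (modkMk1 mH) ?SU //; have -> : (ndJ (U.1.2, f0) n1 + (- U.1.2, f0) + 0 = (f0, f0) :> V)%R.
      by rewrite addr0; apply: (congr2 pair); [exact: subrr | ].
    rewrite nc_mpnn ?SU //; congr (modperm _ _ _ _ _ _ _ _); ring.
  by rewrite !groupM // Xe.
have PG4 W : W.2 \in nS -> mp4 W \in G by move=> SW; apply: mp_G.
exists e, (Group gE), (modgroup nc_P_hyp), w1, w2, u, b; split.
- split=> //; apply/subsetP=> g /setIP[/nc_modelP[n [v [c [k [Sk ->]]]]] cEg].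
  have [|A1 D1] := @mod_cent_me _ _ _ _ _ _ _ _ _ _ _ _ mH n v (c, f0) k (nDDc c) Sk.
    move=> [x d] /= /nDDP[c' ->]; apply/conjg_fixP/commgP/commute_sym/(centP cEg).
    by apply/imsetP; exists (x, c').
  have v0 : v = 0%R by have [_] := D1 _ (nDDc f1); rewrite mulV_sc; case: (v) => [x y]; rewrite /scV /= !mul1r.
  have -> : k = n1.
    apply: nS_inj; rewrite ?nS1 //=; have [a1 a2] := nA_cols k.
    by rewrite [k.1]surjective_pairing -a1 -a2 !A1.
  by rewrite v0; apply/imsetP; exists (n, c).
- split=> -[x c].
  + have w1E : w1 = mp W1.1.1.1 oneV (W1.1.2, f0) n1 by rewrite /w1 /mp4 v1 k1.
    by rewrite w1E Ew; case: (c).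
  + have w2E : w2 = mp W2.1.1.1 sqV (W2.1.2, f0) n1 by rewrite /w2 /mp4 v2 k2.
    by rewrite w2E Ew; case: (c).
  + have uE : u = mp U.1.1.1 0%R (U.1.2, f0) nU by rewrite /u /mp4 vu ku.
    rewrite uE eJ ?SU // scV0 addr0; congr (e (_, _)).
    by apply/eqP; move: (x); apply: V_all; vm_compute.
  rewrite [LHS](eJ x c 0%R 0%R f0 nB SB) scV0 addr0; congr (e (_, _)).
  by apply/eqP; move: (x); apply: V_all; vm_compute.
- split.
  + apply: (mulgI u); rewrite -conjgC /u /w2 /w1 !mp4M ?pc4_in //; congr mp4; exact: r1.
  + apply: (mulgI u); rewrite -conjgC -[e _]/(mp4 ((f0, f1), 0%R, f0, n1)) /u /w1 !mp4M ?pc4_in ?nS1 //; congr mp4; exact: r2.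
  apply: (mulgI (w2 * w1)); rewrite -commgC -[e _]/(mp4 ((f0, gam), 0%R, gam, n1)) !mp4M ?pc4_in ?nS1 //; congr mp4; exact: r3.
- by rewrite !mp4X5 ?r4 ?r5 ?r6 //; split; apply: (modperm1 mH).
have genI (X : {group {perm V * V}}) (A : {set {perm V * V}}) : X = <<e @: setT :|: A>> :> {set _} ->
    e @: setT \subset X /\ A \subset X.
  by move=> ->; split; apply: (subset_trans _ (subset_gen _)); rewrite ?subsetUl ?subsetUr.
split; last exact: nc_card.
- apply/eqP; rewrite eqEsubset gen_subG subUset; apply/and3P; split; last first.
  + by apply/subsetP=> x; rewrite !inE => /or4P[] /eqP->; rewrite ?PG4 //; apply: (mh_in mH); apply: SB.
  + by apply/subsetP=> _ /imsetP[x _ ->]; apply: nc_CG (nc_eC _ _).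
  pose X := <<e @: setT :|: [set:: [:: w1; w2; u; b]]>>%G; rewrite -[<<_>>]/(gval X).
  have [sE sA] := genI X _ (erefl _).
  have XA x : x \in [:: w1; w2; u; b] -> x \in X by move=> Ax; apply: (subsetP sA); rewrite inE.
  have [||Xe XT1 XT2 XU] := genE X sE; [by apply: XA; rewrite !inE eqxx ?orbT.. | ].
  by apply: nc_genG => //; [apply: XU | ]; apply: XA; rewrite !inE eqxx ?orbT.
- apply/eqP; rewrite eqEsubset gen_subG subUset; apply/and3P; split; last first.
  + by apply/subsetP=> x; rewrite !inE => /or3P[] /eqP->; apply: (modperm_in nc_P_hyp); rewrite ?nDDc ?k1 ?k2 ?ku.
  + by apply/subsetP=> _ /imsetP[x _ ->]; apply: (modperm_in nc_P_hyp); rewrite ?nDDc.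
  pose X := <<e @: setT :|: [set:: [:: w1; w2; u]]>>%G; rewrite -[<<_>>]/(gval X).
  have [sE sA] := genI X _ (erefl _).
  have XA x : x \in [:: w1; w2; u] -> x \in X by move=> Ax; apply: (subsetP sA); rewrite inE.
  have [||Xe XT1 XT2 XU] := genE X sE; [by apply: XA; rewrite !inE eqxx ?orbT.. | ].
  have {}XU : mh nU \in X by apply: XU; apply: XA; rewrite !inE eqxx ?orbT.
  apply/subsetP=> _ /modsetP[n [v [d [k [/nDDP[c ->] Uk ->]]]]]; apply: nc_genP => //; first exact: nU5_sub.
  have X0 : mh n1 \in X by exact: (Xe 0%R f0).
  have XM k' : k' \in nS -> mh k' \in X -> mh (nM k' nU) \in X by move=> Sk' Xk'; rewrite -(mhM mH) ?SU // groupM.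
  have S2 : nM nU nU \in nS by case: (modkM mH SU SU).
  have S3 : nM (nM nU nU) nU \in nS by case: (modkM mH S2 SU).
  by move: Uk; rewrite !inE => /or4P[||| /orP[]] /eqP->; rewrite ?XM ?SU.
exact: nc_P_card.
Qed.

Lemma nc_commC g h : g \in C -> h \in C -> exists x c, [~ g, h] = me (x, (c, f0)) /\ (kap = f0 -> c = f0).
Proof.
move=> Cg Ch; have /nc_CP[n [v [c def_q]]] : [~ g, h] \in C by rewrite groupR.
case/nc_CP: Cg def_q => n' [v' [c' ->]]; case/nc_CP: Ch => n'' [v'' [c'' ->]] def_q.
have : mp n' v' (c', f0) n1 * mp n'' v'' (c'', f0) n1 = (mp n'' v'' (c'', f0) n1 * mp n' v' (c', f0) n1) * mp n v (c, f0) n1.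
  by rewrite -def_q -commgC.
rewrite -[mp n' _ _ _]/(mp4 (n', v', c', n1)) -[mp n'' _ _ _]/(mp4 (n'', v'', c'', n1)) -[mp n _ _ _]/(mp4 (n, v, c, n1)).
rewrite !mp4M ?pc4_in ?nS1 // => /(modperm_inj mH) [||_ eqv eqd _]; try by rewrite !pc4_in ?nS1.
rewrite /= !nA1 in eqv eqd.
have v0 : v = 0%R by apply: (addrI (v' + v'')%R); rewrite addr0 {2}eqv; ring.
rewrite def_q v0; exists n, c; split=> // k0.
have {}eqd : (c' + c'' = c'' + c' + c)%R.
  by move: eqd => /(congr1 fst) /=; rewrite k0 -[f0]/(0%R : GF5) !mulr0 !subr0.
by apply: (addrI (c' + c'')%R); rewrite {2}eqd -[f0]/(0%R : GF5) addr0; ring.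
Qed.

Lemma nc_nilC : nilpotent C. Proof. exact: pgroup_nil (nc_pC kap). Qed.

(** The lower central series of C descends through E and then N, which C centralizes. *)
Lemma nc_class3 : (nil_class C <= 3)%N.
Proof.
apply/(lcn_nil_classP _ nc_nilC)/trivgP.
have sub (A B : {set {perm V * V}}) (X : {group {perm V * V}}) : {in A & B, forall a b, [~ a, b] \in X} -> [~: A, B] \subset X.
  by move=> AB; rewrite gen_subG; apply/subsetP=> _ /imset2P[a b Aa Bb ->]; apply: AB.
have gE : group_set [set me (x.1, (x.2, f0)) | x in [set: V * GF5]].
  apply/group_setP; split; first by apply/imsetP; exists 0%R; rewrite // -nc_me0.
  by move=> _ _ /imsetP[u _ ->] /imsetP[v _ ->]; rewrite -nc_eM; apply/imsetP; exists (u + v)%R.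
have gN : group_set (nn @: [set: V]).
  apply/group_setP; split; first by apply/imsetP; exists 0%R; rewrite // -nc_me0.
  by move=> _ _ /imsetP[u _ ->] /imsetP[v _ ->]; rewrite -nc_nnM (imset_f nn).
have L2 : 'L_2(C) \subset Group gE.
  rewrite (lcnSn 0) lcn1; apply: sub => a b Ca Cb; have [x [c [-> _]]] := nc_commC Ca Cb.
  by apply/imsetP; exists (x, c).
have L3 : 'L_3(C) \subset Group gN.
  rewrite (lcnSn 1); apply: sub => a b /(subsetP L2)/imsetP[[x c] _ ->] /nc_CP[n [v [c' ->]]] /=.
  rewrite commgEl nc_eJ ?nS1 // nc_eV -nc_eM addNr; exact: imset_f.
apply: (@sub _ _ 1%G) => a b /(subsetP L3)/imsetP[x _ ->] Cb.
by rewrite (_ : [~ nn x, b] = 1) ?group1 //; apply/eqP/conjg_fixP; apply: nc_CnnJ.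
Qed.

Lemma nc_class2 : kap = f0 -> nil_class C = 2%N.
Proof.
move=> k0; apply/eqP; rewrite eqn_leq nil_class2 ltnNge nil_class1; apply/andP; split.
  rewrite gen_subG; apply/subsetP=> _ /imset2P[a b Ca Cb ->]; have [x [c [-> /(_ k0)->]]] := nc_commC Ca Cb.
  apply/centerP; split=> [|y Cy]; first exact: nc_eC.
  by apply/commgP/conjg_fixP; apply: nc_CnnJ.
apply/negP=> /centsP/(_ _ (nc_eC 0%R f1) _ (nc_TC oneV))/commgP/conjg_fixP.
by rewrite [LHS](nc_eJ 0%R f1 0%R oneV f0 nS1) => /(me_inj mH)[].
Qed.

Lemma nc_class3_eq W1 W2 U : nc_rel f1 W1 W2 U -> nil_class C = 3%N.
Proof.
move=> rel; have W r : r.2 = n1 -> mp4 r \in C by move=> r1; rewrite /mp4 r1; apply: mp_C.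
case/and5P: rel => _ _ /eqP r3 _ /and3P[_ _ /and4P[_ _ _ /and3P[/eqP k1 /eqP k2 _]]].
apply/eqP; rewrite eqn_leq nc_class3 ltnNge nil_class2; apply/negP=> sub.
have : [~ mp4 W1, mp4 W2] \in 'Z(C) by rewrite (subsetP sub) // mem_commg ?W.
have -> : [~ mp4 W1, mp4 W2] = me ((f0, f1), (f1, f0)).
  apply: (mulgI (mp4 W2 * mp4 W1)); rewrite -commgC -[me _]/(mp4 ((f0, f1), 0%R, f1, n1)).
  by rewrite !mp4M ?pc4_in ?k1 ?k2 ?nS1 // r3.
case/centerP=> _ /(_ _ (nc_TC oneV))/commgP/conjg_fixP.
by rewrite [LHS](nc_eJ _ f1 0%R oneV f0 nS1) => /(me_inj mH)[].
Qed.
End NCI.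

(** Searches for w1 in the relation w2^u = w2 w1; the default of [head] would fail [nc_rel], so
    [nc_rel3] and [nc_rel2] confirm a genuine solution. *)
Definition find_w1 kap (w2 u : nc4) := head (0, 0, f0, n1)%R
  (filter (fun t => pc4 kap w2 u == pc4 kap u (pc4 kap w2 t)) [seq (n, oneV, c, n1) | n <- Vs, c <- GF5s]).
Definition u3 : nc4 := (0%R, 0%R, f1, nU).
Definition u2 : nc4 := (0%R, 0%R, f3, nU).
Definition w23 : nc4 := pc4 f2 (0%R, sqV, f0, n1) (0%R, 0%R, f3, n1).
Definition w22 : nc4 := (0%R, sqV, f0, n1).
Lemma nc_rel3 : nc_rel f2 f1 (find_w1 f2 w23 u3) w23 u3. Proof. by vm_compute. Qed.
Lemma nc_rel2 : nc_rel f0 f0 (find_w1 f0 w22 u2) w22 u2. Proof. by vm_compute. Qed.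

(** * Classification of the groups that are not 5-closed, and conclusion *)

(*BEGIN*)
Lemma nonclosed_structure (gT : finGroupType) (G : {group gT}) :
  Isaacs_group 25 G -> ~ p_closed 5 G -> nc_data f0 G \/ nc_data f1 G.
Proof.
case=> _; rewrite Isaacs25_order => oG [i chi1] ncl.
have [N [nsN oN chiN chiG]] := small_normal_exists oG chi1.
have trN' := small_normal_trans chi1 nsN chiN chiG.
have trN : {in N^# &, forall x y, x \in y ^: G} by move=> x y; apply: trN'.
have [n1 [n2 [u0 [b0 [[N1 N2 nt1] [Pu0 nCu0 n2u0] [Pb0 nt2 n1b0]]]]]] := nf_shears oG nsN oN trN ncl.
have [t [[Gt t2 invN] parC]] := nf_involution oG nsN oN trN.
pose C := 'C_G(N)%G; pose P := 'C_G[n1]%G.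
have Nn1 : n1 \in N^# by rewrite !inE nt1.
have Nn2 : n2 \in N^# by rewrite !inE nt2.
have fixt : {in G, forall g, exists2 c, c \in C & (g * c) ^ t = g * c}.
  by apply: nf_fixt.
have nsC : C <| G := nf_nsC nsN; have sCG : C \subset G := normal_sub nsC.
(* Multiplying the shears by elements of C makes them commute with t without changing their action
   on N. *)
have [Gu0 cu0] := setIP Pu0; have [Gb0 cb0] := setIP Pb0.
have [c Cc ut] := fixt u0 Gu0; have [d Cd bt] := fixt b0 Gb0.
have cN x n : x \in C -> n \in N -> n ^ x = n.
  by case/setIP=> _ /centP cx Nn; apply/conjg_fixP/commgP/commute_sym/cx.
have syl := nf_syl oG nsN oN trN.
have pP : 5.-group P := pHall_pgroup (syl _ Nn1).
have sCP : C \subset P := nf_sCP G N1.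
have sCP2 : C \subset 'C_G[n2] := nf_sCP G N2.
set u := u0 * c in ut; set b := b0 * d in bt.
have Pu : u \in P := groupM Pu0 (subsetP sCP c Cc).
have Gu : u \in G by case/setIP: Pu.
have Gb : b \in G := groupM Gb0 (subsetP sCG d Cd).
have nCu : u \notin C by rewrite groupMr.
have n2u : n2 ^ u = n2 * n1 by rewrite conjgM n2u0 cN ?groupM.
have n1P : {in P, forall x, commute n1 x} by move=> x /setIP[_ /cent1P/commute_sym].
have n1u : n1 ^ u = n1 by apply/conjg_fixP/commgP/n1P.
have n1b : n1 ^ b = n1 * n2 by rewrite conjgM n1b0 cN ?groupM.
have n2b0 : n2 ^ b0 = n2 by apply/conjg_fixP/commgP/commute_sym/cent1P.
have n2b : n2 ^ b = n2 by rewrite conjgM n2b0 cN.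
have pb : 5.-elt b.
  exact: mem_p_elt (pHall_pgroup (syl _ Nn2)) (groupM Pb0 (subsetP sCP2 d Cd)).
have oC : #|C| = (5 ^ 5)%N by apply: nf_cardC.
have pC : 5.-group C by rewrite /pgroup oC pnatX.
have sNC : N \subset C := nf_sNC nsN oN.
have cCN : {in C & N, forall x y, commute x y}.
  by move=> x y Cx Ny; apply/commute_sym/commgP/conjg_fixP/cN.
have N5 : {in N, forall n, n ^+ 5 = 1} by move=> n Nn; apply: (nf_N5 (G := G) (N := N)).
have nKn2 : n2 \notin <[n1]>.
  apply: contra nt1 => /cycleP[k e]; have fx : n2 ^ u = n2 by rewrite e conjXg n1u.
  by rewrite -(mulKg n2 n1) -n2u fx mulVg.
have genN : <[n1]> <*> <[n2]> = N by apply: (nf_gen (G := G)).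
have oP : #|P| = (5 ^ 6)%N by apply: (nf_oC (N := N)).
have sPG : P \subset G := subsetIl _ _.
have sNP : N \subset P := subset_trans sNC sCP.
have sK : <[n1]> \subset N by rewrite cycle_subG.
have nsK : <[n1]> <| P.
  rewrite /normal (subset_trans sK sNP); apply/subsetP=> x Px.
  by rewrite inE -cycleJ (_ : n1 ^ x = n1) //; apply/conjg_fixP/commgP/n1P.
have camP x m : x \in P -> x \notin N -> m \in N -> exists2 y, y \in P & m^-1 * [~ x, y] \in <[n1]>.
  move=> Px nNx Nm; apply: (Camina_Sylow (K := <[n1]>%G) oG chi1 nsN oN chiN chiG (syl _ Nn1)) => //.
    by apply: nf_comm.
  by rewrite inE nNx.
have [[gam [x [mu pre]]] C5] : (exists gam x mu, nc_pre G N C gam x mu) /\ {in C, forall c, c ^+ 5 = 1}.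
  by apply: (co_pre_ex (P := P) (n1 := n1) (n2 := n2) (u := u) (b := b) (t := t)).
have oPn : {in N^#, forall n, #|'C_G[n]| = (5 ^ 6)%N} by move=> n; apply: (nf_oC (N := N)).
by case: (nc_pre_cases sCG C5 pre) => h; [left | right]; apply: (nc_pre_data oG sCG C5 oPn h).
Qed.

Lemma size_cparams : size cparams = 24%N. Proof. by vm_compute. Qed.
Lemma uniq_cparams : uniq cparams. Proof. by vm_compute. Qed.
Definition cparam_nth (i : 'I_24) : cparam := nth (false, 0%N, Q0) cparams i.
Lemma cparam_nth_mem i : cparam_nth i \in cparams.
Proof. by rewrite mem_nth // size_cparams. Qed.
Definition closed_group i := closed_model (allP all_cok _ (cparam_nth_mem i)).
(** The value [f2] realizes gam = 1 and class 3, by [nc_rel3]; [f0] realizes gam = 0 and class 2. *)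
Definition nonclosed_group (i : 'I_2) := nc_model (if i == ord0 then f2 else f0).
Local Close Scope ring_scope.

Theorem mainTheorem7 :
  (exists (gT : 'I_24 -> finGroupType) (G : forall i : 'I_24, {group gT i}),
     isog_representatives
       (fun (hT : finGroupType) (H : {group hT}) =>
          Isaacs_group 25 H /\ p_closed 5 H) G)
  /\
  (exists (gT : 'I_2 -> finGroupType) (G : forall i : 'I_2, {group gT i}),
     [/\ isog_representatives
           (fun (hT : finGroupType) (H : {group hT}) =>
              Isaacs_group 25 H /\ ~ p_closed 5 H) G,
         forall i : 'I_2, ~~ solvable (G i) /\ ~ p_solvable 5 (G i),
         nil_class 'O_5(G ord0) = 3%N
       & nil_class 'O_5(G ord_max) = 2%N]).
Proof.
split.
  exists (fun _ => {perm (V * V)%type} : finGroupType), closed_group; split.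
  - by move=> i; apply: closed_model_Isaacs.
  - move=> i j /closed_model_isog_inj eqn; apply/val_inj/eqP.
    have := eqn (cparam_nth_mem i) (cparam_nth_mem j); rewrite /cparam_nth => /eqP.
    by rewrite nth_uniq ?uniq_cparams ?size_cparams.
  move=> hT H [isaH clH]; have [c Cc dataH] := closed_structure isaH clH.
  have lt_c : (index c cparams < 24)%N by rewrite -size_cparams index_mem.
  exists (Ordinal lt_c); apply: closed_data_isog (closed_model_data _).
  by rewrite /cparam_nth /= nth_index.
have cl3 : nil_class 'O_5(nc_model f2) = 3%N by rewrite nc_pcore (nc_class3_eq nc_rel3).
have cl2 : nil_class 'O_5(nc_model f0) = 2%N by rewrite nc_pcore nc_class2.
have no_isog : ~ nc_model f2 \isog nc_model f0.
  move=> iso; have := isog_nil_class (isog_pcore 5 iso).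
  by rewrite cl3 cl2.
exists (fun _ => {perm (V * V)%type} : finGroupType), nonclosed_group; split.
- split.
  + by move=> i; apply: nc_Isaacs.
  + move=> i j; rewrite /nonclosed_group.
    case: (i =P ord0) => [-> | ni]; case: (j =P ord0) => [-> | nj] //.
    * by rewrite isog_sym => /no_isog.
    have max k : k <> ord0 :> 'I_2 -> k = ord_max.
      by case: k => [[|[|k]] hk] nk //; [case: nk; apply: val_inj | apply: val_inj].
    by rewrite (max i ni) (max j nj).
  move=> hT H [isaH nclH]; have [dataH | dataH] := nonclosed_structure isaH nclH.
    exists ord_max; exact: nc_data_isog dataH (nc_model_data nc_rel2).
  exists ord0; exact: nc_data_isog dataH (nc_model_data nc_rel3).
- by move=> i; split; [apply: nc_nsol | apply: nc_npsol].
- exact: cl3.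
exact: cl2.
Qed.
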